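(* Let $(\mathfrak{G},\mathfrak{G}_{\mathrm{int}},\tilde L)$ be a cut-and-project scheme and let $W\subset\mathfrak{G}_{\mathrm{int}}$ be a window such that the model set $\Lambda(W)$ is repetitive, $\Lambda(W)-\Lambda(W)$ generates $L$, $W=\mathrm{Cl}(\mathrm{Int}(W))$, $W$ has no nontrivial translation invariance (i.e. $\{c\in\mathfrak{G}_{\mathrm{int}}: c+W=W\}=\{0\}$), and $\theta(\partial W)=0$ for the Haar measure $\theta$ of $\mathfrak{G}_{\mathrm{int}}$. Let $\{B_y(\omega)\}_{y\in W}$ be a complex-valued stochastic process such that the sample path $b_\omega(y)=1_W(y)B_y(\omega)$ is continuous on $W$ for almost every $\omega$. Then the Dirac comb $\pi(\omega)=\sum_{s\in\Lambda(W)}B_{s^\star}(\omega)\delta_s$ has a diffraction measure $\widehat{\gamma_\pi}(\omega)$ whose expectation is pure-point: $$\mathrm{E}_\omega[\widehat{\gamma_\pi}(\omega)]=\sum_{\chi\in\mathcal{L}}\frac{\mathrm{E}\bigl[|\widehat{b_\omega}(-\chi^\star)|^2\bigr]}{|\tilde L|^2}\,\delta_\chi .$$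
   Context: LCAG means locally compact, $\sigma$-compact Abelian Hausdorff group. $\mathfrak{G},\mathfrak{G}_{\mathrm{int}}$ are LCAGs with fixed Haar measures ($dx$ on $\mathfrak{G}$; $\theta$, also written $dy$, on $\mathfrak{G}_{\mathrm{int}}$); $|A|$ is the Haar measure of $A$; $1_W$ is the indicator function of $W$. Cut-and-project scheme: a triple $(\mathfrak{G},\mathfrak{G}_{\mathrm{int}},\tilde L)$ where $\tilde L$ is a lattice (discrete cocompact subgroup) of $\mathfrak{G}\times\mathfrak{G}_{\mathrm{int}}$ such that the projection $\Pi:\mathfrak{G}\times\mathfrak{G}_{\mathrm{int}}\to\mathfrak{G}$ is injective on $\tilde L$ and $\Pi_{\mathrm{int}}(\tilde L)$ is dense in $\mathfrak{G}_{\mathrm{int}}$, $\Pi_{\mathrm{int}}$ being the other projection. $L:=\Pi(\tilde L)$; for $s\in L$, $s^\star:=\Pi_{\mathrm{int}}((\Pi|_{\tilde L})^{-1}(s))$. $|\tilde L|$ is the measure of a fundamental domain of $\tilde L$ for the product Haar measure. A window is a nonempty, measurable, relatively compact $W\subset\mathfrak{G}_{\mathrm{int}}$; the model set is $\Lambda(W)=\{s\in L:s^\star\in W\}$. Dual scheme: $\tilde{\mathcal{L}}\subset\widehat{\mathfrak{G}}\times\widehat{\mathfrak{G}_{\mathrm{int}}}$ is the annihilator of $\tilde L$, i.e. the set of $(\chi,\eta)$ with $\chi(s)\eta(s^\star)=1$ for all $s\in L$. $(\widehat{\mathfrak{G}},\widehat{\mathfrak{G}_{\mathrm{int}}},\tilde{\mathcal{L}})$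 is a cut-and-project scheme; $\mathcal{L}$ is the projection of $\tilde{\mathcal{L}}$ to $\widehat{\mathfrak{G}}$ and for $\chi\in\mathcal{L}$, $\chi^\star$ is the unique element with $(\chi,\chi^\star)\in\tilde{\mathcal{L}}$. The dual groups are written additively, so $-\chi^\star$ is the complex-conjugate character of $\chi^\star$. A set $P\subset\mathfrak{G}$ has finite local complexity if it is countable and $P-P$ is closed and discrete. Such a $P$ is repetitive if for every compact $K\subset\mathfrak{G}$ there is a compact $K'\subset\mathfrak{G}$ such that for all $t_1,t_2\in\mathfrak{G}$ there is $s\in K'$ with $(t_1+P)\cap K=(s+t_2+P)\cap K$. Van Hove sequence: an increasing sequence $\{D_n\}$ of compact subsets of $\mathfrak{G}$ with $|D_n|>0$ and $\lim_n|\partial^K(D_n)|/|D_n|=0$ for every compact $K$, where $\partial^K(A):=((A+K)\setminus \mathrm{Int}(A))\cup((\mathrm{Cl}(\mathfrak{G}\setminus A)-K)\cap A)$. One is fixed. Diffraction: for a Dirac comb $\mu=\sum_{s\in S}w_s\delta_s$, the autocorrelation measure is the vague limit $\gamma_\mu$ of $|D_n|^{-1}\,\mu|_{D_n}*\widetilde{\mu|_{D_n}}$, where $\tilde\mu(B)=\overline{\mu(-B)}$. The diffraction measure is its Fourier transform $\widehat{\gamma_\mu}$. The Fourier transform of a function $f$ on an LCAG $H$ is $\hat f(\chi)=\int_H f(x)\overline{\chi(x)}\,dx$; that of a measure $\lambda$ on $\mathfrak{G}$ is the unique measure $\widehat\lambda$ on $\widehat{\mathfrak{G}}$ with $\int_{\mathfrak{G}}(\varphi*\tilde\varphi)\,d\lambda=\int_{\widehat{\mathfrak{G}}}|\widehat\varphi(-\chi)|^2\,d\widehat\lambda(\chi)$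 for all continuous compactly supported $\varphi:\mathfrak{G}\to\mathbb{C}$, where $\tilde\varphi(x)=\overline{\varphi(-x)}$. The function $b_\omega$ is regarded as a function on $\mathfrak{G}_{\mathrm{int}}$, zero outside $W$. *)

(* Defs.v *)
From HB Require Import structures.
From mathcomp Require Import all_boot all_order all_algebra ring_quotient.
From mathcomp Require Import all_classical all_reals all_analysis.
From mathcomp Require Import measurable_realfun complex.

Set Implicit Arguments.
Unset Strict Implicit.
Unset Printing Implicit Defensive.

Import Order.TTheory GRing.Theory Num.Theory.
Import numFieldTopology.Exports numFieldNormedType.Exports.
Import ComplexField.

Local Open Scope classical_set_scope.
Local Open Scope complex_scope.
Local Open Scope ring_scope.

(* Complex numbers are taken in [R[i]^o], the copy of [R[i]] that carries the
   topology of the norm. *)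

Definition borel (G : PreTopologicalZmodule.type) : Type := G.

HB.instance Definition _ (G : PreTopologicalZmodule.type) :=
  Choice.on (borel G).
HB.instance Definition _ (G : PreTopologicalZmodule.type) :=
  isPointed.Build (borel G) (0 : G).
HB.instance Definition _ (G : PreTopologicalZmodule.type) :=
  @isMeasurable.Build (sigma_display (@open G)) (borel G) <<s @open G >>
    (@sigma_algebra0 _ setT (@open G))
    (@sigma_algebraC (borel G) (@open G))
    (@sigma_algebra_bigcup _ setT (@open G)).

Definition lcag (G : topologicalZmodType) : Prop :=
  [/\ hausdorff_space G, locally_compact [set: G] &
      exists2 K : nat -> set G, forall n, compact (K n) & \bigcup_n K n = setT].

(* On the sigma-compact groups this agrees with the other usual notions of
   Radon measure; on a dual group, which need not be sigma-compact, it is the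
   inner regular Radon measure attached to a positive functional on C_c. *)
Definition radon (R : realType) (G : PreTopologicalZmodule.type)
    (mu : {measure set (borel G) -> \bar R}) : Prop :=
  (forall K : set G, compact K -> (mu K < +oo)%E) /\
  (forall A : set (borel G), measurable A ->
    mu A = ereal_sup [set mu K | K in [set K : set G | compact K /\ K `<=` A]]).

Definition haar (R : realType) (G : topologicalZmodType)
    (mu : {measure set (borel G) -> \bar R}) : Prop :=
  [/\ radon mu, mu setT != 0%E &
      forall (A : set (borel G)) (x : G), measurable A ->
        mu [set x + (y : G) | y in A] = mu A].

Record dual_group (R : realType) (G : topologicalZmodType) := Character {
  char_fun :> G -> R[i]^o ;
  char_norm : forall x, `|char_fun x| = 1 ;
  charD : forall x y, char_fun (x + y) = char_fun x * char_fun y ;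
  char_continuous : continuous char_fun }.

Section DualGroup.
Context {R : realType} {G : topologicalZmodType}.
Implicit Types chi eta : dual_group R G.

Lemma char_eq chi eta : (forall x, chi x = eta x) -> chi = eta.
Proof.
case: chi eta => [f f1 f2 f3] [g g1 g2 g3] /= /funext fg.
by subst g; congr Character; exact: Prop_irrelevance.
Qed.

HB.instance Definition _ := gen_eqMixin (dual_group R G).
HB.instance Definition _ := gen_choiceMixin (dual_group R G).

Lemma conj_continuous : continuous ((fun z => z^*) : R[i]^o -> R[i]^o).
Proof.
move=> z A [e /= e0 zA]; exists e => // w zw; apply: zA.
by move: zw; rewrite /ball_/= -[X in _ -> `|X| < _]rmorphB normcJ.
Qed.

Lemma char_zero_continuous : continuous ((fun=> 1) : G -> R[i]^o).
Proof. by move=> x; exact: cvg_cst. Qed.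

Lemma char_add_continuous chi eta :
  continuous ((fun x => chi x * eta x) : G -> R[i]^o).
Proof. by move=> x; apply: cvgM; exact: char_continuous. Qed.

Lemma char_opp_continuous chi :
  continuous ((fun x => (chi x)^*) : G -> R[i]^o).
Proof.
move=> x; apply: (@continuous_comp _ _ _ chi (fun z : R[i]^o => z^* : R[i]^o)).
  exact: char_continuous.
exact: conj_continuous.
Qed.

Lemma char_zero_norm (x : G) : `|1 : R[i]^o| = 1.
Proof. by rewrite normr1. Qed.

Lemma char_zeroD (x y : G) : (1 : R[i]^o) = 1 * 1.
Proof. by rewrite mulr1. Qed.

Lemma char_add_norm chi eta x : `|chi x * eta x| = 1.
Proof. by rewrite normrM !char_norm mulr1. Qed.

Lemma char_addD chi eta x y :
  chi (x + y) * eta (x + y) = (chi x * eta x) * (chi y * eta y).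
Proof. by rewrite !charD mulrACA. Qed.

Lemma char_opp_norm chi x : `|(chi x)^* : R[i]^o| = 1.
Proof. by rewrite normcJ char_norm. Qed.

Lemma char_oppD chi x y : (chi (x + y))^* = (chi x)^* * (chi y)^*.
Proof. by rewrite charD rmorphM. Qed.

Definition char_zero : dual_group R G :=
  Character char_zero_norm char_zeroD char_zero_continuous.

Definition char_add chi eta : dual_group R G :=
  Character (char_add_norm chi eta) (char_addD chi eta)
    (char_add_continuous (chi := chi) (eta := eta)).

(* The groups being written additively, [- chi] is the conjugate character. *)
Definition char_opp chi : dual_group R G :=
  Character (char_opp_norm chi) (char_oppD chi)
    (char_opp_continuous (chi := chi)).

Lemma char_addA : associative char_add.
Proof. by move=> a b c; apply: char_eq => x /=; rewrite mulrA. Qed.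

Lemma char_addC : commutative char_add.
Proof. by move=> a b; apply: char_eq => x /=; rewrite mulrC. Qed.

Lemma char_add0 : left_id char_zero char_add.
Proof. by move=> a; apply: char_eq => x /=; rewrite mul1r. Qed.

Lemma char_addN : left_inverse char_zero char_opp char_add.
Proof.
by move=> a; apply: char_eq => x /=; rewrite mulrC -sqr_normc char_norm expr1n.
Qed.

HB.instance Definition _ := GRing.isZmodule.Build (dual_group R G)
  char_addA char_addC char_add0 char_addN.

HB.instance Definition _ := Topological.copy (dual_group R G)
  (initial_topology
    (fun chi => char_fun chi : {compact-open, G -> R[i]^o})).

End DualGroup.

Definition cintegral (R : realType) (G : PreTopologicalZmodule.type)
    (mu : {measure set (borel G) -> \bar R}) (f : G -> R[i]^o) : R[i]^o :=
  (\int[mu]_(x in setT) complex.Re (f x)) +i*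
  (\int[mu]_(x in setT) complex.Im (f x)).

Definition sqnorm (R : realType) (z : R[i]^o) : R := Normc.normc z ^+ 2.

Definition fourier (R : realType) (G : topologicalZmodType)
    (mu : {measure set (borel G) -> \bar R}) (f : G -> R[i]^o)
    (chi : dual_group R G) : R[i]^o :=
  cintegral mu (fun x => f x * (chi x)^*).

Definition continuous_cs (R : realType) (G : topologicalZmodType)
    (f : G -> R[i]^o) : Prop :=
  continuous f /\ compact (closure [set x | f x != 0]).

Definition tilde (R : realType) (G : topologicalZmodType)
    (f : G -> R[i]^o) : G -> R[i]^o := fun x => (f (- x))^*.

Definition convolution (R : realType) (G : topologicalZmodType)
    (mu : {measure set (borel G) -> \bar R}) (f g : G -> R[i]^o) :
    G -> R[i]^o :=
  fun x => cintegral mu (fun y => f y * g (x - y)).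

(* An unbounded complex measure on [G] is represented by the functional
   [f |-> \int f d mu], as is usual for complex Radon measures, which need not
   extend to countably additive functions on all Borel sets. *)
Definition functional (R : realType) (G : topologicalZmodType) : Type :=
  (G -> R[i]^o) -> R[i]^o.

Definition complex_radon (R : realType) (G : topologicalZmodType)
    (mu : functional R G) : Prop :=
  (forall (a : R[i]^o) f g, continuous_cs f -> continuous_cs g ->
     mu (fun x => a * f x + g x) = a * mu f + mu g) /\
  (forall K : set G, compact K -> exists M : R,
     forall f (c : R), continuous_cs f -> [set x | f x != 0] `<=` K ->
       (forall x, Normc.normc (f x) <= c) -> Normc.normc (mu f) <= M * c).

Definition dirac_comb (R : realType) (G : topologicalZmodType)
    (S : set G) (w : G -> R[i]^o) : functional R G :=
  fun f => \sum_(s \in S) w s * f s.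

Definition mrestrict (R : realType) (G : topologicalZmodType)
    (mu : functional R G) (D : set G) : functional R G :=
  fun f => mu (fun x => (x \in D)%:R * f x).

(* [\int f d(tilde mu)] is the conjugate of [\int tilde f d mu] when
   [tilde mu (B)] is the conjugate of [mu (- B)]. *)
Definition mtilde (R : realType) (G : topologicalZmodType)
    (mu : functional R G) : functional R G :=
  fun f => (mu (tilde f))^*.

Definition mconvolution (R : realType) (G : topologicalZmodType)
    (mu nu : functional R G) : functional R G :=
  fun f => mu (fun x => nu (fun y => f (x + y))).

Definition vh_boundary (G : topologicalZmodType) (K A : set G) : set G :=
  ([set a + k | a in A & k in K] `\` interior A) `|`
  ([set c - k | c in closure (~` A) & k in K] `&` A).

Definition van_hove (R : realType) (G : topologicalZmodType)
    (mu : {measure set (borel G) -> \bar R}) (D : nat -> set G) : Prop :=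
  [/\ forall n, D n `<=` D n.+1, forall n, compact (D n),
      forall n, (0 < mu (D n))%E &
      forall K : set G, compact K ->
        (mu (vh_boundary K (D n)) * ((fine (mu (D n)))^-1)%:E)%E
          @[n --> \oo] --> 0%E].

(* The limit is taken in the vague topology. *)
Definition autocorrelation (R : realType) (G : topologicalZmodType)
    (m : {measure set (borel G) -> \bar R}) (D : nat -> set G)
    (mu gamma : functional R G) : Prop :=
  complex_radon gamma /\
  forall f, continuous_cs f ->
    ((fine (m (D n)))^-1)%:C *
      mconvolution (mrestrict mu (D n)) (mtilde (mrestrict mu (D n))) f
      @[n --> \oo] --> gamma f.

(* [gamma] being a limit of positive definite measures, its Fourier transform
   is positive, so that it can be sought among nonnegative measures. *)
Definition fourier_transform (R : realType) (G : topologicalZmodType)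
    (m : {measure set (borel G) -> \bar R}) (gamma : functional R G)
    (nu : {measure set (borel (dual_group R G)) -> \bar R}) : Prop :=
  radon nu /\
  forall f, continuous_cs f ->
    let F := fun chi : dual_group R G => sqnorm (fourier m f (- chi)) in
    nu.-integrable setT (EFin \o F) /\
    gamma (convolution m f (tilde f)) = (\int[nu]_(chi in setT) F chi)%:C.

Definition diffraction_measure (R : realType) (G : topologicalZmodType)
    (m : {measure set (borel G) -> \bar R}) (D : nat -> set G)
    (mu : functional R G)
    (nu : {measure set (borel (dual_group R G)) -> \bar R}) : Prop :=
  exists2 gamma : functional R G,
    autocorrelation m D mu gamma & fourier_transform m gamma nu.

Definition discrete_set (T : topologicalType) (A : set T) : Prop :=
  A `<=` isolated A.

Definition cut_project_scheme (G Gint : topologicalZmodType)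
    (Lt : zmodClosed (G * Gint)%type) : Prop :=
  [/\ lcag G /\ lcag Gint,
      discrete_set [set` Lt],
      compact [set: quotient_topology {ideal_quot Lt}],
      {in Lt &, injective (fun p : G * Gint => p.1)} &
      dense [set p.2 | p in [set` Lt]]].

(* Used, like [star_map], for a lattice and for its dual lattice. *)
Definition proj_lattice (A B : zmodType) (L : set (A * B)) : set A :=
  [set p.1 | p in L].

Definition star_map (A B : zmodType) (L : set (A * B)) (a : A) : B :=
  xget 0 [set b | L (a, b)].

Definition fundamental_domain (G Gint : topologicalZmodType)
    (Lt : zmodClosed (G * Gint)%type) (F : set (G * Gint)) : Prop :=
  measurable (F : set (borel G * borel Gint)) /\
  forall x, exists! y, F y /\ x - y \in Lt.

Definition covolume (R : realType) (G Gint : topologicalZmodType)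
    (m : {measure set (borel G) -> \bar R})
    (theta : {measure set (borel Gint) -> \bar R})
    (Lt : zmodClosed (G * Gint)%type) : R :=
  fine ((m \x theta)%E (xget set0 [set F | fundamental_domain Lt F])).

Definition window (Gint : topologicalZmodType) (W : set Gint) : Prop :=
  [/\ W !=set0, measurable (W : set (borel Gint)) & precompact W].

Definition model_set (G Gint : topologicalZmodType)
    (Lt : zmodClosed (G * Gint)%type) (W : set Gint) : set G :=
  [set s | proj_lattice [set` Lt] s /\ W (star_map [set` Lt] s)].

Definition dual_lattice (R : realType) (G Gint : topologicalZmodType)
    (Lt : zmodClosed (G * Gint)%type) :
    set (dual_group R G * dual_group R Gint) :=
  [set p : dual_group R G * dual_group R Gint |
     forall s, proj_lattice [set` Lt] s ->
     p.1 s * p.2 (star_map [set` Lt] s) = 1].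

Arguments dual_lattice R {G Gint} Lt.

Definition minkowski_diff (G : zmodType) (A B : set G) : set G :=
  [set x - y | x in A & y in B].

Definition translate (G : zmodType) (t : G) (A : set G) : set G :=
  [set t + x | x in A].

Definition generated (G : zmodType) (A : set G) : set G :=
  smallest [set H : set G | H 0 /\ forall x y, H x -> H y -> H (x - y)] A.

Definition finite_local_complexity (G : topologicalZmodType) (P : set G) :
    Prop :=
  [/\ countable P, closed (minkowski_diff P P) & discrete_set (minkowski_diff P P)].

Definition repetitive (G : topologicalZmodType) (P : set G) : Prop :=
  finite_local_complexity P /\
  forall K : set G, compact K -> exists2 K' : set G, compact K' &
    forall t1 t2 : G, exists2 s, K' s &
      translate t1 P `&` K = translate (s + t2) P `&` K.

Definition complex_process (R : realType) (d : measure_display)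
    (Omega : measurableType d) (I : Type) (W : set I)
    (B : I -> Omega -> R[i]^o) : Prop :=
  forall y, W y ->
    measurable_fun setT (fun om => complex.Re (B y om)) /\
    measurable_fun setT (fun om => complex.Im (B y om)).

Definition sample_path (R : realType) (Omega I : Type) (W : set I)
    (B : I -> Omega -> R[i]^o) (om : Omega) : I -> R[i]^o :=
  fun y => (y \in W)%:R * B y om.

Definition random_comb (R : realType) (Omega : Type)
    (G Gint : topologicalZmodType) (Lt : zmodClosed (G * Gint)%type)
    (W : set Gint) (B : Gint -> Omega -> R[i]^o) (om : Omega) :
    functional R G :=
  dirac_comb (model_set Lt W) (fun s => B (star_map [set` Lt] s) om).

(* A random variable that is only defined almost surely has to be measurable
   up to a null set for its expectation to make sense. *)
Definition ae_measurable (R : realType) (d : measure_display)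
    (Omega : measurableType d) (P : probability Omega R)
    (X : Omega -> \bar R) : Prop :=
  exists2 Y : Omega -> \bar R,
    measurable_fun setT Y & {ae P, forall om, X om = Y om}.

(* Main.v *)
(* Fix a realization b of the process. Since the boundary of W is null, b is
   Riemann integrable; weighted averages of its values along the van Hove
   sequence are compared with means of lattice-periodic functions, which the
   density of the internal projection makes equidistributed, and the
   autocorrelation is |L~|^-1 sum_z (b * b~)(z^star) delta_z. Its value at
   phi * phi~ is the mean square, over the compact quotient by the lattice, of
   the periodization of phi (x) b. Parseval's identity on the quotient, whose
   characters come from the top eigenspaces of convolution operators, turns it
   into sum_chi |phi^(-chi)|^2 |b^(-chi^star)|^2 / |L~|^2, so that a pure-point
   measure is a Fourier transform of the autocorrelation. Test functions that
   isolate one character show that every Fourier transform has the same atoms,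
   and the total mass leaves no room for anything else.

   The dual module may be uncountable, so expectation and sum cannot be
   exchanged at once. As W is regular closed and aperiodic, the function
   c |-> theta((c + W) \ W) vanishes only at 0. On W every character is then,
   up to any epsilon, determined by its rounded values on a finite net that is
   fine for this function, hence by one of countably many codes. This yields a
   countable set of characters that carries the sum for all realizations
   simultaneously. Each term is measurable as a limit of finite averages, and
   Tonelli's theorem concludes. *)
Require Import Defs.
From HB Require Import structures.
From mathcomp Require Import all_boot all_order all_algebra ring_quotient.
From mathcomp Require Import all_classical all_reals all_analysis.
From mathcomp Require Import measurable_realfun complex ring lra zify.

Set Implicit Arguments.
Unset Strict Implicit.
Unset Printing Implicit Defensive.

Import Order.TTheory GRing.Theory Num.Theory.
Import numFieldTopology.Exports numFieldNormedType.Exports.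

Local Open Scope classical_set_scope.
Local Open Scope complex_scope.
Local Open Scope ring_scope.

(** Three obstacles shape the details. A realization [b] may jump on the boundary of [W], so its
    periodization is not continuous. It is replaced by a continuous [f1]; as the number of
    characters needed then depends on [f1], the error [b - f1] is controlled by Bessel's inequality
    and not character by character. Secondly, the groups need not have countable bases: the product
    of the two Borel sigma-algebras may miss open sets of the product group, which is why
    measurability accompanies continuity there. The analysis on the quotient uses only continuous
    functions and uniform limits; an L^2-Cauchy sequence is made uniformly Cauchy by convolving it
    with a fixed function. Thirdly, the statement admits any choice of diffraction measures, made
    separately for each realization. So all of them must be identified on every measurable set, and
    [nu om A] is known only to agree almost surely with a measurable function of [om]. *)

Section ComplexNorm.
Context {R : realType}.
Local Notation C := (R[i]^o).
Implicit Types z w : C.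

Definition nrm (z : C) : R := Normc.normc z.

Lemma normE z : `|z| = (nrm z)%:C. Proof. by []. Qed.

Lemma nrm0 : nrm 0 = 0. Proof. exact: Normc.normc0. Qed.

Lemma nrm1 : nrm 1 = 1. Proof. exact: Normc.normc1. Qed.

Lemma nrmM z w : nrm (z * w) = nrm z * nrm w.
Proof. exact: Normc.normcM. Qed.

Lemma nrmN z : nrm (- z) = nrm z. Proof. exact: normcN. Qed.

Lemma nrmD z w : nrm (z + w) <= nrm z + nrm w.
Proof. exact: le_normcD. Qed.

Lemma nrmB z w : nrm (z - w) <= nrm z + nrm w.
Proof. by rewrite -(nrmN w) nrmD. Qed.

Lemma nrm_sym z w : nrm (z - w) = nrm (w - z).
Proof. by rewrite -nrmN opprB. Qed.

Lemma nrm_ge0 z : 0 <= nrm z.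
Proof. by rewrite -lecR -normE normr_ge0. Qed.

Lemma nrm_eq0 z : (nrm z == 0) = (z == 0).
Proof. by rewrite -(inj_eq (@complexI _)) -normE normr_eq0. Qed.

Lemma nrm_gt0 z : (0 < nrm z) = (z != 0).
Proof. by rewrite lt0r nrm_ge0 nrm_eq0 andbT. Qed.

Lemma nrmR (x : R) : nrm x%:C = `|x|.
Proof. by rewrite /nrm /Normc.normc /= expr0n addr0 sqrtr_sqr. Qed.

Lemma nrmJ z : nrm z^* = nrm z.
Proof. by apply: (@complexI R); rewrite -!normE normcJ. Qed.

Lemma mulJ z : z * (z^* : C) = (nrm z ^+ 2)%:C :> C.
Proof. by rewrite rmorphXn /= -normE sqr_normc. Qed.

Lemma Re_nrm z : `|complex.Re z| <= nrm z.
Proof. by rewrite -lecR -normE normc_ge_Re. Qed.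

Lemma Im_nrm z : `|complex.Im z| <= nrm z.
Proof.
rewrite -sqrtr_sqr /nrm /Normc.normc; case: z => a b /=.
by rewrite ler_sqrt ?addr_ge0 ?sqr_ge0// lerDr sqr_ge0.
Qed.

Lemma nrm_ReIm z : nrm z <= `|complex.Re z| + `|complex.Im z|.
Proof.
rewrite {1}(complexE z) (le_trans (nrmD _ _))// nrmM !nrmR.
by rewrite lerD// [nrm _](_ : _ = 1) ?mul1r// /nrm /= expr0n expr1n add0r sqrtr1.
Qed.

Lemma conjK z : (z^*)^* = z :> C. Proof. exact: conjcK. Qed.

Lemma conj0 : (0 : C)^* = 0 :> C. Proof. exact: conjc0. Qed.

Lemma conj1 : (1 : C)^* = 1 :> C. Proof. exact: conjc1. Qed.

Lemma ReJ z : complex.Re z^* = complex.Re z. Proof. by case: z. Qed.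

Lemma ImJ z : complex.Im z^* = - complex.Im z. Proof. by case: z. Qed.

Lemma conjM z w : (z * w)^* = (z^* : C) * (w^* : C) :> C. Proof. exact: rmorphM. Qed.

Lemma conjD z w : (z + w)^* = (z^* : C) + (w^* : C) :> C. Proof. exact: rmorphD. Qed.

Lemma conjB z w : (z - w)^* = (z^* : C) - (w^* : C) :> C. Proof. exact: rmorphB. Qed.

Lemma conj_sum (I : Type) (r : seq I) (P : pred I) (F : I -> C) :
  (\sum_(i <- r | P i) F i)^* = \sum_(i <- r | P i) ((F i)^* : C) :> C.
Proof. exact: rmorph_sum. Qed.

Lemma conjR (x : R) : (x%:C : C)^* = x%:C :> C. Proof. exact: conjc_real. Qed.

Lemma RC_eq0 (x : R) : ((x%:C : C) == 0) = (x == 0).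
Proof. exact: (inj_eq (@complexI R) x 0). Qed.

Lemma ReD z w : complex.Re (z + w) = complex.Re z + complex.Re w.
Proof. by case: z w => [? ?] []. Qed.

Lemma ReB z w : complex.Re (z - w) = complex.Re z - complex.Re w.
Proof. by case: z w => [? ?] []. Qed.

Lemma ImD z w : complex.Im (z + w) = complex.Im z + complex.Im w.
Proof. by case: z w => [? ?] []. Qed.

Lemma ReRM (x : R) z : complex.Re (x%:C * z) = x * complex.Re z.
Proof. by case: z => a b; rewrite /= mul0r subr0. Qed.

Lemma ImRM (x : R) z : complex.Im (x%:C * z) = x * complex.Im z.
Proof. by case: z => a b; rewrite /= mul0r addr0. Qed.

Lemma nrm_sum (I : Type) (r : seq I) (P : pred I) (F : I -> C) :
  nrm (\sum_(i <- r | P i) F i) <= \sum_(i <- r | P i) nrm (F i).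
Proof.
elim/big_rec2: _ => [|i y x _ h]; first by rewrite nrm0.
by rewrite (le_trans (nrmD _ _))// lerD2l.
Qed.

Lemma nrm_dist z w : `|nrm z - nrm w| <= nrm (z - w).
Proof.
rewrite ler_norml -[X in _ && X]opprK; apply/andP; split.
  by rewrite lerNl opprB lerBlDl nrm_sym -{1}(subrK z w) addrC nrmD.
by rewrite opprK lerBlDl -{1}(subrK w z) addrC nrmD.
Qed.

Lemma nrm_le_eq z w : (forall e : R, 0 < e -> nrm (z - w) <= e) -> z = w.
Proof.
move=> h; apply/eqP; rewrite -subr_eq0 -nrm_eq0 eq_le nrm_ge0 andbT.
by apply/ler_addgt0Pr => e e0; rewrite add0r h.
Qed.

Lemma nrm_split w z (t : C) : nrm (z - t) <= nrm (z - w) + nrm (w - t).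
Proof. by rewrite -{1}(subrK w z) -addrA nrmD. Qed.

Lemma cvgC_nrm (T : Type) (F : set_system T) (FF : Filter F) (f : T -> C) (l : C) :
  f x @[x --> F] --> l <->
  forall e : R, 0 < e -> \forall x \near F, nrm (f x - l) < e.
Proof.
split=> [/cvgrPdist_lt h e e0|h].
  have e0' : (0 : R[i]) < e%:C by rewrite ltcR.
  apply: filterS (h _ e0') => x; rewrite distrC normE ltcR; exact.
(* A positive element of [R[i]] is real, so the complex radii of the norm topology are the real
   ones. *)
apply/cvgrPdist_lt => e; case: e => a b; rewrite ltcE /= => /andP[/eqP -> a0].
by apply: filterS (h _ a0) => x; rewrite distrC normE ltcR.
Qed.

Lemma continuous_nrm (T : topologicalType) (f : T -> C) (x : T) :
  {for x, continuous f} <->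
  forall e : R, 0 < e -> \forall y \near x, nrm (f y - f x) < e.
Proof. by rewrite /prop_for /continuous_at; exact: cvgC_nrm. Qed.

Lemma nrm_continuous (T : topologicalType) (f : T -> C) :
  continuous f -> continuous (fun x => nrm (f x)).
Proof.
move=> cf x; apply/cvgrPdist_lt => e e0.
have /(_ _ e0) := (continuous_nrm f x).1 (cf x).
apply: filterS => y; apply: le_lt_trans; rewrite nrm_sym; exact: nrm_dist.
Qed.

Lemma ReC_continuous (T : topologicalType) (f : T -> C) :
  continuous f -> continuous (fun x => complex.Re (f x)).
Proof.
move=> cf x; apply/cvgrPdist_lt => e e0.
have /(_ _ e0) := (continuous_nrm f x).1 (cf x).
apply: filterS => y; apply: le_lt_trans; rewrite nrm_sym -ReB; exact: Re_nrm.
Qed.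

Lemma ImC_continuous (T : topologicalType) (f : T -> C) :
  continuous f -> continuous (fun x => complex.Im (f x)).
Proof.
move=> cf x; apply/cvgrPdist_lt => e e0.
have /(_ _ e0) := (continuous_nrm f x).1 (cf x).
apply: filterS => y; apply: le_lt_trans.
rewrite nrm_sym (_ : _ - _ = complex.Im (f x - f y)) ?Im_nrm//.
by case: (f x) (f y) => [? ?] [].
Qed.

Lemma real_complex_continuous (T : topologicalType) (f : T -> R) :
  continuous f -> continuous (fun x => (f x)%:C : C).
Proof.
move=> cf x; apply/continuous_nrm => e e0.
have /cvgrPdist_lt/(_ _ e0) := cf x.
by apply: filterS => y; rewrite -rmorphB nrmR distrC.
Qed.

Lemma cauchyC_lim (u : nat -> C) :
  (forall e : R, 0 < e -> exists N, forall n m, (N <= n)%N -> (N <= m)%N ->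
     nrm (u n - u m) <= e) ->
  exists l : C, forall e : R, 0 < e -> forall N,
    (forall n m, (N <= n)%N -> (N <= m)%N -> nrm (u n - u m) <= e) ->
    forall n, (N <= n)%N -> nrm (u n - l) <= 2 * e.
Proof.
move=> hu.
have cv (p : C -> R) : (forall z w, `|p z - p w| <= nrm (z - w)) ->
    cvgn (fun n => p (u n)).
  move=> hp; apply/cauchy_cvgP/cauchy_ballP => e e0.
  have [N hN] := hu _ (divr_gt0 e0 (ltr0n _ 2)).
  pose A := [set x | exists2 n, (N <= n)%N & x = p (u n)].
  exists (A, A); first by split; exists N => // n Nn; exists n.
  move=> [_ _] /= [[n hn ->] [m hm ->]]; rewrite /ball/=.
  rewrite (le_lt_trans (hp _ _))// (le_lt_trans (hN _ _ hn hm))//.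
  by rewrite ltr_pdivrMr// mulr_natr mulr2n ltrDl.
have hR z w : `|complex.Re z - complex.Re w| <= nrm (z - w).
  by rewrite -ReB Re_nrm.
have hI z w : `|complex.Im z - complex.Im w| <= nrm (z - w).
  rewrite (_ : _ - _ = complex.Im (z - w)) ?Im_nrm//.
  by case: z w => [? ?] [].
have /cvg_ex[a ha] := cv _ hR; have /cvg_ex[b hb] := cv _ hI.
exists (a +i* b) => e e0 N hN n Nn.
have bnd (p : C -> R) c : (forall z w, `|p z - p w| <= nrm (z - w)) ->
    (fun n => p (u n)) @ \oo --> c -> `|p (u n) - c| <= e.
  move=> hp hc; apply/ler_addgt0Pr => d d0.
  have /cvgrPdist_lt/(_ _ d0)[K _ hK] := hc.
  have := hK (maxn K N) (leq_maxl _ _).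
  rewrite distrC => h1; rewrite -(subrK (p (u (maxn K N))) (p (u n))) -addrA.
  rewrite (le_trans (ler_normD _ _))// lerD// ?(ltW h1)//.
  by rewrite (le_trans (hp _ _))// hN// leq_maxr.
rewrite (le_trans (nrm_ReIm _))//.
have -> : complex.Re (u n - (a +i* b)) = complex.Re (u n) - a.
  by case: (u n).
have -> : complex.Im (u n - (a +i* b)) = complex.Im (u n) - b.
  by case: (u n).
by rewrite mulr2n mulrDl mul1r lerD// bnd.
Qed.

End ComplexNorm.

(** * Bounded mean systems and their characters *)

(* [mfun] plays the role of the continuous functions on a compact quotient of
   [X] and [mean] that of its normalized Haar integral; [mean_riemann] says
   that the mean is approximated by weighted point evaluations, uniformly over
   all functions with a given modulus of continuity, and replaces Fubini. *)
Record mean_system (R : realType) (X : zmodType) := MeanSystem {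
  mfun : (X -> R[i]^o) -> Prop ;
  mean : (X -> R[i]^o) -> R[i]^o ;
  mnbh : set X -> Prop ;
  mfun_cst : forall a, mfun (fun=> a) ;
  mfun_lin : forall a f g, mfun f -> mfun g -> mfun (fun x => a * f x + g x) ;
  mfun_mul : forall f g, mfun f -> mfun g -> mfun (fun x => f x * g x) ;
  mfun_conj : forall f, mfun f -> mfun (fun x => (f x)^*) ;
  mfun_shift : forall f t, mfun f -> mfun (fun x => f (x + t)) ;
  mfun_opp : forall f, mfun f -> mfun (fun x => f (- x)) ;
  mfun_bnd : forall f, mfun f -> exists c : R, forall x, nrm (f x) <= c ;
  mfun_lim : forall f, (forall e : R, 0 < e -> exists2 g, mfun g &
    forall x, nrm (f x - g x) <= e) -> mfun f ;
  mfun_unif : forall f (e : R), mfun f -> 0 < e -> exists2 U, mnbh U &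
    forall x u, U u -> nrm (f (x + u) - f x) <= e ;
  mnbhI : forall U V, mnbh U -> mnbh V -> mnbh (U `&` V) ;
  mean_cst : forall a, mean (fun=> a) = a ;
  mean_lin : forall a f g, mfun f -> mfun g ->
    mean (fun x => a * f x + g x) = a * mean f + mean g ;
  mean_conj : forall f, mfun f -> mean (fun x => (f x)^*) = (mean f)^* ;
  mean_le : forall f (c : R), mfun f -> (forall x, nrm (f x) <= c) ->
    nrm (mean f) <= c ;
  mean_shift : forall f t, mfun f -> mean (fun x => f (x + t)) = mean f ;
  mean_ge0 : forall f, mfun f ->
    0 <= complex.Re (mean (fun x => f x * (f x)^*)) ;
  mean_eq0 : forall f, mfun f -> mean (fun x => f x * (f x)^*) = 0 ->
    forall x, f x = 0 ;
  mean_riemann : forall U, mnbh U -> exists l : seq (R[i]^o * X),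
    forall f (e : R), mfun f ->
    (forall x u, U u -> nrm (f (x + u) - f x) <= e) ->
    nrm (mean f - \sum_(p <- l) p.1 * f p.2) <= e }.

Section MeanTheory.
Context {R : realType} {X : zmodType} (S : mean_system R X).
Local Notation C := (R[i]^o).
Local Notation V := (mfun S).
Local Notation M := (mean S).
Implicit Types f g h k p q : X -> C.

Lemma mfunZ a f : V f -> V (fun x => a * f x).
Proof.
move=> Vf; have := mfun_lin a Vf (mfun_cst S 0).
by congr (mfun S _); apply/funext => x; rewrite addr0.
Qed.

Lemma mfunD f g : V f -> V g -> V (fun x => f x + g x).
Proof.
move=> Vf Vg; have := mfun_lin 1 Vf Vg.
by congr (mfun S _); apply/funext => x; rewrite mul1r.
Qed.

Lemma mfunB f g : V f -> V g -> V (fun x => f x - g x).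
Proof.
move=> Vf Vg; have := mfun_lin (-1) Vg Vf.
by congr (mfun S _); apply/funext => x; rewrite mulN1r addrC.
Qed.

Lemma mfun_sum (I : Type) (r : seq I) (F : I -> X -> C) :
  (forall i, V (F i)) -> V (fun x => \sum_(i <- r) F i x).
Proof.
move=> VF; elim: r => [|i r IH].
  have := mfun_cst S 0; congr (mfun S _).
  by apply/funext => x; rewrite big_nil.
have := mfunD (VF i) IH; congr (mfun S _).
by apply/funext => x; rewrite big_cons.
Qed.

Lemma meanZ a f : V f -> M (fun x => a * f x) = a * M f.
Proof.
move=> Vf; have := mean_lin a Vf (mfun_cst S 0); rewrite mean_cst addr0 => <-.
by congr M; apply/funext => x; rewrite addr0.
Qed.

Lemma meanD f g : V f -> V g -> M (fun x => f x + g x) = M f + M g.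
Proof.
move=> Vf Vg; have := mean_lin 1 Vf Vg; rewrite mul1r => <-.
by congr M; apply/funext => x; rewrite mul1r.
Qed.

Lemma meanB f g : V f -> V g -> M (fun x => f x - g x) = M f - M g.
Proof.
move=> Vf Vg; have := mean_lin (-1) Vg Vf; rewrite mulN1r addrC => <-.
by congr M; apply/funext => x; rewrite mulN1r addrC.
Qed.

Lemma mean_sum (I : Type) (r : seq I) (F : I -> X -> C) :
  (forall i, V (F i)) ->
  M (fun x => \sum_(i <- r) F i x) = \sum_(i <- r) M (F i).
Proof.
move=> VF; elim: r => [|i r IH].
  rewrite big_nil -[RHS](mean_cst S); congr M.
  by apply/funext => x; rewrite big_nil.
rewrite big_cons -IH -meanD ?VF//; last exact: mfun_sum.
by congr M; apply/funext => x; rewrite big_cons.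
Qed.

Definition modulus (F : X -> X -> C) := forall e : R, 0 < e ->
  exists2 U, mnbh S U & forall r u s, U u -> nrm (F (r + u) s - F r s) <= e.

(** The kernels for which two means commute. Equicontinuity in each variable, uniform in the other
    one, stands in for continuity on the square of the compact quotient. *)
Definition joint (F : X -> X -> C) :=
  [/\ forall s, V (F^~ s), forall r, V (F r),
      exists c : R, forall r s, nrm (F r s) <= c,
      modulus F & modulus (fun s r => F r s)].

(** The Riemann sums of [mean_riemann] are finite combinations of the functions [F p.2], and they
    approximate the mean uniformly in [s]; [mfun_lim] then applies. *)
Lemma mfun_mean F : joint F -> V (fun s => M (F^~ s)).
Proof.
move=> [V1 V2 _ m1 _]; apply: mfun_lim => e e0.
have [U EU hU] := m1 _ e0; have [l hl] := mean_riemann EU.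
exists (fun s => \sum_(p <- l) p.1 * F p.2 s).
  by apply: mfun_sum => p; apply: mfunZ.
by move=> s; apply: hl => // x u Uu; apply: hU.
Qed.

Lemma jointC F : joint F -> joint (fun s r => F r s).
Proof. by move=> [? ? [c hc] ? ?]; split => //; exists c. Qed.

(** One of the two means is replaced by a Riemann sum, which commutes with the other mean by
    linearity. By equicontinuity each side is within [e / 2] of the mean of the sum. *)
Lemma mean_swap F : joint F ->
  M (fun r => M (F r)) = M (fun s => M (F^~ s)).
Proof.
move=> jF; have [V1 V2 _ m1 _] := jF.
apply: nrm_le_eq => e e0; have e20 : 0 < e / 2 by rewrite divr_gt0.
have [U EU hU] := m1 _ e20; have [l hl] := mean_riemann EU.
have VM1 : V (fun r => M (F r)) by exact: mfun_mean (jointC jF).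
have VM2 := mfun_mean jF.
rewrite (le_trans (nrm_split (\sum_(p <- l) p.1 * M (F p.2)) _ _))//.
rewrite [leRHS]splitr lerD//.
  apply: hl => // x u Uu; rewrite -meanB//; apply: mean_le => [|s].
    exact: mfunB.
  exact: hU.
have -> : \sum_(p <- l) p.1 * M (F p.2) =
          M (fun s => \sum_(p <- l) p.1 * F p.2 s).
  rewrite mean_sum => [|p]; last exact: mfunZ.
  by apply: eq_bigr => p _; rewrite meanZ.
rewrite -meanB//; last by apply: mfun_sum => p; apply: mfunZ.
apply: mean_le => [|s].
  by apply: mfunB => //; apply: mfun_sum => p; apply: mfunZ.
by rewrite nrm_sym; apply: hl => // x u Uu; exact: hU.
Qed.

Lemma modulus_mul F G : (exists c : R, forall r s, nrm (F r s) <= c) ->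
  (exists c : R, forall r s, nrm (G r s) <= c) ->
  modulus F -> modulus G -> modulus (fun r s => F r s * G r s).
Proof.
move=> [c hc] [d hd] mF mG e e0.
have c0 : 0 <= c by rewrite (le_trans (nrm_ge0 (F 0 0))).
have d0 : 0 <= d by rewrite (le_trans (nrm_ge0 (G 0 0))).
(* Adding 1 keeps the denominator positive when the bounds vanish; the same device recurs
   throughout. *)
have cd0 : 0 < c + d + 1 by rewrite ltr_wpDl ?addr_ge0.
have e'0 : 0 < e / (c + d + 1) by rewrite divr_gt0.
have [U EU hU] := mF _ e'0; have [U' EU' hU'] := mG _ e'0.
exists (U `&` U'); first exact: mnbhI.
move=> r u s [Uu Uu'].
have -> : F (r + u) s * G (r + u) s - F r s * G r s =
  (F (r + u) s - F r s) * G (r + u) s + F r s * (G (r + u) s - G r s).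
  by rewrite mulrBl mulrBr addrA subrK.
rewrite (le_trans (nrmD _ _))// !nrmM.
apply: (@le_trans _ _ (e / (c + d + 1) * d + c * (e / (c + d + 1)))).
  by rewrite lerD// ler_pM ?nrm_ge0// ?hU ?hU'.
rewrite [c * _]mulrC -mulrDr -mulrA ger_pMr// mulrC ler_pdivrMr// mul1r.
by rewrite addrC lerDl.
Qed.

Lemma jointM F G : joint F -> joint G -> joint (fun r s => F r s * G r s).
Proof.
move=> [F1 F2 F3 F4 F5] [G1 G2 G3 G4 G5].
have [c hc] := F3; have [d hd] := G3.
split=> [s|r|||]; [exact: mfun_mul| exact: mfun_mul | | exact: modulus_mul | ].
- by exists (c * d) => r s; rewrite nrmM ler_pM ?nrm_ge0.
- by apply: modulus_mul => //; [exists c|exists d].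
Qed.

Lemma joint_l f : V f -> joint (fun r _ => f r).
Proof.
move=> Vf; split=> //; first by move=> r; exact: mfun_cst.
- by have [c hc] := mfun_bnd Vf; exists c.
- by move=> e e0; have [U EU hU] := mfun_unif Vf e0; exists U => // *; exact: hU.
- move=> e e0; have [U EU hU] := mfun_unif Vf e0; exists U => // r u s _.
  by rewrite subrr nrm0 ltW.
Qed.

Lemma joint_r f : V f -> joint (fun _ s => f s).
Proof. by move=> Vf; apply: jointC; exact: joint_l. Qed.

Lemma joint_sub f t : V f -> joint (fun r s => f (t + r - s)).
Proof.
move=> Vf; have Vg := mfun_opp Vf; split.
- move=> s; have := mfun_shift (t - s) Vf; congr (mfun S _).
  by apply/funext => x; congr f; rewrite addrCA addrA.
- move=> r; have := mfun_shift (- (t + r)) Vg; congr (mfun S _).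
  by apply/funext => x; congr f; rewrite opprD opprK addrC.
- by have [c hc] := mfun_bnd Vf; exists c.
- move=> e e0; have [U EU hU] := mfun_unif Vf e0; exists U => // r u s Uu.
  have -> : t + (r + u) - s = t + r - s + u by rewrite addrA [LHS]addrAC.
  exact: hU.
- move=> e e0; have [U EU hU] := mfun_unif Vg e0; exists U => // s u r Uu.
  have -> : f (t + r - (s + u)) = f (- ((s - (t + r)) + u)).
    by congr f; rewrite !opprD !opprK; rewrite [in RHS](addrC (- s)) addrA.
  have -> : f (t + r - s) = f (- (s - (t + r))) by rewrite opprB.
  exact: hU.
Qed.

(** Reflection invariance is not among the axioms. It follows by taking the two iterated means of
    [f (r - s)]: shift invariance turns one into the mean of [f (- x)] and the other into that of
    [f]. *)
Lemma mean_opp f : V f -> M (fun x => f (- x)) = M f.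
Proof.
move=> Vf; have := mean_swap (joint_sub 0 Vf).
have -> : (fun r => M (fun s => f (0 + r - s))) = fun=> M (fun x => f (- x)).
  apply/funext => r; rewrite -[RHS](mean_shift (- r) (mfun_opp Vf)).
  by congr M; apply/funext => s; rewrite add0r opprB.
have -> : (fun s => M (fun r => f (0 + r - s))) = fun=> M f.
  apply/funext => s; rewrite -[RHS](mean_shift (- s) Vf).
  by congr M; apply/funext => r; rewrite add0r.
by rewrite !mean_cst.
Qed.

(** With [conv] and [til] the functions of the system form a commutative star-algebra; [ip] and [nn]
    are the inner product and the squared norm of L^2 on the quotient. *)
Definition conv f g : X -> C := fun r => M (fun s => f s * g (r - s)).
Definition til f : X -> C := fun x => (f (- x))^*.
Definition ip f g : C := M (fun x => f x * (g x)^*).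
Definition nn f : R := complex.Re (ip f f).
Local Notation "f ** g" := (conv f g) (at level 40, left associativity).

Lemma mfun_til f : V f -> V (til f).
Proof. by move=> Vf; apply: (mfun_opp (f := fun x => (f x)^*)); exact: mfun_conj. Qed.

Lemma tilK f : til (til f) = f.
Proof. by apply/funext => x; rewrite /til opprK conjK. Qed.

Lemma mfun_flip f r : V f -> V (fun s => f (r - s)).
Proof. by move=> Vf; have [_ + _ _ _] := joint_sub 0 Vf; move=> /(_ r); rewrite add0r. Qed.

Lemma mean_flip f r : V f -> M (fun s => f (r - s)) = M f.
Proof.
move=> Vf; rewrite -(mean_opp Vf) -(mean_shift (- r) (mfun_opp Vf)).
by congr M; apply/funext => s; rewrite opprB.
Qed.

Lemma mfun_conv f g : V f -> V g -> V (f ** g).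
Proof.
move=> Vf Vg; apply: (mfun_mean (F := fun s r => f s * g (r - s))).
apply: jointM; first exact: joint_l.
by apply: jointC; have := joint_sub 0 Vg; under eq_fun do under eq_fun do rewrite add0r.
Qed.
Hint Resolve mfun_conv mfun_til : core.

Lemma convC f g : V f -> V g -> f ** g = g ** f.
Proof.
move=> Vf Vg; apply/funext => r; rewrite /conv.
have V1 : V (fun s => f s * g (r - s)) by apply: mfun_mul => //; exact: mfun_flip.
rewrite -(mean_flip r V1); congr M; apply/funext => s.
by rewrite subKr mulrC.
Qed.

Lemma convA f g h : V f -> V g -> V h -> f ** g ** h = f ** (g ** h).
Proof.
move=> Vf Vg Vh; apply/funext => t; rewrite /conv.
pose F r s := f s * g (r - s) * h (t - r).
have jF : joint F.
  apply: jointM; last by apply: joint_l; exact: mfun_flip.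
  apply: jointM; first exact: joint_r.
  by have := joint_sub 0 Vg; under eq_fun do under eq_fun do rewrite add0r.
transitivity (M (fun r => M (F r))).
  congr M; apply/funext => r; rewrite mulrC -meanZ.
    by congr M; apply/funext => s; rewrite mulrC.
  by apply: mfun_mul => //; exact: mfun_flip.
rewrite (mean_swap jF); congr M; apply/funext => s.
have V1 : V (fun r => g r * h (t - s - r)) := mfun_mul Vg (mfun_flip (t - s) Vh).
rewrite -(mean_shift (- s) V1) -meanZ; last exact: (mfun_shift (- s) V1).
congr M; apply/funext => r; rewrite /F -mulrA; congr (_ * (_ * h _)).
by rewrite opprB addrA subrK.
Qed.

Lemma til_conv f g : V f -> V g -> til (f ** g) = til f ** til g.
Proof.
move=> Vf Vg; apply/funext => x; rewrite /til /conv -mean_conj; last first.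
  by apply: mfun_mul => //; exact: mfun_flip.
have V1 : V (fun s => (f s * g (- x - s))^*).
  by apply: mfun_conj; apply: mfun_mul => //; exact: mfun_flip.
rewrite -(mean_opp V1); congr M; apply/funext => s.
by rewrite conjM opprB opprK addrC.
Qed.

Lemma ipE f g : ip f g = (f ** til g) 0.
Proof. by rewrite /ip /conv; congr M; apply/funext => s; rewrite /til sub0r opprK. Qed.

Lemma convBl f g h : V f -> V g -> V h ->
  (fun x => f x - g x) ** h = fun x => (f ** h) x - (g ** h) x.
Proof.
move=> Vf Vg Vh; apply/funext => x; rewrite /conv -meanB.
- by congr M; apply/funext => s; rewrite mulrBl.
- by apply: mfun_mul => //; exact: mfun_flip.
- by apply: mfun_mul => //; exact: mfun_flip.
Qed.

Lemma convDl f g h : V f -> V g -> V h ->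
  (fun x => f x + g x) ** h = fun x => (f ** h) x + (g ** h) x.
Proof.
move=> Vf Vg Vh; apply/funext => x; rewrite /conv -meanD.
- by congr M; apply/funext => s; rewrite mulrDl.
- by apply: mfun_mul => //; exact: mfun_flip.
- by apply: mfun_mul => //; exact: mfun_flip.
Qed.

Lemma convZl a f h : V f -> V h ->
  (fun x => a * f x) ** h = fun x => a * (f ** h) x.
Proof.
move=> Vf Vh; apply/funext => x; rewrite /conv -meanZ.
- by congr M; apply/funext => s; rewrite mulrA.
- by apply: mfun_mul => //; exact: mfun_flip.
Qed.

Lemma ip_conj f g : V f -> V g -> (ip f g)^* = ip g f.
Proof.
move=> Vf Vg; rewrite /ip -mean_conj; last by apply: mfun_mul => //; exact: mfun_conj.
by congr M; apply/funext => x; rewrite conjM conjK mulrC.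
Qed.

Lemma ip_lin a f g h : V f -> V g -> V h ->
  ip (fun x => a * f x + g x) h = a * ip f h + ip g h.
Proof.
move=> Vf Vg Vh; have Vh' := mfun_conj Vh; rewrite /ip -mean_lin; try exact: mfun_mul.
by congr M; apply/funext => x; rewrite mulrDl mulrA.
Qed.

Lemma ipBl f g h : V f -> V g -> V h ->
  ip (fun x => f x - g x) h = ip f h - ip g h.
Proof.
move=> Vf Vg Vh; have Vh' := mfun_conj Vh; rewrite /ip -meanB; try exact: mfun_mul.
by congr M; apply/funext => x; rewrite mulrBl.
Qed.

Lemma ipZl a f h : V f -> V h -> ip (fun x => a * f x) h = a * ip f h.
Proof.
move=> Vf Vh; have Vh' := mfun_conj Vh; rewrite /ip -meanZ; last exact: mfun_mul.
by congr M; apply/funext => x; rewrite mulrA.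
Qed.

Lemma ipBr f g h : V f -> V g -> V h ->
  ip h (fun x => f x - g x) = ip h f - ip h g.
Proof.
move=> Vf Vg Vh; rewrite -ip_conj ?ipBl ?conjB ?ip_conj//; exact: mfunB.
Qed.

Lemma ipZr a f h : V f -> V h -> ip h (fun x => a * f x) = a^* * ip h f.
Proof.
by move=> Vf Vh; rewrite -ip_conj ?ipZl ?conjM ?ip_conj//; exact: mfunZ.
Qed.

Lemma nnE f : V f -> ip f f = (nn f)%:C.
Proof.
move=> Vf; have := ip_conj Vf Vf; rewrite /nn; case: (ip f f) => a b [/=].
by move=> /eqP; rewrite -subr_eq0 -opprD oppr_eq0 -mulr2n mulrn_eq0/= => /eqP ->.
Qed.

Lemma nn_ge0 f : V f -> 0 <= nn f. Proof. exact: mean_ge0. Qed.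

Lemma nn_eq0 f : V f -> nn f = 0 -> f = fun=> 0.
Proof.
move=> Vf f0; apply/funext; apply: (mean_eq0 Vf).
by move: (nnE Vf); rewrite f0 /ip => ->.
Qed.

Lemma nn_gt0 f : V f -> f <> (fun=> 0) -> 0 < nn f.
Proof.
move=> Vf f0; rewrite lt0r nn_ge0// andbT; apply/eqP => h.
exact: f0 (nn_eq0 Vf h).
Qed.

Lemma nnB f g : V f -> V g ->
  nn (fun x => f x - g x) = nn f + nn g - 2 * complex.Re (ip f g).
Proof.
move=> Vf Vg; rewrite /nn ipBl ?ipBr//; last exact: mfunB.
rewrite !ReB -(ip_conj Vf Vg).
rewrite ReJ.
ring.
Qed.

Lemma nnZ a f : V f -> nn (fun x => a * f x) = nrm a ^+ 2 * nn f.
Proof.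
move=> Vf; rewrite {1}/nn ipZl ?ipZr// ?nnE//; last exact: mfunZ.
by rewrite mulrA mulJ -rmorphM.
Qed.

Lemma ip_CS f g : V f -> V g -> nrm (ip f g) ^+ 2 <= nn f * nn g.
Proof.
move=> Vf Vg; have [g0|g0] := eqVneq (nn g) 0.
  rewrite (nn_eq0 Vg g0) [ip _ _](_ : _ = 0) ?nrm0 ?expr0n/= ?mulr_ge0 ?nn_ge0//.
    exact: mfun_cst.
  by rewrite -[RHS](mean_cst S) /ip; congr M; apply/funext => x; rewrite conj0 mulr0.
have gp : 0 < nn g by rewrite lt0r g0 nn_ge0.
(* The coefficient is that of the orthogonal projection of [f] onto [g]. *)
have := nn_ge0 (mfunB Vf (mfunZ (ip f g * ((nn g)^-1)%:C) Vg)).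
rewrite nnB//; last exact: mfunZ.
rewrite nnZ// ipZr// nrmM nrmR ger0_norm.
- have -> : (ip f g * ((nn g)^-1)%:C)^* * ip f g =
            (nrm (ip f g) ^+ 2 * (nn g)^-1)%:C.
    by rewrite conjM conjR mulrC mulrA mulJ -rmorphM.
  rewrite exprMn /=.
  have -> : nn f + nrm (ip f g) ^+ 2 * (nn g)^-1 ^+ 2 * nn g -
    2 * (nrm (ip f g) ^+ 2 * (nn g)^-1) = nn f - nrm (ip f g) ^+ 2 / nn g.
    by field.
  by rewrite subr_ge0 ler_pdivrMr.
- by rewrite invr_ge0 ltW.
Qed.

Lemma nn_flip f r : V f -> nn (fun s => (f (r - s))^*) = nn f.
Proof.
move=> Vf; rewrite /nn /ip.
have V1 : V (fun x => f x * (f x)^*) by apply: mfun_mul => //; exact: mfun_conj.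
rewrite -(mean_flip r V1); congr (complex.Re (M _)); apply/funext => s.
by rewrite conjK mulrC.
Qed.

Lemma nn_til f : V f -> nn (til f) = nn f.
Proof.
by move=> Vf; rewrite -(nn_flip 0 Vf); congr nn; apply/funext => s; rewrite /til sub0r.
Qed.

Lemma conv_bound f g x : V f -> V g -> nrm ((f ** g) x) ^+ 2 <= nn f * nn g.
Proof.
move=> Vf Vg; rewrite -(nn_flip x Vg).
have := ip_CS Vf (mfun_conj (mfun_flip x Vg)).
by congr (nrm (M _) ^+ 2 <= _); apply/funext => s; rewrite conjK.
Qed.

Lemma nn_bound f (c : R) : V f -> (forall x, nrm (f x) ^+ 2 <= c) -> nn f <= c.
Proof.
move=> Vf h; rewrite (le_trans (ler_norm _))// (le_trans (Re_nrm _))//.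
apply: mean_le => [|x]; first by apply: mfun_mul => //; exact: mfun_conj.
by rewrite nrmM nrmJ -expr2.
Qed.

(** Cauchy-Schwarz bounds the convolution at every point, and the mean has total mass 1. *)
Lemma nn_conv f g : V f -> V g -> nn (f ** g) <= nn f * nn g.
Proof. by move=> Vf Vg; apply: nn_bound => [|x]; [exact: mfun_conv|exact: conv_bound]. Qed.

(** Both inner products are values at 0 of one triple convolution, by [ipE]. *)
Lemma ip_adj k f g : V k -> V f -> V g -> ip (k ** f) g = ip f (til k ** g).
Proof.
move=> Vk Vf Vg; rewrite !ipE til_conv ?tilK//; last exact: mfun_til.
by rewrite (convC Vk Vf) convA//; exact: mfun_til.
Qed.

End MeanTheory.

(* Log-convexity makes the ratios [u n.+1 / u n] increase to a limit [L], and
   submultiplicativity keeps [u n / L ^ n] bounded below. *)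
Lemma geometric_growth (R : realType) (u : nat -> R) (c : R) :
  (forall n, 0 < u n) -> (forall n, u n.+1 ^+ 2 <= u n * u n.+2) ->
  0 < c -> (forall n m, u (n + m).+1 <= c * (u n * u m)) ->
  exists L l : R, [/\ 0 < L, 0 < l & forall e : R, 0 < e -> exists N,
    forall n, (N <= n)%N -> `|u n / L ^+ n - l| <= e].
Proof.
move=> u0 uconv c0 usub.
pose r n := u n.+1 / u n.
have r0 n : 0 < r n by rewrite divr_gt0.
have rS n : r n <= r n.+1.
  by rewrite /r ler_pdivrMr// mulrAC ler_pdivlMr// -expr2 mulrC.
have rmono : {homo r : n m / (n <= m)%N >-> n <= m}.
  exact/nondecreasing_seqP.
have rb n : r n <= c * u 0%N.
  by rewrite /r ler_pdivrMr// -mulrA; have := usub 0%N n; rewrite add0n.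
have rcv : cvgn r.
  apply: nondecreasing_is_cvgn => //.
  by exists (c * u 0%N) => _ [n _ <-].
pose L := limn r.
have rL n : r n <= L by apply: nondecreasing_cvgn_le.
have L0 : 0 < L by rewrite (lt_le_trans (r0 0%N)).
have prodr n m : r n ^+ m * u n <= u (n + m)%N.
  elim: m => [|m IH]; first by rewrite expr0 mul1r addn0.
  rewrite exprS -mulrA addnS (_ : u (n + m).+1 = r (n + m)%N * u (n + m)%N).
    rewrite ler_pM ?(ltW (r0 _))// ?rmono ?leq_addr//.
    by rewrite mulr_ge0 ?exprn_ge0 ?(ltW (r0 _)) ?(ltW (u0 _)).
  by rewrite /r divfK// gt_eqF.
(* Dividing [r n ^+ m.+1 * u n <= u (n + m).+1 <= c * (u n * u m)] by [u n] and letting [n] grow. *)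
have uL m : L ^+ m.+1 <= c * u m.
  have cvr : (fun n => r n ^+ m.+1) @ \oo --> L ^+ m.+1.
    exact: (continuous_cvg _ (@exprn_continuous R m.+1 L) rcv).
  rewrite -(cvg_lim (@Rhausdorff R) cvr); apply: limr_le; first by apply/cvg_ex; exists (L ^+ m.+1).
  near=> n; have := le_trans (prodr n m.+1) (eq_ind _ (fun i => u i <= _) (usub n m) _ (esym (addnS n m))).
  by rewrite mulrCA [u n * _]mulrC ler_pM2r.
(* This sequence decreases because every ratio is at most [L], and [uL] keeps it above [L / c]. *)
pose v n := u n / L ^+ n.
have vdec : {homo v : n m / (n <= m)%N >-> m <= n}.
  apply/nonincreasing_seqP => n; rewrite /v exprS invfM mulrA ler_pM2r ?invr_gt0 ?exprn_gt0//.
  by rewrite ler_pdivrMr// mulrC -ler_pdivrMr// rL.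
have vb n : L / c <= v n.
  by rewrite /v ler_pdivrMr// mulrAC ler_pdivlMr ?exprn_gt0// -exprS mulrC uL.
have vcv : cvgn v.
  by apply: nonincreasing_is_cvgn => //; exists (L / c) => _ [n _ <-].
exists L, (limn v); split => //.
  rewrite (lt_le_trans (divr_gt0 L0 c0))//; apply: limr_ge => //.
  by near=> n.
move=> e e0; have /cvgrPdist_le/(_ _ e0)[N _ hN] := vcv.
by exists N => n Nn; rewrite distrC; exact: hN.
Unshelve. all: by end_near. Qed.

(** * Convolution powers and the projection onto a top eigenspace *)

Section Parseval.
Context {R : realType} {X : zmodType} (S : mean_system R X).
Local Notation C := (R[i]^o).
Local Notation V := (mfun S).
Local Notation M := (mean S).
Local Notation conv := (conv S).
Local Notation ip := (ip S).
Local Notation nn := (nn S).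
Local Notation "f ** g" := (conv f g) (at level 40, left associativity).
Implicit Types f g h k p q : X -> C.

Definition cpow k n g : X -> C := iter n (conv k) g.

Arguments cpow : simpl never.

Lemma mfun_cpow k n g : V k -> V g -> V (cpow k n g).
Proof. by move=> Vk Vg; elim: n => // n IH; exact: mfun_conv. Qed.

Create HintDb mfundb.
#[local] Hint Resolve mfun_conv mfun_til mfun_cpow mfunZ mfunB mfunD : mfundb.
#[local] Hint Extern 0 (mfun _ _) => solve [auto 8 with mfundb nocore] : core.

Lemma cpowS k n g : cpow k n.+1 g = k ** cpow k n g. Proof. by []. Qed.

Lemma cpowSr k n g : cpow k n.+1 g = cpow k n (k ** g).
Proof. exact: iterSr. Qed.

Lemma cpowD k n m g : cpow k (n + m)%N g = cpow k n (cpow k m g).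
Proof. exact: iterD. Qed.

Lemma cpow_conv k n a b : V k -> V a -> V b -> cpow k n a ** b = cpow k n (a ** b).
Proof. by move=> Vk Va Vb; elim: n => // n IH; rewrite !cpowS convA// IH. Qed.

Lemma til_cpow k n a : V k -> V a -> til (cpow k n a) = cpow (til k) n (til a).
Proof. by move=> Vk Va; elim: n => // n IH; rewrite !cpowS til_conv// IH. Qed.

Lemma ip_cpow k n a b : V k -> til k = k -> V a -> V b ->
  ip (cpow k n a) b = ip a (cpow k n b).
Proof.
move=> Vk tk Va Vb; elim: n a Va => // n IH a Va.
by rewrite cpowSr IH// ip_adj// tk.
Qed.

Definition ucv (P : nat -> X -> C) p := forall e : R, 0 < e -> exists N,
  forall n, (N <= n)%N -> forall x, nrm (P n x - p x) <= e.

Lemma ucv_uniq P p q : ucv P p -> ucv P q -> p = q.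
Proof.
move=> hp hq; apply/funext => x; apply: nrm_le_eq => e e0.
have e20 : 0 < e / 2 by rewrite divr_gt0.
have [N hN] := hp _ e20; have [K hK] := hq _ e20.
rewrite (le_trans (nrm_split (P (maxn N K) x) _ _))// [leRHS]splitr lerD//.
  by rewrite nrm_sym hN// leq_maxl.
by rewrite hK// leq_maxr.
Qed.

Lemma ucv_shift P p (s : nat -> nat) : (forall n, (n <= s n)%N) ->
  ucv P p -> ucv (fun n => P (s n)) p.
Proof.
move=> hs hp e e0; have [N hN] := hp _ e0; exists N => n Nn x.
by apply: hN; exact: leq_trans Nn (hs n).
Qed.

Lemma ucvZ a P p : ucv P p -> ucv (fun n x => a * P n x) (fun x => a * p x).
Proof.
move=> hp e e0; have a0 : 0 < nrm a + 1 by rewrite ltr_wpDl ?nrm_ge0.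
have [N hN] := hp _ (divr_gt0 e0 a0); exists N => n Nn x.
rewrite -mulrBr nrmM (le_trans (ler_wpM2l (nrm_ge0 _) (hN _ Nn x)))//.
by rewrite mulrCA ger_pMr// ler_pdivrMr// mul1r lerDl.
Qed.

Lemma ucv_cst p : ucv (fun=> p) p.
Proof. by move=> e e0; exists 0%N => n _ x; rewrite subrr nrm0 ltW. Qed.

Lemma ucv_til P p : ucv P p -> ucv (fun n => til (P n)) (til p).
Proof.
move=> hp e e0; have [N hN] := hp _ e0; exists N => n Nn x.
by rewrite /til -conjB nrmJ; exact: hN.
Qed.

Lemma ucv_conv P p a : (forall n, V (P n)) -> V p -> V a -> ucv P p ->
  ucv (fun n => P n ** a) (p ** a).
Proof.
move=> VP Vp Va hp e e0; have [c hc] := mfun_bnd Va.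
have c0 : 0 <= c by rewrite (le_trans (nrm_ge0 (a 0))).
have c1 : 0 < c + 1 by rewrite ltr_wpDl.
have [N hN] := hp _ (divr_gt0 e0 c1); exists N => n Nn x.
have VB := mfunB (VP n) Vp.
have := congr1 (fun F => F x) (convBl (VP n) Vp Va) => /= <-.
apply: mean_le => [|s]; first by apply: mfun_mul => //; exact: mfun_flip.
rewrite nrmM (le_trans (ler_pM (nrm_ge0 _) (nrm_ge0 _) (hN _ Nn s) (hc _)))//.
by rewrite -mulrA ger_pMr// mulrC ler_pdivrMr// mul1r lerDl.
Qed.

(** [cauchyC_lim] gives pointwise limits with an error valid from the same rank at every point,
    hence a uniform limit, and [mfun] is closed under these. *)
Lemma ucv_ex P : (forall n, V (P n)) ->
  (forall e : R, 0 < e -> exists N, forall n m, (N <= n)%N -> (N <= m)%N ->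
     forall x, nrm (P n x - P m x) <= e) ->
  exists2 p, V p & ucv P p.
Proof.
move=> VP hP.
have /choice[p hp] x := @cauchyC_lim R (P^~ x)
  (fun e e0 => let: ex_intro N h := hP e e0 in
     ex_intro _ N (fun n m Nn Nm => h n m Nn Nm x)).
have cvp : ucv P p.
  move=> e e0; have e20 : 0 < e / 2 by rewrite divr_gt0.
  have [N hN] := hP _ e20; exists N => n Nn x.
  have := hp x _ e20 N (fun n m Nn Nm => hN n m Nn Nm x) n Nn.
  by rewrite mulrCA divff// mulr1.
exists p => //; apply: mfun_lim => e e0; have [N hN] := cvp _ e0.
by exists (P N) => // x; rewrite nrm_sym hN.
Qed.

(** Convolution with such a [q] is an orthogonal projection that commutes with translations. In the
    end [q] is a finite sum of distinct characters and [nn q] is their number, which explains why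
    [nn] measures its size below. *)
Definition idempotent q := [/\ V q, til q = q, q ** q = q & q <> fun=> 0].

(* [k ^ n / L ^ n] converges to the projection onto the top eigenspace. *)
Lemma spectral_idempotent f : V f -> f <> (fun=> 0) ->
  let k := f ** til f in
  exists p (L : R), [/\ idempotent p, 0 < L,
    k ** k ** p = (fun x => L%:C * p x) &
    forall q, V q -> f ** q = f -> p ** q = p].
Proof.
move=> Vf f0 k; have Vtf := mfun_til Vf; have Vk : V k by exact: mfun_conv.
have tk : til k = k by rewrite /k til_conv// tilK convC.
pose y n := cpow k n f; have Vy n : V (y n) by rewrite /y.
have tit n : V (til (y n)) by exact: mfun_til.
pose u n := nn (y n).
have ipy n m : ip (y n) (y m) = ip (y (n + m)%N) f.
  by rewrite /y -(@ip_cpow k m)// -cpowD addnC.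
(* Only even powers are used from here on: their inner products are themselves squared norms
   [u (n + m)], so the growth of [u] alone decides the Cauchy property. *)
have ipxx n m : ip (y n.*2) (y m.*2) = (u (n + m)%N)%:C.
  by rewrite ipy -doubleD -addnn -ipy nnE.
(* Log-convexity is Cauchy-Schwarz for [y n] and [y n.+2]. *)
have uconv n : u n.+1 ^+ 2 <= u n * u n.+2.
  have -> : u n.+1 ^+ 2 = nrm (ip (y n) (y n.+2)) ^+ 2.
    have -> : ip (y n) (y n.+2) = ip (y n.+1) (y n.+1).
      by rewrite !ipy !addnS addSn.
    by rewrite nnE// nrmR ger0_norm// nn_ge0.
  exact: ip_CS.
have nnf : 0 < nn f by exact: nn_gt0.
have k0 : k 0 = (nn f)%:C by rewrite /k -ipE nnE.
(* If [k ** f] vanished, so would the squared norm of [til f ** f], which is [k]; but [k 0] is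
   [nn f], which is positive. *)
have u1 : 0 < u 1%N.
  apply: nn_gt0 => // y10.
  have : ip (y 1%N) f = 0.
    by rewrite y10 -[RHS](mean_cst S); congr M; apply/funext => x; rewrite mul0r.
  rewrite /y cpowS -[cpow k 0 f]/f /k convA// ip_adj//.
  rewrite nnE//.
  move=> [/(nn_eq0 (mfun_conv Vtf Vf)) h]; move: k0.
  by rewrite /k convC// h => -[/eqP]; rewrite eq_sym gt_eqF.
have ugt n : 0 < u n.
  have u0 : 0 < u 0%N by exact: nnf.
  suff : 0 < u n /\ 0 < u n.+1 by case.
  elim: n => [//|n [h1 h2]]; split=> //.
  by rewrite -(pmulr_rgt0 _ h1) (lt_le_trans _ (uconv n))// exprn_gt0.
have ycon n m : y n ** til (y m) = cpow k (n + m)%N k.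
  rewrite /y til_cpow// tk cpow_conv // (convC Vf) // cpow_conv//.
  by rewrite -cpowD (convC Vtf).
(* By [ycon], the function [y (n + m).+1] is the convolution of [y n], [til (y m)] and [f], so two
   uses of [nn_conv] give the constant [nn f]. *)
have usub n m : u (n + m).+1 <= nn f * (u n * u m).
  rewrite {1}/u /y cpowSr.
  rewrite -cpow_conv// -ycon (le_trans (nn_conv _ _))//.
  rewrite mulrC ler_pM2l//.
  by rewrite (le_trans (nn_conv _ _))// nn_til.
(* As [u] consists of squared norms, [L] is the square of the top eigenvalue of [k]; this is why the
   conclusion has two factors [k]. *)
have [L [l [L0 l0 hl]]] := geometric_growth ugt uconv nnf usub.
have Ln n : L ^+ n != 0 by rewrite expf_neq0// gt_eqF.
pose Xn n x := (L ^- n)%:C * y n.*2 x.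
have VX n : V (Xn n) by apply: mfunZ.
have ipX n m : ip (Xn n) (Xn m) = (u (n + m)%N / L ^+ (n + m))%:C.
  rewrite /Xn ipZl ?ipZr ?ipxx//.
  by rewrite conjR -!rmorphM /= exprD invfM; congr (_%:C); ring.
have cauX (e : R) : 0 < e -> exists N, forall n m, (N <= n)%N -> (N <= m)%N ->
    nn (fun x => Xn n x - Xn m x) <= e.
  move=> e0; have e40 : 0 < e / 4 by rewrite divr_gt0.
  have [N hN] := hl _ e40; exists N => n m Nn Nm.
  rewrite nnB// /nn !ipX /=.
  have := hN _ (leq_trans Nn (leq_addr n n)); have := hN _ (leq_trans Nm (leq_addr m m)).
  have := hN _ (leq_trans Nn (leq_addr m n)).
  by rewrite !ler_norml => /andP[a1 a2] /andP[b1 b2] /andP[c1 c2]; lra.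
pose g0 := k ** til f; have Vg0 : V g0 by exact: mfun_conv.
(* [P n] is the convolution power of order [n.+1] of [k ** k], divided by [L ^+ n.+1]. *)
pose P n x := (L ^- n.+1)%:C * cpow k n.*2.+1 k x.
have VP n : V (P n) by apply: mfunZ.
(* Writing [P n] as the convolution of [Xn n] with the fixed [g0] turns L^2 estimates into uniform
   ones, by [conv_bound]. *)
have PX n : P n = fun x => (L^-1)%:C * (Xn n ** g0) x.
  apply/funext => x; rewrite /P /Xn convZl// mulrA -rmorphM /= -invfM -exprS.
  congr (_ * _); rewrite /y /g0 cpow_conv// cpowSr; congr (cpow _ _ _ _).
  by rewrite (convC Vk Vtf) -convA.
have cauP (e : R) : 0 < e -> exists N, forall n m, (N <= n)%N -> (N <= m)%N ->
    forall x, nrm (P n x - P m x) <= e.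
  move=> e0; pose c := L^-1 ^+ 2 * nn g0 + 1.
  have c0 : 0 < c by rewrite ltr_wpDl// mulr_ge0 ?nn_ge0// sqr_ge0.
  have ec0 : 0 < e ^+ 2 / c by rewrite divr_gt0// exprn_gt0.
  have [N hN] := cauX _ ec0; exists N => n m Nn Nm x.
  rewrite -(ler_pXn2r (n := 2))// ?nnegrE ?nrm_ge0 ?(ltW e0)//.
  rewrite !PX -mulrBr nrmM exprMn nrmR.
  have := congr1 (fun F => F x) (convBl (VX n) (VX m) Vg0) => /= <-.
  have VB := mfunB (VX n) (VX m).
  apply: (@le_trans _ _ (`|L^-1| ^+ 2 * (e ^+ 2 / c * nn g0))).
    rewrite ler_wpM2l ?sqr_ge0// (le_trans (conv_bound _ VB Vg0))//.
    by rewrite ler_wpM2r ?nn_ge0// hN.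
  rewrite real_normK ?num_real//.
  rewrite [leLHS](_ : _ = e ^+ 2 * ((L^-1 ^+ 2 * nn g0) / c)); last by ring.
  by rewrite ger_pMr ?exprn_gt0// ler_pdivrMr// mul1r /c lerDl.
have [p Vp cvp] := ucv_ex VP cauP.
(* The [P n] multiply like powers, so their limit is idempotent. *)
have Pconv n m : P n ** P m = P (n + m).+1.
  rewrite /P convZl //.
  apply/funext => x; rewrite convC ?convZl //.
  rewrite mulrA -rmorphM /= -invfM -exprD -addSnnS addSn.
  congr (_ * _); rewrite cpow_conv // (convC Vk) // cpow_conv//.
  by rewrite -cpowSr -cpowD; congr (cpow k _ k x); rewrite -!addnn; lia.
have tp : til p = p.
  apply: (ucv_uniq _ cvp); have := ucv_til cvp.
  congr ucv; apply/funext => n; apply/funext => x; rewrite /til /P conjM conjR.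
  by congr (_ * _); rewrite -[LHS]/(til (cpow k n.*2.+1 k) x) til_cpow// tk.
have pP m : p ** P m = p.
  apply: (ucv_uniq (ucv_conv VP Vp (VP m) cvp)).
  rewrite (_ : (fun n => P n ** P m) = fun n => P (n + m).+1).
    by apply: (@ucv_shift _ _ (fun n => (n + m).+1) _ cvp) => n; lia.
  by apply/funext => n; rewrite Pconv.
have pp : p ** p = p.
  have := ucv_conv VP Vp Vp cvp.
  rewrite (_ : (fun n => P n ** p) = fun=> p).
    by move=> h; exact: ucv_uniq h (ucv_cst _).
  by apply/funext => n; rewrite convC// pP.
(* The values of [P n ** k] at 0 are [u n.+1 / L ^+ n.+1], which tend to [l > 0]; the tolerance
   [l / 4], used twice, contradicts a zero limit. *)
have p0 : p <> fun=> 0.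
  move=> p0; have := ucv_conv VP Vp Vk cvp.
  have -> : p ** k = fun=> 0.
    by apply/funext => x; rewrite p0 -[RHS](mean_cst S); congr M; apply/funext => s; rewrite mul0r.
  move=> h; have l20 : 0 < l / 4 by rewrite divr_gt0.
  have [N hN] := h _ l20; have [K hK] := hl _ l20.
  have := hN _ (leq_maxl N K) 0; have := hK (maxn N K).+1 (leqW (leq_maxr N K)).
  set n := maxn N K; rewrite subr0.
  have -> : (P n ** k) 0 = (u n.+1 / L ^+ n.+1)%:C.
    rewrite /P convZl // rmorphM /= mulrC; congr (_ * _).
    rewrite -nnE// ipE ycon cpow_conv//.
    by rewrite -cpowSr; congr (cpow k _ k 0); rewrite -addnn; lia.
  rewrite nrmR ler_norml => /andP[a1 a2] a3.
  have := le_trans (ler_norm _) a3; lra.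
exists p, L; split => //.
- apply: (@ucv_uniq (fun n x => L%:C * P n.+1 x)); last first.
    by apply: ucvZ; apply: ucv_shift cvp => n; exact: leqnSn.
  rewrite convC//.
  have := ucv_conv VP Vp (mfun_conv Vk Vk) cvp; congr ucv.
  apply/funext => n; apply/funext => x; rewrite /P convZl //.
  rewrite mulrA -rmorphM /=.
  have -> : L * L ^- n.+2 = L ^- n.+1.
    by rewrite [L ^+ n.+2]exprS invfM mulrA divff ?mul1r ?gt_eqF.
  congr (_ * _).
  rewrite cpow_conv//.
  by rewrite doubleS -!cpowSr.
- move=> q Vq fq; have kq : k ** q = k by rewrite /k (convC Vf)// convA// fq (convC Vtf).
  apply: (ucv_uniq (ucv_conv VP Vp Vq cvp)).
  suff -> : (fun n => P n ** q) = P by [].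
  apply/funext => n; rewrite /P convZl //; apply/funext => x.
  by rewrite cpow_conv// kq.
Qed.

End Parseval.

(** * Minimal idempotents and characters *)

Section Characters.
Context {R : realType} {X : zmodType} (S : mean_system R X).
Local Notation C := (R[i]^o).
Local Notation V := (mfun S).
Local Notation M := (mean S).
Local Notation conv := (conv S).
Local Notation ip := (ip S).
Local Notation nn := (nn S).
Local Notation idempotent := (idempotent S).
Local Notation "f ** g" := (conv f g) (at level 40, left associativity).
Implicit Types f g h k p q psi : X -> C.

#[local] Hint Resolve mfun_conv mfun_til mfunZ mfunB mfunD mfun_conj : mfundb.
#[local] Hint Extern 0 (mfun _ _) => solve [auto 8 with mfundb nocore] : core.

Lemma conv_shift f g t : V f -> V g ->
  (fun x => f (x + t)) ** g = fun x => (f ** g) (x + t).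
Proof.
move=> Vf Vg; apply/funext => x; rewrite /conv.
have V1 : V (fun s => f s * g (x + t - s)).
  by apply: mfun_mul => //; exact: mfun_flip.
rewrite -(mean_shift t V1); congr M; apply/funext => s.
by rewrite opprD addrA addrAC addrK.
Qed.

Lemma idempotent_val q : idempotent q -> q 0 = (nn q)%:C.
Proof. by move=> [Vq tq qq _]; rewrite -{1}qq -{2}tq -ipE nnE. Qed.

(** Since [q ** q = q], the pointwise bound gives [nn q <= nn q * nn q]. This gap above 0 is what
    makes minimal idempotents exist. *)
Lemma idempotent_ge1 q : idempotent q -> 1 <= nn q.
Proof.
move=> [Vq tq qq q0]; have qp := nn_gt0 Vq q0.
rewrite -(ler_pM2l qp) mulr1; apply: nn_bound => // x.
by rewrite -{1}qq conv_bound.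
Qed.

Lemma idempotentB q e : idempotent q -> idempotent e -> e ** q = e ->
  e <> q -> idempotent (fun x => q x - e x).
Proof.
move=> [Vq tq qq q0] [Ve te ee e0] eq neq; split => //.
- by apply/funext => x; rewrite -[in RHS]tq -[in RHS]te /til conjB.
- rewrite convBl// (convC Vq)// (convC Ve)// !convBl// qq eq (convC Vq)// eq ee.
  by apply/funext => x; rewrite subrr subr0.
- move=> h; apply: neq; apply/funext => x; apply/esym/eqP.
  by rewrite -subr_eq0; apply/eqP; have := congr1 (@^~ x) h.
Qed.

Definition is_char psi := [/\ V psi, forall x y, psi (x + y) = psi x * psi y &
  forall x, nrm (psi x) = 1].

(* An idempotent of almost minimal squared norm below [p] is minimal, hence its
   translates are proportional to it. *)
Lemma exists_char p : idempotent p -> exists2 psi, is_char psi & p ** psi = psi.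
Proof.
move=> ip0; have [Vp _ _ _] := ip0.
pose A := [set x | exists q, [/\ idempotent q, q ** p = q & x = nn q]].
have A1 x : A x -> 1 <= x by move=> [q [iq _ ->]]; exact: idempotent_ge1.
have infA : has_inf A.
  split; first by exists (nn p), p; split=> //; case: ip0.
  by exists 1 => x /A1.
(* Being less than 1 above the infimum forces minimality: a proper part [e] would split [nn q] into
   [nn e], at least 1, and the rest, at least the infimum. *)
have [_ [q [iq qp ->]] qlt] := inf_adherent ltr01 infA.
have [Vq tq qq q0] := iq.
have nqp : 0 < nn q by exact: nn_gt0.
have mini e : idempotent e -> e ** q = e -> e = q.
  move=> ie eq; apply: contrapT => neq.
  have [Ve _ _ _] := ie.
  have id2 := idempotentB iq ie eq neq.
  have h1 : inf A <= nn (fun x => q x - e x).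
    apply: ge_inf; first by exists 1 => x /A1.
    exists (fun x => q x - e x); split => //.
    by rewrite convBl// qp -{1}eq convA// qp eq.
  have h2 := idempotent_ge1 ie.
  have : nn q = nn e + nn (fun x => q x - e x).
    apply: (@complexI R); rewrite rmorphD /= -!idempotent_val//.
    by rewrite addrC subrK.
  by move: qlt; lra.
(* Half the sum of [q] and [h / sqrt mu] is an idempotent below [q] or zero; by minimality it is [q]
   or zero, and either case makes [h] a multiple of [q]. *)
have root h (mu : R) : V h -> til h = h -> h ** q = h -> 0 <= mu ->
    h ** h = (fun x => mu%:C * q x) -> exists nu : C, h = fun x => nu * q x.
  move=> Vh th hq mu0 hh; have [mu00|mun0] := eqVneq mu 0.
    exists 0; apply/funext => x; rewrite mul0r.
    suff /(congr1 (@^~ x)) : h = fun=> 0 by [].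
    apply: (nn_eq0 Vh); apply: (@complexI R).
    by rewrite -nnE// ipE th hh mu00 mul0r.
  have mup : 0 < mu by rewrite lt0r mun0.
  have smu : 0 < Num.sqrt mu by rewrite sqrtr_gt0.
  pose a : R := (Num.sqrt mu)^-1.
  have a0 : a != 0 by rewrite invr_eq0 gt_eqF.
  have aa : a * a * mu = 1.
    by rewrite /a -expr2 exprVn sqr_sqrtr// mulVf.
  pose e x := (2^-1 : R)%:C * (q x + a%:C * h x).
  have Ve : V e by apply: mfunZ; apply: mfunD => //; exact: mfunZ.
  have te : til e = e.
    apply/funext => x; rewrite -[in RHS]/(e x) /e /til conjM conjR conjD conjM conjR.
    by rewrite -[_^*]/(til q x) -[(h _)^*]/(til h x) tq th.
  have ahZ : V (fun x => a%:C * h x) by [].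
  have eq : e ** q = e.
    by rewrite /e convZl// ?convDl ?convZl ?qq ?hq//.
  have ee : e ** e = e.
    rewrite {1}/e convZl//.
    rewrite convDl// (convC Vq)// eq convZl// (convC Vh)// /e convZl//.
    rewrite convDl// (convC Vq)// hq convZl// hh.
    apply/funext => x.
    have aac : (a%:C * a%:C * mu%:C : C) = 1 by rewrite -!rmorphM /= aa.
    have H2 : ((2^-1 : R)%:C * 2%:R : C) = 1.
      by rewrite -(rmorph_nat (real_complex R)) -rmorphM /= mulVf// pnatr_eq0.
    move: aac H2; move: (a%:C : C) ((2^-1 : R)%:C : C) (mu%:C : C) => al H m aac H2.
    transitivity (H * (H * (q x + al * h x) + H * (al * h x + (al * al * m) * q x))).
      by ring.
    rewrite aac; transitivity (H * 2%:R * (H * (q x + al * h x))); first by ring.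
    by rewrite H2 mul1r.
  have [e0|ne0] := pselect (e = fun=> 0).
    exists (- (a^-1)%:C); apply/funext => x.
    have /eqP := congr1 (@^~ x) e0; rewrite /e mulf_eq0.
    have -> : ((2^-1 : R)%:C == 0 :> C) = false.
      by rewrite RC_eq0 invr_eq0 pnatr_eq0.
    rewrite orFb addr_eq0 => /eqP qx; rewrite qx mulrNN mulrA -rmorphM /= mulVf//.
    by rewrite mul1r.
  have ie : idempotent e by split.
  have eqq := mini e ie eq.
  exists (a^-1)%:C; apply/funext => x.
  have := congr1 (@^~ x) eqq; rewrite /e => ex.
  have : q x + a%:C * h x = 2%:R * q x.
    rewrite -[in RHS]ex mulrA.
    have -> : (2%:R : C) * (2^-1 : R)%:C = 1.
      by rewrite -(rmorph_nat (real_complex R)) -rmorphM /= divff// pnatr_eq0.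
    by rewrite mul1r.
  rewrite mulr_natl mulr2n => /addrI <-.
  by rewrite mulrA -rmorphM /= mulVf// mul1r.
(* The spectral idempotent of [h] lies below [q], hence equals [q]. So the square of [h ** h] is a
   positive multiple of [q], and taking square roots with [root] twice reaches [h]. *)
have selfadj h : V h -> til h = h -> h ** q = h -> exists nu : C, h = fun x => nu * q x.
  move=> Vh th hq; have [h0|nh0] := pselect (h = fun=> 0).
    by exists 0; rewrite h0; apply/funext => x; rewrite mul0r.
  have [p' [L [ip' L0 Kp hp]]] := spectral_idempotent Vh nh0.
  have p'q : p' = q by apply: mini => //; exact: hp.
  move: Kp; rewrite p'q th => Kq.
  have hhq : h ** h ** q = h ** h by rewrite convA// hq.
  have K2 : h ** h ** (h ** h) = fun x => L%:C * q x.
    by rewrite -Kq [RHS]convA// hhq.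
  have [nu hnu] : exists nu : C, h ** h = fun x => nu * q x.
    by apply: (root _ L) => //; rewrite ?til_conv ?th// ltW.
  have nuE : nu = (nn h / nn q)%:C.
    have := congr1 (@^~ 0) hnu; rewrite -{2}th -ipE nnE// idempotent_val// => E.
    by rewrite rmorphM /= E fmorphV mulfK// RC_eq0 gt_eqF.
  apply: (root _ (nn h / nn q)) => //.
    by rewrite divr_ge0 ?nn_ge0.
  by rewrite hnu nuE.
(* A general [f] is split into its self-adjoint parts, as a complex number into real and imaginary
   part. *)
have all f : V f -> f ** q = f -> exists nu : C, f = fun x => nu * q x.
  move=> Vf fq; have Vtf := mfun_til Vf.
  have tfq : til f ** q = til f by rewrite -{1}tq -til_conv// fq.
  have [a ha] : exists nu : C, (fun x => f x + til f x) = fun x => nu * q x.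
    apply: selfadj => //; last by rewrite convDl// fq tfq.
    apply/funext => x; rewrite {1}/til conjD -[(f (- x))^*]/(til f x).
    by rewrite -[(til f (- x))^*]/(til (til f) x) tilK addrC.
  have [b hb] : exists nu : C, (fun x => 'i%C * (f x - til f x)) = fun x => nu * q x.
    apply: selfadj => //; last by rewrite convZl ?convBl ?fq ?tfq//; exact: mfunB.
    apply/funext => x; rewrite {1}/til conjM conjB -[(f (- x))^*]/(til f x).
    rewrite -[(til f (- x))^*]/(til (til f) x) tilK.
    have -> : ('i%C : C)^* = - 'i%C by apply/eqP; rewrite eq_complex /= oppr0 !eqxx.
    by rewrite mulNr -mulrN opprB.
  exists ((2^-1 : R)%:C * (a - 'i%C * b)); apply/funext => x.
  have hax := congr1 (@^~ x) ha; have hbx := congr1 (@^~ x) hb.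
  rewrite -mulrA mulrBl -mulrA -hax -hbx mulrA.
  have -> : ('i%C * 'i%C : C) = -1 by rewrite -expr2 sqr_i.
  rewrite mulN1r opprK addrACA addrN addr0.
  rewrite -[f x + f x]mulr2n -[f x *+ 2]mulr_natl mulrA.
  have -> : (2^-1 : R)%:C * (2%:R : C) = 1.
    by rewrite -(rmorph_nat (real_complex R)) -rmorphM /= mulVf// pnatr_eq0.
  by rewrite mul1r.
have q00 : q 0 != 0.
  by rewrite idempotent_val// RC_eq0 gt_eqF.
(* A translate of [q] still lies below [q], hence is a multiple of [q]; comparing values at 0 shows
   that [q / q 0] is multiplicative. *)
have qD x t : q (x + t) * q 0 = q t * q x.
  have [||nu hnu] := all (fun x => q (x + t)); first exact: mfun_shift.
    by rewrite conv_shift// qq.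
  have := congr1 (@^~ 0) hnu; rewrite /= add0r => ->.
  by have := congr1 (@^~ x) hnu => /= ->; rewrite mulrAC.
exists (fun x => (q 0)^-1 * q x).
  split=> [//|x t|x].
    apply: (mulfI q00); rewrite mulVKf//; apply: (mulIf q00).
    rewrite qD; move: q00; set c := q 0; set d := q t; set e := q x => c0.
    by field.
  have qx : q x * (q x)^* = (q 0) * (q 0).
    have cq : (q x)^* = q (- x) by rewrite -[in RHS]tq /til opprK.
    by rewrite cq -qD addNr.
  have q0p : nrm (q 0) = nn q by rewrite idempotent_val// nrmR ger0_norm// nn_ge0.
  have : nrm (q x) ^+ 2 = nrm (q 0) ^+ 2.
    have := congr1 nrm qx; rewrite !nrmM nrmJ -!expr2 //.
  move/eqP; rewrite eqrXn2 ?nrm_ge0// => /eqP qxn.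
  by rewrite nrmM qxn -nrmM mulVf// nrm1.
by rewrite convC// ?convZl// ?qp//.
Qed.

End Characters.

(** * Parseval's identity for an invariant mean *)

Section ParsevalIdentity.
Context {R : realType} {X : zmodType} (S : mean_system R X).
Local Notation C := (R[i]^o).
Local Notation V := (mfun S).
Local Notation M := (mean S).
Local Notation conv := (conv S).
Local Notation ip := (ip S).
Local Notation nn := (nn S).
Local Notation is_char := (is_char S).
Local Notation "f ** g" := (conv f g) (at level 40, left associativity).
Implicit Types (f g h k p q psi F : X -> C) (l : seq (X -> C)).

#[local] Hint Resolve mfun_conv mfun_til mfunZ mfunB mfunD mfun_conj : mfundb.
#[local] Hint Extern 0 (mfun _ _) => solve [auto 8 with mfundb nocore] : core.

Definition char_list l := uniq l /\ (forall psi, psi \in l -> is_char psi).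
Definition energy l F : R := \sum_(psi <- l) nrm (ip F psi) ^+ 2.
Definition char_sum l F x : C := \sum_(psi <- l) ip F psi * psi x.

Lemma char_neg psi x : is_char psi -> psi (- x) = (psi x)^*.
Proof.
move=> [_ pD p1].
have px : psi x != 0 by rewrite -nrm_eq0 p1 oner_eq0.
have p0 : psi 0 = 1.
  by apply: (mulfI px); rewrite -pD addr0 mulr1.
by apply: (mulfI px); rewrite -pD subrr p0 mulJ p1 expr1n.
Qed.

Lemma char_nn psi : is_char psi -> ip psi psi = 1.
Proof.
move=> [_ _ p1]; rewrite -(mean_cst S 1); congr M; apply/funext => x.
by rewrite mulJ p1 expr1n.
Qed.

(** Shift invariance multiplies the inner product by [psi t * (phi t)^*], which differs from 1 for
    some [t]. *)
Lemma char_orth psi phi : is_char psi -> is_char phi -> psi <> phi -> ip psi phi = 0.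
Proof.
move=> cp cq neq; have [Vp pD p1] := cp; have [Vq qD q1] := cq.
have [t ht] : exists t, psi t * (phi t)^* != 1.
  apply/not_existsP => h; apply: neq; apply/funext => t.
  have /negP := h t; rewrite negbK => /eqP E.
  by rewrite -[RHS]mul1r -E -mulrA [_^* * _]mulrC mulJ q1 expr1n mulr1.
have Vpq : V (fun x => psi x * (phi x)^*) by apply: mfun_mul.
have : ip psi phi = psi t * (phi t)^* * ip psi phi.
  rewrite -[ip psi phi]/(M _) -{1}(mean_shift t Vpq) -meanZ//; congr M; apply/funext => x.
  by rewrite pD qD conjM mulrACA mulrC.
move/eqP; rewrite -{1}[ip psi phi]mul1r -subr_eq0 -mulrBl mulf_eq0 subr_eq0.
by rewrite eq_sym (negbTE ht) => /eqP.
Qed.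

Lemma conv_char F psi : V F -> is_char psi -> F ** psi = fun x => ip F psi * psi x.
Proof.
move=> VF cp; have [Vp pD _] := cp; apply/funext => x.
rewrite mulrC /conv -meanZ; last by apply: mfun_mul.
congr M; apply/funext => s.
by rewrite pD char_neg// mulrCA.
Qed.

Lemma chars_behead phi l : (forall psi, psi \in phi :: l -> is_char psi) ->
  forall psi, psi \in l -> is_char psi.
Proof. by move=> h psi hp; apply: h; rewrite inE hp orbT. Qed.

Lemma mfun_char_sum l F : (forall psi, psi \in l -> is_char psi) -> V (char_sum l F).
Proof.
elim: l => [|phi l IH] h.
  have := mfun_cst S 0; congr (mfun S _).
  by apply/funext => x; rewrite /char_sum big_nil.
have [Vphi _ _] := h _ (mem_head _ _).
have := mfun_lin (ip F phi) Vphi (IH (chars_behead h)).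
by congr (mfun S _); apply/funext => x; rewrite /char_sum big_cons.
Qed.

Lemma ip_char_sum l F psi : char_list l -> is_char psi ->
  ip (char_sum l F) psi = if psi \in l then ip F psi else 0.
Proof.
move=> [ul cl] cp; have [Vp _ _] := cp.
have -> : ip (char_sum l F) psi = \sum_(phi <- l) ip F phi * ip phi psi.
  elim: l cl {ul} => [|phi l IH] h.
    rewrite big_nil -[RHS](mean_cst S); congr M; apply/funext => x.
    by rewrite /char_sum big_nil mul0r.
  have [Vphi _ _] := h _ (mem_head _ _).
  have h2 := chars_behead h.
  rewrite big_cons -IH// -ip_lin//; last exact: mfun_char_sum.
  by congr ip; apply/funext => x; rewrite /char_sum big_cons.
case: ifPn => [pl|pl].
  rewrite (bigD1_seq psi)//= char_nn// mulr1 big1_seq ?addr0// => phi /andP[/eqP np pin].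
  by rewrite (char_orth (cl _ pin) cp np) mulr0.
rewrite big1_seq// => phi /andP[_ pin]; rewrite (char_orth (cl _ pin) cp) ?mulr0//.
by move=> e; move: pl; rewrite -e pin.
Qed.

Lemma ip_char_sum2 l l' F : V F -> char_list l -> char_list l' ->
  ip (char_sum l F) (char_sum l' F) =
  (\sum_(psi <- l' | psi \in l) nrm (ip F psi) ^+ 2)%:C.
Proof.
move=> VF cl [ul' cl'].
have Vl := mfun_char_sum F cl.2.
have -> : ip (char_sum l F) (char_sum l' F) =
    \sum_(psi <- l') (ip F psi)^* * ip (char_sum l F) psi.
  elim: l' cl' {ul'} => [|phi l' IH] h.
    rewrite big_nil -[RHS](mean_cst S); congr M; apply/funext => x.
    by rewrite [char_sum [::] F x]big_nil conj0 mulr0.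
  have [Vphi _ _] := h _ (mem_head _ _).
  have h2 := chars_behead h.
  have Vl' := mfun_char_sum F h2.
  rewrite big_cons -IH// -(ip_conj Vphi Vl) -(ip_conj Vl' Vl) -conjM -conjD -ip_lin//.
  rewrite ip_conj//.
  by congr ip; apply/funext => x; rewrite /char_sum big_cons.
rewrite rmorph_sum /= [RHS]big_mkcond /=; apply: eq_big_seq => psi pin.
rewrite ip_char_sum//; last exact: cl'.
by case: ifP => _; rewrite ?mulr0// mulrC mulJ.
Qed.

Lemma nn_char_sum l F : V F -> char_list l -> nn (char_sum l F) = energy l F.
Proof.
move=> VF cl; rewrite /nn ip_char_sum2//= big_seq_cond; rewrite /energy [RHS]big_seq.
by apply: eq_bigl => psi; rewrite andbb.
Qed.

Lemma ip_char_sumr l F : V F -> char_list l -> ip F (char_sum l F) = (energy l F)%:C.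
Proof.
move=> VF [ul cl]; elim: l cl {ul} => [|phi l IH] h.
  rewrite /energy big_nil -[RHS](mean_cst S); congr M; apply/funext => x.
  by rewrite [char_sum [::] F x]big_nil conj0 mulr0.
have [Vphi _ _] := h _ (mem_head _ _).
have h2 := chars_behead h.
have Vl := mfun_char_sum F h2.
rewrite /energy big_cons -/(energy l F) rmorphD /= -(IH h2) -mulJ.
have -> : ip F phi * (ip F phi)^* + ip F (char_sum l F) =
    (ip F phi * ip phi F + ip (char_sum l F) F)^*.
  by rewrite conjD conjM !ip_conj// mulrC.
rewrite -ip_lin// ip_conj//.
by congr ip; apply/funext => x; rewrite /char_sum big_cons.
Qed.

Lemma nn_remainder l F : V F -> char_list l ->
  nn (fun x => F x - char_sum l F x) = nn F - energy l F.
Proof.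
move=> VF cl; have Vl := mfun_char_sum F cl.2.
by rewrite nnB// nn_char_sum// ip_char_sumr//=; ring.
Qed.

Lemma bessel l F : V F -> char_list l -> energy l F <= nn F.
Proof.
move=> VF cl; rewrite -subr_ge0 -nn_remainder//; apply: nn_ge0.
by apply: mfunB => //; exact: mfun_char_sum F cl.2.
Qed.

(** Inclusion-exclusion, with [u] the union of the lists. It is used to show that two lists of
    nearly maximal energy have nearly all of it in common. *)
Lemma energy_merge l l' F : char_list l -> char_list l' -> exists2 u, char_list u &
  energy u F + \sum_(psi <- l' | psi \in l) nrm (ip F psi) ^+ 2 = energy l F + energy l' F.
Proof.
move=> [ul cl] [ul' cl']; exists (l ++ [seq psi <- l' | psi \notin l]).
  split; first rewrite cat_uniq ul filter_uniq// andbT -all_predC.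
    by apply/allP => x; rewrite mem_filter => /andP[].
  by move=> x; rewrite mem_cat mem_filter => /orP[/cl|/andP[_ /cl']].
rewrite /energy big_cat big_filter /= -addrA; congr (_ + _).
by rewrite [RHS](bigID (fun psi => psi \in l)) /= addrC.
Qed.

(** Otherwise the remainders of lists of nearly maximal energy converge, after convolution with
    [til F], to a nonzero [h] that every character annihilates. The spectral projection of [h] would
    nevertheless contain a character. *)
Theorem parseval F (e : R) : V F -> 0 < e ->
  exists2 l, char_list l & nn F - e <= energy l F.
Proof.
move=> VF e0; apply: contrapT => /forall2NP noL.
pose A := [set x | exists2 l, char_list l & x = energy l F].
have supA : has_sup A.
  split; first by exists (energy [::] F), [::].
  by exists (nn F) => _ [l cl ->]; exact: bessel.
have Ale l : char_list l -> energy l F <= sup A.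
  by move=> cl; apply: sup_upper_bound => //; exists l.
have supe : sup A <= nn F - e.
  apply: ge_sup => [|_ [l cl ->]]; first by case: supA.
  by have [//|/negP] := noL l; rewrite -ltNge => /ltW.
have hl n : {l | char_list l & sup A - n.+1%:R^-1 <= energy l F}.
  apply/cid2; have n0 : 0 < (n.+1%:R : R)^-1 by rewrite invr_gt0.
  by have [_ [l cl ->] /ltW] := sup_adherent n0 supA; exists l.
pose l n := s2val (hl n).
have cl n : char_list (l n) by exact: (s2valP (hl n)).
have le n : sup A - n.+1%:R^-1 <= energy (l n) F by exact: (s2valP' (hl n)).
pose D n x := F x - char_sum (l n) F x.
have Vl n : V (char_sum (l n) F) by exact: mfun_char_sum F (cl n).2.
have VD n : V (D n) by apply: mfunB.
(* The union of the two lists has energy at most [sup A], which forces the energy of the common part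
   to be large. *)
have nnD n m : nn (fun x => D n x - D m x) <= n.+1%:R^-1 + m.+1%:R^-1.
  have -> : (fun x => D n x - D m x) = fun x => char_sum (l m) F x - char_sum (l n) F x.
    by apply/funext => x; rewrite /D opprB addrC addrA subrK.
  rewrite nnB// !nn_char_sum// ip_char_sum2//=.
  have [w cw Ew] := energy_merge F (cl m) (cl n).
  have aux (a b c d s x y : R) : a + b = c + d -> a <= s -> s - x <= d ->
    s - y <= c -> c + d - 2 * b <= x + y by lra.
  exact: aux Ew (Ale _ cw) (le n) (le m).
pose tF := til F; have VtF : V tF by exact: mfun_til.
(* The remainders are Cauchy only for [nn]; convolution with a fixed function makes them uniformly
   Cauchy, and at 0 it returns their inner product with [F]. *)
pose P n := D n ** tF; have VP n : V (P n) by exact: mfun_conv.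
have inv_small (d : R) : 0 < d -> exists N, forall n, (N <= n)%N -> n.+1%:R^-1 <= d.
  move=> d0; exists (Num.truncn (d^-1)) => n Nn.
  rewrite -[leRHS]invrK lef_pV2 ?posrE ?invr_gt0//.
  by rewrite ltW// (lt_le_trans (truncnS_gt _))// ler_nat.
have cauP (d : R) : 0 < d -> exists N, forall n m, (N <= n)%N -> (N <= m)%N ->
    forall x, nrm (P n x - P m x) <= d.
  move=> d0; pose c := 2 * nn F + 1.
  have c0 : 0 < c by rewrite ltr_wpDl// mulr_ge0 ?nn_ge0.
  have [N hN] := inv_small (d ^+ 2 / c) (divr_gt0 (exprn_gt0 _ d0) c0).
  exists N => n m Nn Nm x.
  rewrite -(ler_pXn2r (n := 2))// ?nnegrE ?nrm_ge0 ?(ltW d0)//.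
  have := congr1 (fun G => G x) (convBl (VD n) (VD m) VtF) => /= <-.
  rewrite (le_trans (conv_bound _ (mfunB (VD n) (VD m)) VtF))// nn_til//.
  have h := le_trans (nnD n m) (lerD (hN _ Nn) (hN _ Nm)).
  rewrite (le_trans (ler_wpM2r (nn_ge0 VF) h))//.
  rewrite [leLHS](_ : _ = d ^+ 2 * ((2 * nn F) / c)); last by ring.
  by rewrite ger_pMr ?exprn_gt0// ler_pdivrMr// mul1r /c lerDl.
have [h Vh cvh] := ucv_ex VP cauP.
have h0 : h <> fun=> 0.
  move=> h0; have [N hN] := cvh _ (divr_gt0 e0 (ltr0n R 2)).
  have := hN _ (leqnn N) 0; rewrite h0 subr0 /P /tF -ipE.
  have -> : ip (D N) F = (nn F - energy (l N) F)%:C.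
    by rewrite /D ipBl// nnE// -(ip_conj VF (Vl N)) ip_char_sumr// conjR -rmorphB.
  rewrite nrmR => a3; have := le_trans (ler_norm _) a3.
  by move: (Ale _ (cl N)) supe; lra.
(* A character outside the list [l n] could be appended without passing [sup A], so its coefficient
   in the remainder is small; a character of the list has coefficient 0. *)
have hchar psi : is_char psi -> h ** psi = fun=> 0.
  move=> cp; have [Vp _ _] := cp; apply: (ucv_uniq (ucv_conv VP Vh Vp cvh)).
  move=> d d0; have [c hc] := mfun_bnd VtF.
  have n1 : 0 < nn F + 1 by rewrite ltr_wpDl ?nn_ge0.
  have [N hN] := inv_small (d ^+ 2 / (nn F + 1)) (divr_gt0 (exprn_gt0 _ d0) n1).
  exists N => n Nn x; rewrite subr0.
  rewrite -(ler_pXn2r (n := 2))// ?nnegrE ?nrm_ge0 ?(ltW d0)//.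
  rewrite /P convA// (convC VtF)// -convA// (conv_char (VD n) cp) convZl// nrmM exprMn.
  have ipD : nrm (ip (D n) psi) ^+ 2 <= n.+1%:R^-1.
    rewrite /D ipBl// ip_char_sum//; case: ifPn => [_|pl].
      by rewrite subrr nrm0 expr0n /= invr_ge0.
    rewrite subr0.
    have cu : char_list (psi :: l n).
      split=> [|phi]; first by rewrite /= pl (cl n).1.
      by rewrite inE => /orP[/eqP ->//|/(cl n).2].
    have := Ale _ cu; rewrite /energy big_cons -/(energy (l n) F).
    have aux (a b s y : R) : s - y <= b -> a + b <= s -> a <= y by lra.
    exact: aux (le n).
  have nnpsi : nn psi = 1 by rewrite /nn char_nn.
  rewrite (le_trans (ler_pM (sqr_ge0 _) (sqr_ge0 _) (le_trans ipD (hN _ Nn)) (conv_bound _ Vp VtF)))//.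
  rewrite nnpsi mul1r nn_til//.
  rewrite [leLHS](_ : _ = d ^+ 2 * (nn F / (nn F + 1))); last by ring.
  by rewrite ger_pMr ?exprn_gt0// ler_pdivrMr// mul1r lerDl.
(* A character fixed by [p] is annihilated by [h ** til h], while [Kp] says that the square of this
   kernel acts as [L] on it. *)
have [p [L [ip0 L0 Kp _]]] := spectral_idempotent Vh h0.
have [psi cp pp] := exists_char ip0.
have [Vp _ _ _] := ip0; have [Vpsi _ p1] := cp.
have Vth := mfun_til Vh.
have z0 g : V g -> g ** (fun=> 0) = fun=> 0.
  move=> Vg; apply/funext => x; rewrite -[RHS](mean_cst S) /conv.
  by congr M; apply/funext => s; rewrite mulr0.
have khp : h ** til h ** psi = fun=> 0 by rewrite (convC Vh)// convA// hchar// z0.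
have : h ** til h ** (h ** til h) ** p ** psi = fun=> 0.
  by rewrite (convA _ Vp Vpsi)// pp convA// khp z0.
rewrite Kp convZl// pp => /(congr1 (@^~ 0)) /eqP.
rewrite mulf_eq0 RC_eq0 (gt_eqF L0) /= -nrm_eq0 p1 oner_eq0.
by [].
Qed.

End ParsevalIdentity.

(** * Topological groups *)

Section ProductGroup.
Variables A B : topologicalZmodType.

Lemma prod_sub_continuous :
  continuous (fun p : (A * B) * (A * B) => p.1 - p.2 : A * B).
Proof.
move=> [[a b] [a' b']].
have c1 : continuous (fun p : (A * B) * (A * B) => p.1.1 - p.2.1).
  move=> {a b a' b'} p.
  apply: (@continuous_comp _ _ _ (fun p : (A * B) * (A * B) => (p.1.1, p.2.1))
    (fun q : A * A => q.1 - q.2)); last exact: sub_continuous.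
  apply: cvg_pair => /=.
    by apply: (@continuous_comp _ _ _ fst fst); exact: cvg_fst.
  by apply: (@continuous_comp _ _ _ snd fst); [exact: cvg_snd|exact: cvg_fst].
have c2 : continuous (fun p : (A * B) * (A * B) => p.1.2 - p.2.2).
  move=> {a b a' b'} p.
  apply: (@continuous_comp _ _ _ (fun p : (A * B) * (A * B) => (p.1.2, p.2.2))
    (fun q : B * B => q.1 - q.2)); last exact: sub_continuous.
  apply: cvg_pair => /=.
    by apply: (@continuous_comp _ _ _ fst snd); [exact: cvg_fst|exact: cvg_snd].
  by apply: (@continuous_comp _ _ _ snd snd); exact: cvg_snd.
exact: (cvg_pair (c1 _) (c2 _)).
Qed.

End ProductGroup.

(* An alias is needed because the library already attaches to [prod] an
   instance that only applies to topological vector spaces. *)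
Definition prodG (A B : topologicalZmodType) : Type := (A * B)%type.

HB.instance Definition _ (A B : topologicalZmodType) :=
  Topological.copy (prodG A B) (A * B)%type.
HB.instance Definition _ (A B : topologicalZmodType) :=
  GRing.Zmodule.copy (prodG A B) (A * B)%type.
HB.instance Definition _ (A B : topologicalZmodType) :=
  PreTopologicalNmodule_isTopologicalZmodule.Build (prodG A B)
    (@prod_sub_continuous A B).

(** Near-covering compactness is applied to the filter of finite lists of points of [K] ordered by
    inclusion: near each point all large enough lists cover. *)
Lemma compact_finite_cover (T : topologicalType) (K : set T) (U : T -> set T) :
  compact K -> (forall x, K x -> nbhs x (U x)) ->
  exists2 s : seq T, (forall x, x \in s -> K x) &
    forall y, K y -> exists2 x, x \in s & U x y.
Proof.
move=> /compact_near_coveringP cK hU.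
pose F (A : set (seq T)) := exists2 s0 : seq T, (forall x, x \in s0 -> K x) &
  forall s, {subset s0 <= s} -> A s.
have FF : Filter F.
  split; first by exists [::].
    move=> P Q [s hs Ps] [t ht Qt]; exists (s ++ t).
      by move=> x; rewrite mem_cat => /orP[/hs|/ht].
    move=> u su; split; [apply: Ps|apply: Qt] => x xs; apply: su;
      by rewrite mem_cat xs ?orbT.
  by move=> P Q PQ [s hs Ps]; exists s => // t st; apply: PQ; exact: Ps.
have [x Kx|s hs Ps] := cK _ F (fun (s : seq T) y => exists2 x, x \in s & U x y) FF.
  exists (U x, [set s : seq T | x \in s]).
    split=> /=; first exact: hU.
    exists [:: x]; first by move=> y; rewrite inE => /eqP ->.
    by move=> s; apply; rewrite inE eqxx.
  by move=> [y s] /= [Uy xs]; exists x.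
by exists s => //; exact: Ps.
Qed.

Section TopGroup.
Context {G : topologicalZmodType}.
Implicit Types (A B K U V : set G) (x y t u : G).

Lemma addr_cont t : continuous (fun x => x + t).
Proof.
move=> x; apply: (@continuous_comp _ _ _ (fun x => (x, t)) (fun p : G * G => p.1 + p.2)).
  by apply: cvg_pair; [exact: cvg_id|exact: cvg_cst].
exact: add_continuous.
Qed.

Lemma near_add x u A : nbhs (x + u) A ->
  \forall y \near x & v \near u, A (y + v).
Proof. by move=> h; have := @add_continuous G (x, u) _ h. Qed.

Lemma nbhs_shift x t A : nbhs (x + t) A -> nbhs x [set y | A (y + t)].
Proof. exact: addr_cont. Qed.

Lemma nbhs0_shift x A : nbhs x A -> nbhs 0 [set u | A (x + u)].
Proof.
move=> h; rewrite (_ : [set u | _] = [set u | A (u + x)]).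
  by apply: nbhs_shift; rewrite add0r.
by apply/seteqP; split => u /=; rewrite addrC.
Qed.

Lemma nbhs0_unshift x U : nbhs 0 U -> nbhs x [set y | U (y - x)].
Proof. by move=> h; apply: (@nbhs_shift x (- x)); rewrite subrr. Qed.

Lemma nbhs0_opp U : nbhs 0 U -> nbhs 0 [set u | U (- u)].
Proof. by move=> h; have := @opp_continuous G 0; rewrite /continuous_at oppr0; apply. Qed.

Lemma nbhs0_half U : nbhs 0 U -> exists V, [/\ nbhs 0 V, V `<=` U,
  forall u, V u -> V (- u) & forall u v, V u -> V v -> U (u + v)].
Proof.
move=> h; have /near_add : nbhs (0 + 0 : G) U by rewrite addr0.
move=> [[A B] /= [nA nB] hAB].
pose V0 := A `&` B `&` U; have nV0 : nbhs 0 V0 by apply: filterI => //; exact: filterI.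
exists (V0 `&` [set u | V0 (- u)]); split.
- by apply: filterI => //; exact: nbhs0_opp.
- by move=> u [[]].
- by move=> u [h1 h2]; split => //=; rewrite opprK.
- by move=> u v [[[Au _] _] _] [[[_ Bv] _] _]; exact: (hAB (u, v)).
Qed.

Lemma translateE t A : translate t A = [set y | A (y - t)].
Proof.
apply/seteqP; split => [_ [x Ax <-]|y Ay] /=; first by rewrite addrC addKr.
by exists (y - t) => //; rewrite addrCA subrr addr0.
Qed.

Lemma open_translate t A : open A -> open (translate t A).
Proof.
move=> oA; rewrite translateE.
exact: (open_comp (f := fun y => y - t)) (fun x _ => @addr_cont (- t) x) oA.
Qed.

Lemma compact_translate t K : compact K -> compact (translate t K).
Proof.
move=> cK; apply: continuous_compact => //; apply: continuous_subspaceT => x.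
rewrite (_ : (fun x => t + x) = fun x => x + t); first exact: addr_cont.
by apply/funext => y; rewrite addrC.
Qed.

Lemma compact_add K B : compact K -> compact B ->
  compact [set a + b | a in K & b in B].
Proof.
move=> cK cB; have -> : [set a + b | a in K & b in B] =
    (fun p : G * G => p.1 + p.2) @` (K `*` B).
  apply/seteqP; split => [_ [a Ka [b Bb <-]]|_ [[a b] [/= Ka Bb] <-]].
    by exists (a, b).
  by exists a => //; exists b.
apply: continuous_compact; last exact: compact_setX.
exact/continuous_subspaceT/add_continuous.
Qed.

Lemma compact_opp K : compact K -> compact [set - a | a in K].
Proof.
by move=> cK; apply: continuous_compact => //; exact/continuous_subspaceT/opp_continuous.
Qed.

Lemma compact_diff K B : compact K -> compact B -> compact (minkowski_diff K B).
Proof.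
move=> cK cB; have := compact_add cK (compact_opp cB); congr compact.
apply/seteqP; split => [_ [a Ka [_ [b Bb <-] <-]]|_ [a Ka [b Bb <-]]].
  by exists a => //; exists b.
by exists a => //; exists (- b) => //; exists b.
Qed.

Lemma compact_nbhs_sub K A : compact K -> (forall x, K x -> nbhs x A) ->
  exists2 U, nbhs 0 U & forall x u, K x -> U u -> A (x + u).
Proof.
move=> /compact_near_coveringP cK hA.
exists [set u | K `<=` (fun x => A (x + u))]; last by move=> x u Kx /(_ _ Kx).
apply: (cK _ (nbhs (0 : G)) (fun u x => A (x + u))) => x Kx.
by apply: near_add; rewrite addr0; exact: hA.
Qed.

Lemma unif_on_compact (R : realType) (f : G -> R[i]^o) K (e : R) :
  compact K -> continuous f -> 0 < e ->
  exists2 U, nbhs 0 U & forall x u, K x -> U u -> nrm (f (x + u) - f x) <= e.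
Proof.
move=> /compact_near_coveringP cK cf e0.
exists [set u | K `<=` (fun x => nrm (f (x + u) - f x) <= e)]; last first.
  by move=> x u Kx /(_ _ Kx).
apply: (cK _ (nbhs (0 : G)) (fun u x => nrm (f (x + u) - f x) <= e)) => x Kx.
have e20 : 0 < e / 2 by rewrite divr_gt0.
have := (continuous_nrm f x).1 (cf x) _ e20 => h1.
have /near_add [[A B] /= [nA nB] hAB] : nbhs (x + 0) [set y | nrm (f y - f x) < e / 2].
  by rewrite addr0.
exists (A `&` [set y | nrm (f y - f x) < e / 2], B).
  by split => //=; exact: filterI.
move=> [y v] /= [[Ay yx] Bv]; rewrite (le_trans (nrm_split (f x) _ _))// [leRHS]splitr.
by rewrite lerD ?(ltW (hAB (y, v) _))// nrm_sym ltW.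
Qed.

Lemma unif_of_cs (R : realType) (f : G -> R[i]^o) (e : R) :
  continuous_cs f -> 0 < e ->
  exists2 U, nbhs 0 U & forall x u, U u -> nrm (f (x + u) - f x) <= e.
Proof.
move=> [cf cK] e0; have [U nU hU] := unif_on_compact cK cf e0.
(* The neighbourhood is made symmetric because, when only [x + u] meets the support, the estimate is
   applied there with the step [- u]. *)
exists (U `&` [set u | U (- u)]); first by apply: filterI => //; exact: nbhs0_opp.
move=> x u [Uu U'u].
have [Kx|nKx] := pselect (closure [set x | f x != 0] x); first exact: hU.
have fx : f x = 0 by apply: contrapT => /eqP h; apply: nKx; exact: subset_closure.
have [Kx|nKxu] := pselect (closure [set x | f x != 0] (x + u)).
  by have := hU _ _ Kx U'u; rewrite addrK nrm_sym.
have fxu : f (x + u) = 0 by apply: contrapT => /eqP h; apply: nKxu; exact: subset_closure.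
by rewrite fx fxu subrr nrm0 ltW.
Qed.

Lemma closed_add K A : compact K -> closed A -> closed [set a + k | a in A & k in K].
Proof.
move=> /compact_near_coveringP cK clA; rewrite -openC openE => x nx.
suff : \forall y \near x, K `<=` (fun k => ~ A (y - k)).
  rewrite /interior; apply: filterS => y hy [a Aa [k Kk E]].
  by apply: (hy k Kk); rewrite -E addrK.
apply: (cK _ (nbhs x) (fun y k => ~ A (y - k))) => k Kk.
have nA : nbhs (x - k) (~` A).
  apply: open_nbhs_nbhs; split; first by rewrite openC.
  by move=> Axk; apply: nx; exists (x - k) => //; exists k => //; rewrite subrK.
have := @sub_continuous G (x, k) _ nA => -[[P Q] /= [nP nQ] hPQ].
by exists (Q, P) => // -[k' y] /= [Qk Py]; exact: (hPQ (y, k')).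
Qed.

Lemma closed_sub K A : compact K -> closed A -> closed [set a - k | a in A & k in K].
Proof.
move=> cK cA; have := closed_add (compact_opp cK) cA; congr closed.
apply/seteqP; split => [_ [a Ka [_ [b Bb <-] <-]]|_ [a Ka [b Bb <-]]].
  by exists a => //; exists b.
by exists a => //; exists (- b) => //; exists b.
Qed.

Hypothesis hG : lcag G.

Lemma lc_nbhs : exists2 N : set G, nbhs 0 N & compact N /\ closed N.
Proof.
have [_ lc _] := hG; have [N nN hN] := lc 0 I; exists N => //.
by move: nN; rewrite /within /=; apply: filterS => x; apply.
Qed.

Lemma compact_is_closed K : compact K -> closed K.
Proof. by have [h _ _] := hG; exact: compact_closed. Qed.

Lemma lc_open K : compact K -> exists O C : set G,
  [/\ open O, compact C, K `<=` O & O `<=` C].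
Proof.
move=> cK; have [N nN [cN _]] := lc_nbhs.
exists (\bigcup_(x in K) translate x (interior N)), [set a + b | a in K & b in N].
split.
- by apply: bigcup_open => x _; apply: open_translate; exact: open_interior.
- exact: compact_add.
- move=> x Kx; exists x => //; exists 0; last by rewrite addr0.
  exact: nbhs_singleton (nbhs_interior nN).
- by move=> _ [x Kx [y Ny <-]]; exists x => //; exists y => //; exact: interior_subset.
Qed.

Lemma lc_nbhs_in U : nbhs 0 U -> exists V, [/\ nbhs 0 V, compact V, V `<=` U,
  forall u, V u -> V (- u) & forall u v, V u -> V v -> U (u + v)].
Proof.
move=> nU; have [N nN [cN clN]] := lc_nbhs.
have [V [nV VU Vo V2]] := nbhs0_half nU.
have nVN : nbhs 0 (interior V `&` interior N).
  by apply: filterI; apply: nbhs_interior.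
have [W [nW WV Wo W2]] := nbhs0_half nVN.
have cW : compact (closure W).
  apply: (subclosed_compact _ cN); first exact: closed_closure.
  by rewrite [X in _ `<=` X](closure_id N).1//; apply: closure_subset => u /WV[_ /interior_subset].
have clV u : closure W u -> V u.
  move=> clu; have /clu[w [Ww /= wu]] : nbhs u [set y | W (y - u)] by exact: nbhs0_unshift.
  have [/interior_subset + _] := W2 _ _ Ww (Wo _ wu).
  by rewrite opprB addrCA subrr addr0.
exists (closure W `&` [set u | closure W (- u)]); split.
- apply: filterI; first by apply: filterS nW; exact: subset_closure.
  by apply: nbhs0_opp; apply: filterS nW; exact: subset_closure.
- apply: (subclosed_compact _ cW); last by move=> u [].
  apply: closedI; first exact: closed_closure.
  apply: (closed_comp (f := -%R)) (fun x _ => @opp_continuous G x) _.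
  exact: closed_closure.
- by move=> u [/clV/VU].
- by move=> u [h1 h2]; split => //=; rewrite opprK.
- by move=> u v [/clV h _] [/clV h' _]; exact: V2.
Qed.

End TopGroup.

(** * Integration of complex functions *)

Section ComplexIntegral.
Context {d : measure_display} {T : measurableType d} {R : realType}.
Local Notation C := (R[i]^o).
Implicit Types (f g : T -> C) (D : set T).

Definition cmeas D f := measurable_fun D (fun x => complex.Re (f x)) /\
  measurable_fun D (fun x => complex.Im (f x)).

Lemma cmeas_cst D (a : C) : cmeas D (fun=> a).
Proof. by split; exact: measurable_cst. Qed.

Lemma cmeasD D f g : cmeas D f -> cmeas D g -> cmeas D (fun x => f x + g x).
Proof.
move=> [f1 f2] [g1 g2]; split.
  by under eq_fun do rewrite ReD; exact: measurable_funD.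
by under eq_fun do rewrite ImD; exact: measurable_funD.
Qed.

Lemma cmeasM D f g : cmeas D f -> cmeas D g -> cmeas D (fun x => f x * g x).
Proof.
move=> [f1 f2] [g1 g2].
have ReM (z w : C) : complex.Re (z * w) =
    complex.Re z * complex.Re w - complex.Im z * complex.Im w by case: z w => [? ?] [].
have ImM (z w : C) : complex.Im (z * w) =
    complex.Re z * complex.Im w + complex.Im z * complex.Re w by case: z w => [? ?] [].
split.
  by under eq_fun do rewrite ReM; apply: measurable_funB; exact: measurable_funM.
by under eq_fun do rewrite ImM; apply: measurable_funD; exact: measurable_funM.
Qed.

Lemma cmeasZ D (a : C) f : cmeas D f -> cmeas D (fun x => a * f x).
Proof. by apply: cmeasM; exact: cmeas_cst. Qed.

Lemma cmeasB D f g : cmeas D f -> cmeas D g -> cmeas D (fun x => f x - g x).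
Proof.
move=> mf mg; have := cmeasD mf (cmeasZ (-1) mg).
by congr (cmeas _ _); apply/funext => x; rewrite mulN1r.
Qed.

Lemma cmeas_conj D f : cmeas D f -> cmeas D (fun x => (f x)^*).
Proof.
move=> [f1 f2]; split; first by under eq_fun do rewrite ReJ.
by under eq_fun do rewrite ImJ -mulN1r; apply: measurable_funM.
Qed.

Lemma cmeas_real D (h : T -> R) : measurable_fun D h -> cmeas D (fun x => (h x)%:C : C).
Proof. by move=> mh; split => //=; exact: measurable_cst. Qed.

Lemma cmeas_sum D (I : Type) (r : seq I) (F : I -> T -> C) :
  (forall i, cmeas D (F i)) -> cmeas D (fun x => \sum_(i <- r) F i x).
Proof.
move=> mF; elim: r => [|i r IH].
  by under eq_fun do rewrite big_nil; exact: cmeas_cst.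
by under eq_fun do rewrite big_cons; exact: cmeasD.
Qed.

Lemma cmeasS D E f : measurable D -> E `<=` D -> cmeas D f -> cmeas E f.
Proof. by move=> mD ED [f1 f2]; split; apply: measurable_funS ED _. Qed.

Lemma measurable_nrm D f : cmeas D f -> measurable_fun D (fun x => nrm (f x)).
Proof.
move=> [f1 f2].
have -> : (fun x => nrm (f x)) =
    Num.sqrt \o (fun x => complex.Re (f x) ^+ 2 + complex.Im (f x) ^+ 2).
  by apply/funext => x; rewrite /nrm /Normc.normc /=; case: (f x).
apply: measurableT_comp.
  by apply: continuous_measurable_fun; exact: sqrt_continuous.
by apply: measurable_funD; exact: measurable_funX.
Qed.

Variable mu : {measure set T -> \bar R}.

Definition cint D f : C := (\int[mu]_(x in D) complex.Re (f x)) +i*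
  (\int[mu]_(x in D) complex.Im (f x)).

Definition cintble D f := mu.-integrable D (EFin \o (fun x => complex.Re (f x))) /\
  mu.-integrable D (EFin \o (fun x => complex.Im (f x))).

Lemma cintble_cmeas D f : cintble D f -> cmeas D f.
Proof. by move=> [i1 i2]; split; apply/measurable_EFinP; [exact: measurable_int i1|exact: measurable_int i2]. Qed.

Lemma cint_eq D f g : (forall x, D x -> f x = g x) -> cint D f = cint D g.
Proof.
move=> fg; rewrite /cint; congr (_ +i* _);
  by apply: eq_Rintegral => x; rewrite inE => Dx; rewrite fg.
Qed.

Lemma cint0 D : cint D (fun=> 0) = 0.
Proof.
by rewrite /cint /Rintegral /= integral0.
Qed.

Lemma cint_cst D (a : C) : measurable D -> cint D (fun=> a) = (fine (mu D))%:C * a.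
Proof.
move=> mD; rewrite /cint !Rintegral_cst//; case: a => a b /=.
by apply/eqP; rewrite eq_complex /= !mul0r subr0 addr0 ![_ * fine _]mulrC !eqxx.
Qed.

Lemma integrable_le D (h : T -> R) (k : T -> R) : measurable D ->
  measurable_fun D h -> (forall x, D x -> `|h x| <= k x) ->
  mu.-integrable D (EFin \o k) -> mu.-integrable D (EFin \o h).
Proof.
move=> mD mh hk; apply: le_integrable => //; first exact/measurable_EFinP.
move=> x Dx /=; rewrite lee_fin (le_trans (hk _ Dx))//; exact: ler_norm.
Qed.

Lemma integrableRD D (h k : T -> R) : measurable D ->
  mu.-integrable D (EFin \o h) -> mu.-integrable D (EFin \o k) ->
  mu.-integrable D (EFin \o (fun x => h x + k x)).
Proof. by move=> mD hi ki; have := integrableD mD hi ki; apply: eq_integrable. Qed.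

Lemma integrableRZ D (a : R) (h : T -> R) : measurable D ->
  mu.-integrable D (EFin \o h) -> mu.-integrable D (EFin \o (fun x => a * h x)).
Proof. by move=> mD hi; have := integrableZl mD a hi; apply: eq_integrable. Qed.

Lemma cintbleP D f : measurable D ->
  cintble D f <-> cmeas D f /\ mu.-integrable D (EFin \o (fun x => nrm (f x))).
Proof.
move=> mD; split=> [h|[mf h]].
  have mf := cintble_cmeas h; split => //; have [h1 h2] := h.
  apply: (@integrable_le _ _ (fun x => `|complex.Re (f x)| + `|complex.Im (f x)|)) => //.
  - exact: measurable_nrm.
  - by move=> x _; rewrite ger0_norm ?nrm_ge0// nrm_ReIm.
  - by apply: integrableRD => //; exact: integrable_norm.
by split; apply: integrable_le h => //; [exact: mf.1|by move=> x _; exact: Re_nrm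
  |exact: mf.2|by move=> x _; exact: Im_nrm].
Qed.

Lemma cintble_bounded D A f (c : R) : measurable D -> measurable A ->
  (mu A < +oo)%E -> cmeas D f -> (forall x, D x -> nrm (f x) <= c) ->
  (forall x, D x -> ~ A x -> f x = 0) -> cintble D f.
Proof.
move=> mD mA Afin mf fc f0; apply/cintbleP => //; split=> //.
apply: (@integrable_le _ _ (fun x => c * \1_A x)) => //; first exact: measurable_nrm.
  move=> x Dx; rewrite ger0_norm ?nrm_ge0// indicE.
  have [Ax|Ax] := pselect (A x); first by rewrite mem_set// mulr1 fc.
  by rewrite memNset// mulr0 f0// nrm0.
have /integrableS : mu.-integrable setT (EFin \o (fun x => c * \1_A x)).
  apply: integrableRZ => //; apply/integrableP; split.
    by apply/measurable_EFinP; exact: measurable_indic.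
  under eq_integral do rewrite /= ger0_norm ?indicE ?ler0n// -indicE.
  by rewrite integral_indic// setIT.
by apply.
Qed.

Lemma cintble_fin D f (c : R) : measurable D -> (mu D < +oo)%E ->
  cmeas D f -> (forall x, D x -> nrm (f x) <= c) -> cintble D f.
Proof.
by move=> mD Dfin mf fc; apply: (cintble_bounded mD mD Dfin mf fc) => x Dx /(_ Dx).
Qed.

Lemma cintble_le D f (k : T -> R) : measurable D -> cmeas D f ->
  (forall x, D x -> nrm (f x) <= k x) -> mu.-integrable D (EFin \o k) -> cintble D f.
Proof.
move=> mD mf fk ik; apply/cintbleP => //; split => //.
apply: integrable_le ik => //; first exact: measurable_nrm.
by move=> x Dx; rewrite ger0_norm ?nrm_ge0// fk.
Qed.

Lemma cintbleD D f g : measurable D -> cintble D f -> cintble D g ->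
  cintble D (fun x => f x + g x).
Proof.
move=> mD [f1 f2] [g1 g2]; split.
  by under [X in EFin \o X]eq_fun do rewrite ReD; exact: integrableRD.
by under [X in EFin \o X]eq_fun do rewrite ImD; exact: integrableRD.
Qed.

Lemma cintbleM D f g (c : R) : measurable D -> cmeas D g -> cintble D f ->
  (forall x, D x -> nrm (g x) <= c) -> cintble D (fun x => f x * g x).
Proof.
move=> mD mg fi gc; have mf := cintble_cmeas fi.
apply: (@cintble_le _ _ (fun x => c * nrm (f x))) => //; first exact: cmeasM.
  by move=> x Dx; rewrite nrmM mulrC ler_wpM2r ?nrm_ge0 ?gc.
by apply: integrableRZ => //; exact: ((cintbleP _ _).1 fi).2.
Qed.

Lemma cintbleZ D (a : C) f : measurable D -> cintble D f -> cintble D (fun x => a * f x).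
Proof.
move=> mD fi; have := cintbleM mD (cmeas_cst D a) fi (c := nrm a) (fun x _ => lexx _).
by congr cintble; apply/funext => x; rewrite mulrC.
Qed.

Lemma cintble_conj D f : measurable D -> cintble D f -> cintble D (fun x => (f x)^*).
Proof.
move=> mD /(cintbleP _ mD)[mf nf]; apply/cintbleP => //; split; first exact: cmeas_conj.
by under [X in EFin \o X]eq_fun do rewrite nrmJ.
Qed.

Lemma cintD D f g : measurable D -> cintble D f -> cintble D g ->
  cint D (fun x => f x + g x) = cint D f + cint D g.
Proof.
move=> mD [f1 f2] [g1 g2]; rewrite /cint.
under eq_Rintegral do rewrite ReD.
under [X in _ +i* X]eq_Rintegral do rewrite ImD.
by rewrite !RintegralD.
Qed.

Lemma cintR D (a : R) f : measurable D -> cintble D f ->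
  cint D (fun x => a%:C * f x) = a%:C * cint D f.
Proof.
move=> mD [f1 f2]; rewrite /cint.
under eq_Rintegral do rewrite ReRM.
under [X in _ +i* X]eq_Rintegral do rewrite ImRM.
rewrite !RintegralZl//; apply/eqP; rewrite eq_complex /=.
by rewrite !mul0r subr0 addr0 !eqxx.
Qed.

Lemma cinti D f : measurable D -> cintble D f ->
  cint D (fun x => 'i%C * f x) = 'i%C * cint D f.
Proof.
move=> mD [f1 f2]; rewrite /cint.
have Rei (z : C) : complex.Re ('i%C * z) = -1 * complex.Im z.
  by case: z => a b /=; ring.
have Imi (z : C) : complex.Im ('i%C * z) = complex.Re z.
  by case: z => a b /=; ring.
under eq_Rintegral do rewrite Rei.
under [X in _ +i* X]eq_Rintegral do rewrite Imi.
rewrite !RintegralZl//; apply/eqP; rewrite eq_complex /=; apply/andP; split; apply/eqP; ring.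
Qed.

Lemma cintZ D (a : C) f : measurable D -> cintble D f ->
  cint D (fun x => a * f x) = a * cint D f.
Proof.
move=> mD fi; have ifi := cintbleZ 'i%C mD fi.
transitivity (cint D (fun x => (complex.Re a)%:C * f x + (complex.Im a)%:C * ('i%C * f x))).
  by apply: cint_eq => x _; rewrite {1}(complexE a) mulrDl mulrA [_ * 'i%C]mulrC.
rewrite cintD//; [|exact: cintbleZ|exact: cintbleZ].
rewrite cintR// cintR// cinti// mulrA -mulrDl [_ * 'i%C]mulrC -complexE.
by [].
Qed.

Lemma cintB D f g : measurable D -> cintble D f -> cintble D g ->
  cint D (fun x => f x - g x) = cint D f - cint D g.
Proof.
move=> mD fi gi; rewrite -[X in _ - X]mul1r -mulNr -cintZ// -cintD//.
  by apply: cint_eq => x _; rewrite mulN1r.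
exact: cintbleZ.
Qed.

Lemma cintbleB D f g : measurable D -> cintble D f -> cintble D g ->
  cintble D (fun x => f x - g x).
Proof.
move=> mD fi gi; have := cintbleD mD fi (cintbleZ (-1) mD gi).
by congr cintble; apply/funext => x; rewrite mulN1r.
Qed.

Lemma cint_conj D f : measurable D -> cintble D f ->
  cint D (fun x => (f x)^*) = (cint D f)^*.
Proof.
move=> mD [f1 f2]; rewrite /cint.
under eq_Rintegral do rewrite ReJ.
under [X in _ +i* X]eq_Rintegral do rewrite ImJ -mulN1r.
rewrite RintegralZl//; apply/eqP; rewrite eq_complex /=.
by rewrite mulN1r !eqxx.
Qed.

Lemma cintble_cst0 D : cintble D (fun=> 0).
Proof. by split; exact: integrable0. Qed.

Lemma cintble_sum D (I : Type) (r : seq I) (F : I -> T -> C) : measurable D ->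
  (forall i, cintble D (F i)) -> cintble D (fun x => \sum_(i <- r) F i x).
Proof.
move=> mD Fi; elim: r => [|i r IH].
  by under eq_fun do rewrite big_nil; exact: cintble_cst0.
by under eq_fun do rewrite big_cons; exact: cintbleD.
Qed.

Lemma cint_sum D (I : Type) (r : seq I) (F : I -> T -> C) : measurable D ->
  (forall i, cintble D (F i)) ->
  cint D (fun x => \sum_(i <- r) F i x) = \sum_(i <- r) cint D (F i).
Proof.
move=> mD Fi; elim: r => [|i r IH].
  by rewrite big_nil -[RHS](cint0 D); apply: cint_eq => x _; rewrite big_nil.
rewrite big_cons -IH -cintD//; last exact: cintble_sum.
by apply: cint_eq => x _; rewrite big_cons.
Qed.

(* Rotating the integral onto the positive axis reduces to the real case. *)
Lemma nrm_cint D f : measurable D -> cintble D f ->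
  nrm (cint D f) <= \int[mu]_(x in D) nrm (f x).
Proof.
move=> mD fi; have [z0|z0] := eqVneq (cint D f) 0.
  by rewrite z0 nrm0 Rintegral_ge0// => x _; exact: nrm_ge0.
have nz : 0 < nrm (cint D f) by rewrite nrm_gt0.
pose u : C := (nrm (cint D f))^-1%:C * (cint D f)^*.
have nu : nrm u = 1.
  by rewrite nrmM nrmJ nrmR ger0_norm ?invr_ge0 ?(ltW nz)// mulVf// gt_eqF.
have uz : u * cint D f = (nrm (cint D f))%:C.
  rewrite -mulrA [_^* * _]mulrC mulJ -rmorphM /=; congr (_%:C).
  by rewrite expr2 mulKf// gt_eqF.
have := congr1 (@complex.Re R) uz; rewrite -cintZ// /= => <-.
apply: le_Rintegral => //; first exact: (cintbleZ u mD fi).1.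
  exact: ((cintbleP _ mD).1 fi).2.
by move=> x _; rewrite (le_trans (ler_norm _))// (le_trans (Re_nrm _))// nrmM nu mul1r.
Qed.

Lemma nrm_cint_le D f (c : R) : measurable D -> (mu D < +oo)%E ->
  cmeas D f -> (forall x, D x -> nrm (f x) <= c) ->
  nrm (cint D f) <= c * fine (mu D).
Proof.
move=> mD Dfin mf fc; have fi := cintble_fin mD Dfin mf fc.
rewrite (le_trans (nrm_cint mD fi))// -Rintegral_cst//.
apply: le_Rintegral => //; first exact: ((cintbleP _ mD).1 fi).2.
exact: finite_measure_integrable_cst || (apply: measurable_bounded_integrable => //; exact: bounded_cst).
Qed.

Lemma cintU D E f : measurable D -> measurable E -> [disjoint D & E] ->
  cintble (D `|` E) f -> cint (D `|` E) f = cint D f + cint E f.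
Proof.
by move=> mD mE DE [f1 f2]; rewrite /cint !Rintegral_setU.
Qed.

Lemma cintbleS D E f : measurable D -> measurable E -> E `<=` D ->
  cintble D f -> cintble E f.
Proof. by move=> mD mE ED [f1 f2]; split; exact: integrableS ED _. Qed.

Lemma cint_widen D f : measurable D -> (forall x, ~ D x -> f x = 0) ->
  cint setT f = cint D f.
Proof.
move=> mD f0; rewrite /cint [in RHS]Rintegral_mkcond [X in _ = _ +i* X]Rintegral_mkcond.
congr (_ +i* _); apply: eq_Rintegral => x _; rewrite patchE; case: ifPn => //;
  by rewrite notin_setE => /f0 ->.
Qed.

Lemma cint_real D (h : T -> R) :
  cint D (fun x => (h x)%:C : C) = (\int[mu]_(x in D) h x)%:C.
Proof.
apply/eqP; rewrite eq_complex /= eqxx /= /Rintegral.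
by rewrite integral0 /= eqxx.
Qed.

Lemma cint_comp (phi : T -> T) f : measurable_fun setT phi ->
  (forall A, measurable A -> mu (phi @^-1` A) = mu A) ->
  cintble setT f ->
  cintble setT (f \o phi) /\ cint setT (f \o phi) = cint setT f.
Proof.
move=> mphi hphi [f1 f2].
have aux (h : T -> \bar R) : mu.-integrable setT h ->
    mu.-integrable setT (h \o phi) /\
    (\int[mu]_(x in setT) (h \o phi) x = \int[mu]_(x in setT) h x)%E.
  move=> hi; have mh := measurable_int mu hi.
  have E k : (\int[pushforward mu phi]_(x in setT) k x = \int[mu]_(x in setT) k x)%E.
    by apply: eq_measure_integral => A mA _; exact: hphi.
  have hi2 : mu.-integrable (phi @^-1` setT) (h \o phi).
    rewrite preimage_setT; apply/integrableP; split; first exact: measurableT_comp.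
    have /integrableP[_] := hi; rewrite -(E (fun x => `|h x|)%E).
    rewrite ge0_integral_pushforward ?preimage_setT//.
    by apply: measurableT_comp.
  have hi3 : mu.-integrable setT (h \o phi) by move: hi2; rewrite preimage_setT.
  split; first exact: hi3.
  by rewrite -[RHS]E integral_pushforward ?preimage_setT.
have [a1 a2] := aux _ f1; have [b1 b2] := aux _ f2.
split; first by split.
by rewrite /cint /Rintegral a2 b2.
Qed.

End ComplexIntegral.

(** * Haar measures *)

Section Borel.
Context {R : realType} {G : topologicalZmodType}.
Local Notation C := (R[i]^o).

Lemma borel_open (A : set G) : open A -> measurable (A : set (borel G)).
Proof. by move=> oA; exact: sub_sigma_algebra. Qed.

Lemma borel_closed (A : set G) : closed A -> measurable (A : set (borel G)).
Proof.
by move=> cA; rewrite -[A]setCK; apply: measurableC; apply: borel_open; rewrite openC.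
Qed.

Lemma borel_map (H : topologicalZmodType) (f : G -> H) : continuous f ->
  measurable_fun setT (f : borel G -> borel H).
Proof.
move=> cf; apply: (@measurability _ _ (borel G) (borel H) setT f (@open H)) => //.
move=> _ [B oB <-]; rewrite setTI; apply: borel_open.
by apply: open_comp => // x _; exact: cf.
Qed.

Lemma borel_continuous (f : G -> R) : continuous f ->
  measurable_fun setT (f : borel G -> R).
Proof.
move=> cf; apply: (measurability (@RGenOInfty.G R)).
  exact: RGenOInfty.measurableE.
move=> _ [_ [x ->] <-]; rewrite setTI; apply: borel_open.
by apply: open_comp => [y _|]; [exact: cf|exact: interval_open].
Qed.

Lemma cmeas_continuous (f : G -> C) : continuous f ->
  cmeas setT (f : borel G -> C).
Proof.
move=> cf; split; apply: borel_continuous; first exact: ReC_continuous.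
exact: ImC_continuous.
Qed.

Lemma translate_id (t : G) (A : set G) : translate (- t) (translate t A) = A.
Proof. by rewrite !translateE; apply/seteqP; split => x /=; rewrite opprK addrK. Qed.

Lemma translate_preimage (t : G) (A : set G) : (fun x => x + t) @^-1` A = translate (- t) A.
Proof. by rewrite translateE opprK. Qed.

Lemma borel_translate (t : G) (A : set G) : measurable (A : set (borel G)) ->
  measurable (translate t A : set (borel G)).
Proof.
move=> mA; rewrite translateE -[X in measurable X]setTI.
exact: (borel_map (@addr_cont G (- t))).
Qed.

End Borel.

Section HaarMeasure.
Context {R : realType} {G : topologicalZmodType}.
Variable mu : {measure set (borel G) -> \bar R}.
Hypotheses (hG : lcag G) (hmu : haar mu).
Local Notation C := (R[i]^o).
Implicit Types (A K U V : set G).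

Lemma borel_compact K : compact K -> measurable (K : set (borel G)).
Proof. by move=> cK; apply: borel_closed; exact: compact_is_closed. Qed.

Lemma haar_lty K : compact K -> (mu K < +oo)%E.
Proof. by move=> cK; have [[h _] _ _] := hmu; exact: h. Qed.

Lemma haar_fin K : compact K -> mu K \is a fin_num.
Proof. by move=> cK; rewrite ge0_fin_numE// haar_lty. Qed.

Lemma haar_translate t A : measurable (A : set (borel G)) -> mu (translate t A) = mu A.
Proof. by move=> mA; have [_ _ h] := hmu; exact: h. Qed.

Lemma measure_mono (A B : set G) : measurable (A : set (borel G)) ->
  measurable (B : set (borel G)) -> A `<=` B -> (mu A <= mu B)%E.
Proof. by move=> mA mB AB; exact: (le_measure mu (mem_set mA) (mem_set mB) AB). Qed.

Lemma measure_null_sub (A B : set G) : measurable (A : set (borel G)) ->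
  measurable (B : set (borel G)) -> A `<=` B -> mu B = 0%E -> mu A = 0%E.
Proof.
by move=> mA mB AB B0; apply/eqP; rewrite eq_le measure_ge0 andbT -B0 measure_mono.
Qed.

(** If [U] were null, every compact set, being covered by finitely many translates of [U], would be
    null, and inner regularity would make the whole measure vanish. *)
Lemma haar_gt0 U : nbhs 0 U -> measurable (U : set (borel G)) -> (0 < mu U)%E.
Proof.
move=> nU mU; rewrite lt0e measure_ge0 andbT; apply/negP => /eqP U0.
have [[_ irr] muT _] := hmu.
have K0 K : compact K -> mu K = 0%E.
  move=> cK; have [s hs Ks] : exists2 s : seq G, (forall x, x \in s -> K x) &
      forall y, K y -> exists2 x, x \in s & U (y - x).
    by apply: (compact_finite_cover (U := fun x y => U (y - x))) => // x _; exact: nbhs0_unshift.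
  apply/eqP; rewrite eq_le measure_ge0 andbT.
  have mt x : measurable (translate x U : set (borel G)) by exact: borel_translate.
  have mbig : measurable (\big[setU/set0]_(x <- s) translate x U : set (borel G)).
    by apply: bigsetU_measurable => x _.
  apply: (@le_trans _ _ (mu (\big[setU/set0]_(x <- s) translate x U))).
    apply: measure_mono => //; first exact: borel_compact.
    move=> y /Ks[x xs Uyx]; rewrite -bigcup_seq; exists x => //.
    by rewrite translateE.
  elim: s {hs Ks} mbig => [|x s IH] _; first by rewrite big_nil measure0.
  have mr : measurable (\big[setU/set0]_(y <- s) translate y U : set (borel G)).
    by apply: bigsetU_measurable => y _.
  rewrite big_cons.
  apply: (@le_trans _ _ (mu (translate x U) + mu (\big[setU/set0]_(y <- s) translate y U))%E).
    exact: measureU2.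
  rewrite haar_translate// U0 add0e; exact: IH.
move/negP: muT; apply; rewrite (irr setT measurableT).
apply/eqP/le_anti/andP; split.
  by apply: ge_ereal_sup => _ [K [cK _] <-]; rewrite K0.
by apply: ereal_sup_ubound; exists set0; [split => //; exact: compact0|rewrite measure0].
Qed.

(** Outer regularity at [K] is obtained from inner regularity of [O \ K], for [O] open and
    relatively compact: the compact subset that exhausts its mass up to [e] is removed from [O]. *)
Lemma haar_outer K (e : R) : compact K -> 0 < e -> exists O C : set G,
  [/\ open O, compact C, K `<=` O, O `<=` C & (mu O <= mu K + e%:E)%E].
Proof.
move=> cK e0; have [ O [C [oO cC KO OC]]] := lc_open hG cK.
have mK := borel_compact cK; have mO := borel_open oO; have mC := borel_compact cC.
have mOK : measurable (O `\` K : set (borel G)) by exact: measurableD.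
have Ofin : (mu O < +oo)%E by rewrite (le_lt_trans _ (haar_lty cC))// measure_mono.
have OKfin : mu (O `\` K) \is a fin_num.
  rewrite ge0_fin_numE// (le_lt_trans _ Ofin)// measure_mono//; by move=> x [].
have [[_ irr] _ _] := hmu.
have [K' [cK' K'OK] hK'] : exists2 K', compact K' /\ K' `<=` O `\` K &
    (mu (O `\` K) - e%:E < mu K')%E.
  have : (mu (O `\` K) - e%:E < mu (O `\` K))%E by rewrite lteBlDr// lteDl// lte_fin.
  rewrite {2}(irr _ mOK) => /ereal_sup_gt[_ [K' hK' <-] h]; by exists K'.
have mK' := borel_compact cK'.
exists (O `\` K'), C; split.
- by rewrite setDE; apply: openI => //; rewrite openC; exact: compact_is_closed.
- by [].
- by move=> x Kx; split; [exact: KO|move=> /K'OK[]].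
- by move=> x [/OC].
- have K'O : K' `<=` O by move=> x /K'OK[].
  have mOK' : measurable (O `\` K' : set (borel G)) by exact: measurableD.
  have E1 : (mu (O `\` K') + mu K' = mu O)%E.
    rewrite -measureU//; last by apply/seteqP; split => x // -[[]].
    by rewrite setDKU.
  have E2 : (mu (O `\` K) + mu K = mu O)%E.
    rewrite -measureU//; last by apply/seteqP; split => x // -[[]].
    by rewrite setDKU.
  have fK := haar_fin cK; have fK' := haar_fin cK'.
  have fOK' : mu (O `\` K') \is a fin_num.
    rewrite ge0_fin_numE// (le_lt_trans _ Ofin)// measure_mono//; by move=> x [].
  move: hK' E1; rewrite -E2 -(fineK fOK') -(fineK fK') -(fineK fK) -(fineK OKfin).
  rewrite -!EFinD lee_fin lte_fin => h [] h2.
  by move: h h2; lra.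
Qed.

(** A small translate of [K] stays inside an open set that exceeds [K] by measure at most [e]. *)
Lemma haar_shift K (e : R) : compact K -> 0 < e ->
  exists2 U, nbhs 0 U & forall c, U c -> (mu (translate c K `\` K) <= e%:E)%E.
Proof.
move=> cK e0; have [ O [C [oO cC KO OC hO]]] := haar_outer cK e0.
have mK := borel_compact cK; have mO := borel_open oO.
have [U nU hU] := compact_nbhs_sub cK (A := O) (fun x Kx => open_nbhs_nbhs (conj oO (KO x Kx))).
exists U => // c Uc.
have mOK : measurable (O `\` K : set (borel G)) by exact: measurableD.
apply: (@le_trans _ _ (mu (O `\` K))).
  apply: measure_mono => //; first by apply: measurableD => //; exact: borel_translate.
  by move=> _ [[x Kx <-] nK]; split => //; rewrite addrC; exact: hU.
have E2 : (mu (O `\` K) + mu K = mu O)%E.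
  rewrite -measureU//; last by apply/seteqP; split => x // -[[]].
  by rewrite setDKU.
by move: hO; rewrite -E2 addeC leeD2lE// haar_fin.
Qed.

(* The bump function is [m ((x + V) /\ (K + V)) / m V], which is continuous by
   [haar_shift]; no uniform structure is needed. *)
Lemma bump K O : compact K -> open O -> K `<=` O -> exists g : G -> R,
  [/\ continuous g, forall x, 0 <= g x <= 1, forall x, K x -> g x = 1 &
    exists K', [/\ compact K', K' `<=` O & forall x, ~ K' x -> g x = 0]].
Proof.
move=> cK oO KO.
have [U nU hU] := compact_nbhs_sub cK (A := O) (fun x Kx => open_nbhs_nbhs (conj oO (KO x Kx))).
have [V [nV cV VU Vo V2]] := lc_nbhs_in hG nU.
have mV := borel_compact cV.
have cKV := compact_add cK cV; set KV := [set a + b | a in K & b in V] in cKV.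
have mKV := borel_compact cKV.
have mt x : measurable (translate x V : set (borel G)) by exact: borel_translate.
have mI x : measurable (translate x V `&` KV : set (borel G)) by exact: measurableI.
have Vp : 0 < fine (mu V).
  by rewrite fine_gt0// haar_gt0// haar_lty.
have fI x : mu (translate x V `&` KV) \is a fin_num.
  rewrite ge0_fin_numE// (le_lt_trans _ (haar_lty cKV))// measure_mono//; by move=> y [].
have IV x : fine (mu (translate x V `&` KV)) <= fine (mu V).
  apply: fine_le; [exact: fI|exact: haar_fin|].
  rewrite -(haar_translate x mV); exact: measure_mono.
exists (fun x => fine (mu (translate x V `&` KV)) / fine (mu V)); split.
(* A one-sided estimate is enough: the neighbourhood used below is symmetric, so [x] and [y] can be
   exchanged. *)
- have key x y (e : R) : (mu (translate (x - y) V `\` V) <= e%:E)%E ->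
      fine (mu (translate x V `&` KV)) - fine (mu (translate y V `&` KV)) <= e.
    move=> h; rewrite lerBlDl -lee_fin EFinD !fineK//.
    have mD : measurable (translate (x - y) V `\` V : set (borel G)).
      exact: measurableD.
    have E : translate y (translate (x - y) V `\` V) = translate x V `\` translate y V.
      by rewrite !translateE; apply/seteqP; split => z /=; rewrite opprB addrA subrK.
    apply: (@le_trans _ _ (mu ((translate y V `&` KV) `|` (translate x V `\` translate y V)))).
      apply: measure_mono => //; first by apply: measurableU => //; exact: measurableD.
      move=> z [xz kz]; have [yz|yz] := pselect (translate y V z); first by left.
      by right.
    have m2 : measurable (translate x V `\` translate y V : set (borel G)) by exact: measurableD.
    apply: (@le_trans _ _ (mu (translate y V `&` KV) + mu (translate x V `\` translate y V))%E).
      exact: measureU2.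
    by rewrite leeD2l// -E haar_translate.
  move=> y; apply/cvgrPdist_le => e e0.
  have e'0 : 0 < e * fine (mu V) by rewrite mulr_gt0.
  have [W nW hW] := haar_shift cV e'0.
  have : nbhs y [set x | (W `&` [set u | W (- u)]) (x - y)].
    by apply: nbhs0_unshift; apply: filterI => //; exact: nbhs0_opp.
  apply: filterS => x [/= W1 W2]; rewrite opprB in W2.
  rewrite -mulrBl normrM [X in _ * X]ger0_norm ?invr_ge0 ?(ltW Vp)// ler_pdivrMr//.
  by rewrite ler_norml lerNl opprB !key// hW.
- move=> x; rewrite divr_ge0 ?fine_ge0 ?(ltW Vp)//=.
  by rewrite ler_pdivrMr// mul1r.
- move=> x Kx; rewrite [X in mu X](_ : _ = translate x V).
    by rewrite haar_translate// divff// gt_eqF.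
  apply/seteqP; split => y; first by case.
  by move=> hy; split => //; move: hy => [v Vv <-]; exists x => //; exists v.
- exists [set a + b | a in KV & b in V]; split.
  + exact: compact_add.
  + move=> _ [_ [k Kk [v Vv <-]] [w Vw <-]]; rewrite -addrA; apply: hU => //.
    exact: V2.
  + move=> x nx; rewrite [X in mu X](_ : _ = set0) ?measure0 ?mul0r//.
    apply/seteqP; split => // _ [[v Vv <-] h]; apply: nx; exists (x + v) => //.
    by exists (- v); [exact: Vo|rewrite addrK].
Qed.

End HaarMeasure.

(** Product measures are formed from sigma-finite structures, whereas the theorem is stated for
    plain measures. The equality allows the given measure to be replaced by its sigma-finite
    package. *)
Lemma sigma_finite_pack d (T : measurableType d) (R : realType)
    (mu : {measure set T -> \bar R}) : sigma_finite setT mu ->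
  exists mu' : {sigma_finite_measure set T -> \bar R},
    mu = mu' :> {measure set T -> \bar R}.
Proof.
case: mu => f [c s] h.
pose nu : {measure set T -> \bar R} := HB.pack f c s.
pose B := Measure_isSigmaFinite.Build _ _ _ nu h.
pose mu' : {sigma_finite_measure set T -> \bar R} := HB.pack f c s B.
by exists mu'.
Qed.

Lemma haar_sigma_finite (R : realType) (G : topologicalZmodType)
    (mu : {measure set (borel G) -> \bar R}) : lcag G -> haar mu -> sigma_finite setT mu.
Proof.
move=> hG hmu; have [_ _ [K cK KT]] := hG; exists K; first by rewrite -KT.
by move=> i; split; [exact: borel_compact|exact: haar_lty].
Qed.

(** * The product of the physical and the internal group *)

Section ProductHaar.
Context {R : realType} {G Gint : topologicalZmodType}.
Variables (m : {sigma_finite_measure set (borel G) -> \bar R})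
  (theta : {sigma_finite_measure set (borel Gint) -> \bar R}).
Hypotheses (hG : lcag G) (hGint : lcag Gint) (hm : haar m) (htheta : haar theta).
Local Notation C := (R[i]^o).
Local Notation X := (prodG G Gint).
(** [X] and [bX] have the same points. The sigma-algebra of [bX] is generated by measurable boxes
    and may be smaller than the Borel sigma-algebra of [X], so open sets are shrunk to boxes
    wherever a measure is taken. *)
Local Notation bX := (borel G * borel Gint)%type.
Local Notation mu := (m \x theta)%E.

Lemma prod_map (f : G -> G) (g : Gint -> Gint) : continuous f -> continuous g ->
  measurable_fun setT ((fun x => (f x.1, g x.2)) : bX -> bX).
Proof.
move=> cf cg; apply: measurable_fun_pair.
  exact: (measurableT_comp (borel_map cf) measurable_fst).
exact: (measurableT_comp (borel_map cg) measurable_snd).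
Qed.

Lemma prod_shift (t : X) : measurable_fun setT ((fun x => x + t) : bX -> bX).
Proof. exact: (prod_map (@addr_cont G t.1) (@addr_cont Gint t.2)). Qed.

Lemma prod_opp : measurable_fun setT ((fun x : X => - x) : bX -> bX).
Proof. exact: (prod_map (@opp_continuous G) (@opp_continuous Gint)). Qed.

Lemma prod_box (U : set G) (V : set Gint) : measurable (U : set (borel G)) ->
  measurable (V : set (borel Gint)) -> measurable (U `*` V : set bX).
Proof. by move=> mU mV; exact: measurableX. Qed.

Lemma prod_translate_measurable (t : X) (A : set X) :
  measurable (A : set bX) -> measurable (translate t A : set bX).
Proof.
move=> mA; rewrite (@translateE X) -[X in measurable X]setTI.
exact: (@prod_shift (- t)).
Qed.

Lemma haar_preimage (H : topologicalZmodType) (nu : {measure set (borel H) -> \bar R})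
    (t : H) (A : set H) : haar nu -> measurable (A : set (borel H)) ->
  nu ((fun x => x + t) @^-1` A) = nu A.
Proof. by move=> hnu mA; rewrite translate_preimage haar_translate. Qed.

Lemma prod_invariant (t : X) (A : set bX) : measurable A ->
  mu ((fun x : X => x + t)%R @^-1` A) = mu A.
Proof.
move=> mA; rewrite /product_measure1.
pose tA (x : borel G) := theta (xsection A x).
have mxA x : measurable (xsection A x) by exact: measurable_xsection.
have E (x : borel G) : theta (xsection ((fun x : X => x + t) @^-1` A) x) =
    tA ((x : G) + t.1 : borel G).
  rewrite /tA -(haar_preimage t.2 htheta (mxA _)).
  by congr (theta _); apply/seteqP; split => y /=; rewrite /xsection /= !inE.
rewrite (eq_integral (fun x : borel G => tA ((x : G) + t.1 : borel G))); last first.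
  by move=> x _; exact: E.
have mf : measurable_fun setT tA by exact: measurable_fun_xsection.
pose ph : borel G -> borel G := fun x => (x : G) + t.1.
have mph : measurable_fun setT ph by exact: (borel_map (@addr_cont G t.1)).
transitivity (\int[pushforward m ph]_(x in setT) tA x)%E.
  by rewrite ge0_integral_pushforward.
by apply: eq_measure_integral => B mB _; exact: (haar_preimage t.1 hm mB).
Qed.

Lemma prod_cint_shift (t : X) (f : X -> C) : cintble mu setT f ->
  cintble mu setT (fun x => f (x + t)) /\
  cint mu setT (fun x => f (x + t)) = cint mu setT f.
Proof.
move=> fi; have := cint_comp (prod_shift t) _ fi; apply.
by move=> A mA; exact: prod_invariant.
Qed.

Lemma ge0_prod_shift (t : X) (A : set X) (h : X -> \bar R) :
  measurable (A : set bX) -> measurable_fun (setT : set bX) h -> (forall x, 0 <= h x)%E ->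
  (\int[mu]_(x in (translate t A : set bX)) h x = \int[mu]_(x in (A : set bX)) h ((x : X) + t)%R)%E.
Proof.
move=> mA mh h0.
have E : (fun x : X => x + t) @^-1` (translate t A) = A.
  rewrite (@translate_preimage X); exact: (@translate_id X).
have mtA := prod_translate_measurable t mA.
pose ph : bX -> bX := fun x => (x : X) + t.
have mph : measurable_fun setT ph by exact: prod_shift.
transitivity (\int[pushforward mu ph]_(x in (translate t A : set bX)) h x)%E.
  by apply: eq_measure_integral => B mB _; rewrite /pushforward; exact/esym/prod_invariant.
rewrite ge0_integral_pushforward//.
- by rewrite E.
- exact: measurable_funTS.
Qed.

Lemma prod_lty (K : set G) (L : set Gint) : compact K -> compact L -> (mu (K `*` L) < +oo)%E.
Proof.
move=> cK cL; rewrite product_measure1E; [|exact: borel_compact|exact: borel_compact].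
by rewrite lte_mul_pinfty ?haar_lty// haar_fin.
Qed.

Lemma compact_in_box (K : set X) : compact K -> exists K1 K2,
  [/\ compact K1, compact K2 & K `<=` K1 `*` K2].
Proof.
move=> cK; exists (fst @` K), (snd @` K); split.
- by apply: continuous_compact => //; apply: continuous_subspaceT => x; exact: cvg_fst.
- by apply: continuous_compact => //; apply: continuous_subspaceT => x; exact: cvg_snd.
- by move=> x Kx; split; exists x.
Qed.

Lemma nbhs_box (U : set X) : nbhs 0 U -> exists V1 V2,
  [/\ open V1, open V2, V1 0, V2 0 & V1 `*` V2 `<=` U].
Proof.
move=> [[A B] /= [nA nB] AB]; exists (interior A), (interior B).
split; try exact: open_interior; try exact: nbhs_singleton (nbhs_interior _).
by move=> x [/interior_subset h1 /interior_subset h2]; exact: AB.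
Qed.

Lemma nbhs_setX (a : G) (b : Gint) (A : set G) (B : set Gint) :
  nbhs a A -> nbhs b B -> nbhs ((a, b) : X) (A `*` B).
Proof. by move=> nA nB; exists (A, B). Qed.

Lemma prod_lcag : lcag X.
Proof.
have [h1 _ [K1 cK1 K1T]] := hG; have [N1 nN1 [cN1 _]] := lc_nbhs hG.
have [h2 _ [K2 cK2 K2T]] := hGint; have [N2 nN2 [cN2 _]] := lc_nbhs hGint.
split.
- move=> [a b] [a' b'] hab; congr pair.
    apply: h1 => A B nA nB.
    have [[x y] [[/= Ax _] [/= Bx _]]] := hab (A `*` setT) (B `*` setT)
      (nbhs_setX nA filterT) (nbhs_setX nB filterT).
    by exists x.
  apply: h2 => A B nA nB.
  have [[x y] [[/= _ Ax] [/= _ Bx]]] := hab (setT `*` A) (setT `*` B)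
    (nbhs_setX filterT nA) (nbhs_setX filterT nB).
  by exists y.
- move=> x _; exists (translate x (N1 `*` N2)).
    rewrite /within /=; apply: (@filterS _ _ _ (translate x (N1 `*` N2))) => [y //|].
    by rewrite (@translateE X); apply: nbhs0_unshift; exists (N1, N2).
  split; first by apply: compact_translate; exact: compact_setX.
  have clN : closed (N1 `*` N2).
    rewrite (_ : N1 `*` N2 = (fst : X -> G) @^-1` N1 `&` (snd : X -> Gint) @^-1` N2)//.
    apply: closedI.
      apply: (closed_comp (f := fst : X -> G)); last exact: compact_is_closed.
      by move=> y _; exact: cvg_fst.
    apply: (closed_comp (f := snd : X -> Gint)); last exact: compact_is_closed.
    by move=> y _; exact: cvg_snd.
  rewrite (@translateE X); apply: (closed_comp (f := fun y : X => y - x)) => // y _.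
  exact: (@addr_cont X).
- exists (fun n => (\bigcup_(i < n) K1 i) `*` (\bigcup_(i < n) K2 i)).
    move=> n; apply: compact_setX; rewrite bigcup_mkord; exact: bigsetU_compact.
  apply/seteqP; split => // -[x y] _.
  have [i _ xi] : (\bigcup_n K1 n) x by rewrite K1T.
  have [j _ yj] : (\bigcup_n K2 n) y by rewrite K2T.
  exists (maxn i j).+1 => //; split.
    by exists i => //=; rewrite ltnS leq_maxl.
  by exists j => //=; rewrite ltnS leq_maxr.
Qed.

End ProductHaar.

(** * Lattices and fundamental domains *)

Section Lattice.
Context {R : realType} {G Gint : topologicalZmodType}.
Variables (m : {sigma_finite_measure set (borel G) -> \bar R})
  (theta : {sigma_finite_measure set (borel Gint) -> \bar R})
  (Lt : zmodClosed (G * Gint)%type).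
Hypotheses (hLt : cut_project_scheme Lt) (hm : haar m) (htheta : haar theta).
Local Notation C := (R[i]^o).
Local Notation X := (prodG G Gint).
Local Notation bX := (borel G * borel Gint)%type.
Local Notation mu := (m \x theta)%E.
Implicit Types (x y l t : X) (F K : set X).

Lemma cps_lcag1 : lcag G. Proof. by have [[]] := hLt. Qed.
Lemma cps_lcag2 : lcag Gint. Proof. by have [[]] := hLt. Qed.
Let hG := cps_lcag1.
Let hGint := cps_lcag2.
Let hX : lcag X := prod_lcag hG hGint.

Definition Lam : set X := fun x => x \in Lt.

Lemma Lam0 : Lam 0. Proof. exact: rpred0. Qed.
Lemma LamD l t : Lam l -> Lam t -> Lam (l + t). Proof. exact: rpredD. Qed.
Lemma LamB l t : Lam l -> Lam t -> Lam (l - t). Proof. exact: rpredB. Qed.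
Lemma LamN l : Lam l -> Lam (- l). Proof. by rewrite /Lam rpredN. Qed.

(** Isolation of 0 suffices: if differences of points of [V] stay in a neighbourhood that contains
    no other lattice point, then [V] meets each coset at most once. *)
Lemma latt_sep : exists V : set X, [/\ nbhs 0 V, V `<=` V,
  forall u, V u -> V (- u) & forall u v, V u -> V v -> Lam (u - v) -> u = v].
Proof.
have [_ dis _ _ _] := hLt.
have [_ [U nU UL]] := dis 0 (rpred0 Lt).
have [V [nV VU Vo V2]] := nbhs0_half (nU : nbhs (0 : X) U).
exists V; split => // u v Vu Vv Luv; apply/eqP; rewrite -subr_eq0; apply/eqP.
have : (U `&` [set` Lt]) (u - v) by split => //; apply: V2 => //; exact: Vo.
by rewrite UL.
Qed.

(** Finitely many translates of the separating neighbourhood cover [K], and each of them holds at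
    most one lattice point. *)
Lemma latt_finite K : compact K -> finite_set [set l | Lam l /\ K l].
Proof.
move=> cK; have [V [nV _ Vo hV]] := latt_sep.
have [s hs Ks] := compact_finite_cover (U := fun x y => V (y - x)) cK
  (fun x _ => nbhs0_unshift x nV).
apply: (@sub_finite_set _ _ (\bigcup_(x in [set` s]) [set l | Lam l /\ V (l - x)])).
  by move=> l [Ll /Ks[x xs Vl]]; exists x.
apply: bigcup_finite => [|x _]; first exact: finite_seq.
have [[l0 [Ll0 Vl0]]|ne] := pselect (exists l, Lam l /\ V (l - x)); last first.
  rewrite (_ : [set l | _] = set0)//; apply/seteqP; split => // l h.
  by case: ne; exists l.
apply: (@sub_finite_set _ _ [set l0]) => // l [Ll Vl] /=.
apply: (addIr (- x)); apply: hV => //.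
by rewrite opprB addrA subrK; exact: LamB.
Qed.

Lemma latt_seq K : compact K -> exists2 s : seq X, uniq s &
  forall l, (l \in s) <-> Lam l /\ K l.
Proof.
move=> /latt_finite /finite_seqP[s Es]; exists (undup s); first exact: undup_uniq.
move=> l; rewrite mem_undup; have := congr1 (@^~ l) Es => /= E.
by split => [h|h]; [rewrite E|rewrite -E].
Qed.

Lemma latt_countable : countable Lam.
Proof.
have [_ _ [K cK KT]] := hX.
rewrite (_ : Lam = \bigcup_n [set l | Lam l /\ K n l]).
  by apply: bigcup_countable => // n _; apply: finite_set_countable; exact: latt_finite.
apply/seteqP; split => [l Ll|l [n _ []]//].
have [n _ Knl] : (\bigcup_n K n) l by rewrite KT.
by exists n.
Qed.

(** The quotient map is open, so the images of translates of the interior of a compact neighbourhood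
    cover the quotient; finitely many of these neighbourhoods, placed at representatives, form
    [K]. *)
Lemma latt_cocompact : exists2 K : set X, compact K &
  forall x, exists2 l, Lam l & K (x - l).
Proof.
have [_ _ cQ _ _] := hLt; have [N nN [cN _]] := lc_nbhs hX.
pose Q := quotient_topology {ideal_quot Lt}.
pose pi (x : X) : Q := (\pi_Q (x : G * Gint))%qT.
have piE x y : pi x = pi y -> Lam (x - y).
  move=> h; apply: (etrans (Quotient.idealrBE Lt x y)); exact/eqP.
have piE2 x y : Lam (x - y) -> pi x = pi y.
  by move=> h; exact: (eqP (etrans (esym (Quotient.idealrBE Lt x y)) h)).
have opi (U : set X) : open U -> open (pi @` U).
  move=> oU; have : open (\bigcup_(l in Lam) translate l U).
    by apply: bigcup_open => l _; exact: open_translate.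
  rewrite [X in _ -> X](_ : _ = open (pi @^-1` (pi @` U)))//.
  congr open; apply/seteqP; split => [x [l Ll [u Uu <-]]|x [u Uu /piE hu]] /=.
    by exists u => //; apply: piE2; rewrite opprD addrCA subrr addr0; exact: LamN.
  exists (x - u); first by rewrite -opprB; exact: LamN.
  by exists u => //; rewrite subrK.
pose U (q : Q) := pi @` translate (repr q : X) (interior N).
have hU q : setT q -> nbhs q (U q).
  move=> _; apply: open_nbhs_nbhs; split.
    by apply: opi; apply: open_translate; exact: open_interior.
  exists (repr q : X); last exact: reprK.
  by exists 0; [exact: nbhs_singleton (nbhs_interior nN)|rewrite addr0].
have [s _ hs] := compact_finite_cover cQ hU.
exists (\big[setU/set0]_(q <- s) translate (repr q : X) N).
  by apply: bigsetU_compact => q _; exact: compact_translate.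
move=> x; have [q qs [y [u Nu uy] /piE hy]] := hs (pi x) I.
exists (x - y); first by rewrite -opprB; exact: LamN.
rewrite subKr -bigcup_seq; exists q => //; exists u => //.
exact: interior_subset.
Qed.

(** Countable unions and sums of measures are indexed by [nat]; the cell [n] holds the lattice point
    with code [n], if there is one, which also covers a finite lattice. *)
Lemma latt_enum : exists cell : nat -> set X,
  [/\ forall n, cell n = set0 \/ exists2 l, Lam l & cell n = [set l],
      forall l, Lam l -> exists n, cell n l &
      forall n n' l, cell n l -> cell n' l -> n = n'].
Proof.
have /countable_injP[phi phi_inj] := latt_countable.
exists (fun n => [set l | Lam l /\ phi l = n]); split.
- move=> n; have [[l [Ll ln]]|ne] := pselect (exists l, Lam l /\ phi l = n).
    right; exists l => //; apply/seteqP; split => [l' [Ll' l'n]|_ ->//] /=.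
    by apply: phi_inj; rewrite ?inE// ln.
  by left; apply/seteqP; split => // l h; case: ne; exists l.
- by move=> l Ll; exists (phi l).
- by move=> n n' l [_ <-] [_ <-].
Qed.

Lemma bigcup_Lam_measurable (A : X -> set X) :
  (forall l, measurable (A l : set bX)) -> measurable (\bigcup_(l in Lam) A l : set bX).
Proof.
move=> mA; have [cell [c1 c2 _]] := latt_enum.
rewrite (_ : \bigcup_(l in Lam) A l = \bigcup_n \bigcup_(l in cell n) A l).
  apply: bigcup_measurable => n _.
  by have [->|[l Ll ->]] := c1 n; rewrite ?bigcup_set0 ?bigcup_set1.
apply/seteqP; split => [x [l Ll Ax]|x [n _ [l nl Ax]]].
  by have [n nl] := c2 _ Ll; exists n => //; exists l.
exists l => //; have [c0|[l' Ll' cl']] := c1 n; first by rewrite c0 in nl.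
by move: nl; rewrite cl' => ->.
Qed.

(** A greedy choice: finitely many small boxes meet every coset, each at most once, and from every
    box the cosets met by the boxes after it in the list are left to those handled separately by
    [Fs], which keeps one representative per coset. Boxes ensure measurability, and the compact hull
    bounds the domain. *)
Lemma exists_fd : exists F K, [/\ fundamental_domain Lt F, compact K & F `<=` K].
Proof.
have [V [nV _ Vo hV]] := latt_sep; have [N nN [cN _]] := lc_nbhs hX.
have nVN : nbhs (0 : X) (V `&` N) by exact: filterI.
have [V1 [V2 [oV1 oV2 V10 V20 VVN]]] := nbhs_box nVN.
have [K cK hK] := latt_cocompact.
pose B y := translate y (V1 `*` V2 : set X).
have mB y : measurable (B y : set bX).
  by apply: prod_translate_measurable; apply: prod_box; exact: borel_open.
have Bu y u v : B y u -> B y v -> Lam (u - v) -> u = v.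
  rewrite /B (@translateE X) => Bu Bv Luv.
  have [Vu _] := VVN _ Bu; have [Vv _] := VVN _ Bv.
  by apply: (addIr (- y)); apply: hV => //; rewrite opprB addrA subrK.
have nB y : nbhs y (B y).
  rewrite /B (@translateE X); apply: (@nbhs0_unshift X).
  by exists (V1, V2) => //; split; apply: open_nbhs_nbhs.
have [s _ hs] := compact_finite_cover (U := B) cK (fun x _ => nB x).
pose BL y := \bigcup_(l in Lam) translate l (B y).
have mBL y : measurable (BL y : set bX).
  by apply: bigcup_Lam_measurable => l; exact: prod_translate_measurable.
have BLP y x : BL y x <-> exists2 z, B y z & Lam (x - z).
  split=> [[l Ll [z Bz <-]]|[z Bz Lz]]; first by exists z => //; rewrite addrK.
  by exists (x - z) => //; exists z => //; rewrite subrK.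
pose Fs := fix Fs (s : seq X) := if s is y :: s' then B y `|` (Fs s' `\` BL y) else set0.
have mFs r : measurable (Fs r : set bX).
  by elim: r => //= y r IH; apply: measurableU => //; exact: measurableD.
have FsB r x : Fs r x -> exists2 y, y \in r & B y x.
  elim: r => //= y r IH [Bx|[/IH[z zr Bz] _]]; first by exists y => //; rewrite mem_head.
  by exists z => //; rewrite inE zr orbT.
have Fsu r x : (exists2 y, y \in r & BL y x) -> exists! z, Fs r z /\ Lam (x - z).
  elim: r => [[//]|y r IH] /= [z zr Bz].
  have [Byx|nByx] := pselect (BL y x).
    have [w Bw Lw] := (BLP _ _).1 Byx; exists w; split; first by split => //; left.
    move=> w' [[Bw'|[_ nBw']] Lw'].
      apply: (Bu y) => //; have := LamB Lw' Lw.
      by rewrite opprB addrC addrA subrK.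
    case: nBw'; apply/BLP; exists w => //; have := LamB Lw Lw'.
    by rewrite opprB addrC addrA subrK.
  have {}zr : exists2 y', y' \in r & BL y' x.
    move: zr; rewrite inE => /orP[/eqP zy|zr]; last by exists z.
    by case: nByx; rewrite -zy.
  have [w [[Fw Lw] wu]] := IH zr; exists w; split.
    split => //; right; split => // /BLP[v Bv Lv]; apply: nByx; apply/BLP.
    by exists v => //; have := LamD Lw Lv; rewrite addrA subrK.
  move=> w' [[Bw'|[Fw' _]] Lw']; last by apply: wu.
  by case: nByx; apply/BLP; exists w'.
have FsNK x : Fs s x -> (\big[setU/set0]_(y <- s) translate y N) x.
  move=> /FsB[y ys]; rewrite /B => -[u Vu <-]; have [_ Nu] := VVN _ Vu.
  by rewrite -bigcup_seq; exists y => //; exists u.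
exists (Fs s), (\big[setU/set0]_(y <- s) translate y N); split => //.
  split=> // x; apply: (Fsu s x).
  have [l Ll /hs[y ys Bxl]] := hK x; exists y => //; apply/BLP.
  by exists (x - l) => //; rewrite subKr.
by apply: bigsetU_compact => y _; exact: compact_translate.
Qed.

Lemma fd_measurable F : fundamental_domain Lt F -> measurable (F : set bX).
Proof. by case. Qed.

Lemma fd_ex F x : fundamental_domain Lt F -> exists2 y, F y & Lam (x - y).
Proof. by move=> [_ h]; have [y [[Fy Ly] _]] := h x; exists y. Qed.

Lemma fd_uniq F y y' : fundamental_domain Lt F -> F y -> F y' -> Lam (y - y') -> y = y'.
Proof.
move=> [_ h] Fy Fy' L; have [z [_ zu]] := h y.
rewrite -(zu y) ?(zu y')//; split=> //.
by have := Lam0; rewrite -(subrr y).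
Qed.

Lemma fd_translate F t : fundamental_domain Lt F -> fundamental_domain Lt (translate t F : set X).
Proof.
move=> hF; split; first by apply: prod_translate_measurable; exact: fd_measurable.
move=> x; have [y Fy Ly] := fd_ex (x - t) hF.
exists (t + y); split.
  by split; [exists y|rewrite opprD addrA].
move=> _ [[z Fz <-] Lz]; congr (t + _); apply: (fd_uniq hF) => //.
by have := LamB Lz Ly; rewrite opprD addrA opprB [X in Lam X]addrC addrA subrK.
Qed.

Definition periodic (T : Type) (h : X -> T) := forall x l, Lam l -> h (x + l) = h x.

(** Both domains are cut into pieces indexed by the lattice, so that translation by [l] carries one
    piece of [F] onto one of [F']. Periodicity makes the integrals over matching pieces equal. *)
Lemma fd_integral F F' (h : X -> \bar R) :
  fundamental_domain Lt F -> fundamental_domain Lt F' ->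
  measurable_fun (setT : set bX) h -> (forall x, 0 <= h x)%E -> periodic h ->
  (\int[mu]_(x in (F : set bX)) h x = \int[mu]_(x in (F' : set bX)) h x)%E.
Proof.
move=> hF hF' mh h0 hper; have [cell [c1 c2 c3]] := latt_enum.
have cL n l : cell n l -> Lam l.
  by have [->|[l' Ll' ->]] := c1 n => // ->.
have mF := fd_measurable hF; have mF' := fd_measurable hF'.
pose T n := \bigcup_(l in cell n) (F' `&` translate l F).
pose S n := \bigcup_(l in cell n) (F `&` translate (- l) F').
have mT n : measurable (T n : set bX).
  rewrite /T; have [->|[l Ll ->]] := c1 n; rewrite ?bigcup_set0 ?bigcup_set1//.
  by apply: measurableI => //; exact: prod_translate_measurable.
have mS n : measurable (S n : set bX).
  rewrite /S; have [->|[l Ll ->]] := c1 n; rewrite ?bigcup_set0 ?bigcup_set1//.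
  by apply: measurableI => //; exact: prod_translate_measurable.
have TF : \bigcup_n T n = F'.
  apply/seteqP; split => [x [n _ [l _ []//]]|x F'x].
  have [y Fy Ly] := fd_ex x hF; have [n nl] := c2 _ Ly.
  by exists n => //; exists (x - y) => //; split => //; exists y => //; rewrite subrK.
have SF : \bigcup_n S n = F.
  apply/seteqP; split => [x [n _ [l _ []//]]|x Fx].
  have [y F'y Ly] := fd_ex x hF'; have [n nl] := c2 _ (LamN Ly).
  exists n => //; exists (- (x - y)) => //; split => //; exists y => //.
  by rewrite opprK subrK.
have tT : trivIset setT T.
  apply/trivIsetP => i j _ _ ij; apply/seteqP; split => // x.
  move=> [[l il [_ [y Fy yx]]] [l' jl [_ [y' Fy' y'x]]]]; move/eqP: ij; apply.
  apply: (c3 _ _ l) => //; suff -> : l = l' by [].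
  have yy : y = y'.
    apply: (fd_uniq hF) => //.
    have -> : y - y' = l' - l by rewrite -(addKr l y) yx -(addKr l' y') y'x opprD opprK addrACA subrr addr0 addrC.
    by apply: LamB; [exact: cL jl|exact: cL il].
  by apply: (addIr y); rewrite yx yy y'x.
have tS : trivIset setT S.
  apply/trivIsetP => i j _ _ ij; apply/seteqP; split => // x.
  move=> [[l il [_ [y Fy yx]]] [l' jl [_ [y' Fy' y'x]]]]; move/eqP: ij; apply.
  apply: (c3 _ _ l) => //; suff -> : l = l' by [].
  have yy : y = y'.
    apply: (fd_uniq hF') => //.
    have -> : y - y' = l - l'.
      by rewrite -(addKr (- l) y) yx -(addKr (- l') y') y'x !opprK opprD addrACA subrr addr0.
    by apply: LamB; [exact: cL il|exact: cL jl].
  by apply: oppr_inj; apply: (addIr y); rewrite yx yy y'x.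
have additive (U : nat -> set X) : (forall n, measurable (U n : set bX)) -> trivIset setT U ->
    (\int[mu]_(x in (\bigcup_n U n : set bX)) h x =
     \sum_(n <oo) \int[mu]_(x in (U n : set bX)) h x)%E.
  by move=> mU tU; exact: (ge0_integral_bigcup mu mU (measurable_funTS mh) (fun x _ => h0 x) tU).
rewrite -SF -TF (additive _ mS tS) (additive _ mT tT).
apply: eq_eseriesr => n _; rewrite /S /T.
have [->|[l Ll ->]] := c1 n; rewrite ?bigcup_set0 ?integral_set0// !bigcup_set1.
have -> : F' `&` translate l F = translate l (F `&` translate (- l) F').
  rewrite !(@translateE X); apply/seteqP; split => x /=; rewrite opprK subrK;
    by move=> [].
rewrite ge0_prod_shift//; last by apply: measurableI => //; exact: prod_translate_measurable.
by apply: eq_integral => x _; rewrite hper.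
Qed.

(** This makes [covolume], defined through an arbitrary choice, computable on any fundamental
    domain. *)
Lemma fd_measure F F' : fundamental_domain Lt F -> fundamental_domain Lt F' ->
  mu F = mu F'.
Proof.
move=> hF hF'; have := @fd_integral F F' (fun=> 1%E) hF hF'.
rewrite !integral_cst ?mul1e; [|exact: fd_measurable..]; apply=> //.
Qed.

End Lattice.

Lemma bounded_on_compact (R : realType) (T : topologicalType) (f : T -> R[i]^o)
    (K : set T) : compact K -> continuous f -> exists c : R, forall x, K x -> nrm (f x) <= c.
Proof.
move=> cK cf.
have [s _ hs] := compact_finite_cover (U := fun x => [set y | nrm (f y - f x) < 1]) cK
  (fun x _ => (continuous_nrm f x).1 (cf x) 1 ltr01).
exists (\sum_(x <- s) (nrm (f x) + 1)) => y /hs[x xs /= yx].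
have h0 z : 0 <= nrm (f z) + 1 by rewrite addr_ge0 ?nrm_ge0.
apply: (@le_trans _ _ (nrm (f x) + 1)).
  by rewrite -[f y](subrK (f x)) (le_trans (nrmD _ _))// addrC lerD2l ltW.
elim: s xs {hs} => // z s IH; rewrite inE big_cons => /orP[/eqP <-|/IH h].
  by rewrite lerDl sumr_ge0.
by rewrite (le_trans h)// lerDr.
Qed.

Lemma cmeas_lim d (T : measurableType d) (R : realType) (f : T -> R[i]^o) :
  (forall e : R, 0 < e -> exists2 g, cmeas setT g & forall x, nrm (f x - g x) <= e) ->
  cmeas setT f.
Proof.
move=> h; have hn n : {g : T -> R[i]^o | cmeas setT g &
    forall x, nrm (f x - g x) <= n.+1%:R^-1}.
  by apply/cid2; apply: h; rewrite invr_gt0.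
have key (p : R[i]^o -> R) : (forall z w, `|p z - p w| <= nrm (z - w)) ->
    forall x, (fun n => p (s2val (hn n) x)) @ \oo --> p (f x).
  move=> hp x; apply/cvgrPdist_le => e e0.
  exists (Num.truncn (e^-1)) => // n /= Nn.
  rewrite (le_trans (hp _ _))// (le_trans (s2valP' (hn n) x))//.
  rewrite -[leRHS]invrK lef_pV2 ?posrE ?invr_gt0//.
  by rewrite ltW// (lt_le_trans (truncnS_gt _))// ler_nat ltnS.
split.
  apply: (@measurable_fun_cvg _ _ _ _ (fun n x => complex.Re (s2val (hn n) x))).
    by move=> n; exact: (s2valP (hn n)).1.
  by move=> x _; apply: (key (@complex.Re R)) => z w; rewrite -ReB Re_nrm.
apply: (@measurable_fun_cvg _ _ _ _ (fun n x => complex.Im (s2val (hn n) x))).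
  by move=> n; exact: (s2valP (hn n)).2.
move=> x _; apply: (key (@complex.Im R)) => z w.
rewrite (_ : _ - _ = complex.Im (z - w)) ?Im_nrm//.
by case: z w => [? ?] [].
Qed.

Lemma continuous_lim (R : realType) (T : topologicalType) (f : T -> R[i]^o) :
  (forall e : R, 0 < e -> exists2 g : T -> R[i]^o, continuous g & forall x, nrm (f x - g x) <= e) ->
  continuous f.
Proof.
move=> h x; apply/continuous_nrm => e e0; have e30 : 0 < e / 3 by rewrite divr_gt0.
have [g cg hg] := h _ e30.
have := (continuous_nrm g x).1 (cg x) _ e30; apply: filterS => y gyx.
rewrite (le_lt_trans (nrm_split (g y) _ _))//.
have h1 := hg y; have h2 := nrm_split (g x) (g y) (f x).
have h3 := hg x; rewrite nrm_sym in h3; lra.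
Qed.

(** * The invariant mean on the quotient by the lattice *)

Section LatticeMean.
Context {R : realType} {G Gint : topologicalZmodType}.
Variables (m : {sigma_finite_measure set (borel G) -> \bar R})
  (theta : {sigma_finite_measure set (borel Gint) -> \bar R})
  (Lt : zmodClosed (G * Gint)%type).
Hypotheses (hLt : cut_project_scheme Lt) (hm : haar m) (htheta : haar theta).
Local Notation C := (R[i]^o).
Local Notation X := (prodG G Gint).
Local Notation bX := (borel G * borel Gint)%type.
Local Notation mu := (m \x theta)%E.
Local Notation Lam := (Lam Lt : set X).
Let hG := cps_lcag1 hLt.
Let hGint := cps_lcag2 hLt.
Let hX : lcag X := prod_lcag hG hGint.

Variables (F K : set X).
Hypotheses (hF : fundamental_domain Lt F) (cK : compact K) (FK : F `<=` K).

Let mF : measurable (F : set bX) := fd_measurable hF.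
Definition covol : R := fine (mu F).

Lemma box_gt0 (V1 : set G) (V2 : set Gint) : open V1 -> open V2 -> V1 0 -> V2 0 ->
  (0 < mu (V1 `*` V2))%E.
Proof.
move=> o1 o2 h1 h2; rewrite product_measure1E; [|exact: borel_open..].
have g1 := haar_gt0 hG hm (open_nbhs_nbhs (conj o1 h1)) (borel_open o1).
have g2 := haar_gt0 hGint htheta (open_nbhs_nbhs (conj o2 h2)) (borel_open o2).
exact: mule_gt0.
Qed.

Lemma fd_lty : (mu F < +oo)%E.
Proof.
have [K1 [K2 [cK1 cK2 KK]]] := compact_in_box cK.
apply: le_lt_trans (prod_lty hG hGint hm htheta cK1 cK2).
apply: le_measure; rewrite ?inE//; last by move=> x /FK/KK.
by apply: prod_box; exact: borel_compact.
Qed.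

(** Countably many lattice translates of the part of [A] inside [F] cover [A]. *)
Lemma periodic_null (A : set X) : measurable (A : set bX) ->
  (forall x l, Lam l -> A x -> A (x + l)) -> mu (A `&` F) = 0%E -> mu A = 0%E.
Proof.
move=> mA pA A0; have [cell [c1 c2 c3]] := latt_enum hLt.
apply: measure_negligible => //.
have mAF : measurable (A `&` F : set bX) by exact: measurableI.
rewrite (_ : A = \bigcup_n \bigcup_(l in cell n) translate l (A `&` F)).
  apply: negligible_bigcup => n.
  have [->|[l Ll ->]] := c1 n; rewrite ?bigcup_set0 ?bigcup_set1; first exact: negligible_set0.
  apply/negligibleP; first exact: prod_translate_measurable.
  apply: (etrans (esym (prod_invariant hm htheta l (prod_translate_measurable l mAF)))).
  apply: etrans A0; congr (product_measure1 _ _ _).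
  by rewrite (@translate_preimage X) (@translate_id X).
apply/seteqP; split => [x Ax|_ [n _ [l nl [x [Ax Fx] <-]]]].
  have [y Fy Ly] := fd_ex x hF; have [n nl] := c2 _ Ly.
  exists n => //; exists (x - y) => //; exists y; last by rewrite subrK.
  split => //; have := pA x (- (x - y)) (LamN Ly) Ax.
  by rewrite opprB addrCA subrr addr0.
rewrite addrC; apply: pA => //.
by have [c0|[l' Ll' cl']] := c1 n; [rewrite c0 in nl|move: nl; rewrite cl' => ->].
Qed.

Lemma covol_gt0 : 0 < covol.
Proof.
rewrite fine_gt0// fd_lty andbT lt0e measure_ge0 andbT; apply/negP => /eqP F0.
have := @periodic_null setT measurableT; rewrite setTI => /(_ _ F0) T0.
have := box_gt0 (@openT G) (@openT Gint) I I.
by rewrite setXTT T0// ltxx.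
Qed.

(** Measurability is a separate condition because it refers to [bX], where continuity on [X] need
    not imply it. *)
Definition mfunX (f : X -> C) := [/\ continuous f, periodic Lt f &
  cmeas setT (f : bX -> C)].

Definition meanX (f : X -> C) : C := (covol^-1)%:C * cint mu F f.

Lemma mfunX_bnd f : mfunX f -> exists c : R, forall x, nrm (f x) <= c.
Proof.
move=> [cf pf _]; have [c hc] := bounded_on_compact cK cf.
exists c => x; have [y Fy Ly] := fd_ex x hF.
by have := pf y _ Ly; rewrite addrCA subrr addr0 => ->; apply: hc; exact: FK.
Qed.

Lemma mfunX_cintble f : mfunX f -> cintble mu F f.
Proof.
move=> Vf; have [c hc] := mfunX_bnd Vf; have [_ _ mf] := Vf.
apply: (cintble_fin mF fd_lty) => //; exact: cmeasS mf.
Qed.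

Lemma mfunX_cst a : mfunX (fun=> a).
Proof. by split; [move=> x; exact: cst_continuous|by []|exact: cmeas_cst]. Qed.

Lemma mfunX_mul f g : mfunX f -> mfunX g -> mfunX (fun x => f x * g x).
Proof.
move=> [f1 f2 f3] [g1 g2 g3]; split; last exact: cmeasM.
  by move=> x; apply: cvgM; [exact: f1|exact: g1].
by move=> x l Ll; rewrite f2// g2.
Qed.

Lemma mfunX_lin a f g : mfunX f -> mfunX g -> mfunX (fun x => a * f x + g x).
Proof.
move=> Vf [g1 g2 g3]; have [f1 f2 f3] := mfunX_mul (mfunX_cst a) Vf.
split; last exact: cmeasD.
  by move=> x; apply: cvgD; [exact: f1|exact: g1].
by move=> x l Ll; rewrite g2//; congr (_ + _); exact: f2.
Qed.

Lemma mfunX_conj f : mfunX f -> mfunX (fun x => (f x)^*).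
Proof.
move=> [f1 f2 f3]; split; last exact: cmeas_conj.
  move=> x; apply: (@continuous_comp _ _ _ f (fun z : R[i]^o => z^* : R[i]^o)); first exact: f1.
  exact: conj_continuous.
by move=> x l Ll; rewrite f2.
Qed.

Lemma cmeas_shift (f : X -> C) t : cmeas setT (f : bX -> C) ->
  cmeas setT ((fun x : X => f (x + t)) : bX -> C).
Proof.
move=> [f1 f2]; split; first exact: (measurableT_comp f1 (prod_shift t)).
exact: (measurableT_comp f2 (prod_shift t)).
Qed.

Lemma mfunX_shift f t : mfunX f -> mfunX (fun x => f (x + t)).
Proof.
move=> [f1 f2 f3]; split; last exact: cmeas_shift.
  move=> x; apply: (@continuous_comp _ _ _ (fun x => x + t) f); last exact: f1.
  exact: (@addr_cont X).
move=> x l Ll; have -> : x + l + t = x + t + l by rewrite -!addrA [l + t]addrC.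
exact: f2.
Qed.

Lemma mfunX_opp f : mfunX f -> mfunX (fun x => f (- x)).
Proof.
move=> [f1 f2 [f3 f4]]; split; last first.
- split; first exact: (measurableT_comp f3 (@prod_opp G Gint)).
  exact: (measurableT_comp f4 (@prod_opp G Gint)).
- by move=> x l Ll; rewrite opprD f2//; exact: LamN.
- move=> x; apply: (@continuous_comp _ _ _ (fun x : X => - x) f); last exact: f1.
  exact: (@opp_continuous X).
Qed.

Lemma mfunX_lim f : (forall e : R, 0 < e -> exists2 g, mfunX g &
  forall x, nrm (f x - g x) <= e) -> mfunX f.
Proof.
move=> h; split.
- by apply: continuous_lim => e /h[g [g1 _ _] fg]; exists g.
- move=> x l Ll; apply: nrm_le_eq => e e0; have e20 : 0 < e / 2 by rewrite divr_gt0.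
  have [g [_ g2 _] fg] := h _ e20.
  rewrite (le_trans (nrm_split (g x) _ _))// [leRHS]splitr lerD//.
    by rewrite -(g2 x l Ll).
  by rewrite nrm_sym.
- by apply: cmeas_lim => e /h[g [_ _ g3] fg]; exists g.
Qed.

Lemma mfunX_unif f (e : R) : mfunX f -> 0 < e -> exists2 U, nbhs (0 : X) U &
  forall x u, U u -> nrm (f (x + u) - f x) <= e.
Proof.
move=> [f1 f2 f3] e0; have [U nU hU] := unif_on_compact cK f1 e0.
exists U => // x u Uu; have [y Fy Ly] := fd_ex x hF.
have h1 := f2 y _ Ly; have h2 := f2 (y + u) _ Ly.
rewrite addrCA subrr addr0 in h1; rewrite addrAC addrCA subrr addr0 in h2.
by rewrite h1 h2; apply: hU => //; exact: FK.
Qed.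

Lemma covolV : (covol^-1)%:C * covol%:C = 1 :> C.
Proof. by rewrite -rmorphM /= mulVf// gt_eqF// covol_gt0. Qed.

Lemma meanX_cst a : meanX (fun=> a) = a.
Proof.
by rewrite /meanX cint_cst// mulrA -/covol covolV mul1r.
Qed.

Lemma meanX_lin a f g : mfunX f -> mfunX g ->
  meanX (fun x => a * f x + g x) = a * meanX f + meanX g.
Proof.
move=> Vf Vg; have fi := mfunX_cintble Vf; have gi := mfunX_cintble Vg.
rewrite /meanX cintD ?cintZ//; last exact: cintbleZ.
by rewrite mulrDr mulrCA.
Qed.

Lemma meanX_conj f : mfunX f -> meanX (fun x => (f x)^*) = (meanX f)^*.
Proof.
by move=> Vf; rewrite /meanX cint_conj ?conjM ?conjR//; exact: mfunX_cintble.
Qed.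

Lemma meanX_le f (c : R) : mfunX f -> (forall x, nrm (f x) <= c) -> nrm (meanX f) <= c.
Proof.
move=> [_ _ mf] fc; rewrite /meanX nrmM nrmR ger0_norm ?invr_ge0 ?(ltW covol_gt0)//.
rewrite ler_pdivrMl ?covol_gt0// mulrC; apply: nrm_cint_le => //.
  exact: fd_lty.
exact: cmeasS mf.
Qed.

(** Shifting the argument moves the integral to a translate of [F], again a fundamental domain.
    Adding the constant [c] first makes the integrand nonnegative, as [fd_integral] requires. *)
Lemma Rint_shift (h : X -> R) (c : R) t : measurable_fun (setT : set bX) h ->
  (forall x, `|h x| <= c) -> periodic Lt h ->
  \int[mu]_(x in (F : set bX)) h ((x : X) + t) = \int[mu]_(x in (F : set bX)) h x.
Proof.
move=> mh hc ph; pose k x := h x + c.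
have k0 x : 0 <= k x by rewrite /k -lerBlDr sub0r; have := hc x; rewrite ler_norml => /andP[].
have mk : measurable_fun (setT : set bX) k by exact: measurable_funD.
have E : \int[mu]_(x in (F : set bX)) k ((x : X) + t) = \int[mu]_(x in (F : set bX)) k x.
  rewrite /Rintegral; congr fine.
  have mEk : measurable_fun (setT : set bX) (EFin \o k) by exact/measurable_EFinP.
  rewrite -(ge0_prod_shift hm htheta t (h := EFin \o k))//.
    apply: (fd_integral hLt hm htheta) => //; first exact: fd_translate.
    by move=> x l Ll; rewrite /= /k ph.
have bi (g : X -> R) : measurable_fun (setT : set bX) g -> (forall x, `|g x| <= c) ->
    mu.-integrable (F : set bX) (EFin \o g).
  move=> mg gc; apply: measurable_bounded_integrable => //; first exact: fd_lty.
    exact: measurable_funTS.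
  exists c; split; first exact: num_real.
  by move=> M cM x _; exact: le_trans (gc x) (ltW cM).
have i1 : mu.-integrable (F : set bX) (EFin \o (fun=> c)).
  apply: bi => // x; rewrite ger0_norm//; exact: le_trans (hc x).
have i2 : mu.-integrable (F : set bX) (EFin \o (fun x : X => h (x + t))).
  by apply: bi => //; exact: (measurableT_comp mh (prod_shift t)).
move: E; rewrite /k RintegralD// RintegralD//; last exact: bi.
by move/addIr.
Qed.

Lemma meanX_shift f t : mfunX f -> meanX (fun x => f (x + t)) = meanX f.
Proof.
move=> Vf; have [c hc] := mfunX_bnd Vf; have [_ pf [m1 m2]] := Vf.
rewrite /meanX /cint; congr (_ * (_ +i* _)).
  apply: (@Rint_shift (fun x => complex.Re (f x)) c) => // [x|x l Ll]; last by rewrite pf.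
  by rewrite (le_trans (Re_nrm _)).
apply: (@Rint_shift (fun x => complex.Im (f x)) c) => // [x|x l Ll]; last by rewrite pf.
by rewrite (le_trans (Im_nrm _)).
Qed.

Lemma mean_sqE f : meanX (fun x => f x * (f x)^*) =
  (covol^-1 * \int[mu]_(x in (F : set bX)) (nrm (f x) ^+ 2))%:C.
Proof.
rewrite /meanX rmorphM /=; congr (_ * _); rewrite -cint_real.
by apply: cint_eq => x _; rewrite mulJ.
Qed.

Lemma meanX_ge0 f : mfunX f -> 0 <= complex.Re (meanX (fun x => f x * (f x)^*)).
Proof.
move=> _; rewrite mean_sqE /= mulr_ge0 ?invr_ge0 ?(ltW covol_gt0)//.
by apply: Rintegral_ge0 => x _; exact: sqr_ge0.
Qed.

(** The open set where [f] is nonzero is null inside [F], hence null by periodicity; if it were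
    nonempty it would contain a box of positive measure. *)
Lemma meanX_eq0 f : mfunX f -> meanX (fun x => f x * (f x)^*) = 0 -> forall x, f x = 0.
Proof.
move=> Vf; have [cf pf mf] := Vf; rewrite mean_sqE => /eqP.
rewrite RC_eq0 mulf_eq0 invr_eq0 (gt_eqF covol_gt0) /= => /eqP I0.
have mn : measurable_fun (setT : set bX) (fun x => nrm (f x)) by exact: measurable_nrm.
pose h x := (nrm (f x) ^+ 2)%:E.
have mh : measurable_fun (setT : set bX) h.
  by apply/measurable_EFinP; exact: measurable_funX.
have [c hc] := mfunX_bnd Vf.
have ih : mu.-integrable (F : set bX) h.
  apply: measurable_bounded_integrable => //; first exact: fd_lty.
    by apply/measurable_EFinP; exact: measurable_funTS mh.
  exists (c ^+ 2); split; first exact: num_real.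
  move=> M cM x _ /=; rewrite ger0_norm ?sqr_ge0// (le_trans _ (ltW cM))//.
  by rewrite ler_pXn2r ?nnegrE ?nrm_ge0// (le_trans (nrm_ge0 (f x)) (hc x)).
have Ia : (\int[mu]_(x in (F : set bX)) `|h x| = 0)%E.
  have E x : (`|h x| = h x)%E by rewrite /h gee0_abs// lee_fin sqr_ge0.
  under eq_integral do rewrite E.
  by rewrite -[LHS]fineK ?integrable_fin_num// -[fine _]/(\int[mu]_(x in (F : set bX)) (nrm (f x) ^+ 2)) I0.
have /ae_eq_integral_abs := Ia => /(_ mF (measurable_funTS mh)) hae.
pose A : set X := [set x | f x != 0].
have oA : open A.
  rewrite (_ : A = (fun x => nrm (f x)) @^-1` [set r | 0 < r]).
    apply: open_comp => [x _|]; first exact: nrm_continuous.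
    exact: open_gt.
  by apply/seteqP; split => x /=; rewrite nrm_gt0.
have mA : measurable (A : set bX).
  rewrite (_ : A = (fun x => nrm (f x)) @^-1` `]0, +oo[%classic).
    by rewrite -[X in measurable X]setTI; exact: mn.
  by apply/seteqP; split => x /=; rewrite in_itv /= andbT nrm_gt0.
have A0 : mu A = 0%E.
  apply: periodic_null => // [x l Ll|]; first by rewrite /A /= pf.
  apply: measure_negligible; first exact: measurableI.
  apply: negligibleS hae => x [Ax Fx] /= /(_ Fx) []/eqP.
  by rewrite sqrf_eq0 nrm_eq0 (negbTE Ax).
apply: contrapT => /existsNP[x0 /eqP x0A].
have := nbhs0_shift (open_nbhs_nbhs (conj oA (x0A : A x0))) => /nbhs_box.
move=> [V1 [V2 [ o1 o2 h1 h2 VA]]].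
have := box_gt0 o1 o2 h1 h2.
have mV : measurable (V1 `*` V2 : set bX) by apply: prod_box; exact: borel_open.
have : (mu (V1 `*` V2) <= mu A)%E.
  rewrite -(prod_invariant hm htheta (- x0) mV); apply: le_measure; rewrite ?inE//.
    by rewrite (@translate_preimage X); exact: prod_translate_measurable.
  by rewrite (@translate_preimage X) opprK => _ [y /VA Vy <-].
by rewrite A0 => hle; rewrite ltNge hle.
Qed.

(** [F] is partitioned into pieces, each inside a box around one of finitely many points; the
    weights are the measures of the pieces and do not depend on the function. *)
Lemma meanX_riemann U : nbhs (0 : X) U -> exists l : seq (C * X),
  forall f (e : R), mfunX f -> (forall x u, U u -> nrm (f (x + u) - f x) <= e) ->
  nrm (meanX f - \sum_(p <- l) p.1 * f p.2) <= e.
Proof.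
move=> nU; have [V1 [V2 [ o1 o2 h1 h2 VU]]] := nbhs_box nU.
pose B : set X := V1 `*` V2.
have mB : measurable (B : set bX) by apply: prod_box; exact: borel_open.
have nB : nbhs (0 : X) B by exists (V1, V2) => //; split; apply: open_nbhs_nbhs.
have [s _ hs] := compact_finite_cover (U := fun x y => B (y - x)) cK
  (fun x _ => nbhs0_unshift x nB).
suff [l hl] : exists l : seq (C * X), forall f (e : R), mfunX f ->
    (forall x u, U u -> nrm (f (x + u) - f x) <= e) ->
    nrm (cint mu F f - \sum_(p <- l) p.1 * f p.2) <= e * covol.
  exists [seq ((covol^-1)%:C * p.1, p.2) | p <- l] => f e Vf fU.
  rewrite big_map /= /meanX.
  have -> : \sum_(p <- l) (covol^-1)%:C * p.1 * f p.2 =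
      (covol^-1)%:C * \sum_(p <- l) p.1 * f p.2.
    by rewrite mulr_sumr; apply: eq_bigr => p _; rewrite mulrA.
  rewrite -mulrBr nrmM nrmR ger0_norm ?invr_ge0 ?(ltW covol_gt0)//.
  by rewrite ler_pdivrMl ?covol_gt0// mulrC hl.
have cov : forall y, F y -> exists2 x, x \in s & B (y - x) by move=> y /FK/hs.
suff gen (r : seq X) (A : set X) : (forall y, A y -> exists2 x, x \in r & B (y - x)) ->
    measurable (A : set bX) -> (mu A < +oo)%E -> (forall f, mfunX f -> cintble mu A f) ->
    exists l : seq (C * X), forall f (e : R), mfunX f ->
    (forall x u, U u -> nrm (f (x + u) - f x) <= e) ->
    nrm (cint mu A f - \sum_(p <- l) p.1 * f p.2) <= e * fine (mu A).
  by apply: (gen s F) => //; [exact: fd_lty|move=> f; exact: mfunX_cintble].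
elim: r A => [|x r IH] A covA mA Afin iA.
  exists [::] => f e _ _; rewrite big_nil subr0.
  rewrite (_ : A = set0); last by apply/seteqP; split => // y /covA[].
  by rewrite /cint !Rintegral_set0 measure0 mulr0 nrm0.
pose A1 := A `&` translate x B; pose A2 := A `\` translate x B.
have mtB := prod_translate_measurable x mB.
have mA1 : measurable (A1 : set bX) by exact: measurableI.
have mA2 : measurable (A2 : set bX) by exact: measurableD.
have A1fin : (mu A1 < +oo)%E.
  by apply: le_lt_trans Afin; apply: le_measure; rewrite ?inE//; move=> y [].
have A2fin : (mu A2 < +oo)%E.
  by apply: le_lt_trans Afin; apply: le_measure; rewrite ?inE//; move=> y [].
have A12 : A = A1 `|` A2.
  apply/seteqP; split => [y Ay|y [[]//|[]//]].
  by have [h|h] := pselect (translate x B y); [left|right].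
have dis : [disjoint A1 & A2].
  by apply/disj_setPS => y [[_ h1'] [_ h2']].
have [||l hl] := IH A2 _ mA2 A2fin.
- move=> y [/covA[z]]; rewrite inE => /orP[/eqP -> Bz []|zs Bz _]; last by exists z.
  by rewrite (@translateE X).
- by move=> f Vf; apply: cintbleS (iA f Vf) => // y [].
exists (((fine (mu A1))%:C, x) :: l) => f e Vf fU.
have fi := iA f Vf.
have fi1 : cintble mu A1 f by apply: cintbleS fi => // y [].
have fin1 : mu A1 \is a fin_num by rewrite ge0_fin_numE.
have fin2 : mu A2 \is a fin_num by rewrite ge0_fin_numE.
have EA : fine (mu A) = fine (mu A1) + fine (mu A2).
  rewrite -fineD// -measureU//; first by rewrite -A12.
  exact/disj_set2P.
rewrite EA {1}A12 cintU//; last by rewrite -A12.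
rewrite big_cons /= opprD addrACA mulrDr (le_trans (nrmD _ _))// lerD ?hl//.
have -> : cint mu A1 f - (fine (mu A1))%:C * f x = cint mu A1 (fun y => f y - f x).
  have ci : cintble mu A1 (fun=> f x).
    by apply: (cintble_fin mA1 A1fin) => //; exact: cmeas_cst.
  by rewrite cintB// cint_cst.
apply: nrm_cint_le => //.
  have [_ _ mf] := Vf; apply: cmeasB; last exact: cmeas_cst.
  exact: cmeasS mf.
move=> y [_]; rewrite (@translateE X) => By.
by have := fU x _ (VU _ By); rewrite addrCA subrr addr0.
Qed.

Definition lattice_system : mean_system R X :=
  @MeanSystem R X mfunX meanX (nbhs (0 : X)) mfunX_cst mfunX_lin mfunX_mul
    mfunX_conj mfunX_shift mfunX_opp mfunX_bnd mfunX_lim mfunX_unif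
    (fun U V => @filterI _ (nbhs (0 : X)) _ U V) meanX_cst meanX_lin meanX_conj
    meanX_le meanX_shift meanX_ge0 meanX_eq0 meanX_riemann.

End LatticeMean.

(** * Compactly supported functions and periodization *)

Section CompactSupport.
Context {R : realType} {H : topologicalZmodType}.
Hypothesis hH : lcag H.
Local Notation C := (R[i]^o).
Implicit Types f g : H -> C.

Lemma csP f : continuous_cs f <->
  continuous f /\ exists2 K : set H, compact K & forall x, ~ K x -> f x = 0.
Proof.
split=> [[cf cK]|[cf [K cK K0]]].
  split=> //; exists (closure [set x | f x != 0]) => // x nx.
  by apply: contrapT => /eqP h; apply: nx; exact: subset_closure.
split=> //; apply: (subclosed_compact _ cK); first exact: closed_closure.
rewrite [X in _ `<=` X](closure_id K).1; last exact: compact_is_closed.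
by apply: closure_subset => x /= h; apply: contrapT => /K0 e; rewrite e eqxx in h.
Qed.

Lemma cs_mulr f g : continuous_cs f -> continuous g -> continuous_cs (fun x => f x * g x).
Proof.
move=> /csP[cf [K cK K0]] cg; apply/csP; split.
  by move=> x; apply: cvgM; [exact: cf|exact: cg].
by exists K => // x /K0 ->; rewrite mul0r.
Qed.

Lemma cs_lin (a : C) f g : continuous_cs f -> continuous_cs g ->
  continuous_cs (fun x => a * f x + g x).
Proof.
move=> /csP[cf [K cK K0]] /csP[cg [L cL L0]]; apply/csP; split.
  move=> x; apply: cvgD; last exact: cg.
  by apply: cvgM; [exact: cvg_cst|exact: cf].
exists (K `|` L); first exact: compactU.
by move=> x nKL; rewrite K0 ?L0 ?mulr0 ?addr0// => h; apply: nKL; [right|left].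
Qed.

Lemma csB f g : continuous_cs f -> continuous_cs g -> continuous_cs (fun x => f x - g x).
Proof.
move=> hf hg; have := cs_lin (-1) hg hf.
by congr continuous_cs; apply/funext => x; rewrite mulN1r addrC.
Qed.

Lemma conj_cont f : continuous f -> continuous (fun x => (f x)^* : C).
Proof.
move=> cf x; apply: (@continuous_comp _ _ _ f (fun z : R[i]^o => z^* : R[i]^o)); first exact: cf.
exact: conj_continuous.
Qed.

Lemma cont_shift f t : continuous f -> continuous (fun x => f (x + t)).
Proof.
move=> cf x; apply: (@continuous_comp _ _ _ (fun x => x + t) f); last exact: cf.
exact: addr_cont.
Qed.

Lemma cs_shift f t : continuous_cs f -> continuous_cs (fun x => f (x + t)).
Proof.
move=> /csP[cf [K cK K0]]; apply/csP; split; first exact: cont_shift.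
exists (translate (- t) K); first exact: compact_translate.
by move=> x; rewrite translateE /= opprK => /K0.
Qed.

Lemma cs_bounded f : continuous_cs f -> exists2 c : R, 0 <= c & forall x, nrm (f x) <= c.
Proof.
move=> /csP[cf [K cK K0]]; have [c hc] := bounded_on_compact cK cf.
exists `|c| => // x; have [Kx|/K0 ->] := pselect (K x); last by rewrite nrm0.
by rewrite (le_trans (hc _ Kx))// ler_norm.
Qed.

Variable mu : {measure set (borel H) -> \bar R}.
Hypothesis hmu : haar mu.

Lemma cs_cintble f : continuous_cs f -> cintble mu setT f.
Proof.
move=> hf; have [c c0 hc] := cs_bounded hf; have /csP[cf [K cK K0]] := hf.
apply: (cintble_bounded measurableT (borel_compact hH cK) (haar_lty hmu cK) (c := c)) => //.
  exact: cmeas_continuous.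
by move=> x _ /K0.
Qed.

Lemma haar_cint_shift f t : cintble mu setT f ->
  cintble mu setT (fun x : H => f (x + t)) /\
  cint mu setT (fun x : H => f (x + t)) = cint mu setT f.
Proof.
move=> fi; have := cint_comp (borel_map (@addr_cont H t)) _ fi; apply.
by move=> A mA; exact: haar_preimage.
Qed.

End CompactSupport.

Section Periodization.
Context {R : realType} {G Gint : topologicalZmodType}.
Variables (m : {sigma_finite_measure set (borel G) -> \bar R})
  (theta : {sigma_finite_measure set (borel Gint) -> \bar R})
  (Lt : zmodClosed (G * Gint)%type).
Hypotheses (hLt : cut_project_scheme Lt) (hm : haar m) (htheta : haar theta).
Local Notation C := (R[i]^o).
Local Notation X := (prodG G Gint).
Local Notation bX := (borel G * borel Gint)%type.
Local Notation mu := (m \x theta)%E.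
Local Notation Lam := (Lam Lt : set X).
Let hG := cps_lcag1 hLt.
Let hGint := cps_lcag2 hLt.
Let hX : lcag X := prod_lcag hG hGint.

Definition nice (f : X -> C) := [/\ continuous f, cmeas setT (f : bX -> C) &
  exists2 K : set X, compact K & forall x, ~ K x -> f x = 0].

Definition tens (h : G -> C) (k : Gint -> C) : X -> C := fun x => h x.1 * k x.2.

Lemma cmeas_tens (h : borel G -> C) (k : borel Gint -> C) : cmeas setT h -> cmeas setT k ->
  cmeas setT ((fun x => h x.1 * k x.2) : bX -> C).
Proof.
move=> [h1 h2] [k1 k2]; apply: cmeasM; split.
- exact: (measurableT_comp h1 measurable_fst).
- exact: (measurableT_comp h2 measurable_fst).
- exact: (measurableT_comp k1 measurable_snd).
- exact: (measurableT_comp k2 measurable_snd).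
Qed.

Lemma cont_tens h k : continuous h -> continuous k -> continuous (tens h k).
Proof.
move=> ch ck x; apply: cvgM.
  by apply: (@continuous_comp _ _ _ (fst : X -> G) h); [exact: cvg_fst|exact: ch].
by apply: (@continuous_comp _ _ _ (snd : X -> Gint) k); [exact: cvg_snd|exact: ck].
Qed.

Lemma nice_tens h k : continuous_cs h -> continuous_cs k -> nice (tens h k).
Proof.
move=> /(csP hG)[ch [K cK K0]] /(csP hGint)[ck [L cL L0]]; split.
- exact: cont_tens.
- by apply: cmeas_tens; exact: cmeas_continuous.
- exists (K `*` L : set X); first exact: compact_setX.
  move=> [x y] nKL; rewrite /tens /=.
  have [Kx|/K0 ->] := pselect (K x); last by rewrite mul0r.
  have [Ly|/L0 ->] := pselect (L y); last by rewrite mulr0.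
  by case: nKL.
Qed.

Lemma nice_bounded f : nice f -> exists c : R, forall x, nrm (f x) <= c.
Proof.
move=> [cf _ [K cK K0]]; have [c hc] := bounded_on_compact cK cf.
exists `|c| => x; have [Kx|/K0 ->] := pselect (K x); last by rewrite nrm0.
by rewrite (le_trans (hc _ Kx))// ler_norm.
Qed.

Lemma nice_cintble f : nice f -> cintble mu setT f.
Proof.
move=> nf; have [c hc] := nice_bounded nf; have [_ mf [K cK K0]] := nf.
have [K1 [K2 [cK1 cK2 KK]]] := compact_in_box cK.
apply: (cintble_bounded measurableT _ (prod_lty hG hGint hm htheta cK1 cK2) (c := c)) => //.
  by apply: prod_box; exact: borel_compact.
by move=> x _ nx; apply: K0 => /KK.
Qed.

Definition per (f : X -> C) (x : X) : C := \sum_(l \in Lam) f (x + l).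

(** For [x] in [Q] only lattice points in the difference of the support and [Q] contribute, and
    these are finitely many. *)
Lemma per_seq f (Q : set X) : nice f -> compact Q -> exists s : seq X,
  [/\ uniq s, forall l, l \in s -> Lam l,
      forall x, Q x -> per f x = \sum_(l <- s) f (x + l) &
      forall x l, Q x -> Lam l -> f (x + l) <> 0 -> l \in s].
Proof.
move=> [cf _ [K cK K0]] cQ.
have [s us hs] := latt_seq hLt (compact_diff cK cQ).
have in_s x l : Q x -> Lam l -> f (x + l) <> 0 -> l \in s.
  move=> Qx Ll fxl; apply/hs; split => //.
  have Kxl : K (x + l) by apply: contrapT => /K0.
  by exists (x + l) => //; exists x => //; rewrite addrAC subrr add0r.
exists s; split => // [l /hs[]//|x Qx].
rewrite /per (fsbig_seq _ _ us) /=; apply/esym/fsbig_widen => l.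
  by move=> /hs[].
move=> [Ll ns] /=; apply: contrapT => h; apply: ns; exact: (in_s x).
Qed.

Lemma mfunX_per f : nice f -> mfunX Lt (per f).
Proof.
move=> nf; have [cf [mf1 mf2] _] := nf; split.
- move=> x; have [N nN [cN _]] := lc_nbhs hX.
  have [s [us sL Es _]] := per_seq nf (@compact_translate X x N cN).
  have cs : continuous (fun y => \sum_(l <- s) f (y + l)).
    elim: s {us sL Es} => [|l s IH].
      by under eq_fun do rewrite big_nil; move=> y; exact: cvg_cst.
    under eq_fun do rewrite big_cons; move=> y; apply: cvgD; last exact: IH.
    exact: (@cont_shift R X f l cf).
  apply/continuous_nrm => e e0; have := (continuous_nrm _ x).1 (cs x) _ e0.
  have nxN : nbhs x (translate x N) by rewrite (@translateE X); exact: nbhs0_unshift.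
  have xN := nbhs_singleton nxN.
  by apply: filterS2 nxN => y yN; rewrite Es// Es.
- move=> x l' Ll'; rewrite /per.
  rewrite [RHS](@reindex_fsbig _ _ _ _ _ (fun l : X => l' + l) Lam Lam).
    by apply: eq_fsbigr => l _; rewrite addrA.
  split => [l Ll|l t _ _ /addrI//|l Ll]; first exact: LamD.
  exists (l - l'); first exact: LamB.
  by rewrite addrCA subrr addr0.
- have [_ _ [K cK KT]] := hX.
  have hn n := per_seq nf (cK n).
  have box n : {KK : set X | measurable (KK : set bX) /\ K n `<=` KK &
      cmeas (KK : set bX) (per f)}.
    apply/cid2; have [K1 [K2 [cK1 cK2 KK]]] := compact_in_box (cK n).
    have mKK : measurable (K1 `*` K2 : set bX) by apply: prod_box; exact: borel_compact.
    exists (K1 `*` K2) => //.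
    have [s [_ _ Es _]] := per_seq nf (compact_setX cK1 cK2 : compact (K1 `*` K2 : set X)).
    have [i1 i2] : cmeas (K1 `*` K2 : set bX) (fun x => \sum_(l <- s) f ((x : X) + l)).
      apply: cmeas_sum => l; apply: cmeasS (cmeas_shift l (conj mf1 mf2)) => //.
    split; first by apply: (eq_measurable_fun _ _ i1) => x; rewrite inE => /Es ->.
    by apply: (eq_measurable_fun _ _ i2) => x; rewrite inE => /Es ->.
  have UT : \bigcup_n (s2val (box n)) = setT.
    apply/seteqP; split => // x _; have [n _ Kx] : (\bigcup_n K n) x by rewrite KT.
    by exists n => //; apply: (s2valP (box n)).2.
  split; rewrite -UT; apply/measurable_fun_bigcup => n.
  + exact: (s2valP (box n)).1.
  + exact: (s2valP' (box n)).1.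
  + exact: (s2valP (box n)).1.
  + exact: (s2valP' (box n)).2.
Qed.

Variables (F K : set X).
Hypotheses (hF : fundamental_domain Lt F) (cK : compact K) (FK : F `<=` K).

(** Weil's formula: summing over the lattice and integrating over [F] amounts to integrating over
    the whole group. *)
Lemma unfold f u : nice f -> mfunX Lt u ->
  meanX m theta F (fun x => per f x * u x) =
  ((covol m theta F)^-1)%:C * cint mu setT (fun x => f x * u x).
Proof.
move=> nf Vu; rewrite /meanX; congr (_ * _).
have mF : measurable (F : set bX) := fd_measurable hF.
have [c hc] := mfunX_bnd hF cK FK Vu; have [cu pu mu_] := Vu.
have [s [us sL Es in_s]] := per_seq nf cK.
pose g x : C := f x * u x.
have gi : cintble mu setT g.
  by apply: (cintbleM (c := c)) => //; exact: nice_cintble.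
pose F1 (x : X) : C := (\1_F x)%:C.
have mF1 : cmeas setT (F1 : bX -> C).
  by apply: cmeas_real; exact: measurable_indic.
have F1b x : nrm (F1 x) <= 1.
  by rewrite nrmR indicE; case: (x \in F); rewrite ?normr1 ?normr0.
have F1in x : F x -> F1 x = 1 by move=> Fx; rewrite /F1 indicE mem_set.
have F1out x : ~ F x -> F1 x = 0 by move=> Fx; rewrite /F1 indicE memNset.
have gsi (l : X) : cintble mu setT (fun x : X => g (x + l)) by have [] := prod_cint_shift hm htheta l gi.
have gli l : cintble mu setT (fun x : X => g (x + l) * F1 x).
  by apply: (cintbleM (c := 1)).
have gmi l : cintble mu setT (fun x : X => g x * F1 (x - l)).
  apply: (cintbleM (c := 1)) => //; exact: (cmeas_shift (- l) mF1).
transitivity (cint mu F (fun x => \sum_(l <- s) (g (x + l) * F1 x))).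
  apply: cint_eq => x Fx; rewrite Es; last exact: FK.
  rewrite mulr_suml; apply: eq_big_seq => l ls.
  by rewrite F1in// mulr1 /g pu//; exact: sL.
rewrite -(cint_widen _ mF); last first.
  by move=> x nF; apply: big1 => l _; rewrite F1out// mulr0.
rewrite cint_sum//.
transitivity (\sum_(l <- s) cint mu setT (fun x : X => g x * F1 (x - l))).
  apply: eq_bigr => l _; rewrite -[RHS](prod_cint_shift hm htheta l (gmi l)).2.
  by apply: cint_eq => x _; rewrite addrK.
rewrite -cint_sum//; apply: cint_eq => x _; rewrite -mulr_sumr -/(g x).
have [g0|g0] := eqVneq (g x) 0; first by rewrite g0 mul0r.
(* Exactly one lattice translate of [x] lies in [F], and its index is in [s] because [f x] is
   nonzero: the indicators sum to 1. *)
have [y Fy Ly] := fd_ex x hF.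
have xy : x - y \in s.
  apply: (in_s y) => //; first exact: FK.
  rewrite addrCA subrr addr0 => fx0; move: g0; rewrite /g fx0 mul0r eqxx//.
rewrite (bigD1_seq _ xy us) /= subKr F1in// big1_seq ?addr0 ?mulr1//.
move=> l /andP[nl ls]; apply: F1out => Fl; move/eqP: nl; apply.
have yl : y = x - l.
  apply: (fd_uniq hF) => //; rewrite opprB addrC.
  have := LamB (sL _ ls) Ly; congr (Lam _).
  by rewrite opprB -addrA [- x + _]addrC.
by rewrite yl subKr.
Qed.

Lemma cint_tens (h : G -> C) (k : Gint -> C) : continuous_cs h -> continuous_cs k ->
  cint mu setT (tens h k) = cint m setT h * cint theta setT k.
Proof.
move=> hh hk; have ni := nice_cintble (nice_tens hh hk).
have hi := cs_cintble hG hm hh; have ki := cs_cintble hGint htheta hk.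
have aux (p : X -> R) (q : G -> R) :
    (mu.-integrable (setT : set bX) (EFin \o p)) ->
    (forall x, (\int[theta]_(y in setT) (p (x, y))%:E = (q x)%:E)%E) ->
    \int[mu]_(x in (setT : set bX)) p x = \int[m]_(x in setT) q x.
  move=> ip pq; rewrite /Rintegral -(integral12_prod_meas1 ip); congr fine.
  by apply: eq_integral => x _; exact: pq.
have sec x : cintble theta setT (fun y => tens h k (x, y)).
  by have := cintbleZ (h x) measurableT ki.
have Esec x : cint theta setT (fun y => tens h k (x, y)) = h x * cint theta setT k.
  by rewrite -cintZ.
have Efin (p : Gint -> R) : theta.-integrable setT (EFin \o p) ->
    (\int[theta]_(y in setT) (p y)%:E = (\int[theta]_(y in setT) p y)%:E)%E.
  by move=> ip; rewrite /Rintegral fineK//; exact: integrable_fin_num.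
have -> : cint m setT h * cint theta setT k = cint m setT (fun x => cint theta setT k * h x).
  by rewrite cintZ// mulrC.
rewrite /cint; congr (_ +i* _); apply: aux.
- exact: ni.1.
- move=> x; rewrite Efin; last exact: (sec x).1.
  by have := congr1 (@complex.Re R) (Esec x); rewrite mulrC /= => ->.
- exact: ni.2.
- move=> x; rewrite Efin; last exact: (sec x).2.
  by have := congr1 (@complex.Im R) (Esec x); rewrite mulrC /= => ->.
Qed.

End Periodization.

(** * Averages along van Hove sequences *)

Section VanHove.
Context {R : realType} {G : topologicalZmodType}.
Variables (m : {measure set (borel G) -> \bar R}) (D : nat -> set G).
Hypotheses (hG : lcag G) (hm : haar m) (hD : van_hove m D).
Local Notation C := (R[i]^o).

Definition vol n : R := fine (m (D n)).

Lemma vh_compact n : compact (D n). Proof. by have [_ h _ _] := hD. Qed.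

Lemma vh_measurable n : measurable (D n : set (borel G)).
Proof. by apply: borel_compact => //; exact: vh_compact. Qed.

Lemma vh_lty n : (m (D n) < +oo)%E.
Proof. by apply: haar_lty => //; exact: vh_compact. Qed.

Lemma vol_gt0 n : 0 < vol n.
Proof.
have [_ cD pD _] := hD.
by rewrite fine_gt0// pD (haar_lty hm (cD n)).
Qed.

Lemma bd_measurable K n : compact K -> measurable (vh_boundary K (D n) : set (borel G)).
Proof.
move=> cK; apply: measurableU.
  apply: measurableD; first by apply: borel_compact => //; apply: compact_add => //; exact: vh_compact.
  by apply: borel_open; exact: open_interior.
apply: measurableI; last exact: vh_measurable.
by apply: borel_closed; apply: closed_sub => //; exact: closed_closure.
Qed.

Lemma bd_fin K n : compact K -> m (vh_boundary K (D n)) \is a fin_num.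
Proof.
move=> cK; rewrite ge0_fin_numE//.
have cDK : compact ([set a + k | a in D n & k in K] `|` D n).
  by apply: compactU; [apply: compact_add => //|]; exact: vh_compact.
apply: le_lt_trans (haar_lty hm cDK); apply: measure_mono.
- exact: bd_measurable.
- exact: borel_compact.
- by move=> x [[h _]|[_ h]]; [left|right].
Qed.

Lemma vh_eps K (e : R) : compact K -> 0 < e -> exists N, forall n, (N <= n)%N ->
  fine (m (vh_boundary K (D n))) <= e * vol n.
Proof.
move=> cK e0; have [_ _ _ /(_ _ cK) h] := hD.
have h2 : (fun n => fine (m (vh_boundary K (D n)) * ((fine (m (D n)))^-1)%:E)%E) @ \oo -->
  (0 : R) := fine_cvg h.
pose F n := fine (m (vh_boundary K (D n)) * ((fine (m (D n)))^-1)%:E)%E.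
have {}h2 : F @ \oo --> (0 : R) by exact: h2.
have [N _ hN] : \forall n \near \oo, `|0 - F n| < e by exact: (cvgr_dist_lt F 0 h2).
exists N => n /hN /=; rewrite sub0r normrN /F -(fineK (bd_fin n cK)) -EFinM /=.
move=> /(le_lt_trans (ler_norm _)); rewrite -/(vol n) ltr_pdivrMr ?vol_gt0//.
exact: ltW.
Qed.

Definition avg n (f : G -> C) : C := ((vol n)^-1)%:C * cint m (D n) f.

Lemma vol_inv n (z : C) : nrm (((vol n)^-1)%:C * z) = nrm z / vol n.
Proof. by rewrite nrmM nrmR ger0_norm ?invr_ge0 ?(ltW (vol_gt0 n))// mulrC. Qed.

Lemma bounded_cintble (A : set G) f (c : R) : measurable (A : set (borel G)) -> (m A < +oo)%E ->
  continuous f -> (forall x, nrm (f x) <= c) -> cintble m A f.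
Proof.
move=> mA Afin cf fc; apply: (cintble_fin mA Afin (c := c)) => //.
exact: cmeasS (cmeas_continuous cf).
Qed.

Lemma avg_le n f (c : R) : continuous f -> (forall x, nrm (f x) <= c) -> nrm (avg n f) <= c.
Proof.
move=> cf fc; rewrite /avg vol_inv ler_pdivrMr ?vol_gt0//.
apply: nrm_cint_le => //; first exact: vh_measurable.
  by apply: haar_lty => //; exact: vh_compact.
apply: cmeasS (cmeas_continuous cf) => //; exact: measurableT.
Qed.

Lemma cint_layer (A : set G) (w : borel G -> C) (c : R) : measurable (A : set (borel G)) ->
  (m A < +oo)%E -> cmeas setT w -> (forall x, nrm (w x) <= c) ->
  (forall x, ~ A x -> w x = 0) -> nrm (cint m setT w) <= c * fine (m A).
Proof.
move=> mA Afin mw wc w0; rewrite (cint_widen m mA w0).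
apply: nrm_cint_le => //; exact: cmeasS mw.
Qed.

Definition ind (A : set G) (x : G) : C := (\1_A x)%:C.

Lemma ind_in A x : A x -> ind A x = 1.
Proof. by move=> Ax; rewrite /ind indicE mem_set. Qed.

Lemma ind_out A x : ~ A x -> ind A x = 0.
Proof. by move=> Ax; rewrite /ind indicE memNset. Qed.

Lemma ind_nrm A x : nrm (ind A x) <= 1.
Proof.
have [h|h] := pselect (A x); first by rewrite ind_in// nrm1.
by rewrite ind_out// nrm0 ler01.
Qed.

Lemma cmeas_ind (A : set G) : measurable (A : set (borel G)) -> cmeas setT (ind A : borel G -> C).
Proof. by move=> mA; apply: cmeas_real; exact: measurable_indic. Qed.

Lemma borel_cmeas_shift (f : G -> C) t : cmeas setT (f : borel G -> C) ->
  cmeas setT ((fun x : G => f (x + t)) : borel G -> C).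
Proof.
move=> [f1 f2]; split; first exact: (measurableT_comp f1 (borel_map (@addr_cont G t))).
exact: (measurableT_comp f2 (borel_map (@addr_cont G t))).
Qed.

Lemma cint_ind (A : set G) f : measurable (A : set (borel G)) ->
  cint m A f = cint m setT (fun x => ind A x * f x).
Proof.
move=> mA; rewrite (@cint_widen _ _ _ m A)//; last by move=> x /ind_out ->; rewrite mul0r.
by apply: cint_eq => x Ax; rewrite ind_in// mul1r.
Qed.

(** The two parts of [vh_boundary] account for entering and for leaving [D n] under the shift; the
    second one needs [- t]. *)
Lemma vh_layer n t x : ind (D n) (x - t) - ind (D n) x <> 0 ->
  vh_boundary [set t; - t] (D n) x.
Proof.
have [h1|h1] := pselect (D n (x - t)); have [h2|h2] := pselect (D n x);
  rewrite ?(ind_in h1) ?(ind_out h1) ?(ind_in h2) ?(ind_out h2) ?subrr// => _.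
  left; split; last by move=> /interior_subset.
  by exists (x - t) => //; exists t; [left|rewrite subrK].
right; split=> //; exists (x - t); first exact: subset_closure.
by exists (- t); [right|rewrite opprK subrK].
Qed.

(** Shifting [f] amounts to shifting [D n], and the two sets differ only inside the boundary for the
    finite set of [t] and [- t]. *)
Lemma avg_shift f t (c : R) : continuous f -> (forall x, nrm (f x) <= c) ->
  forall e : R, 0 < e -> exists N, forall n, (N <= n)%N ->
  nrm (avg n (fun x => f (x + t)) - avg n f) <= e.
Proof.
move=> cf fc e e0; have c0 : 0 <= c by rewrite (le_trans (nrm_ge0 (f 0))).
have c1 : 0 < c + 1 by rewrite ltr_wpDl.
have cK : compact [set t; - t].
  by apply: compactU; exact: compact_set1.
have [N hN] := vh_eps cK (divr_gt0 e0 c1); exists N => n Nn.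
rewrite /avg -mulrBr vol_inv ler_pdivrMr ?vol_gt0//.
have mD := vh_measurable n; have Dfin := vh_lty n.
have mf := cmeas_continuous cf.
have fi : cintble m setT (fun x : G => ind (D n) x * f x).
  apply: (cintble_bounded measurableT mD Dfin (c := c)).
  - by apply: cmeasM => //; exact: cmeas_ind.
  - by move=> x _; rewrite nrmM -[leRHS]mul1r ler_pM ?nrm_ge0 ?ind_nrm.
  - by move=> x _ /ind_out ->; rewrite mul0r.
have gi : cintble m setT (fun x : G => ind (D n) (x - t) * f x).
  have gi0 : cintble m setT (fun x : G => ind (D n) x * f (x + t)).
    apply: (cintble_bounded measurableT mD Dfin (c := c)).
    - by apply: cmeasM; [exact: cmeas_ind|exact: borel_cmeas_shift].
    - by move=> x _; rewrite nrmM -[leRHS]mul1r ler_pM ?nrm_ge0 ?ind_nrm.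
    - by move=> x _ /ind_out ->; rewrite mul0r.
  have [+ _] := haar_cint_shift hm (- t) gi0.
  by congr cintble; apply/funext => x; rewrite subrK.
rewrite (cint_ind (fun x => f (x + t)) mD) (cint_ind f mD).
have -> : cint m setT (fun x : G => ind (D n) x * f (x + t)) =
          cint m setT (fun x : G => ind (D n) (x - t) * f x).
  rewrite -(haar_cint_shift hm t gi).2; apply: cint_eq => x _.
  by rewrite addrK.
rewrite -cintB//.
apply: (@le_trans _ _ (c * fine (m (vh_boundary [set t; - t] (D n))))).
  apply: cint_layer.
  - exact: bd_measurable.
  - by rewrite -ge0_fin_numE// bd_fin.
  - apply: cmeasB; first exact: (cintble_cmeas gi).
    exact: (cintble_cmeas fi).
  - move=> x; rewrite -mulrBl nrmM -[leRHS]mul1r ler_pM ?nrm_ge0//.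
    have [h1|h1] := pselect (D n (x - t)); have [h2|h2] := pselect (D n x);
    rewrite ?(ind_in h1) ?(ind_out h1) ?(ind_in h2) ?(ind_out h2) ?subrr ?subr0 ?sub0r ?nrmN ?nrm0 ?nrm1//.
  - move=> x nx; rewrite -mulrBl; apply/eqP; rewrite mulf_eq0; apply/orP; left.
    by apply/eqP; apply: contrapT => /vh_layer.
rewrite (le_trans (ler_wpM2l c0 (hN _ Nn)))//.
rewrite mulrA ler_pM2r ?vol_gt0// mulrCA ger_pMr// ler_pdivrMr// mul1r lerDl//.
Qed.

End VanHove.

(** * Equidistribution of lattice-periodic functions *)

Section Equidistribution.
Context {R : realType} {G Gint : topologicalZmodType}.
Variables (m : {sigma_finite_measure set (borel G) -> \bar R})
  (theta : {sigma_finite_measure set (borel Gint) -> \bar R})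
  (Lt : zmodClosed (G * Gint)%type) (D : nat -> set G).
Hypotheses (hLt : cut_project_scheme Lt) (hm : haar m) (htheta : haar theta)
  (hD : van_hove m D).
Local Notation C := (R[i]^o).
Local Notation X := (prodG G Gint).
Local Notation bX := (borel G * borel Gint)%type.
Local Notation mu := (m \x theta)%E.
Local Notation Lam := (Lam Lt : set X).
Let hG := cps_lcag1 hLt.
Let hGint := cps_lcag2 hLt.
Let hX : lcag X := prod_lcag hG hGint.
Variables (F K : set X).
Hypotheses (hF : fundamental_domain Lt F) (cK : compact K) (FK : F `<=` K).
Local Notation M := (meanX m theta F).

Lemma cont_slice (u : X -> C) (t : X) : continuous u -> continuous (fun x : G => u (t + (x, 0))).
Proof.
move=> cu x; apply: (@continuous_comp _ _ _ (fun x : G => t + ((x, 0) : X)) u); last exact: cu.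
apply: (@continuous_comp _ _ _ (fun x : G => (x, 0) : X) (fun y : X => t + y)).
  by apply: cvg_pair; [exact: cvg_id|exact: cvg_cst].
rewrite (_ : (fun y : X => t + y) = fun y => y + t); first exact: (@addr_cont X).
by apply/funext => y; rewrite addrC.
Qed.

(* Points of [X] are moved into [G x 0] modulo the lattice by density of the
   internal projection. *)
Lemma mean_orbit u (e : R) : mfunX Lt u -> 0 < e -> exists l : seq (C * G),
  \sum_(p <- l) p.1 = 1 /\
  forall t : X, nrm (M u - \sum_(p <- l) p.1 * u (t + (p.2, 0))) <= e.
Proof.
move=> Vu e0; have e20 : 0 < e / 2 by rewrite divr_gt0.
have [U nU hU] := mfunX_unif hF cK FK Vu e20.
have [l hl] := meanX_riemann hLt hm htheta hF cK FK nU.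
(* The constant function 1 has modulus 0, so the Riemann sum is exact for it. *)
have sl : \sum_(p <- l) p.1 = 1.
  have h0 (x u0 : X) : U u0 -> nrm (1 - 1 : C) <= 0 by rewrite subrr nrm0.
  have := hl (fun=> 1) 0 (mfunX_cst Lt 1) h0.
  rewrite (meanX_cst hLt hm htheta hF cK FK) => h.
  apply/esym/nrm_le_eq => d d0; apply: le_trans (ltW d0).
  by move: h; under eq_bigr do rewrite mulr1.
pose W := \sum_(p <- l) nrm p.1.
have W0 : 0 <= W by apply: sumr_ge0 => p _; exact: nrm_ge0.
have W1 : 0 < W + 1 by rewrite ltr_wpDl.
have [V nV hV] := mfunX_unif hF cK FK Vu (divr_gt0 e20 W1).
have [V1 [V2 [ o1 o2 h1 h2 VV]]] := nbhs_box nV.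
have [_ _ _ _ dL] := hLt.
(* Density gives a lattice point [p] with second coordinate [s.2 + v], where [v] is small; adding
   [p] to [t + (s.1 - p.1, 0)] yields [s + t + (0, v)]. *)
have key (s : X) : exists g : G, forall t, nrm (u (t + (g, 0)) - u (s + t)) <= e / 2 / (W + 1).
  have [|z [[v V2v vz] [p Lp pz]]] := dL (translate s.2 V2) _ (open_translate s.2 o2).
    by exists s.2; exists 0 => //; rewrite addr0.
  exists (s.1 - p.1) => t.
  have Lp' : Lam (- (p : X)) by apply: LamN.
  have [_ pu _] := Vu.
  have -> : t + ((s.1 - p.1, 0) : X) = s + t + ((0, v) : X) + - (p : X).
    case: s vz => s1 s2 /= vz; case: p Lp pz Lp' => p1 p2 /= _ pz _; case: t => t1 t2.
    apply/eqP; rewrite xpair_eqE /=; apply/andP; split; apply/eqP => /=.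
      by rewrite /= addr0 addrA [t1 + s1]addrC.
    by rewrite addr0 pz -vz /= opprD addrACA subrr addr0 addrAC subrr add0r.
  by rewrite pu//; apply: hV; apply: VV.
have /choice[gg hgg] := key.
exists [seq (p.1, gg p.2) | p <- l]; rewrite big_map /=; split => // t.
rewrite (le_trans (nrm_split (\sum_(p <- l) p.1 * u (p.2 + t)) _ _))// [leRHS]splitr lerD//.
  rewrite -(meanX_shift hLt hm htheta hF cK FK t Vu).
  apply: (hl (fun x => u (x + t))); first exact: mfunX_shift.
  by move=> x u0 Uu0; rewrite addrAC; exact: hU.
rewrite big_map -sumrB (le_trans (nrm_sum _ _ _))//.
apply: (@le_trans _ _ (\sum_(p <- l) nrm p.1 * (e / 2 / (W + 1)))).
  apply: ler_sum => p _; rewrite -mulrBr nrmM ler_wpM2l ?nrm_ge0// nrm_sym.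
  exact: hgg.
rewrite -mulr_suml -/W mulrCA ger_pMr// ler_pdivrMr// mul1r lerDl//.
Qed.

(** By [mean_orbit] a weighted combination of physical shifts of [u] is nearly the constant [M u],
    and by [avg_shift] these shifts do not affect averages in the limit; the weights sum to 1. *)
Lemma equidistribution u (e : R) : mfunX Lt u -> 0 < e -> exists N, forall n, (N <= n)%N ->
  nrm (avg m D n (fun x => u (x, 0)) - M u) <= e.
Proof.
move=> Vu e0; have e20 : 0 < e / 2 by rewrite divr_gt0.
have [l [sl hl]] := mean_orbit Vu e20.
have [c hc] := mfunX_bnd hF cK FK Vu; have [cu pu _] := Vu.
pose v x := u (x, 0).
have cv : continuous v.
  have -> : v = fun x : G => u (0 + (x, 0)) by apply/funext => x; rewrite add0r.
  exact: cont_slice.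
pose W := \sum_(p <- l) nrm p.1.
have W0 : 0 <= W by apply: sumr_ge0 => p _; exact: nrm_ge0.
have W1 : 0 < W + 1 by rewrite ltr_wpDl.
have d0 : 0 < e / 2 / (W + 1) by rewrite divr_gt0.
have [N hN] : exists N, forall n, (N <= n)%N -> forall p, p \in l ->
    nrm (avg m D n (fun x => v (x + p.2)) - avg m D n v) <= e / 2 / (W + 1).
  move: d0; move: (e / 2 / (W + 1)) => d d0.
  elim: l {sl hl W W0 W1} => [|p l [N IH]]; first by exists 0%N.
  have [N' hN'] := avg_shift hG hm hD p.2 cv (fun x => hc (x, 0)) d0.
  exists (maxn N N') => n; rewrite geq_max => /andP[Nn N'n] q.
  by rewrite inE => /orP[/eqP ->|ql]; [exact: hN'|exact: IH].
exists N => n Nn.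
have mD := vh_measurable hG hD n; have Dfin := vh_lty hm hD n.
have bi f : continuous f -> (forall x, nrm (f x) <= c) -> cintble m (D n) f.
  by move=> cf fc; apply: (bounded_cintble mD Dfin cf fc).
have vg g : continuous (fun x => v (x + g)) by exact: cont_shift.
have ivg g : cintble m (D n) (fun x : G => v (x + g)).
  exact: (bi _ (vg g) (fun x => hc (x + g, 0))).
have iwg (w : C) g : cintble m (D n) (fun x : G => w * v (x + g)) by apply: cintbleZ.
have iS : cintble m (D n) (fun x : G => \sum_(p <- l) p.1 * v (x + p.2)).
  by apply: cintble_sum => // p.
have ic : cintble m (D n) (fun _ : G => M u).
  by apply: (cintble_fin mD Dfin (c := nrm (M u))) => //; exact: cmeas_cst.
have E1 : avg m D n (fun x => M u - \sum_(p <- l) p.1 * v (x + p.2)) =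
    M u - \sum_(p <- l) p.1 * avg m D n (fun x => v (x + p.2)).
  rewrite /avg cintB// cint_cst// cint_sum//.
  rewrite mulrBr mulrA -rmorphM /= mulVf ?mul1r; last by rewrite gt_eqF// (vol_gt0 hm hD).
  congr (_ - _); rewrite mulr_sumr; apply: eq_bigr => p _.
  by rewrite cintZ// mulrCA.
have -> : avg m D n v - M u =
    \sum_(p <- l) p.1 * (avg m D n v - avg m D n (fun x => v (x + p.2))) -
    avg m D n (fun x => M u - \sum_(p <- l) p.1 * v (x + p.2)).
  rewrite E1; under [X in _ = X - _]eq_bigr do rewrite mulrBr.
  by rewrite sumrB -mulr_suml sl mul1r opprB addrA subrK.
rewrite (le_trans (nrmB _ _))// [leRHS]splitr lerD//.
  rewrite (le_trans (nrm_sum _ _ _))//.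
  apply: (@le_trans _ _ (\sum_(p <- l) nrm p.1 * (e / 2 / (W + 1)))).
    rewrite big_seq [leRHS]big_seq; apply: ler_sum => p pl.
    by rewrite nrmM ler_wpM2l ?nrm_ge0// nrm_sym hN.
  by rewrite -mulr_suml -/W mulrCA ger_pMr// ler_pdivrMr// mul1r lerDl.
apply: (avg_le hG hm hD) => [|x]; last first.
  have := hl (x, 0); congr (nrm (_ - _) <= _); apply: eq_bigr => p _.
  by congr (_ * u _); apply/eqP; rewrite xpair_eqE /= addr0 !eqxx.
have cS : continuous (fun x => \sum_(p <- l) p.1 * v (x + p.2)).
  move: (l) => l0; elim: l0 => [|p l0 IH].
    by under eq_fun do rewrite big_nil; move=> x; exact: cvg_cst.
  under eq_fun do rewrite big_cons.
  by move=> x; apply: cvgD; [apply: cvgM; [exact: cvg_cst|exact: vg]|exact: IH].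
by move=> x; apply: cvgB; [exact: cvg_cst|exact: cS].
Qed.

End Equidistribution.

(** * Weighted counting of lattice points *)

Lemma sum_supp_eq (V : nmodType) (T : eqType) (s s' : seq T) (a : T -> V) :
  uniq s -> uniq s' -> (forall l, a l != 0 -> (l \in s) = (l \in s')) ->
  \sum_(l <- s) a l = \sum_(l <- s') a l.
Proof.
move=> us us' h.
have aux (r : seq T) : \sum_(l <- r) a l = \sum_(l <- [seq l <- r | a l != 0]) a l.
  rewrite big_filter [LHS](bigID (fun l => a l != 0))/= [X in _ + X]big1 ?addr0//.
  by move=> l; rewrite negbK => /eqP.
rewrite aux [RHS]aux; apply: perm_big; apply: uniq_perm; rewrite ?filter_uniq// => l.
by rewrite !mem_filter; case: (boolP (a l != 0)) => //= /h.
Qed.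

Lemma sum_supp_le (R : numDomainType) (T : eqType) (s s' : seq T) (a : T -> R) :
  uniq s -> uniq s' -> (forall l, 0 <= a l) -> (forall l, l \in s -> a l != 0 -> l \in s') ->
  \sum_(l <- s) a l <= \sum_(l <- s') a l.
Proof.
move=> us us' a0 h; rewrite [leRHS](bigID (mem s))/= -[leLHS]addr0 lerD ?sumr_ge0//.
rewrite -[leRHS]big_filter le_eqVlt; apply/orP; left; apply/eqP; apply: sum_supp_eq => //.
  by rewrite filter_uniq.
move=> l al; rewrite mem_filter; apply/idP/andP => [ls|[]//]; split => //; exact: h.
Qed.

Lemma fsum_seq (V : zmodType) (T : choiceType) (Q : set T) (s : seq T) (a : T -> V) :
  uniq s -> (forall l, l \in s -> Q l) -> (forall l, Q l -> a l <> 0 -> l \in s) ->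
  \sum_(l \in Q) a l = \sum_(l <- s) a l.
Proof.
move=> us sQ h; have sub : [set` s] `<=` Q by move=> l /sQ.
rewrite (fsbig_seq _ _ us) /=; apply/esym/fsbig_widen => //.
move=> l [Ql nl] /=; apply: contrapT => al; apply: nl => /=; exact: h.
Qed.

Lemma cs_nrm (R : realType) (H : topologicalZmodType) (f : H -> R[i]^o) : lcag H ->
  continuous_cs f -> continuous_cs (fun y => (nrm (f y))%:C : R[i]^o).
Proof.
move=> hH /(csP hH)[cf [L cL fL]]; apply/(csP hH); split.
  exact: (real_complex_continuous (nrm_continuous cf)).
by exists L => // y /fL ->; rewrite nrm0.
Qed.

Lemma cintZr d (T : measurableType d) (R : realType) (mu : {measure set T -> \bar R})
    (f : T -> R[i]^o) (a : R[i]^o) : cintble mu setT f ->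
  cint mu setT (fun x => f x * a) = cint mu setT f * a.
Proof.
by move=> fi; rewrite mulrC -cintZ//; apply: cint_eq => x _; rewrite mulrC.
Qed.

Section Weight.
Context {R : realType} {G : topologicalZmodType}.
Variables (m : {measure set (borel G) -> \bar R}).
Hypotheses (hG : lcag G) (hm : haar m).
Local Notation C := (R[i]^o).

Lemma bump_integral_gt0 (b : G -> R) : continuous_cs (fun x => (b x)%:C : C) ->
  (forall x, 0 <= b x) -> b 0 = 1 -> 0 < \int[m]_(x in setT) b x.
Proof.
move=> cb b0 b1; have [bi _] := cs_cintble hG hm cb.
have {}cb : continuous b by exact: ReC_continuous cb.1.
pose U := [set x : G | 2^-1 < b x].
have oU : open U.
  by apply: (@open_comp _ _ b [set y | 2^-1 < y]); [move=> x _; exact: cb|exact: open_gt].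
have mU : measurable (U : set (borel G)) by exact: borel_open.
have nU : nbhs 0 U by apply: open_nbhs_nbhs; split=> //; rewrite /U/= b1 invf_lt1 ?ltr1n.
have mb : measurable_fun setT (fun x : borel G => (b x)%:E).
  by apply/measurable_EFinP; exact: borel_continuous.
have h : (0 < \int[m]_(x in setT) (b x)%:E)%E.
  apply: (@lt_le_trans _ _ (\int[m]_(x in U) (2^-1)%:E)%E).
    by rewrite integral_cst// mule_gt0// ?lte_fin ?invr_gt0// (haar_gt0 hG hm).
  apply: (@le_trans _ _ (\int[m]_(x in U) (b x)%:E)%E).
    apply: ge0_le_integral => //.
    - exact: measurable_funTS.
    - by move=> x Ux; rewrite lee_fin ltW.
  by apply: ge0_subset_integral => // x _; rewrite lee_fin.
have h2 := integrable_fin_num measurableT bi.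
by rewrite /Rintegral fine_gt0// h/= ltey_eq h2.
Qed.

(** Spreading every lattice point over [G] with such a weight turns counting into integration. The
    symmetry of [w] and [E] allows the lattice point and the point of integration to be
    exchanged. *)
Lemma unit_weight : exists (w : G -> R) (E : set G),
  [/\ continuous w, forall x, 0 <= w x, forall x, w (- x) = w x &
   [/\ compact E, E 0, forall x, E x -> E (- x), forall x, ~ E x -> w x = 0 &
       \int[m]_(x in setT) w x = 1]].
Proof.
have [V nV [cV _]] := lc_nbhs hG.
have [U oU UV] : exists2 U : set G, open_nbhs 0 U & U `<=` V by move: nV; rewrite nbhsE.
have c0 : compact [set (0 : G)] by exact: compact_set1.
have s0 : [set (0 : G)] `<=` U by move=> _ ->; exact: oU.2.
have [b [cb b01 b1 [K [cK KU bK]]]] := bump hG hm c0 oU.1 s0.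
pose v x := b x + b (- x).
have cv : continuous v.
  move=> x; apply: cvgD; first exact: cb.
  apply: (@continuous_comp _ _ _ (fun x : G => - x) b); [exact: opp_continuous|exact: cb].
pose E := K `|` [set - x | x in K].
have cE : compact E by apply: compactU => //; exact: compact_opp.
have vE x : ~ E x -> v x = 0.
  move=> nE; rewrite /v !bK ?addr0// => Kx; apply: nE; last by left.
  by right; exists (- x); rewrite ?opprK.
have v0 x : 0 <= v x.
  by rewrite addr_ge0//; [have /andP[] := b01 x|have /andP[] := b01 (- x)].
(* The symmetrized bump has value 2 at 0; the factor [2^-1] restores the value 1 asked for by
   [bump_integral_gt0]. *)
have v2 : v 0 = 2 by rewrite /v oppr0 b1//.
have vcs (a : R) : continuous_cs (fun x => (a * v x)%:C : C).
  apply/csP => //; split; last by exists E => // x /vE ->; rewrite mulr0.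
  by apply: real_complex_continuous => x; apply: cvgM; [exact: cvg_cst|exact: cv].
have I0 : 0 < \int[m]_(x in setT) (2^-1 * v x).
  apply: bump_integral_gt0 => //; first by move=> x; rewrite mulr_ge0// invr_ge0.
  by rewrite v2 mulVf.
set I := \int[m]_(x in setT) _ in I0.
exists (fun x => I^-1 * (2^-1 * v x)), E; split.
- move=> x; apply: cvgM; first exact: cvg_cst.
  by apply: cvgM; [exact: cvg_cst|exact: cv].
- by move=> x; rewrite mulr_ge0 ?invr_ge0 ?(ltW I0)// mulr_ge0// invr_ge0.
- by move=> x; rewrite /v opprK [b (- x) + _]addrC.
- split => //.
  + by apply: contrapT => /vE/eqP; rewrite v2 pnatr_eq0.
  + move=> x [Kx|[y Ky <-]]; [right; exists x => //|left; by rewrite opprK].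
  + by move=> x /vE ->; rewrite !mulr0.
  + rewrite RintegralZl//; first by rewrite -/I mulVf// gt_eqF.
    exact: (cs_cintble hG hm (vcs _)).1.
Qed.

End Weight.

Section Counting.
Context {R : realType} {G Gint : topologicalZmodType}.
Variables (m : {sigma_finite_measure set (borel G) -> \bar R})
  (theta : {sigma_finite_measure set (borel Gint) -> \bar R})
  (Lt : zmodClosed (G * Gint)%type) (D : nat -> set G).
Hypotheses (hLt : cut_project_scheme Lt) (hm : haar m) (htheta : haar theta)
  (hD : van_hove m D).
Local Notation C := (R[i]^o).
Local Notation X := (prodG G Gint).
Local Notation bX := (borel G * borel Gint)%type.
Local Notation mu := (m \x theta)%E.
Local Notation Lam := (Lam Lt : set X).
Let hG := cps_lcag1 hLt.
Let hGint := cps_lcag2 hLt.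
Variables (F K : set X).
Hypotheses (hF : fundamental_domain Lt F) (cK : compact K) (FK : F `<=` K).
Local Notation Cov := (((covol m theta F)^-1)%:C : C).

(** The sum of [f] at the star images of the points of the projected lattice inside [D n], written
    over the lattice itself. *)
Definition count n (f : Gint -> C) : C := \sum_(l \in Lam) ind (D n) l.1 * f l.2.

Lemma setX_compact (A : set G) (B : set Gint) : compact A -> compact B ->
  compact ([set x : X | A x.1 /\ B x.2]).
Proof. exact: compact_setX. Qed.

Lemma count_seq n f (L : set Gint) (s : seq X) : (forall y, ~ L y -> f y = 0) ->
  uniq s -> (forall l, l \in s -> Lam l) ->
  (forall l, Lam l -> D n l.1 -> L l.2 -> l \in s) ->
  count n f = \sum_(l <- s) ind (D n) l.1 * f l.2.
Proof.
move=> fL us sL h; apply: fsum_seq => // l Ll.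
have [Dl|/ind_out ->] := pselect (D n l.1); last by rewrite mul0r.
by have [Kl _|/fL ->] := pselect (L l.2); [exact: h|rewrite mulr0].
Qed.

Section Weighted.
Variables (w : G -> R) (E : set G).
Hypotheses (cw : continuous w) (w0 : forall x, 0 <= w x) (wN : forall x, w (- x) = w x)
  (cE : compact E) (E0 : E 0) (EN : forall x, E x -> E (- x)) (wE : forall x, ~ E x -> w x = 0)
  (w1 : \int[m]_(x in setT) w x = 1).
Local Notation wC := (fun x => (w x)%:C : C).

Lemma weight_cs : continuous_cs wC.
Proof.
apply/csP => //; split; first exact: real_complex_continuous.
by exists E => // x /wE ->.
Qed.

Lemma weight_shift t : cintble m setT (fun x : G => wC (x - t)) /\
  cint m setT (fun x : G => wC (x - t)) = 1.
Proof.
have [h1 h2] := haar_cint_shift hm (- t) (cs_cintble hG hm weight_cs).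
by split=> //; rewrite h2 cint_real w1.
Qed.

(** The sums are dominated by the periodization of [w] tensored with the modulus of [g], at
    [(- x, 0)], and a periodization is bounded. *)
Lemma weight_sum_bound g : continuous_cs g -> exists2 c : R, 0 <= c &
  forall (s : seq X) x, uniq s -> (forall l, l \in s -> Lam l) ->
  \sum_(l <- s) nrm (g l.2) * w (x - l.1) <= c.
Proof.
move=> cg; have cg1 := cs_nrm hGint cg.
have ni := nice_tens hLt weight_cs cg1.
have [c hc] := mfunX_bnd hF cK FK (mfunX_per hLt ni).
exists c; first by rewrite (le_trans (nrm_ge0 _) (hc 0)).
move=> s x us sL; apply: le_trans (hc (- x, 0)).
have [s' [us' s'L Es' hs']] := per_seq hLt ni (@compact_set1 X (- x, 0)).
have tE l : tens wC (fun y => (nrm (g y))%:C : C) ((- x, 0) + l) = (nrm (g l.2) * w (x - l.1))%:C.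
  rewrite /tens /= add0r rmorphM /= mulrC; congr (_ * (_)%:C).
  by rewrite -wN opprD opprK.
rewrite Es'//; under [X in nrm X]eq_bigr do rewrite tE.
have -> : \sum_(i <- s') (nrm (g i.2) * w (x - i.1))%:C = (\sum_(i <- s') nrm (g i.2) * w (x - i.1))%:C :> C.
  by rewrite rmorph_sum.
rewrite nrmR ger0_norm; last by apply: sumr_ge0 => l _; rewrite mulr_ge0 ?nrm_ge0.
apply: sum_supp_le => //; first by move=> l; rewrite mulr_ge0 ?nrm_ge0.
move=> l ls /eqP nl; apply: (hs' (- x, 0)) => //; first exact: sL.
by rewrite tE => /eqP; rewrite RC_eq0 => /eqP.
Qed.

(** The constant does not depend on [A], [s] or [v], so any error carried by a van Hove boundary is
    negligible relative to the volume. *)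
Lemma layer_bound g : continuous_cs g -> exists2 c : R, 0 <= c &
  forall (A : set G) (s : seq X) (v : X -> G -> C), measurable (A : set (borel G)) -> (m A < +oo)%E ->
  uniq s -> (forall l, l \in s -> Lam l) -> (forall l, cmeas setT (v l : borel G -> C)) ->
  (forall l x, nrm (v l x) <= 1) -> (forall l x, E (x - l.1) -> v l x <> 0 -> A x) ->
  nrm (cint m setT (fun x : G => \sum_(l <- s) g l.2 * (wC (x - l.1) * v l x))) <= c * fine (m A).
Proof.
move=> cg; have [c c0 hc] := weight_sum_bound cg; exists c => // A s v mA Afin us sL mv v1 vA.
apply: cint_layer => //.
- apply: cmeas_sum => l; apply: cmeasZ; apply: cmeasM => //.
  exact: cintble_cmeas (weight_shift l.1).1.
- move=> x; rewrite (le_trans (nrm_sum _ _ _))//; apply: le_trans (hc s x us sL).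
  apply: ler_sum => l _; rewrite nrmM ler_wpM2l ?nrm_ge0// nrmM nrmR ger0_norm//.
  by rewrite -[leRHS]mulr1 ler_wpM2l.
- move=> x nA; apply: big1 => l _.
  have [El|/wE ->] := pselect (E (x - l.1)); last by rewrite mul0r mulr0.
  have [->|vl] := eqVneq (v l x) 0; first by rewrite !mulr0.
  by case: nA; apply: (vA l) => //; exact/eqP.
Qed.

(** Each lattice point is spread by [w]. Testing membership in [D n] at the integration point [x]
    instead of at the lattice point costs only the [E]-boundary, and what remains is the average of
    a periodic function along [G], with mean given by [unfold]. *)
Lemma counting_weighted g (e : R) : continuous_cs g -> 0 < e -> exists N, forall n, (N <= n)%N ->
  nrm (((vol m D n)^-1)%:C * count n g - Cov * cint theta setT g) <= e.
Proof.
move=> cg e0; have e20 : 0 < e / 2 by rewrite divr_gt0.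
have ni := nice_tens hLt weight_cs cg.
have Vp := mfunX_per hLt ni.
(* The sign makes [u (x, 0)] a sum of weights [w (x - l.1)], by the symmetry of [w]; [mean_opp]
   removes it from the mean. *)
pose u (x : X) := per Lt (tens wC g) (- x).
have Vu : mfunX Lt u by exact: mfunX_opp.
have Mu : meanX m theta F u = Cov * cint theta setT g.
  transitivity (meanX m theta F (per Lt (tens wC g))).
    exact: (mean_opp (S := lattice_system hLt hm htheta hF cK FK) Vp).
  have := unfold hLt hm htheta hF cK FK ni (mfunX_cst Lt 1).
  under [X in meanX _ _ _ X]eq_fun do rewrite mulr1.
  under [X in cint _ _ X]eq_fun do rewrite mulr1.
  move=> ->; rewrite (cint_tens hLt hm htheta weight_cs cg) cint_real w1.
  by rewrite mul1r.
have [c c0 hc] := layer_bound cg.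
have c1 : 0 < c + 1 by rewrite ltr_wpDl.
have [N1 hN1] := equidistribution hLt hm htheta hD hF cK FK Vu e20.
have [N2 hN2] := vh_eps hG hm hD cE (divr_gt0 e20 c1).
exists (maxn N1 N2) => n; rewrite geq_max => /andP[n1 n2].
have [cg' [L cL gL]] := (csP hGint g).1 cg.
have cDn : compact (D n) by exact: (vh_compact hD).
have mDn := vh_measurable hG hD n.
have [s us hs] := latt_seq hLt (setX_compact (compact_add cDn cE) cL).
have sL l : l \in s -> Lam l by move=> /hs[].
have sDL l : Lam l -> D n l.1 -> L l.2 -> l \in s.
  by move=> Ll Dl KL; apply/hs; split=> //; split => //; exists l.1 => //; exists 0; rewrite ?addr0.
have Ex x t : w (x - t) <> 0 -> E (x - t) by move=> h; apply: contrapT => /wE.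
have wi l : cintble m setT (fun x : G => wC (x - l)) := (weight_shift l).1.
have iwi l : cintble m setT (fun x : G => wC (x - l) * ind (D n) x).
  by apply: (cintbleM (c := 1)) => //; [exact: cmeas_ind|move=> x _; exact: ind_nrm].
pose f1 x := \sum_(l <- s) g l.2 * (wC (x - l.1) * ind (D n) x).
pose f2 x := \sum_(l <- s) g l.2 * (wC (x - l.1) * ind (D n) l.1).
have f1i : cintble m setT (f1 : G -> C) by apply: cintble_sum => // l; exact: cintbleZ.
have wi2 l : cintble m setT (fun x : G => wC (x - l) * ind (D n) l).
  by under eq_fun do rewrite mulrC; exact: cintbleZ.
have f2i : cintble m setT (f2 : G -> C) by apply: cintble_sum => // l; exact: cintbleZ.
have cntE : count n g = cint m setT (f2 : G -> C).
  rewrite (count_seq gL us sL sDL) cint_sum//; last by move=> l; exact: cintbleZ.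
  apply: eq_bigr => l _; rewrite cintZ// mulrC; congr (_ * _).
  by rewrite (cintZr _ (wi _)) (weight_shift l.1).2 mul1r.
have avgE : avg m D n (fun x => u (x, 0)) = ((vol m D n)^-1)%:C * cint m setT (f1 : G -> C).
  rewrite /avg; congr (_ * _); rewrite [RHS](cint_widen _ mDn); last first.
    by move=> x nD; apply: big1 => l _; rewrite (ind_out nD) !mulr0.
  apply: cint_eq => x Dx; rewrite /u /per (fsum_seq us sL); last first.
    move=> l Ll; rewrite /tens /= => tl; apply/hs; split=> //; split.
      exists x => //; exists (- x + l.1); last by rewrite addrA subrr add0r.
      by apply: contrapT => /wE h; apply: tl; rewrite h mul0r.
    by apply: contrapT => /gL h; apply: tl; rewrite oppr0 add0r h mulr0.
  apply: eq_bigr => l _; rewrite (ind_in Dx) mulr1 /tens /= oppr0 add0r mulrC.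
  by congr (_ * (_)%:C); rewrite -wN opprD opprK.
have V0 := vol_gt0 hm hD n.
have key : nrm (((vol m D n)^-1)%:C * count n g - avg m D n (fun x => u (x, 0))) <= e / 2.
  rewrite cntE avgE -mulrBr vol_inv// nrm_sym -cintB// ler_pdivrMr//.
  have -> : (fun x => f1 x - f2 x) =
      fun x => \sum_(l <- s) g l.2 * (wC (x - l.1) * (ind (D n) x - ind (D n) l.1)).
    by apply/funext => x; rewrite -sumrB; apply: eq_bigr => l _; rewrite -!mulrBr.
  apply: (@le_trans _ _ (c * fine (m (vh_boundary E (D n))))).
    apply: hc => //.
    - first [exact: (bd_measurable hG hD)| exact: (bd_measurable hG hm hD)].
    - by rewrite -ge0_fin_numE// (bd_fin hG hm hD).
    - by move=> l; apply: cmeasB; [exact: cmeas_ind|exact: cmeas_cst].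
    - move=> l x; have [h1|h1] := pselect (D n x); have [h2|h2] := pselect (D n l.1);
      rewrite ?(ind_in h1) ?(ind_out h1) ?(ind_in h2) ?(ind_out h2) ?subrr ?subr0 ?sub0r ?nrmN ?nrm0 ?nrm1//.
    - move=> l x El; have [h1|h1] := pselect (D n x); have [h2|h2] := pselect (D n l.1);
      rewrite ?(ind_in h1) ?(ind_out h1) ?(ind_in h2) ?(ind_out h2) ?subrr// => _.
        right; split=> //; exists l.1; first exact: subset_closure.
        by exists (- (x - l.1)); [exact: EN|rewrite opprK addrC subrK].
      left; split; last by move=> /interior_subset.
      by exists l.1 => //; exists (x - l.1) => //; rewrite addrC subrK.
  rewrite (le_trans (ler_wpM2l c0 (hN2 _ n2)))//.
  by rewrite mulrA ler_pM2r// mulrCA ger_pMr// ler_pdivrMr// mul1r lerDl.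
rewrite -Mu (le_trans (nrm_split (avg m D n (fun x => u (x, 0))) _ _))// [leRHS]splitr lerD//.
exact: hN1.
Qed.

(** The points that leave [D n] under the shift by [z] lie near its boundary, so even weighted by
    [g] they are negligible relative to the volume. *)
Lemma layer_count_weighted g z (e : R) : continuous_cs g -> 0 < e ->
  exists N, forall n, (N <= n)%N -> forall s : seq X, uniq s -> (forall l, l \in s -> Lam l) ->
  \sum_(l <- s) nrm (g l.2) * \1_[set x | D n x /\ ~ D n (x - z)] l.1 <= e * vol m D n.
Proof.
move=> cg e0; have [c c0 hc] := layer_bound (cs_nrm hGint cg).
have c1 : 0 < c + 1 by rewrite ltr_wpDl.
(* For [x] in [D n] and within [E] of such a point [l.1], the point [l.1 - z] outside [D n] is [x]
   minus [z + (x - l.1)]; this displacement, with its sign, is what [E'] adds to [E]. *)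
pose E' := E `|` [set - x | x in translate z E].
have cE' : compact E' by apply: compactU => //; apply: compact_opp; exact: compact_translate.
have [N hN] := vh_eps hG hm hD cE' (divr_gt0 e0 c1).
exists N => n Nn s us sL; pose P := [set x | D n x /\ ~ D n (x - z)].
have := hc (vh_boundary E' (D n)) s (fun l _ => ind P l.1) _ _ us sL.
have -> : cint m setT (fun x : G => \sum_(l <- s) (nrm (g l.2))%:C * (wC (x - l.1) * ind P l.1)) =
    (\sum_(l <- s) nrm (g l.2) * \1_P l.1)%:C.
  have wi l : cintble m setT (fun x : G => wC (x - l) * ind P l).
    by under eq_fun do rewrite mulrC; apply: cintbleZ => //; exact: (weight_shift l).1.
  rewrite cint_sum//; last by move=> l; exact: cintbleZ.
  rewrite rmorph_sum /=; apply: eq_bigr => l _; rewrite cintZ// rmorphM; congr (_ * _).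
  by rewrite (cintZr _ (weight_shift l.1).1) (weight_shift l.1).2 mul1r.
rewrite nrmR => h; rewrite (le_trans (ler_norm _))//.
apply: (@le_trans _ _ (c * fine (m (vh_boundary E' (D n))))).
  apply: h.
  - first [exact: (bd_measurable hG hD)| exact: (bd_measurable hG hm hD)].
  - by rewrite -ge0_fin_numE// (bd_fin hG hm hD).
  - by move=> l; exact: cmeas_cst.
  - by move=> l x; exact: ind_nrm.
  - move=> l x El vl; have [Dl Dz] : P l.1 by apply: contrapT => /ind_out.
    have [Dx|nDx] := pselect (D n x); last first.
      left; split; last by move=> /interior_subset.
      by exists l.1 => //; exists (x - l.1); [left|rewrite addrC subrK].
    right; split=> //; exists (l.1 - z); first exact: subset_closure.
    exists (- (z + (x - l.1))); last by rewrite opprK addrA subrK addrC subrK.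
    by right; exists (z + (x - l.1)) => //; exists (x - l.1).
rewrite (le_trans (ler_wpM2l c0 (hN _ Nn)))//.
by rewrite mulrA ler_pM2r ?(vol_gt0 hm hD)// mulrCA ger_pMr// ler_pdivrMr// mul1r lerDl.
Qed.

End Weighted.

Lemma counting_cs g (e : R) : continuous_cs g -> 0 < e -> exists N, forall n, (N <= n)%N ->
  nrm (((vol m D n)^-1)%:C * count n g - Cov * cint theta setT g) <= e.
Proof.
have [w [E [cw w0 wN [cE E0 EN wE w1]]]] := unit_weight hG hm.
exact: (counting_weighted cw w0 wN cE E0 EN wE w1).
Qed.

Lemma layer_count g z (e : R) : continuous_cs g -> 0 < e ->
  exists N, forall n, (N <= n)%N -> forall s : seq X, uniq s -> (forall l, l \in s -> Lam l) ->
  \sum_(l <- s) nrm (g l.2) * \1_[set x | D n x /\ ~ D n (x - z)] l.1 <= e * vol m D n.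
Proof.
have [w [E [cw w0 wN [cE E0 EN wE w1]]]] := unit_weight hG hm.
exact: (layer_count_weighted cw w0 wN cE wE w1).
Qed.

End Counting.

(** * Riemann-integrable functions on the internal group *)

Section Approximable.
Context {R : realType} {H : topologicalZmodType}.
Variable theta : {measure set (borel H) -> \bar R}.
Hypotheses (hH : lcag H) (htheta : haar theta).
Local Notation C := (R[i]^o).
Implicit Types (L : set H) (f : H -> C).

(* Riemann integrability: approximation by continuous functions up to a
   continuous error of small integral. *)
Definition apx L (c : R) f := [/\ cmeas setT (f : borel H -> C), forall y, nrm (f y) <= c,
  forall y, ~ L y -> f y = 0 &
  forall e : R, 0 < e -> exists f1 (h : H -> R), [/\ continuous f1, forall y, nrm (f1 y) <= c,
    forall y, ~ L y -> f1 y = 0 &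
    [/\ continuous_cs (fun y => (h y)%:C : C), forall y, nrm (f y - f1 y) <= h y &
        \int[theta]_(y in setT) h y <= e]]].

Lemma bounded_support_cintble L (c : R) f : compact L -> cmeas setT (f : borel H -> C) ->
  (forall y, nrm (f y) <= c) -> (forall y, ~ L y -> f y = 0) -> cintble theta setT f.
Proof.
move=> cL mf fc fL.
apply: (cintble_bounded measurableT (borel_compact hH cL) (haar_lty htheta cL) mf) => [|x _].
  by move=> x _; exact: fc.
exact: fL.
Qed.

Lemma apx_cintble L c f : compact L -> apx L c f -> cintble theta setT f.
Proof. by move=> cL [mf fc fL _]; exact: bounded_support_cintble fL. Qed.

Lemma nrm_cint_dom f (h : H -> R) : cintble theta setT f ->
  continuous_cs (fun y => (h y)%:C : C) -> (forall y, nrm (f y) <= h y) ->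
  nrm (cint theta setT f) <= \int[theta]_(y in setT) h y.
Proof.
move=> fi ch fh; rewrite (le_trans (nrm_cint measurableT fi))//.
apply: le_Rintegral => //; last exact: (cs_cintble hH htheta ch).1.
by have [] := (cintbleP theta f measurableT).1 fi.
Qed.

Lemma apx_bound_ge0 L c f : apx L c f -> 0 <= c.
Proof. by move=> [_ fc _ _]; rewrite (le_trans (nrm_ge0 (f 0))). Qed.

(** Replacing the two factors one after the other gives the error [c * h y + c * h (y - z)], whose
    integral is [2 * c] times that of [h] by invariance. *)
Lemma apx_corr L c f z : compact L -> apx L c f ->
  apx L (c ^+ 2) (fun y => f y * (f (y - z))^*).
Proof.
move=> cL af; have [mf fc fL ha] := af; have c0 := apx_bound_ge0 af; split.
- by apply: cmeasM => //; apply: cmeas_conj; exact: (borel_cmeas_shift (- z)).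
- by move=> y; rewrite nrmM nrmJ expr2 ler_pM ?nrm_ge0.
- by move=> y /fL ->; rewrite mul0r.
- move=> e e0; have c1 : 0 < 2 * (c + 1) by rewrite mulr_gt0// ltr_wpDl.
  have [f1 [h [cf1 f1c f1L [ch fh he]]]] := ha _ (divr_gt0 e0 c1).
  exists (fun y => f1 y * (f1 (y - z))^*), (fun y => c * h y + c * h (y - z)); split.
  + move=> y; apply: cvgM; first exact: cf1.
    have q : continuous (fun x => f1 (x - z)) by exact: cont_shift.
    have q2 := conj_cont q. exact: (q2 y).
  + by move=> y; rewrite nrmM nrmJ expr2 ler_pM ?nrm_ge0.
  + by move=> y /f1L ->; rewrite mul0r.
  + have cs1 := cs_shift hH (- z) ch.
    split.
    * have -> : (fun y => (c * h y + c * h (y - z))%:C : C) =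
        (fun y => c%:C * (h y)%:C + (fun y => c%:C * (h (y - z))%:C + (fun=> 0) y) y).
        by apply/funext => y; rewrite addr0 rmorphD !rmorphM.
      have z0 : continuous_cs ((fun=> 0) : H -> C).
        by apply/(csP hH); split; [move=> x; exact: cvg_cst|exists L].
      exact: (cs_lin hH c%:C ch (cs_lin hH c%:C cs1 z0)).
    * move=> y; rewrite (le_trans (nrm_split (f y * (f1 (y - z))^*) _ _))// addrC lerD//.
        by rewrite -mulrBl nrmM nrmJ mulrC ler_pM ?nrm_ge0.
      by rewrite -mulrBr nrmM -conjB nrmJ ler_pM ?nrm_ge0.
    * have hi := (cs_cintble hH htheta ch).1; have hi1 := (cs_cintble hH htheta cs1).1.
      rewrite RintegralD//; try exact: integrableRZ.
      rewrite !RintegralZl//.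
      have -> : \int[theta]_(y in setT) h (y - z) = \int[theta]_(y in setT) h y.
        have := (haar_cint_shift htheta (- z) (cs_cintble hH htheta ch)).2.
        by rewrite !cint_real => -[].
      rewrite -mulrDl (le_trans (ler_wpM2l _ he)) ?addr_ge0// mulrCA ger_pMr//.
      rewrite ler_pdivrMr// mul1r; lra.
Qed.

Lemma apx_mulr L c f g : apx L c f -> continuous g -> (forall y, nrm (g y) = 1) ->
  apx L c (fun y => f y * g y).
Proof.
move=> [mf fc fL ha] cg g1; split.
- by apply: cmeasM => //; exact: cmeas_continuous.
- by move=> y; rewrite nrmM g1 mulr1.
- by move=> y /fL ->; rewrite mul0r.
- move=> e /ha[f1 [h [cf1 f1c f1L [ch fh he]]]].
  exists (fun y => f1 y * g y), h; split.
  + by move=> y; apply: cvgM; [exact: cf1|exact: cg].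
  + by move=> y; rewrite nrmM g1 mulr1.
  + by move=> y /f1L ->; rewrite mul0r.
  + by split => // y; rewrite -mulrBl nrmM g1 mulr1.
Qed.

Lemma apx_sub L c f f1 : apx L c f -> continuous f1 -> (forall y, nrm (f1 y) <= c) ->
  (forall y, ~ L y -> f1 y = 0) -> apx L (c + c) (fun y => f y - f1 y).
Proof.
move=> [mf fc fL ha] cf1 f1c f1L; split.
- by apply: cmeasB => //; exact: cmeas_continuous.
- by move=> y; rewrite (le_trans (nrmB _ _))// lerD.
- by move=> y nL; rewrite fL// f1L// subrr.
- move=> e /ha[f2 [h [cf2 f2c f2L [ch fh he]]]].
  exists (fun y => f2 y - f1 y), h; split.
  + by move=> y; apply: cvgB; [exact: cf2|exact: cf1].
  + by move=> y; rewrite (le_trans (nrmB _ _))// lerD.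
  + by move=> y nL; rewrite f2L// f1L// subrr.
  + split => // y; apply: le_trans (fh y); rewrite opprB addrA subrK//.
Qed.

(* The discontinuities of the window function sit on the null boundary, where
   a cut-off removes them. *)
Lemma apx_window W (b : H -> C) : compact W -> closed W ->
  theta (closure W `\` interior W) = 0%E -> {within W, continuous b} ->
  (forall y, ~ W y -> b y = 0) -> exists c : R, apx W c b.
Proof.
move=> cW clW bd0 cb bW.
have cWb y : interior W y -> {for y, continuous b}.
  move=> Wy; have := cb y; rewrite /continuous_at /prop_for.
  suff -> : nbhs (y : subspace W) = nbhs (y : H) by [].
  by rewrite /nbhs/= -nbhs_subspace_in ?within_interior//; exact: interior_subset.
have [c0 hc0] : exists c : R, forall y, W y -> nrm (b y) <= c.
  have [|c hc] := @bounded_on_compact R (R[i]^o) id (b @` W) (continuous_compact cb cW).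
    by move=> y; exact: cvg_id.
  by exists c => y Wy; apply: hc; exists y.
pose c := Num.max c0 0.
have c_ge0 : 0 <= c by rewrite /c le_max lexx orbT.
have bc y : nrm (b y) <= c.
  have [Wy|/bW ->] := pselect (W y); last by rewrite nrm0.
  by rewrite /c le_max hc0.
have mWr (p : C -> R) : p 0 = 0 -> continuous p -> measurable_fun setT (fun y : borel H => p (b y)).
  move=> p0 cp; have mW : measurable (W : set (borel H)) by exact: borel_closed.
  have -> : (fun y : borel H => p (b y)) = (fun y : borel H => p (b y)) \_ W.
    apply/funext => y; rewrite patchE; case: ifPn => // /negP nW.
    by rewrite bW ?p0// => Wy; apply: nW; exact: mem_set.
  apply/(measurable_restrictT _ mW).
  apply: (measurability (@RGenOInfty.G R)); first exact: RGenOInfty.measurableE.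
  move=> _ [_ [x ->] <-].
  have cpb : {within W, continuous (fun y => p (b y))}.
    by move=> y; apply: (@continuous_comp _ _ _ (from_subspace W b) p); [exact: cb|exact: cp].
  have oI : open (`]x, +oo[%classic : set R) by exact: interval_open.
  have /continuousP/(_ _ oI) := cpb.
  move=> /open_subspaceP[V oV VW].
  have -> : W `&` (fun y : borel H => p (b y)) @^-1` `]x, +oo[%classic = V `&` W.
    by rewrite VW setIC.
  by apply: measurableI => //; exact: borel_open.
have mb : cmeas setT (b : borel H -> C).
  by split; [apply: (mWr (@complex.Re R)) => //|apply: (mWr (@complex.Im R)) => //];
    [apply: ReC_continuous|apply: ImC_continuous]; move=> y; exact: cvg_id.
exists c; split=> // e e0.
have c1 : 0 < c + 1 by rewrite ltr_wpDl.
pose bd := W `\` interior W.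
have cbd : compact bd.
  by rewrite /bd setDE; apply: compact_closedI => //; exact/open_closedC/open_interior.
have bd1 : theta bd = 0%E by rewrite -bd0 -(closure_id W).1.
have [ O1 [ O' [ oO cO' bdO OO' thO]]] := haar_outer hH htheta cbd (divr_gt0 e0 c1).
have [g [cg g01 g1 [K' [cK' K'O gK']]]] := bump hH htheta cbd oO bdO.
have gC : continuous (fun y => (g y)%:C : C) by exact: real_complex_continuous.
have gcs (a : R) : continuous_cs (fun y => (a * g y)%:C : C).
  apply/(csP hH); split; last by exists K' => // y /gK' ->; rewrite mulr0.
  by apply: real_complex_continuous => y; apply: cvgM; [exact: cvg_cst|exact: cg].
have intg : \int[theta]_(y in setT) g y <= e / (c + 1).
  have mK' := borel_compact hH cK'.
  have h1 : nrm (cint theta setT (fun y => (g y)%:C : C)) <= 1 * fine (theta K').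
    rewrite (cint_widen theta mK'); last by move=> y /gK' ->.
    apply: nrm_cint_le => //; first exact: (haar_lty htheta cK').
      by apply: cmeasS (cmeas_continuous gC) => //; exact: measurableT.
    by move=> y _; rewrite nrmR ger0_norm; case/andP: (g01 y).
  rewrite cint_real nrmR mul1r in h1; rewrite (le_trans (ler_norm _))// (le_trans h1)//.
  rewrite -lee_fin fineK ?(haar_fin htheta)//; apply: (@le_trans _ _ (theta O1)).
    by apply: measure_mono => //; exact: borel_open.
  by move: thO; rewrite bd1 add0e.
(* The cut-off [1 - g] vanishes on the boundary, where boundedness of [b] gives continuity of the
   product; in the interior both factors are continuous, and off the closed set [W] the product is
   locally zero. *)
exists (fun y => b y * (1 - (g y)%:C)), (fun y => c * g y); split.
- move=> y; apply/continuous_nrm => d d0.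
  have [Wy|nWy] := pselect (W y); last first.
    have nU : nbhs y (~` W) by apply: open_nbhs_nbhs; split => //; exact: closed_openC.
    by near=> y'; rewrite !bW ?mul0r ?subrr ?nrm0//; near: y'.
  have [iy|niy] := pselect (interior W y).
    apply: (continuous_nrm (fun y => b y * (1 - (g y)%:C)) y).1 => //.
    by apply: cvgM; [exact: cWb|apply: cvgB; [exact: cvg_cst|exact: gC]].
  rewrite (g1 y)// subrr mulr0; have gy := continuous_nrm (fun y => (g y)%:C : C) y.
  have [+ _] := gy; move=> /(_ (gC y) (d / (c + 1)) (divr_gt0 d0 c1)).
  apply: filterS => y' h; rewrite subr0 nrmM.
  rewrite (le_lt_trans (ler_wpM2r (nrm_ge0 _) (bc y')))//.
  rewrite (g1 y)// nrm_sym in h.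
  have cc : c <= c + 1 by rewrite lerDl.
  have := ler_wpM2r (nrm_ge0 (1 - (g y')%:C : C)) cc.
  by move=> /le_lt_trans; apply; rewrite mulrC -ltr_pdivlMr.
- move=> y; rewrite nrmM -[leRHS]mulr1 ler_pM ?nrm_ge0//.
  have -> : 1 - (g y)%:C = (1 - g y)%:C :> C by rewrite rmorphB.
  by rewrite nrmR ger0_norm; case/andP: (g01 y) => g0 g1'; lra.
- by move=> y /bW ->; rewrite mul0r.
- split; first exact: gcs.
  + move=> y; rewrite mulrBr mulr1 subKr nrmM nrmR ger0_norm; last by case/andP: (g01 y).
    by rewrite ler_wpM2r//; case/andP: (g01 y).
  + rewrite RintegralZl//; last first.
      by have := (cs_cintble hH htheta (gcs 1)).1; under eq_fun do rewrite mul1r.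
    rewrite (le_trans (ler_wpM2l c_ge0 intg))// mulrCA ger_pMr// ler_pdivrMr// mul1r lerDl//.
Unshelve. all: by end_near.
Qed.

End Approximable.


Section CountingApproximable.
Context {R : realType} {G Gint : topologicalZmodType}.
Variables (m : {sigma_finite_measure set (borel G) -> \bar R})
  (theta : {sigma_finite_measure set (borel Gint) -> \bar R})
  (Lt : zmodClosed (G * Gint)%type) (D : nat -> set G).
Hypotheses (hLt : cut_project_scheme Lt) (hm : haar m) (htheta : haar theta)
  (hD : van_hove m D).
Local Notation C := (R[i]^o).
Local Notation X := (prodG G Gint).
Local Notation Lam := (Lam Lt : set X).
Let hG := cps_lcag1 hLt.
Let hGint := cps_lcag2 hLt.
Variables (F K : set X).
Hypotheses (hF : fundamental_domain Lt F) (cK : compact K) (FK : F `<=` K).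
Local Notation Cov := (((covol m theta F)^-1)%:C : C).

Lemma count_list n (L : set Gint) : compact L -> exists s : seq X,
  [/\ uniq s, forall l, l \in s -> Lam l &
   forall f : Gint -> C, (forall y, ~ L y -> f y = 0) ->
    count Lt D n f = \sum_(l <- s) ind (D n) l.1 * f l.2].
Proof.
move=> cL; have cDn : compact (D n) by exact: (vh_compact hD).
have [s us hs] := latt_seq hLt (setX_compact cDn cL).
have sL l : l \in s -> Lam l by move=> /hs[].
exists s; split=> // f fL; apply: (count_seq fL) => // l Ll Dl KL.
by apply/hs; split.
Qed.

(** The dominating function [h] is itself continuous, so the counting error between [f] and [f1] is
    estimated by counting [h]. *)
Lemma counting_apx (L : set Gint) (c : R) f (e : R) : compact L -> apx theta L c f -> 0 < e ->
  exists N, forall n, (N <= n)%N ->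
  nrm (((vol m D n)^-1)%:C * count Lt D n f - Cov * cint theta setT f) <= e.
Proof.
move=> cL af e0; have e4 : 0 < e / 4 by rewrite divr_gt0.
have k0 : 0 < (covol m theta F)^-1 by rewrite invr_gt0 (covol_gt0 hLt hm htheta hF cK FK).
set k := (covol m theta F)^-1 in k0 *.
have [mf fc fL ha] := af; have fi := apx_cintble hGint htheta cL af.
(* The integral of [h] is made at most [e / 4 / k], so that after multiplication by the density [k]
   it contributes [e / 4]. *)
have [f1 [h [cf1 f1c f1L [ch fh he]]]] := ha _ (divr_gt0 e4 k0).
have cf1' : continuous_cs f1 by apply/(csP hGint); split => //; exists L.
have [Lh cLh hLh] := ((csP hGint _).1 ch).2.
have [N1 hN1] := counting_cs hLt hm htheta hD hF cK FK cf1' e4.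
have [N2 hN2] := counting_cs hLt hm htheta hD hF cK FK ch e4.
have h0 y : 0 <= h y by rewrite (le_trans (nrm_ge0 _) (fh y)).
have int_diff : nrm (cint theta setT f1 - cint theta setT f) <= e / 4 / k.
  have f1i := cs_cintble hGint htheta cf1'.
  rewrite nrm_sym -cintB//; apply: le_trans he; apply: nrm_cint_dom => //.
  exact: cintbleB.
exists (maxn N1 N2) => n; rewrite geq_max => /andP[n1 n2].
have V0 := vol_gt0 hm hD n.
have [s [us sL hs]] := count_list n (compactU cL cLh).
have E0 : count Lt D n f = \sum_(l <- s) ind (D n) l.1 * f l.2.
  by apply: hs => y nL; apply: fL => Ly; apply: nL; left.
have E1 : count Lt D n f1 = \sum_(l <- s) ind (D n) l.1 * f1 l.2.
  by apply: hs => y nL; apply: f1L => Ly; apply: nL; left.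
have E2 : count Lt D n (fun y => (h y)%:C) = \sum_(l <- s) ind (D n) l.1 * (h l.2)%:C.
  by apply: hs => y nL; apply: hLh => Ly; apply: nL; right.
have A2 : nrm (((vol m D n)^-1)%:C * count Lt D n (fun y => (h y)%:C)) <= e / 2.
  have := hN2 _ n2; rewrite cint_real => q.
  rewrite (le_trans (_ : _ <= nrm (((vol m D n)^-1)%:C * count Lt D n (fun y => (h y)%:C) -
    k%:C * (\int[theta]_(x in setT) h x)%:C) + nrm (k%:C * (\int[theta]_(x in setT) h x)%:C : C)))//.
    by rewrite -[X in nrm X <= _](subrK (k%:C * (\int[theta]_(x in setT) h x)%:C)) nrmD.
  rewrite (_ : e / 2 = e / 4 + e / 4); last by lra.
  rewrite lerD// -rmorphM nrmR ger0_norm; last by rewrite mulr_ge0 ?(ltW k0)// Rintegral_ge0.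
  by rewrite mulrC -ler_pdivlMr.
have A1 : nrm (((vol m D n)^-1)%:C * count Lt D n f - ((vol m D n)^-1)%:C * count Lt D n f1) <= e / 2.
  apply: le_trans A2; rewrite -mulrBr !vol_inv// ler_pM2r ?invr_gt0//.
  rewrite E0 E1 E2 -sumrB (le_trans (nrm_sum _ _ _))//.
  have -> : \sum_(l <- s) ind (D n) l.1 * (h l.2)%:C = (\sum_(l <- s) \1_(D n) l.1 * h l.2)%:C :> C.
    by rewrite rmorph_sum; apply: eq_bigr => l _; rewrite rmorphM.
  rewrite nrmR (le_trans _ (ler_norm _))//; apply: ler_sum => l _.
  rewrite -mulrBr nrmM /ind nrmR ger0_norm ?indicE// ler_wpM2l//.
rewrite (le_trans (nrm_split (((vol m D n)^-1)%:C * count Lt D n f1) _ _))//.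
rewrite (_ : e = e / 2 + (e / 4 + e / 4)); last by lra.
rewrite lerD//.
rewrite (le_trans (nrm_split (k%:C * cint theta setT f1) _ _))// lerD//; first exact: hN1.
rewrite -mulrBr nrmM nrmR ger0_norm ?(ltW k0)// mulrC -ler_pdivlMr//.
Qed.

End CountingApproximable.

(** * Autocorrelation *)

Lemma cvg_fin_sum (R : realType) (T : Type) (s : seq T) (u : T -> nat -> R[i]^o) (v : T -> R[i]^o) :
  (forall z, u z @ \oo --> v z) -> (fun n => \sum_(z <- s) u z n) @ \oo --> \sum_(z <- s) v z.
Proof.
move=> h; elim: s => [|z s IH].
  rewrite big_nil (_ : (fun n => _) = (fun=> 0)); first exact: (@cvg_cst (R[i]^o)).
  by apply/funext => n; rewrite big_nil.
rewrite big_cons (_ : (fun n => _) = (fun n => u z n + \sum_(z0 <- s) u z0 n)).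
  exact: (cvgD (h z) IH).
by apply/funext => n; rewrite big_cons.
Qed.

Section Autocorrelation.
Context {R : realType} {G Gint : topologicalZmodType}.
Variables (m : {sigma_finite_measure set (borel G) -> \bar R})
  (theta : {sigma_finite_measure set (borel Gint) -> \bar R})
  (Lt : zmodClosed (G * Gint)%type) (D : nat -> set G).
Hypotheses (hLt : cut_project_scheme Lt) (hm : haar m) (htheta : haar theta)
  (hD : van_hove m D).
Local Notation C := (R[i]^o).
Local Notation X := (prodG G Gint).
Local Notation Lam := (Lam Lt : set X).
Let hG := cps_lcag1 hLt.
Let hGint := cps_lcag2 hLt.
Variables (F K : set X).
Hypotheses (hF : fundamental_domain Lt F) (cK : compact K) (FK : F `<=` K).
Local Notation Cov := (((covol m theta F)^-1)%:C : C).

Lemma star_latt (l : X) : Lam l -> star_map [set` Lt] l.1 = l.2.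
Proof.
move=> Ll; have [_ _ _ inj _] := hLt.
have h : [set` Lt] (l.1, star_map [set` Lt] l.1).
  by apply: (xgetPex 0 (P := [set b | [set` Lt] (l.1, b)])); exists l.2; case: (l) Ll.
by have /= := inj _ _ h Ll erefl => <-.
Qed.

Lemma latt_fst (s : G) : proj_lattice [set` Lt] s -> exists2 l, Lam l & l.1 = s.
Proof. by move=> [l Ll <-]; exists l. Qed.

Lemma latt_fst_inj (l l' : X) : Lam l -> Lam l' -> l.1 = l'.1 -> l = l'.
Proof. by move=> Ll Ll' h; have [_ _ _ inj _] := hLt; exact: (inj _ _ Ll Ll' h). Qed.

Lemma comb_lattice (W : set Gint) (b : Gint -> C) f : (forall y, ~ W y -> b y = 0) ->
  dirac_comb (model_set Lt W) (fun s => b (star_map [set` Lt] s)) f =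
  \sum_(l \in Lam) b l.2 * f l.1.
Proof.
move=> bW; rewrite /dirac_comb.
rewrite -(fsbig_widen [set l | Lam l /\ W l.2] Lam); first last.
- by move=> l [Ll /= nl]; rewrite bW ?mul0r// => Wl; apply: nl.
- by move=> l [].
rewrite (@reindex_fsbig _ _ _ _ _ (fun l : X => l.1) [set l | Lam l /\ W l.2]).
  by apply: eq_fsbigr => l; rewrite inE => -[Ll _]; rewrite star_latt.
split.
- by move=> l [Ll Wl]; split; [exists l|rewrite star_latt].
- by move=> l l'; rewrite !inE => -[Ll _] [Ll' _]; exact: latt_fst_inj.
- by move=> s [[l Ll <-]] Wl; exists l => //; split => //; rewrite -star_latt.
Qed.

Definition corr (b : Gint -> C) (z : Gint) : C :=
  cint theta setT (fun y => b y * (b (y - z))^*).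

(** The future autocorrelation: [Cov] is the density of the lattice, and [corr b] is the convolution
    of [b] with its tilde on the internal side. *)
Definition gam (b : Gint -> C) : functional R G :=
  fun f => \sum_(z \in Lam) (Cov * corr b z.2) * f z.1.

Lemma corr_out (W : set Gint) b z : (forall y, ~ W y -> b y = 0) ->
  ~ minkowski_diff W W z -> corr b z = 0.
Proof.
move=> bW nz; rewrite /corr -[RHS](cint0 theta setT); apply: cint_eq => y _.
have [Wy|/bW ->] := pselect (W y); last by rewrite mul0r.
have [Wz|/bW ->] := pselect (W (y - z)); last by rewrite conj0 mulr0.
by case: nz; exists y => //; exists (y - z) => //; rewrite subKr.
Qed.

(** The lattice points that matter lie over the compact product of [Q] and the difference set of
    [W]; one finite list serves all [b] and [f] with these supports. *)
Lemma gam_list (W : set Gint) (Q : set G) : compact W -> compact Q -> exists Z : seq X,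
  [/\ uniq Z, forall z, z \in Z -> Lam z,
    forall z, z \in Z <-> Lam z /\ (Q z.1 /\ minkowski_diff W W z.2) &
  forall b f, (forall y, ~ W y -> b y = 0) -> (forall x, ~ Q x -> f x = 0) ->
    gam b f = \sum_(z <- Z) (Cov * corr b z.2) * f z.1].
Proof.
move=> cW cQ; have [Z uZ hZ] := latt_seq hLt (setX_compact cQ (compact_diff cW cW)).
have ZL z : z \in Z -> Lam z by move=> /hZ[].
exists Z; split => // b f bW fQ; apply: fsum_seq => // z Lz nz; apply/hZ; split=> //; split.
  by apply: contrapT => /fQ h; apply: nz; rewrite h mulr0.
by apply: contrapT => /(corr_out bW) h; apply: nz; rewrite h mulr0 mul0r.
Qed.

Section Window.
Variables (W : set Gint) (b : Gint -> C) (c : R).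
Hypotheses (cW : compact W) (ab : apx theta W c b).
Let bW : forall y, ~ W y -> b y = 0. Proof. by case: ab. Qed.

Lemma gam_radon : complex_radon (gam b).
Proof.
split.
- move=> a f g /(csP hG)[_ [K1 cK1 f0]] /(csP hG)[_ [K2 cK2 g0]].
  have [Z [uZ ZL _ /(_ b)hZ]] := gam_list cW (compactU cK1 cK2).
  rewrite !hZ//.
  + rewrite mulr_sumr -big_split /=; apply: eq_bigr => z _.
    by rewrite mulrDr mulrCA.
  + by move=> x nx; apply: g0 => h; apply: nx; right.
  + by move=> x nx; apply: f0 => h; apply: nx; left.
  + by move=> x nx; rewrite f0 ?g0 ?mulr0 ?addr0// => h; apply: nx; [right|left].
- move=> Q cQ; have [Z [uZ ZL _ /(_ b)hZ]] := gam_list cW cQ.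
  exists (\sum_(z <- Z) nrm (Cov * corr b z.2)) => f c1 _ fQ fc.
  rewrite hZ//; last by move=> x nQ; apply/eqP; apply: contrapT => /negP h; apply: nQ; exact: fQ.
  rewrite (le_trans (nrm_sum _ _ _))// mulr_suml; apply: ler_sum => z _.
  by rewrite nrmM ler_wpM2l ?nrm_ge0//; exact: fc.
Qed.

(** Without the second indicator this is [counting_apx] for the product of [b] and its shifted
    conjugate. The second indicator matters only for points that leave [D n] under the shift by
    [z.1]. *)
Lemma corr_count z (e : R) : 0 < e -> exists N, forall n, (N <= n)%N ->
  nrm (((vol m D n)^-1)%:C * (\sum_(l \in Lam) (b l.2 * ind (D n) l.1) *
    ((b (l.2 - z.2))^* * ind (D n) (l.1 - z.1))) - Cov * corr b z.2) <= e.
Proof.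
move=> e0; have e20 : 0 < e / 2 by rewrite divr_gt0.
have aq := apx_corr hGint htheta z.2 cW ab.
have [_ qc qW _] := aq; set q := (fun y => _) in aq qc qW.
have [N1 hN1] := counting_apx hLt hm htheta hD hF cK FK cW aq e20.
have [ O1 [C1 [ oO cC1 WO OC]]] := lc_open hGint cW.
(* [layer_count] needs a continuous weight, so the window is dominated by a bump equal to 1 on
   it. *)
have [k [ck k01 k1 [K' [cK' _ kK']]]] := bump hGint htheta cW oO WO.
have kcs : continuous_cs (fun y => (k y)%:C : C).
  apply/(csP hGint); split; last by exists K' => // y /kK' ->.
  exact: real_complex_continuous.
have c1 : 0 < c ^+ 2 + 1 by rewrite ltr_wpDl// sqr_ge0.
have [N2 hN2] := layer_count hLt hm hD hF cK FK z.1 kcs (divr_gt0 e20 c1).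
exists (maxn N1 N2) => n; rewrite geq_max => /andP[n1 n2].
have V0 := vol_gt0 hm hD n; have c0 := apx_bound_ge0 ab.
have cDn : compact (D n) by exact: (vh_compact hD).
have [s us hs] := latt_seq hLt (setX_compact cDn cW).
have sL l : l \in s -> Lam l by move=> /hs[].
have cE : count Lt D n q = \sum_(l <- s) ind (D n) l.1 * q l.2.
  by apply: (count_seq qW) => // l Ll Dl Wl; apply/hs.
have sE : \sum_(l \in Lam) (b l.2 * ind (D n) l.1) * ((b (l.2 - z.2))^* * ind (D n) (l.1 - z.1)) =
    \sum_(l <- s) q l.2 * (ind (D n) l.1 * ind (D n) (l.1 - z.1)).
  rewrite (fsum_seq us sL); first by apply: eq_bigr => l _; rewrite mulrACA.
  move=> l Ll nl; apply/hs; split=> //; split; apply: contrapT => h; apply: nl.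
    by rewrite (ind_out h) mulr0 mul0r.
  by rewrite (bW h) !mul0r.
rewrite sE (le_trans (nrm_split (((vol m D n)^-1)%:C * count Lt D n q) _ _))//.
rewrite [leRHS]splitr lerD//; last exact: hN1.
rewrite -mulrBr vol_inv// ler_pdivrMr// cE -sumrB (le_trans (nrm_sum _ _ _))//.
pose P := [set x | D n x /\ ~ D n (x - z.1)].
apply: (@le_trans _ _ (\sum_(l <- s) c ^+ 2 * (nrm (k l.2)%:C * \1_P l.1))).
  apply: ler_sum => l _.
  have [Wl|/qW ql] := pselect (W l.2); last first.
    have {}ql : q l.2 = 0 := ql.
    rewrite ql mul0r mulr0 subrr nrm0; apply: mulr_ge0; first exact: sqr_ge0.
    by apply: mulr_ge0; [exact: nrm_ge0|rewrite indicE].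
  have -> : k l.2 = 1 by exact: k1.
  rewrite rmorph1 nrm1 mul1r.
  have [h1|h1] := pselect (D n l.1); have [h2|h2] := pselect (D n (l.1 - z.1));
    rewrite ?(ind_in h1) ?(ind_out h1) ?(ind_in h2) ?(ind_out h2) ?mulr1 ?mul1r ?mulr0 ?mul0r ?subrr ?sub0r ?nrmN ?nrm0;
    rewrite ?mulr_ge0 ?sqr_ge0 ?indicE//.
  by rewrite (mem_set (A := P))// mulr1; exact: qc.
rewrite -mulr_sumr (le_trans (ler_wpM2l _ (hN2 _ n2 s us sL))) ?sqr_ge0//.
by rewrite mulrA ler_pM2r// mulrCA ger_pMr// ler_pdivrMr// mul1r lerDl.
Qed.

Let comb : functional R G := fun f => \sum_(l \in Lam) b l.2 * f l.1.

Lemma indR (A : set G) x : (x \in A)%:R = ind A x :> C.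
Proof. by rewrite /ind indicE rmorph_nat. Qed.

Lemma comb_autocorrelation : autocorrelation m D comb (gam b).
Proof.
split; first exact: gam_radon.
move=> f cf; have [_ [Q cQ fQ]] := (csP hG f).1 cf.
have [Z [uZ ZL hZ gZ]] := gam_list cW cQ.
pose T z n : C := \sum_(l \in Lam) (b l.2 * ind (D n) l.1) *
    ((b (l.2 - z.2))^* * ind (D n) (l.1 - z.1)).
(* Substituting [z] for the difference of two lattice points groups the double sum by [z]. The
   supports of [f] and [b] confine [z] to the finite list [Z], which does not depend on [n], so
   limits can be taken term by term. *)
have key n : mconvolution (Defs.mrestrict comb (D n)) (mtilde (Defs.mrestrict comb (D n))) f =
    \sum_(z <- Z) f z.1 * T z n.
  have cDn : compact (D n) by exact: (vh_compact hD).
  have [s us hs] := latt_seq hLt (setX_compact cDn cW).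
  have sL l : l \in s -> Lam l by move=> /hs[].
  have in_s (a : X -> C) l : Lam l -> (b l.2 * ind (D n) l.1) * a l <> 0 -> l \in s.
    move=> Ll nl; apply/hs; split=> //; split; apply: contrapT => h; apply: nl.
      by rewrite (ind_out h) mulr0 mul0r.
    by rewrite (bW h) !mul0r.
  rewrite /mconvolution {1}/Defs.mrestrict {1}/comb.
  under eq_fsbigr do rewrite indR mulrA.
  rewrite (fsum_seq us sL); last by move=> l Ll; exact: (in_s (fun l => mtilde _ _)).
  have inner l : l \in s -> mtilde (Defs.mrestrict comb (D n)) (fun y => f (l.1 + y)) =
      \sum_(z <- Z) ((b (l.2 - z.2))^* * ind (D n) (l.1 - z.1)) * f z.1.
    move=> ls; have Ll := sL _ ls; have [_ [_ Wl]] := (hs l).1 ls.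
    rewrite /mtilde /Defs.mrestrict /comb.
    rewrite (@reindex_fsbig _ _ _ _ _ (fun z : X => l - z) Lam Lam); last first.
      split.
      - by move=> z Lz; exact: LamB.
      - by move=> z z' _ _ /addrI/oppr_inj.
      - by move=> t Ltt; exists (l - t); [exact: LamB|rewrite subKr].
    rewrite (fsum_seq uZ ZL).
      rewrite conj_sum; apply: eq_bigr => z _; rewrite indR !conjM conjR /tilde.
      by rewrite conjK (subKr l.1 z.1 : l.1 - (l - z).1 = z.1) mulrA.
    move=> z Lz; rewrite /tilde => nz; apply/hZ; split=> //; split.
      apply: contrapT => /fQ h; apply: nz.
      by rewrite (subKr l.1 z.1 : l.1 - (l - z).1 = z.1) h conj0 !mulr0.
    have [Wlz|/bW h] := pselect (W (l.2 - z.2)); last by case: nz; rewrite h mul0r.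
    by exists l.2 => //; exists (l.2 - z.2) => //; rewrite subKr.
  rewrite (eq_big_seq (fun l => \sum_(z <- Z) f z.1 * ((b l.2 * ind (D n) l.1) *
    ((b (l.2 - z.2))^* * ind (D n) (l.1 - z.1))))); last first.
    move=> l ls; rewrite inner// mulr_sumr; apply: eq_bigr => z _.
    by rewrite [RHS]mulrC !mulrA.
  rewrite exchange_big /=; apply: eq_bigr => z _; rewrite -mulr_sumr; congr (_ * _).
  rewrite /T (fsum_seq us sL)// => l Ll.
  exact: (in_s (fun l => (b (l.2 - z.2))^* * ind (D n) (l.1 - z.1))).
have lim (Z' : seq X) : (fun n => \sum_(z <- Z') ((vol m D n)^-1)%:C * (f z.1 * T z n)) @ \oo -->
    (\sum_(z <- Z') Cov * corr b z.2 * f z.1 : C).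
  apply: cvg_fin_sum => z; rewrite mulrC (_ : (fun n => _) =
      (fun n => f z.1 * (((vol m D n)^-1)%:C * T z n))); last first.
    by apply/funext => n; rewrite mulrCA.
  apply: cvgM; first exact: cvg_cst.
  apply/cvgC_nrm => e e0; have [N hN] := corr_count z (divr_gt0 e0 (ltr0Sn R 1)).
  exists N => // n Nn; apply: le_lt_trans (hN n Nn) _.
  by rewrite ltr_pdivrMr// ltr_pMr// ltr1n.
have E : (fun n => ((fine (m (D n)))^-1)%:C *
    mconvolution (Defs.mrestrict comb (D n)) (mtilde (Defs.mrestrict comb (D n))) f) =
    (fun n => \sum_(z <- Z) ((vol m D n)^-1)%:C * (f z.1 * T z n)).
  by apply/funext => n; rewrite key mulr_sumr.
by rewrite E gZ//; exact: lim.
Qed.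

End Window.

End Autocorrelation.

(** * Characters of the quotient and the Poisson-Parseval formula *)

Section CharacterFunctions.
Context {R : realType} {H : topologicalZmodType}.
Local Notation C := (R[i]^o).
Implicit Types eta : dual_group R H.

Lemma char_nrm eta x : nrm (eta x) = 1.
Proof.
have := char_norm eta x; rewrite normE => h.
by have := congr1 (@complex.Re R) h.
Qed.

Lemma char_at0 eta : eta 0 = 1.
Proof.
have h := charD eta 0 0; rewrite addr0 in h.
have e0 : eta 0 != 0 by rewrite -nrm_eq0 char_nrm oner_eq0.
by apply: (mulfI e0); rewrite mulr1 -h.
Qed.

Lemma charN eta x : eta (- x) = (eta x)^*.
Proof.
have e0 : eta x != 0 by rewrite -nrm_eq0 char_nrm oner_eq0.
apply: (mulfI e0); rewrite -charD subrr char_at0.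
by rewrite mulJ char_nrm expr1n.
Qed.

Lemma char_conj_cont eta : continuous (fun x => (eta x)^* : C).
Proof. by apply: conj_cont; exact: char_continuous. Qed.

Lemma char_conj_nrm eta x : nrm ((eta x)^* : C) = 1.
Proof. by rewrite nrmJ char_nrm. Qed.

Lemma fourierE (mu : {measure set (borel H) -> \bar R}) f eta :
  fourier mu f eta = cint mu setT (fun x => f x * (eta x)^*).
Proof. by []. Qed.

End CharacterFunctions.

Lemma sqr_drop (R : realDomainType) (x y e : R) : 0 <= x -> 0 <= y -> 0 < e -> x - y <= e ->
  x ^+ 2 <= y ^+ 2 + 2 * x * e.
Proof.
move=> x0 y0 e0 h; have [xy|yx] := leP x y.
  apply: (@le_trans _ _ (y ^+ 2)); first by rewrite ler_pXn2r.
  by rewrite lerDl; apply: mulr_ge0; [exact: mulr_ge0|exact: ltW].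
have : (x - y) * (x + y) <= e * (2 * x) by apply: ler_pM; lra.
by rewrite -subr_sqr; lra.
Qed.

Section Parseval.
Context {R : realType} {G Gint : topologicalZmodType}.
Variables (m : {sigma_finite_measure set (borel G) -> \bar R})
  (theta : {sigma_finite_measure set (borel Gint) -> \bar R})
  (Lt : zmodClosed (G * Gint)%type).
Hypotheses (hLt : cut_project_scheme Lt) (hm : haar m) (htheta : haar theta).
Local Notation C := (R[i]^o).
Local Notation X := (prodG G Gint).
Local Notation bX := (borel G * borel Gint)%type.
Local Notation mu := (m \x theta)%E.
Local Notation Lam := (Lam Lt : set X).
Let hG := cps_lcag1 hLt.
Let hGint := cps_lcag2 hLt.
Variables (F K : set X).
Hypotheses (hF : fundamental_domain Lt F) (cK : compact K) (FK : F `<=` K).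
Local Notation Cov := (((covol m theta F)^-1)%:C : C).
Local Notation S := (lattice_system hLt hm htheta hF cK FK).
Local Notation DG := (dual_group R G).
Local Notation DGint := (dual_group R Gint).
Local Notation dual := (dual_lattice R Lt).

Definition psi (p : DG * DGint) (x : X) : C := p.1 x.1 * p.2 x.2.

Lemma psi_cont p : continuous (psi p).
Proof. by apply: cont_tens; exact: char_continuous. Qed.

Lemma dual_latt (p : DG * DGint) l : dual p -> Lam l -> psi p l = 1.
Proof.
by move=> dp Ll; have := dp l.1 (ex_intro2 _ _ l Ll erefl); rewrite (star_latt hLt Ll).
Qed.

Lemma psi_char p : dual p -> is_char S (psi p).
Proof.
move=> dp; have D x y : psi p (x + y) = psi p x * psi p y.
  by rewrite /psi !charD mulrACA.
split=> //; last by move=> x; rewrite nrmM !char_nrm mulr1.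
split; first exact: psi_cont.
- by move=> x l Ll; rewrite D (dual_latt dp Ll) mulr1.
- by apply: cmeas_tens; apply: cmeas_continuous; exact: char_continuous.
Qed.

(** A character of the product is the product of its restrictions to the two factors, and
    periodicity makes it 1 on the lattice. *)
Lemma char_psi f : is_char S f -> exists2 p, dual p & psi p = f.
Proof.
move=> [[cf pf _] fD f1].
have c1 : continuous (fun x : G => f (x, 0)).
  have -> : (fun x : G => f (x, 0)) = fun x : G => f (0 + (x, 0)).
    by apply/funext => x; rewrite add0r.
  exact: cont_slice.
have c2 : continuous (fun y : Gint => f (0, y)).
  move=> y; apply: (@continuous_comp _ _ _ (fun y : Gint => (0, y) : X) f); last exact: cf.
  by apply: cvg_pair; [exact: cvg_cst|exact: cvg_id].
have n1 x : `|f (x, 0)| = 1 by rewrite normE f1.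
have n2 y : `|f (0, y)| = 1 by rewrite normE f1.
have d1 x y : f (x + y, 0) = f (x, 0) * f (y, 0).
  by rewrite -fD; congr f; apply/eqP; rewrite xpair_eqE /= addr0 !eqxx.
have d2 x y : f (0, x + y) = f (0, x) * f (0, y).
  by rewrite -fD; congr f; apply/eqP; rewrite xpair_eqE /= addr0 !eqxx.
pose p : DG * DGint := (Character n1 d1 c1, Character n2 d2 c2).
have pE : psi p = f.
  apply/funext => -[x y]; rewrite /psi /= -fD; congr f.
  by apply/eqP; rewrite xpair_eqE /= addr0 add0r !eqxx.
exists p => // s /(latt_fst) [l Ll <-]; rewrite (star_latt hLt Ll).
have -> : p.1 l.1 * p.2 l.2 = f (0 + l) by rewrite add0r -pE.
rewrite pf//; have f0 : f 0 != 0 by rewrite -nrm_eq0 f1 oner_eq0.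
by apply: (mulfI f0); rewrite mulr1 -fD addr0.
Qed.

Lemma psi_inj : injective psi.
Proof.
move=> [a b] [a' b'] h; congr (_, _); apply: char_eq => x.
  by have := congr1 (fun f => f (x, 0)) h; rewrite /psi /= !char_at0 !mulr1.
by have := congr1 (fun f => f (0, x)) h; rewrite /psi /= !char_at0 !mul1r.
Qed.

(** Two partners of the same first component agree on the internal projection of the lattice, which
    is dense, and characters are continuous. *)
Lemma star_dual (p : DG * DGint) : dual p -> star_map dual p.1 = p.2.
Proof.
move=> dp; have h : dual (p.1, star_map dual p.1).
  by apply: (xgetPex 0 (P := [set b | dual (p.1, b)])); exists p.2; case: (p) dp.
set eta := star_map dual p.1 in h *; apply: char_eq => y; apply: nrm_le_eq => e e0.
have [_ _ _ _ dL] := hLt.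
have cd : continuous (fun y => eta y - p.2 y : C).
  by move=> z; apply: cvgB; exact: char_continuous.
have := (continuous_nrm (fun y => eta y - p.2 y : C) y).1 (cd y) e e0.
rewrite /prop_near1 nbhsE => -[U [oU Uy] hU].
have [|z [Uz [l Ll lz]]] := dL U _ oU; first by exists y.
rewrite -lz in Uz.
have : nrm ((eta l.2 - p.2 l.2) - (eta y - p.2 y)) < e := hU _ Uz.
have -> : eta l.2 = p.2 l.2.
  have p0 : p.1 l.1 != 0 by rewrite -nrm_eq0 char_nrm oner_eq0.
  by apply: (mulfI p0); rewrite [LHS](dual_latt h Ll) -(dual_latt dp Ll).
by rewrite subrr sub0r nrmN => /ltW.
Qed.

Lemma dualN (p : DG * DGint) : dual p -> dual (- p.1, - p.2).
Proof.
move=> dp s hs; rewrite /= -conjM; have -> := dp s hs.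
exact: conj1.
Qed.

Section TestFunction.
Variable phi : G -> C.
Hypothesis cphi : continuous_cs phi.

Lemma ip_per f p : continuous_cs f -> dual p ->
  ip S (per Lt (tens phi f)) (psi p) = Cov * (fourier m phi p.1 * fourier theta f p.2).
Proof.
move=> cf dp; have [Vp _ _] := psi_char dp.
have := unfold hLt hm htheta hF cK FK (nice_tens hLt cphi cf) (mfunX_conj Vp).
rewrite /ip /= => ->; congr (_ * _).
have c1 : continuous_cs (fun x => phi x * (p.1 x)^*) by apply: cs_mulr => //; exact: char_conj_cont.
have c2 : continuous_cs (fun x => f x * (p.2 x)^*) by apply: cs_mulr => //; exact: char_conj_cont.
rewrite !fourierE -(cint_tens hLt hm htheta c1 c2); apply: cint_eq => x _.
by rewrite /tens /psi conjM mulrACA.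
Qed.

Lemma cs_pair (H : topologicalZmodType) (f : H -> C) t : lcag H -> continuous_cs f ->
  continuous_cs (fun x => f x * (f (x + t))^*).
Proof.
by move=> hH cf; apply: cs_mulr => //; apply: conj_cont; apply: cont_shift; case: cf.
Qed.

Lemma convolution_tildeE x : convolution m phi (tilde phi) x =
  cint m setT (fun y => phi y * (phi (y - x))^*).
Proof. by apply: cint_eq => y _; rewrite /tilde opprB. Qed.

(** Unfolding one factor of the squared norm and expanding the other over the lattice gives, for
    each lattice vector, an autocorrelation of [phi] times one of [f]. *)
Lemma nn_per f : continuous_cs f ->
  gam m theta Lt F f (convolution m phi (tilde phi)) = (nn S (per Lt (tens phi f)))%:C.
Proof.
move=> cf; have ni := nice_tens hLt cphi cf; have Vp := mfunX_per hLt ni.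
rewrite -(nnE (S := S) Vp) /ip /=.
rewrite (unfold hLt hm htheta hF cK FK ni (mfunX_conj Vp)).
have [_ _ [Q cQ Q0]] := ni.
have [s [us sL Es in_s]] := per_seq hLt ni cQ.
have c1 l := cs_pair l hG cphi; have c2 l := cs_pair l hGint cf.
transitivity (Cov * cint mu setT (fun x : X => \sum_(l <- s)
    tens (fun y => phi y * (phi (y + l.1))^*) (fun y => f y * (f (y + l.2))^*) x)); last first.
  congr (_ * _); apply: cint_eq => x _.
  have [Qx|/Q0 z0] := pselect (Q x).
    rewrite Es// conj_sum mulr_sumr; apply: eq_bigr => l _.
    by rewrite /tens conjM mulrACA.
  rewrite z0 mul0r big1// => l _; rewrite /tens mulrACA.
  by rewrite [X in X * _](z0 : phi x.1 * f x.2 = 0) mul0r.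
have nci l := nice_cintble hLt hm htheta (nice_tens hLt (c1 l.1) (c2 l.2)).
rewrite cint_sum// mulr_sumr /gam.
(* Unfolding produces shifts by [+ l], whereas [corr] and [convolution] are written with shifts by
   [- l]. *)
rewrite (@reindex_fsbig _ _ _ _ _ (fun l : X => - l) Lam Lam); last first.
  split.
  - by move=> z Lz; exact: LamN.
  - by move=> z z' _ _ /oppr_inj.
  - by move=> t Ltt; exists (- t); [exact: LamN|rewrite opprK].
have E1 l : convolution m phi (tilde phi) (- l).1 = cint m setT (fun y => phi y * (phi (y + l.1))^*).
  by rewrite convolution_tildeE; apply: cint_eq => y _; rewrite /= opprK.
have E2 l : corr theta f (- l).2 = cint theta setT (fun y => f y * (f (y + l.2))^*).
  by apply: cint_eq => y _; rewrite /= opprK.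
rewrite (fsum_seq us sL).
  apply: eq_bigr => l _; rewrite E1 E2 (cint_tens hLt hm htheta (c1 l.1) (c2 l.2)) -mulrA.
  by rewrite [X in _ * X]mulrC.
have vanish (H : topologicalZmodType) (nu : {measure set (borel H) -> \bar R}) (g : H -> C) :
    cint nu setT g <> 0 -> exists x, g x <> 0.
  move=> h; apply: contrapT => /forallNP g0; apply: h.
  by rewrite -(cint0 nu setT); apply: cint_eq => x _; apply: contrapT; exact: g0.
move=> l Ll; rewrite E1 E2 => nl.
have [|x1 h1] := vanish _ m (fun y => phi y * (phi (y + l.1))^*).
  by move=> h; apply: nl; rewrite h mulr0.
have [|x2 h2] := vanish _ theta (fun y => f y * (f (y + l.2))^*).
  by move=> h; apply: nl; rewrite h mulr0 mul0r.
apply: (in_s (x1, x2)) => //.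
  apply: contrapT => /Q0 /= /eqP; rewrite /tens mulf_eq0 => /orP[]/eqP h.
    by apply: h1; rewrite h mul0r.
  by apply: h2; rewrite h mul0r.
move=> /= /eqP; rewrite /tens mulf_eq0 => /orP[]/eqP /= h.
  by apply: h1; rewrite h conj0 mulr0.
by apply: h2; rewrite h conj0 mulr0.
Qed.

Section Window.
Variables (W : set Gint) (b : Gint -> C) (c : R).
Hypotheses (cW : compact W) (ab : apx theta W c b).
Local Notation Gam f := (gam m theta Lt F f (convolution m phi (tilde phi))).
Local Notation q p := (Cov * fourier m phi p.1).

Lemma fourier_sub f g eta : cintble theta setT f -> cintble theta setT g ->
  fourier theta (fun y => f y - g y) eta = fourier theta f eta - fourier theta g eta.
Proof.
move=> fi gi; have tw h : cintble theta setT h -> cintble theta setT (fun y => h y * (eta y)^*).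
  move=> hi; apply: (cintbleM (c := 1)) => //; last by move=> x _; rewrite char_conj_nrm.
  by apply: cmeas_continuous; exact: char_conj_cont.
rewrite !fourierE -cintB//; try exact: tw.
by apply: cint_eq => y _; rewrite mulrBl.
Qed.

Lemma nrm_fourier f (h : Gint -> R) eta : cintble theta setT f ->
  continuous_cs (fun y => (h y)%:C : C) -> (forall y, nrm (f y) <= h y) ->
  nrm (fourier theta f eta) <= \int[theta]_(y in setT) h y.
Proof.
move=> fi ch fh; rewrite fourierE; apply: (nrm_cint_dom hGint htheta) => //.
  apply: (cintbleM (c := 1)) => //; last by move=> x _; rewrite char_conj_nrm.
  by apply: cmeas_continuous; exact: char_conj_cont.
by move=> y; rewrite nrmM char_conj_nrm mulr1.
Qed.

Lemma corr_diff f g (h : Gint -> R) (c1 : R) z : cintble theta setT f -> cintble theta setT g ->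
  (forall y, nrm (f y) <= c1) -> (forall y, nrm (g y) <= c1) ->
  continuous_cs (fun y => (h y)%:C : C) -> (forall y, nrm (f y - g y) <= h y) ->
  nrm (corr theta f z - corr theta g z) <= 2 * c1 * \int[theta]_(y in setT) h y.
Proof.
move=> fi gi fc gc ch fh; have c0 : 0 <= c1 by rewrite (le_trans (nrm_ge0 (f 0))).
have sh p : cintble theta setT p -> cintble theta setT (fun y => (p (y - z))^*).
  by move=> pi; apply: cintble_conj => //; exact: (haar_cint_shift htheta (- z) pi).1.
have pc p r : cintble theta setT p -> cintble theta setT r -> (forall y, nrm (r y) <= c1) ->
    cintble theta setT (fun y => p y * (r (y - z))^*).
  move=> pi ri rc; apply: (cintbleM (c := c1)) => //; first exact: cintble_cmeas (sh _ ri).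
  by move=> x _; rewrite nrmJ.
have ffi := pc _ _ fi fi fc; have ggi := pc _ _ gi gi gc.
have fgi := pc _ _ fi gi gc.
have hi := (cs_cintble hGint htheta ch).1.
have ch1 := cs_shift hGint (- z) ch; have hi1 := (cs_cintble hGint htheta ch1).1.
have csc (p : Gint -> R) : continuous_cs (fun y => (p y)%:C : C) -> continuous_cs (fun y => (c1 * p y)%:C : C).
  move=> cp; have z0 : continuous_cs ((fun=> 0) : Gint -> C).
    by have := csB hGint cp cp; under eq_fun do rewrite subrr.
  have := cs_lin hGint c1%:C cp z0.
  by under eq_fun do rewrite addr0 -rmorphM.
have b1 : nrm (cint theta setT (fun y => f y * (f (y - z))^* - f y * (g (y - z))^*)) <=
    \int[theta]_(y in setT) (c1 * h (y - z)).
  apply: (nrm_cint_dom hGint htheta); [exact: cintbleB|exact: csc|].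
  by move=> y; rewrite -mulrBr nrmM -conjB nrmJ ler_pM ?nrm_ge0.
have b2 : nrm (cint theta setT (fun y => f y * (g (y - z))^* - g y * (g (y - z))^*)) <=
    \int[theta]_(y in setT) (c1 * h y).
  apply: (nrm_cint_dom hGint htheta); [exact: cintbleB|exact: csc|].
  by move=> y; rewrite -mulrBl nrmM nrmJ mulrC ler_pM ?nrm_ge0.
rewrite (le_trans (nrm_split (cint theta setT (fun y => f y * (g (y - z))^*)) _ _))//.
have -> : 2 * c1 * \int[theta]_(y in setT) h y =
    c1 * \int[theta]_(y in setT) h y + c1 * \int[theta]_(y in setT) h y by ring.
rewrite /corr -!cintB//; apply: lerD.
  rewrite (le_trans b1)// RintegralZl//.
  have := (haar_cint_shift htheta (- z) (cs_cintble hGint htheta ch)).2.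
  by rewrite !cint_real => -[->].
by rewrite (le_trans b2)// RintegralZl.
Qed.

Lemma convolution_tilde_out (Kp : set G) x : (forall x, ~ Kp x -> phi x = 0) ->
  ~ minkowski_diff Kp Kp x -> convolution m phi (tilde phi) x = 0.
Proof.
move=> p0 nx; rewrite convolution_tildeE -[RHS](cint0 m setT); apply: cint_eq => y _.
have [Ky|/p0 ->] := pselect (Kp y); last by rewrite mul0r.
have [Kx|/p0 ->] := pselect (Kp (y - x)); last by rewrite conj0 mulr0.
by case: nx; exists y => //; exists (y - x) => //; rewrite subKr.
Qed.

(** For fixed [phi] and [W] only finitely many lattice points enter, so the estimate of [corr_diff]
    sums to a bound whose factor [T] serves all pairs [f], [g]. *)
Lemma gam_diff : exists2 T : R, 0 <= T & forall f g (h : Gint -> R) (c1 : R),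
  cintble theta setT f -> cintble theta setT g ->
  (forall y, ~ W y -> f y = 0) -> (forall y, ~ W y -> g y = 0) ->
  (forall y, nrm (f y) <= c1) -> (forall y, nrm (g y) <= c1) ->
  continuous_cs (fun y => (h y)%:C : C) -> (forall y, nrm (f y - g y) <= h y) ->
  nrm (Gam f - Gam g) <= T * (2 * c1 * \int[theta]_(y in setT) h y).
Proof.
have [_ [Kp cKp p0]] := (csP hG phi).1 cphi.
have [Z [uZ ZL _ gZ]] := gam_list m theta hLt F cW (compact_diff cKp cKp).
have k0 := fun x => @convolution_tilde_out Kp x p0.
exists (\sum_(z <- Z) nrm (Cov * convolution m phi (tilde phi) z.1)).
  by apply: sumr_ge0 => z _; exact: nrm_ge0.
move=> f g h c1 fi gi fW gW fc gc ch fh.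
rewrite !gZ// -sumrB (le_trans (nrm_sum _ _ _))// mulr_suml; apply: ler_sum => z _.
rewrite (mulrAC _ (corr theta f z.2)) (mulrAC _ (corr theta g z.2)) -mulrBr [leLHS]nrmM.
by apply: ler_wpM2l; [exact: nrm_ge0|exact: corr_diff].
Qed.

(** The bridge from [b] to the continuous functions to which [nn_per] applies. Besides the closeness
    of all quantities it gives a small autocorrelation of [b - f1], which [parseval_apx] needs. *)
Lemma apx_gam (e : R) : 0 < e -> exists f1, [/\ continuous_cs f1,
  apx theta W (c + c) (fun y => b y - f1 y), nrm (Gam b - Gam f1) <= e,
  nrm (Gam (fun y => b y - f1 y)) <= e &
  forall eta, nrm (fourier theta b eta - fourier theta f1 eta) <= e].
Proof.
move=> e0; have [T T0 hT] := gam_diff; have [mb bc bW ha] := ab.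
have c0 := apx_bound_ge0 ab.
(* [4 * c] is the factor [2 * c1] of [gam_diff] for [c1 = c + c], the bound on [b - f1]. *)
have T1 : 0 < 4 * c * T + 1 by rewrite ltr_wpDl// !mulr_ge0.
have [f1 [h [cf1 f1c f1W [ch fh he]]]] := ha _ (divr_gt0 e0 T1).
have bi := apx_cintble hGint htheta cW ab.
have cf1' : continuous_cs f1 by apply/(csP hGint); split => //; exists W.
have f1i := cs_cintble hGint htheta cf1'.
have I0 : 0 <= \int[theta]_(y in setT) h y.
  by apply: Rintegral_ge0 => y _; rewrite (le_trans (nrm_ge0 _) (fh y)).
have main (c1 : R) : 0 <= c1 -> c1 <= c + c -> T * (2 * c1 * \int[theta]_(y in setT) h y) <= e.
  move=> c10 c12; apply: (@le_trans _ _ ((4 * c * T) * (e / (4 * c * T + 1)))).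
    rewrite (_ : T * _ = (2 * c1 * T) * \int[theta]_(y in setT) h y); last by ring.
    by apply: ler_pM => //; [rewrite !mulr_ge0|rewrite ler_wpM2r//; lra].
  by rewrite mulrCA ger_pMr// ler_pdivrMr// mul1r lerDl.
have asub := apx_sub ab cf1 f1c f1W.
exists f1; split => //.
- by rewrite (le_trans (hT b f1 h c bi f1i bW f1W bc f1c ch fh))// main// lerDl.
- have [_ dc dW _] := asub.
  have z0 : Gam (fun=> 0) = 0.
    rewrite /gam; apply: big1 => z _; rewrite /corr.
    rewrite (_ : cint theta setT _ = 0) ?mulr0 ?mul0r//.
    exact: cint0.
  rewrite -[X in nrm X]subr0 -z0.
  have n0 (y : Gint) : nrm (0 : C) <= c + c by rewrite nrm0 addr_ge0.
  have f0 (y : Gint) : nrm ((b y - f1 y) - 0) <= h y by rewrite subr0.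
  rewrite (le_trans (hT (fun y => b y - f1 y) (fun=> 0) h (c + c)
    (cintbleB measurableT bi f1i) (cintble_cst0 _ _) dW (fun _ _ => erefl) dc n0 ch f0))//.
  by apply: main => //; rewrite addr_ge0.
- move=> eta; rewrite -fourier_sub//.
  rewrite (le_trans (nrm_fourier eta (cintbleB measurableT bi f1i) ch fh))//.
  rewrite (le_trans he)// ler_pdivrMr// ler_peMr ?(ltW e0)// lerDr !mulr_ge0//.
Qed.

Lemma gam_real : Gam b = (complex.Re (Gam b))%:C.
Proof.
apply: nrm_le_eq => e e0; have [f1 [cf1 _ h _ _]] := apx_gam e0.
apply: le_trans h; rewrite (nn_per cf1); apply: (le_trans (nrm_ReIm _)); apply: (le_trans _ (Im_nrm _)).
by case: (Gam b) => x y /=; rewrite subrr normr0 add0r oppr0 addr0.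
Qed.

Lemma energy_per f (P : seq (DG * DGint)) : continuous_cs f -> (forall p, p \in P -> dual p) ->
  energy S (map psi P) (per Lt (tens phi f)) =
  \sum_(p <- P) nrm (q p * fourier theta f p.2) ^+ 2.
Proof.
move=> cf dP; rewrite /energy big_map; apply: eq_big_seq => p /dP dp.
by rewrite ip_per// mulrA.
Qed.

(** As [P] is fixed before the approximation is chosen, a small error on each coefficient is enough;
    [sqr_drop] transfers it to the squares. *)
Lemma bessel_apx (P : seq (DG * DGint)) : uniq P -> (forall p, p \in P -> dual p) ->
  \sum_(p <- P) nrm (q p * fourier theta b p.2) ^+ 2 <= complex.Re (Gam b).
Proof.
move=> uP dP; pose T := \sum_(p <- P) nrm (q p) ^+ 2 * (2 * nrm (fourier theta b p.2)).
have T0 : 0 <= T by apply: sumr_ge0 => p _; rewrite mulr_ge0 ?sqr_ge0// mulr_ge0 ?nrm_ge0.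
have T1 : 0 < T + 1 by rewrite ltr_wpDl.
apply/ler_addgt0Pr => d d0; have e0 := divr_gt0 d0 T1; set e := d / (T + 1) in e0.
have [f1 [cf1 _ h1 _ h2]] := apx_gam e0.
have VF := mfunX_per hLt (nice_tens hLt cphi cf1).
have cl : char_list S (map psi P).
  split; first by rewrite map_inj_uniq//; exact: psi_inj.
  by move=> f /mapP[p /dP dp ->]; exact: psi_char.
have := bessel (S := S) VF cl; rewrite energy_per// => hb.
rewrite (nn_per cf1) in h1.
have g1 : nn S (per Lt (tens phi f1)) <= complex.Re (Gam b) + e.
  have := le_trans (Re_nrm _) h1; rewrite ReB /= ler_norml => /andP[]; lra.
apply: (@le_trans _ _ (\sum_(p <- P) (nrm (q p * fourier theta f1 p.2) ^+ 2 +
    e * (nrm (q p) ^+ 2 * (2 * nrm (fourier theta b p.2)))))).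
  apply: ler_sum => p _; have := h2 p.2.
  have := nrm_dist (fourier theta b p.2) (fourier theta f1 p.2).
  rewrite !nrmM; set nb := nrm (fourier theta b _); set nf := nrm (fourier theta f1 _) => a1 a2.
  have := le_trans a1 a2; rewrite ler_norml => /andP[_ a3].
  have nb0 : 0 <= nb := nrm_ge0 _; have nf0 : 0 <= nf := nrm_ge0 _.
  have -> : e * ((nrm Cov * nrm (fourier m phi p.1)) ^+ 2 * (2 * nb)) =
    (nrm Cov * nrm (fourier m phi p.1)) ^+ 2 * (2 * nb * e) by ring.
  rewrite ![(_ * _ * _) ^+ 2]exprMn -mulrDr ler_wpM2l ?sqr_ge0//.
  exact: sqr_drop.
rewrite big_split /= -mulr_sumr -/T.
have eT : e * T + e = d by rewrite /e; field; rewrite gt_eqF.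
rewrite -eT; apply: (@le_trans _ _ (complex.Re (Gam b) + e + e * T)); last lra.
by rewrite lerD2r (le_trans hb).
Qed.

End Window.

Lemma char_list_dual (l : seq (X -> C)) : char_list S l -> exists P : seq (DG * DGint),
  [/\ uniq P, forall p, p \in P -> dual p & map psi P = l].
Proof.
move=> [ul cl]; suff [P dP E] : exists2 P, (forall p, p \in P -> dual p) & map psi P = l.
  by exists P; split => //; apply: (@map_uniq _ _ psi); rewrite E.
elim: l cl {ul} => [|f l IH] cl; first by exists [::].
have [|P dP E] := IH; first by move=> g gl; apply: cl; rewrite inE gl orbT.
have [p dp pf] := char_psi (cl f (mem_head _ _)).
exists (p :: P); last by rewrite /= pf E.
by move=> p'; rewrite inE => /orP[/eqP ->|/dP].
Qed.

(** Here [P] comes from Parseval for [f1], so its length is not known when [f1] is chosen. The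
    coefficients of [b - f1] on [P] are therefore bounded together, by [bessel_apx] for [b - f1]. *)
Lemma parseval_apx (W : set Gint) (b : Gint -> C) (c e : R) : compact W -> apx theta W c b -> 0 < e ->
  exists P : seq (DG * DGint), [/\ uniq P, forall p, p \in P -> dual p &
  complex.Re (gam m theta Lt F b (convolution m phi (tilde phi))) - e <=
    \sum_(p <- P) nrm (Cov * fourier m phi p.1 * fourier theta b p.2) ^+ 2].
Proof.
move=> cW ab e0; set g := complex.Re _.
have bes (P : seq (DG * DGint)) := bessel_apx cW ab (P := P).
have g0 : 0 <= g by have := bes [::] isT; rewrite big_nil; apply.
have g1 : 0 < 2 * (g + 1) by rewrite mulr_gt0// ltr_wpDl.
(* [t] weighs the inequality [(x + y) ^+ 2 <= (1 + t) * x ^+ 2 + (1 + t^-1) * y ^+ 2] so that the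
   excess [t * g] costs at most [e / 2]. *)
pose t := e / (2 * (g + 1)); have t0 : 0 < t by rewrite divr_gt0.
pose u := t^-1; have u0 : 0 < u by rewrite invr_gt0.
have u3 : 0 < 2 * (3 + u) by rewrite mulr_gt0// addr_gt0.
(* The error [e'] enters once from Parseval, once from [nn_per] and [1 + u] times from [b - f1],
   altogether [(3 + u) * e' = e / 2]. *)
pose e' := e / (2 * (3 + u)); have e'0 : 0 < e' by rewrite divr_gt0.
have [f1 [cf1 asub h1 h2 h3]] := apx_gam cW ab e'0.
have VF := mfunX_per hLt (nice_tens hLt cphi cf1).
have [l cl hl] := parseval (S := S) VF e'0.
have [P [uP dP E]] := char_list_dual cl.
exists P; split => //; rewrite -E energy_per// in hl.
have bP := bes P uP dP; have dPb := bessel_apx cW asub uP dP.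
rewrite (nn_per cf1) in h1.
have bi := apx_cintble hGint htheta cW ab; have f1i := cs_cintble hGint htheta cf1.
have a1 : g - e' <= nn S (per Lt (tens phi f1)).
  by have := le_trans (Re_nrm _) h1; rewrite ReB /= ler_norml -/g => /andP[]; lra.
have a2 : \sum_(p <- P) nrm (Cov * fourier m phi p.1 *
    fourier theta (fun y => b y - f1 y) p.2) ^+ 2 <= e'.
  by rewrite (le_trans dPb)// (le_trans (ler_norm _))// (le_trans (Re_nrm _)).
have a3 : \sum_(p <- P) nrm (Cov * fourier m phi p.1 * fourier theta f1 p.2) ^+ 2 <=
    (1 + t) * \sum_(p <- P) nrm (Cov * fourier m phi p.1 * fourier theta b p.2) ^+ 2 +
    (1 + u) * \sum_(p <- P) nrm (Cov * fourier m phi p.1 *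
      fourier theta (fun y => b y - f1 y) p.2) ^+ 2.
  rewrite !mulr_sumr -big_split; apply: ler_sum => p _.
  have E2 (x y : C) : nrm (x * y) ^+ 2 = nrm x ^+ 2 * nrm y ^+ 2 by rewrite nrmM exprMn.
  rewrite fourier_sub// 3!(E2 (_ * _)).
  have := nrmB (fourier theta b p.2) (fourier theta b p.2 - fourier theta f1 p.2).
  rewrite subKr; set k := nrm (_ * _) ^+ 2; have k0 : 0 <= k := sqr_ge0 _.
  set nf := nrm (fourier theta f1 _); set nb := nrm (fourier theta b _); set nd := nrm (_ - _).
  move=> nfb; have nf0 : 0 <= nf := nrm_ge0 _.
  have nb0 : 0 <= nb := nrm_ge0 _; have nd0 : 0 <= nd := nrm_ge0 _.
  have EE : (1 + t) * (k * nb ^+ 2) + (1 + u) * (k * nd ^+ 2) =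
    k * ((1 + t) * nb ^+ 2 + (1 + u) * nd ^+ 2) by ring.
  apply: (@le_trans _ _ (k * ((1 + t) * nb ^+ 2 + (1 + u) * nd ^+ 2))); last by rewrite -EE.
  rewrite ler_wpM2l// (@le_trans _ _ ((nb + nd) ^+ 2))// ?ler_pXn2r ?nnegrE ?addr_ge0//.
  have := mulr_ge0 (ltW u0) (sqr_ge0 (t * nb - nd)).
  have -> : u * (t * nb - nd) ^+ 2 = t * nb ^+ 2 - 2 * nb * nd + u * nd ^+ 2.
    by rewrite /u; field; rewrite gt_eqF.
  lra.
have a4 : (3 + u) * e' = e / 2 by rewrite /e'; field; rewrite gt_eqF// addr_gt0.
have a5 : t * g <= e / 2.
  rewrite /t invfM mulrA -[_ * g]mulrA ger_pMr ?divr_gt0// mulrC ler_pdivrMr ?ltr_wpDl//; lra.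
have a6 := ler_wpM2l (ltW t0) bP.
have a7 : (1 + u) * \sum_(p <- P) nrm (Cov * fourier m phi p.1 *
    fourier theta (fun y => b y - f1 y) p.2) ^+ 2 <= (1 + u) * e'.
  by rewrite ler_wpM2l// ltW// addr_gt0.
move: hl a1 a3 a4 a5 a6 a7; rewrite -/g !mulrDl !mul1r; clear; lra.
Qed.

End TestFunction.

End Parseval.

(** * The dual group *)

Section DualTopology.
Context {R : realType} {G : topologicalZmodType}.
Variable m : {measure set (borel G) -> \bar R}.
Hypotheses (hG : lcag G) (hm : haar m).
Local Notation C := (R[i]^o).
Local Notation DG := (dual_group R G).
Implicit Types chi eta : DG.

(** On continuous functions the compact-open topology is that of uniform convergence on compact
    sets. *)
Lemma dual_nbhs (K : set G) chi (e : R) : compact K -> 0 < e ->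
  nbhs chi [set eta : DG | forall x, K x -> nrm (eta x - chi x) < e].
Proof.
move=> cK e0.
have c1 : (fun eta : DG => char_fun eta : {compact-open, G -> C}) @ chi -->
    (char_fun chi : {compact-open, G -> C}) by exact: initial_continuous.
have c2 := (compact_open_fam_compactP (@char_continuous _ _ chi) (fmap_filter _ (nbhs_filter chi))).1 c1.
have h := (fam_cvgP _ _ (fmap_filter _ (nbhs_filter chi))).1 c2 K cK.
apply: (h [set g : G -> C | forall x, K x -> nrm (g x - chi x) < e]).
apply/uniform_nbhs; exists [set xy : C * C | nrm (xy.2 - xy.1) < e]; split; last by [].
have ec : 0 < e%:C :> C by rewrite ltcR.
have := @entourage_ball _ C (PosNum ec); apply: filterS => -[x y] /=.
move=> xy; have {}xy : `|x - y| < e%:C := xy.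
by move: xy; rewrite distrC normE ltcR.
Qed.

Lemma dual_hausdorff : hausdorff_space DG.
Proof.
move=> p q pq; apply: char_eq => x; apply: nrm_le_eq => e e0.
have e20 : 0 < e / 2 by rewrite divr_gt0.
have [chi [/(_ x erefl) h1 /(_ x erefl) h2]] := pq _ _
  (dual_nbhs p (@compact_set1 G x) e20) (dual_nbhs q (@compact_set1 G x) e20).
rewrite (le_trans (nrm_split (chi x) _ _))// [leRHS]splitr lerD//; last exact: ltW.
by rewrite nrm_sym ltW.
Qed.

Lemma dual_closed (A : set DG) : closed A -> measurable (A : set (borel DG)).
Proof.
move=> cA; rewrite -(setCK A); apply: measurableC.
by apply: sub_sigma_algebra; exact: closed_openC.
Qed.

Lemma dual_compact (K : set DG) : compact K -> measurable (K : set (borel DG)).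
Proof. by move=> cK; apply: dual_closed; exact: compact_closed dual_hausdorff cK. Qed.

Lemma dual_set1 chi : measurable ([set chi] : set (borel DG)).
Proof. by apply: dual_compact; exact: compact_set1. Qed.

Lemma dual_continuous (f : DG -> R) : continuous f ->
  measurable_fun setT (f : borel DG -> R).
Proof.
move=> cf; apply: (measurability (@RGenOInfty.G R)); first exact: RGenOInfty.measurableE.
move=> _ [_ [x ->] <-]; rewrite setTI; apply: sub_sigma_algebra.
by apply: open_comp => [y _|]; [exact: cf|exact: interval_open].
Qed.

(** The Fourier transform at the opposite character, the form in which it enters the transform of a
    measure; there is no conjugation. *)
Definition four (phi : G -> C) chi : C := cint m setT (fun x => phi x * chi x).

Lemma fourierN phi chi : fourier m phi (- chi) = four phi chi.
Proof. by rewrite fourierE; apply: cint_eq => x _; rewrite /= conjK. Qed.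

Definition power (phi : G -> C) chi : R := sqnorm (fourier m phi (- chi)).

Lemma powerE phi chi : power phi chi = nrm (four phi chi) ^+ 2.
Proof. by rewrite /power fourierN. Qed.

Lemma power_ge0 phi chi : 0 <= power phi chi. Proof. exact: sqr_ge0. Qed.

Lemma mul_char_cintble phi chi : cintble m setT phi -> cintble m setT (fun x => phi x * chi x).
Proof.
move=> fi; apply: (cintbleM (c := 1)) => //; last by move=> x _; rewrite char_nrm.
by apply: cmeas_continuous; exact: char_continuous.
Qed.

Lemma four_continuous phi : continuous_cs phi -> continuous (four phi).
Proof.
move=> cphi chi; apply/continuous_nrm => e e0.
have [B B0 hB] := cs_bounded hG cphi; have [cp [K cK pK]] := (csP hG phi).1 cphi.
have mK := borel_compact hG cK; have Kfin := haar_lty hm cK.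
have M0 : 0 <= B * fine (m K) by rewrite mulr_ge0// fine_ge0.
have M1 : 0 < B * fine (m K) + 1 by rewrite ltr_wpDl.
have d0 := divr_gt0 e0 M1; have := dual_nbhs chi cK d0.
apply: filterS => eta h.
have fi := cs_cintble hG hm cphi.
rewrite /four -cintB//; try exact: mul_char_cintble.
apply: (@le_lt_trans _ _ ((B * (e / (B * fine (m K) + 1))) * fine (m K))).
  have E : forall x, phi x * eta x - phi x * chi x = phi x * (eta x - chi x) by move=> x; rewrite mulrBr.
  under eq_fun do rewrite E.
  apply: cint_layer => //.
  - apply: cmeasM; first exact: cmeas_continuous.
    by apply: cmeasB; apply: cmeas_continuous; exact: char_continuous.
  - move=> x; have [Kx|/pK ->] := pselect (K x); last by rewrite mul0r nrm0 mulr_ge0// ltW.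
    by rewrite nrmM ler_pM ?nrm_ge0//; exact/ltW/h.
  - by move=> x /pK ->; rewrite mul0r.
rewrite mulrAC mulrCA -[ltRHS]mulr1 ltr_pM2l// ltr_pdivrMr// mul1r ltrDl//.
Qed.

Lemma power_continuous phi : continuous_cs phi -> continuous (power phi).
Proof.
move=> cphi; have cn := nrm_continuous (four_continuous cphi).
have -> : power phi = fun chi : DG => nrm (four phi chi) * nrm (four phi chi).
  by apply/funext => chi; rewrite powerE expr2.
by move=> chi; exact: (cvgM (cn chi) (cn chi)).
Qed.

Lemma power_measurable phi : continuous_cs phi -> measurable_fun setT (power phi : borel DG -> R).
Proof. by move=> cphi; apply: dual_continuous; exact: power_continuous. Qed.

(** The value 2 gives the power 4, strictly above 1, so that the power stays above 1 in a
    neighbourhood of [chi]. *)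
Lemma test_function : exists2 g : G -> R, continuous_cs (fun x => (g x)%:C : C) &
  forall chi, four (fun x => (g x)%:C * (chi x)^*) chi = 2.
Proof.
have [w [E [cw w0 wN [cE _ _ wE w1]]]] := unit_weight hG hm.
exists (fun x => 2 * w x).
  apply/(csP hG); split; last by exists E => // x /wE ->; rewrite mulr0.
  by apply: real_complex_continuous => x; apply: cvgM; [exact: cvg_cst|exact: cw].
move=> chi; rewrite /four.
transitivity (cint m setT (fun x => (2 * w x)%:C : C)).
  by apply: cint_eq => x _; rewrite -mulrA [_^* * _]mulrC mulJ char_nrm expr1n mulr1.
have wi : m.-integrable setT (EFin \o w).
  have wcs : continuous_cs (fun x => (w x)%:C : C).
    by apply/(csP hG); split; [exact: real_complex_continuous|exists E => // x /wE ->].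
  exact: (cs_cintble hG hm wcs).1.
by rewrite cint_real RintegralZl// w1 mulr1 rmorph_nat.
Qed.

(** Finitely many test functions see every character of [K]. This bounds the mass of [K] by finitely
    many values of the autocorrelation, and it detects null sets inside [K]. *)
Lemma test_family (K : set DG) : compact K -> exists Phi : seq (G -> C),
  (forall phi, phi \in Phi -> continuous_cs phi) /\
  forall chi, K chi -> 1 <= \sum_(phi <- Phi) power phi chi.
Proof.
move=> cK; have [g cg hg] := test_function.
pose phi chi x : C := (g x)%:C * (chi x)^*.
have cphi chi : continuous_cs (phi chi) by apply: cs_mulr => //; exact: char_conj_cont.
have nb chi : K chi -> nbhs chi [set eta | 1 < power (phi chi) eta].
  move=> _; have := power_continuous (cphi chi) (x := chi).
  move=> /(_ [set r | 1 < r]); apply; apply: open_nbhs_nbhs; split; first exact: open_gt.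
  rewrite /= powerE hg (_ : 2 = (2 : R)%:C) ?nrmR; first by rewrite ger0_norm// expr2; lra.
  by rewrite rmorph_nat.
have [s _ hs] := compact_finite_cover cK nb.
exists [seq phi chi | chi <- s]; split; first by move=> _ /mapP[chi _ ->].
move=> eta /hs[chi sc /= h]; rewrite big_map (big_rem chi)//=.
by rewrite (le_trans (ltW h))// lerDl sumr_ge0// => *; exact: power_ge0.
Qed.

End DualTopology.

(** * Atoms of a spectral measure *)


Section CountableIntegral.
Context {d : measure_display} {T : measurableType d} {R : realType}.
Variable nu : {measure set T -> \bar R}.
Hypothesis m1 : forall x : T, measurable [set x].

Lemma integral_countable (N : set T) (f : T -> R) : countable N -> (forall x, 0 <= f x) ->
  measurable_fun setT f ->
  (measurable N /\ \int[nu]_(x in N) (f x)%:E = \esum_(x in N) ((f x)%:E * nu [set x]))%E.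
Proof.
move=> /countable_injP[e einj] f0 mf.
pose J n := N `&` [set x | e x = n].
have JE n : J n = set0 \/ exists2 x, N x & J n = [set x].
  have [[x [Nx ex]]|h] := pselect (exists x, N x /\ e x = n); [right|left].
    exists x => //; apply/seteqP; split => [y [Ny ey]|y ->] //.
    by apply: einj; rewrite ?inE// ey.
  by apply/seteqP; split => // y [Ny ey]; apply: h; exists y.
have mJ n : measurable (J n) by have [->|[x _ ->]] := JE n.
have tJ : trivIset setT J.
  by move=> i j _ _ [x [[_ <-] [_ <-]]].
have NE : N = \bigcup_n J n.
  apply/seteqP; split => [x Nx|x [n _ []]//]; by exists (e x).
have mN : measurable N by rewrite NE; exact: bigcupT_measurable.
split => //; have mE : measurable_fun setT (EFin \o f) by exact/measurable_EFinP.
have mE' : measurable_fun (\bigcup_n J n) (EFin \o f) by exact: measurable_funS mE.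
have ge x : (\bigcup_n J n) x -> (0 <= (EFin \o f) x)%E by rewrite lee_fin.
rewrite NE (ge0_integral_bigcup nu mJ mE' ge tJ).
rewrite nneseries_sum_bigcup//; last by move=> x; rewrite mule_ge0// lee_fin.
apply: eq_eseriesr => n _; have [->|[x _ ->]] := JE n.
  by rewrite integral_set0 esum_set0.
rewrite esum_set1 ?mule_ge0 ?lee_fin// (eq_integral (cst (f x)%:E)); last by move=> y; rewrite inE => ->.
by rewrite integral_cst.
Qed.

End CountableIntegral.

Section Riemann.
Context {R : realType} {G : topologicalZmodType}.
Variables (m : {measure set (borel G) -> \bar R}) (D : nat -> set G).
Hypotheses (hG : lcag G) (hm : haar m) (hD : van_hove m D).
Local Notation C := (R[i]^o).
Local Notation DG := (dual_group R G).

(** As in [meanX_riemann], but the weights are nonnegative with sum 1: such combinations never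
    exceed the bound of the function, which dominated convergence will need. *)
Lemma avg_riemann n (U : set G) : nbhs 0 U -> exists l : seq (R * G),
  [/\ forall p, p \in l -> 0 <= p.1, \sum_(p <- l) p.1 = 1 &
  forall (f : G -> C) (c e : R), continuous f -> (forall x, nrm (f x) <= c) ->
  (forall x u, U u -> nrm (f (x + u) - f x) <= e) ->
  nrm (avg m D n f - \sum_(p <- l) p.1%:C * f p.2) <= e].
Proof.
move=> nU; have V0 := vol_gt0 hm hD n.
have [B [oB B0] BU] : exists2 B : set G, open_nbhs 0 B & B `<=` U by move: nU; rewrite nbhsE.
have nB : nbhs 0 B by exact: open_nbhs_nbhs.
have cDn : compact (D n) by exact: (vh_compact hD).
have [s _ hs] := compact_finite_cover (U := fun x y => B (y - x)) cDn
  (fun x _ => nbhs0_unshift x nB).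
suff [l [l0 l1 hl]] : exists l : seq (R * G), [/\ forall p, p \in l -> 0 <= p.1,
    \sum_(p <- l) p.1 = vol m D n & forall (f : G -> C) (c e : R), continuous f ->
    (forall x, nrm (f x) <= c) -> (forall x u, U u -> nrm (f (x + u) - f x) <= e) ->
    nrm (cint m (D n) f - \sum_(p <- l) p.1%:C * f p.2) <= e * vol m D n].
  exists [seq ((vol m D n)^-1 * p.1, p.2) | p <- l]; split.
  - by move=> _ /mapP[p pl ->] /=; rewrite mulr_ge0 ?invr_ge0 ?(ltW V0)// l0.
  - by rewrite big_map /= -mulr_sumr l1 mulVf// gt_eqF.
  - move=> f c e cf fc fU; rewrite big_map /= /avg.
    have -> : \sum_(p <- l) ((vol m D n)^-1 * p.1)%:C * f p.2 =
        ((vol m D n)^-1)%:C * \sum_(p <- l) p.1%:C * f p.2.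
      by rewrite mulr_sumr; apply: eq_bigr => p _; rewrite rmorphM mulrA.
    by rewrite -mulrBr vol_inv// ler_pdivrMr// (hl f c).
have cov : forall y, D n y -> exists2 x, x \in s & B (y - x) by move=> y /hs.
suff gen (r : seq G) (A : set G) : (forall y, A y -> exists2 x, x \in r & B (y - x)) ->
    measurable (A : set (borel G)) -> (m A < +oo)%E ->
    exists l : seq (R * G), [/\ forall p, p \in l -> 0 <= p.1,
    \sum_(p <- l) p.1 = fine (m A) & forall (f : G -> C) (c e : R), continuous f ->
    (forall x, nrm (f x) <= c) -> (forall x u, U u -> nrm (f (x + u) - f x) <= e) ->
    nrm (cint m A f - \sum_(p <- l) p.1%:C * f p.2) <= e * fine (m A)].
  by apply: (gen s (D n)) => //; [exact: (vh_measurable hG hD)|exact: (vh_lty hm hD)].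
elim: r A => [|x r IH] A covA mA Afin.
  have A0 : A = set0 by apply/seteqP; split => // y /covA[].
  exists [::]; rewrite A0 measure0 /= big_nil; split => // f c e _ _ _.
  by rewrite big_nil subr0 mulr0 /cint !Rintegral_set0 nrm0.
pose A1 := A `&` translate x B; pose A2 := A `\` translate x B.
have mtB : measurable (translate x B : set (borel G)).
  by apply: borel_open; exact: open_translate.
have mA1 : measurable (A1 : set (borel G)) by exact: measurableI.
have mA2 : measurable (A2 : set (borel G)) by exact: measurableD.
have A1fin : (m A1 < +oo)%E.
  by apply: le_lt_trans Afin; apply: measure_mono => //; move=> y [].
have A2fin : (m A2 < +oo)%E.
  by apply: le_lt_trans Afin; apply: measure_mono => //; move=> y [].
have A12 : A = A1 `|` A2.
  apply/seteqP; split => [y Ay|y [[]//|[]//]].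
  by have [h|h] := pselect (translate x B y); [left|right].
have dis : [disjoint A1 & A2].
  by apply/disj_setPS => y [[_ h1'] [_ h2']].
have [|l [l0 l1 hl]] := IH A2 _ mA2 A2fin.
  move=> y [/covA[z]]; rewrite inE => /orP[/eqP -> Bz []|zs Bz _]; last by exists z.
  by rewrite translateE.
have fin1 : m A1 \is a fin_num by rewrite ge0_fin_numE.
have fin2 : m A2 \is a fin_num by rewrite ge0_fin_numE.
have EA : fine (m A) = fine (m A1) + fine (m A2).
  rewrite -fineD// -measureU//; first by rewrite -A12.
  exact/disj_set2P.
exists ((fine (m A1), x) :: l); split.
- by move=> p; rewrite inE => /orP[/eqP -> /=|/l0//]; exact: fine_ge0.
- by rewrite big_cons /= l1 EA.
move=> f c e cf fc fU.
have fi : cintble m A f by exact: (bounded_cintble mA Afin cf fc).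
have fi1 : cintble m A1 f by exact: (bounded_cintble mA1 A1fin cf fc).
rewrite EA {1}A12 cintU//; last by rewrite -A12.
rewrite big_cons /= opprD addrACA mulrDr (le_trans (nrmD _ _))// lerD//; last exact: (hl f c).
have -> : cint m A1 f - (fine (m A1))%:C * f x = cint m A1 (fun y => f y - f x).
  have ci : cintble m A1 (fun=> f x).
    by apply: (cintble_fin mA1 A1fin (c := nrm (f x))) => //; exact: cmeas_cst.
  by rewrite cintB// cint_cst.
apply: nrm_cint_le => //.
  apply: cmeasB; last exact: cmeas_cst.
  by apply: cmeasS (cmeas_continuous cf) => //; exact: measurableT.
move=> y [_]; rewrite translateE => By.
by have := fU x _ (BU _ By); rewrite addrCA subrr addr0.
Qed.

(** A shift by [t] multiplies the average by [eta t], which can be chosen different from 1, while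
    averages are asymptotically shift invariant. *)
Lemma avg_char (eta : DG) (e : R) : eta != 0 -> 0 < e -> exists N, forall n, (N <= n)%N ->
  nrm (avg m D n eta) <= e.
Proof.
move=> eta0 e0; have [t ht] : exists t, eta t != 1.
  apply: contrapT => /forallNP h; move/eqP: eta0; apply; apply: char_eq => x.
  by apply/eqP; apply: contrapT => /negP; exact: h.
have t0 : 0 < nrm (eta t - 1) by rewrite nrm_gt0 subr_eq0.
have n1 x : nrm (eta x) <= 1 by rewrite char_nrm.
have [N hN] := avg_shift hG hm hD t (@char_continuous _ _ eta) n1 (mulr_gt0 e0 t0).
exists N => n /hN; have -> : avg m D n (fun x => eta (x + t)) = eta t * avg m D n eta.
  rewrite /avg mulrCA; congr (_ * _); rewrite -cintZ.
  - by apply: cint_eq => x _; rewrite charD mulrC.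
  - exact: (vh_measurable hG hD).
  - apply: (bounded_cintble _ _ (@char_continuous _ _ eta) n1); first exact: (vh_measurable hG hD).
    exact: (vh_lty hm hD).
by rewrite -[X in _ - X]mul1r -mulrBl nrmM mulrC ler_pM2r.
Qed.

(* Averaging the translates of a modulated bump along the van Hove sequence
   isolates a single character. *)
Lemma atom_tests chi0 : exists (phi : nat -> G -> C) (phi0 : G -> C),
  [/\ forall n, continuous_cs (phi n), continuous_cs phi0, power m phi0 chi0 = 4,
   forall n chi, power m (phi n) chi <= power m phi0 chi &
   forall chi, (fun n => power m (phi n) chi) @ \oo -->
     (if chi == chi0 then 4 else 0 : R)].
Proof.
have [g cg hg] := test_function hG hm.
pose phi0 x : C := (g x)%:C * (chi0 x)^*.
have cphi0 : continuous_cs phi0 by apply: cs_mulr => //; exact: char_conj_cont.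
have h4 : power m phi0 chi0 = 4.
  by rewrite powerE hg (_ : 2 = (2 : R)%:C) ?nrmR ?rmorph_nat// ger0_norm// -natrX.
have [gcont [Kg cKg gK]] := (csP hG _).1 cg.
have phiE (chi : DG) x : phi0 x * chi x = (g x)%:C * (chi - chi0) x.
  by rewrite /phi0 /= mulrAC mulrA.
have gi := cs_cintble hG hm cg.
have fourE (chi : DG) : four m phi0 chi = cint m setT (fun x => (g x)%:C * (chi - chi0) x).
  by apply: cint_eq => x _; exact: phiE.
have mi (chi : DG) t : cintble m setT (fun x : G => (g (x - t))%:C * (chi - chi0) x).
  by apply: mul_char_cintble; exact: (haar_cint_shift hm (- t) gi).1.
have shift (chi : DG) u : (chi - chi0) u * four m phi0 chi = cint m setT (fun x => (g (x - u))%:C * (chi - chi0) x).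
  rewrite fourE -(haar_cint_shift hm (- u) (mul_char_cintble (chi - chi0) gi)).2.
  rewrite -cintZ//; last exact: (haar_cint_shift hm (- u) (mul_char_cintble (chi - chi0) gi)).1.
  apply: cint_eq => x _; rewrite mulrCA -charD; congr (_ * _); congr (char_fun _ _).
  by rewrite addrC subrK.
have [V nV [cV _]] := lc_nbhs hG.
pose K2 := [set a + k | a in Kg & k in V] `|` Kg.
have cK2 : compact K2 by apply: compactU => //; exact: compact_add.
have K20 : 0 < fine (m K2) + 1 by rewrite ltr_wpDl// fine_ge0.
pose f (chi : DG) t : C := four m phi0 chi * (chi - chi0) t.
(* The modulus has to be uniform in [chi], because one list of weights must serve all characters at
   once; it is obtained from the modulus of [g] by moving the shift onto the test function. *)
have modulus (e : R) : 0 < e -> exists2 U, nbhs (0 : G) U & forall chi t u, U u ->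
    nrm (f chi (t + u) - f chi t) <= e.
  move=> e0; have [U1 nU1 hU1] := unif_of_cs cg (divr_gt0 e0 K20).
  exists ([set u | U1 (- u)] `&` V); first by apply: filterI => //; exact: nbhs0_opp.
  move=> chi t u [U1u Vu]; rewrite /f charD mulrCA [X in _ - X]mulrC -mulrBr nrmM char_nrm mul1r.
  have -> : four m phi0 chi * (chi - chi0) u - four m phi0 chi =
      cint m setT (fun x : G => ((g (x - u))%:C - (g x)%:C) * (chi - chi0) x).
    rewrite mulrC shift fourE -cintB//; first by apply: cint_eq => x _; rewrite mulrBl.
    by have := mi chi 0; under eq_fun do rewrite subr0.
  rewrite (le_trans (@cint_layer _ _ _ K2 _ (e / (fine (m K2) + 1)) _ _ _ _ _))//.
  - exact: borel_compact.
  - exact: haar_lty.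
  - apply: cmeasM; last by apply: cmeas_continuous; exact: char_continuous.
    have mg := cmeas_continuous gcont; have mgu := borel_cmeas_shift (- u) mg.
    by apply: cmeasB; [exact: mgu|exact: mg].
  - by move=> x; rewrite nrmM char_nrm mulr1; exact: hU1.
  - move=> x nx; rewrite gK; first rewrite gK ?subrr ?mul0r//.
      by move=> Kx; apply: nx; right.
    by move=> Kx; apply: nx; left; exists (x - u) => //; exists u => //; rewrite subrK.
  - by rewrite mulrAC ler_pdivrMr// ler_wpM2l ?(ltW e0)// lerDl.
have fc chi : continuous (f chi).
  by move=> t; apply: cvgM; [exact: cvg_cst|exact: char_continuous].
have fn chi t : nrm (f chi t) <= nrm (four m phi0 chi).
  by rewrite nrmM char_nrm mulr1.
have pick n : exists l : seq (R * G), [/\ forall p, p \in l -> 0 <= p.1, \sum_(p <- l) p.1 = 1 &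
    forall chi, nrm (avg m D n (f chi) - \sum_(p <- l) p.1%:C * f chi p.2) <= n.+1%:R^-1].
  have e0 : 0 < n.+1%:R^-1 :> R by rewrite invr_gt0 ltr0n.
  have [U nU hU] := modulus _ e0; have [l [l0 l1 hl]] := avg_riemann n nU.
  by exists l; split => // chi; apply: (hl _ _ _ (fc chi) (fn chi)) => x u; exact: hU.
have [l hl] := choice pick.
have sh0 t : continuous_cs (fun x => phi0 (x - t)) := cs_shift hG (- t) cphi0.
(* On the Fourier side this multiplies the transform of [phi0] by a Riemann sum for the average of
   [chi - chi0]: always 1 at [chi0], tending to 0 elsewhere. *)
pose phi n x : C := \sum_(p <- l n) (p.1%:C * (chi0 p.2)^*) * phi0 (x - p.2).
have cphi n : continuous_cs (phi n).
  rewrite /phi; elim: (l n) => [|p r IH].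
    have := csB hG cphi0 cphi0; congr continuous_cs.
    by apply/funext => x; rewrite big_nil subrr.
  have := cs_lin hG (p.1%:C * (chi0 p.2)^*) (sh0 p.2) IH; congr continuous_cs.
  by apply/funext => x; rewrite big_cons.
have four_phi n chi : four m (phi n) chi = \sum_(p <- l n) p.1%:C * f chi p.2.
  transitivity (cint m setT (fun x : G => \sum_(p <- l n) p.1%:C * ((g (x - p.2))%:C * (chi - chi0) x))).
    apply: cint_eq => x _; rewrite mulr_suml; apply: eq_bigr => p _.
    rewrite -!mulrA; congr (_ * _); rewrite /phi0 /= charD charN conjM conjK.
    rewrite mulrCA; congr (_ * _); rewrite [(chi0 x)^* * chi0 _]mulrC !mulrA.
    by rewrite [X in X * _ * _]mulrC mulJ char_nrm expr1n mul1r mulrC.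
  rewrite cint_sum//; last by move=> p; exact: cintbleZ.
  by apply: eq_bigr => p _; rewrite cintZ// -shift mulrC /f [X in _ = _ * X]mulrC mulrC.
have bnd n chi : nrm (\sum_(p <- l n) p.1%:C * f chi p.2) <= nrm (four m phi0 chi).
  have [l0 l1 _] := hl n; rewrite (le_trans (nrm_sum _ _ _))//.
  rewrite -[leRHS]mul1r -l1 mulr_suml big_seq [leRHS]big_seq; apply: ler_sum => p pl.
  by rewrite nrmM nrmR ger0_norm ?l0// ler_wpM2l ?l0.
exists phi, phi0; split => // [n chi|chi].
  by rewrite !powerE four_phi ler_pXn2r ?nnegrE ?nrm_ge0.
have [->|neq] := eqVneq chi chi0.
  have -> : (fun n => power m (phi n) chi0) = fun=> 4; last exact: cvg_cst.
  apply/funext => n; rewrite powerE four_phi -h4 powerE; congr (nrm _ ^+ 2).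
  transitivity (\sum_(p <- l n) p.1%:C * four m phi0 chi0).
    apply: eq_bigr => p _; congr (_ * _); rewrite /f subrr; exact: mulr1.
  have [_ l1 _] := hl n; rewrite -mulr_suml.
  have -> : \sum_(p <- l n) p.1%:C = 1 :> C by rewrite -rmorph_sum l1 rmorph1.
  by rewrite mul1r.
pose a n := nrm (\sum_(p <- l n) p.1%:C * f chi p.2).
have a0 : a @ \oo --> (0 : R).
  apply/cvgrPdist_lt => e e0.
  have eta0 : chi - chi0 != 0 by rewrite subr_eq0.
  have B1 : 0 < nrm (four m phi0 chi) + 1 by rewrite ltr_wpDl// nrm_ge0.
  have e30 : 0 < e / 3 by rewrite divr_gt0.
  have [N1 hN1] := avg_char eta0 (divr_gt0 e30 B1).
  have [N2 _ hN2] : \forall n \near \oo, n.+1%:R^-1 < e / 3 by exact: near_infty_natSinv_lt (PosNum e30).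
  exists (maxn N1 N2) => // n /=; rewrite geq_max => /andP[/hN1 n1 /hN2 /= n2].
  rewrite sub0r normrN ger0_norm ?nrm_ge0// /a.
  have [_ _ /(_ chi) h3] := hl n.
  have h4' : nrm (avg m D n (f chi)) <= e / 3.
    have -> : avg m D n (f chi) = four m phi0 chi * avg m D n (chi - chi0).
      rewrite /avg mulrCA; congr (_ * _); rewrite -cintZ//; first exact: (vh_measurable hG hD).
      apply: (bounded_cintble (c := 1)); first exact: (vh_measurable hG hD).
      - exact: (vh_lty hm hD).
      - exact: char_continuous.
      - by move=> x; rewrite char_nrm.
    rewrite nrmM (le_trans (ler_wpM2l (nrm_ge0 _) n1))// mulrCA ger_pMr// ler_pdivrMr// mul1r lerDl//.
  have := nrmB (avg m D n (f chi)) (avg m D n (f chi) - \sum_(p <- l n) p.1%:C * f chi p.2).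
  rewrite subKr => /le_lt_trans; apply.
  move: h3 h4' n2; move: (n.+1%:R^-1) => q; lra.
have -> : (fun n => power m (phi n) chi) = fun n => a n * a n.
  by apply/funext => n; rewrite powerE four_phi expr2.
by rewrite -[X in _ --> X](mulr0 (0 : R)); exact: (cvgM a0 a0).
Qed.

End Riemann.

(** * Purely atomic measures determined by their Fourier powers *)

Lemma finite_uniq_list (T : choiceType) (X : set T) : finite_set X ->
  exists2 s : seq T, uniq s & X = [set` s].
Proof.
move=> /finite_seqP[s ->]; exists (undup s); first exact: undup_uniq.
by apply/seteqP; split => x /=; rewrite mem_undup.
Qed.

Lemma fsum_EFin (R : realType) (T : choiceType) (s : seq T) (r : T -> R) : uniq s ->
  (\sum_(x \in [set` s]) (r x)%:E = (\sum_(x <- s) r x)%:E)%E.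
Proof. by move=> us; rewrite -fsbig_seq// sumEFin. Qed.

Lemma countable_setU (T : Type) (A B : set T) : countable A -> countable B -> countable (A `|` B).
Proof.
move=> cA cB; have -> : A `|` B = \bigcup_(i in [set: bool]) (if i then A else B).
  apply/seteqP; split => [x [Ax|Bx]|x [[] _ h]]; [by exists true|by exists false|by left|by right].
by apply: bigcup_countable => // -[].
Qed.

Section AtomicMeasure.
Context {R : realType} {d : measure_display} {T : measurableType d}.
Variables (L : set T) (a : T -> R).
Hypothesis a0 : forall x, 0 <= a x.

Lemma atomic_measure : exists nu : {measure set T -> \bar R},
  forall A, nu A = \esum_(x in A `&` L) (a x)%:E.
Proof.
pose ds (A : set T) : \bar R := \esum_(x in A `&` L) (a x)%:E.
have ds0 : ds set0 = 0%E by rewrite /ds set0I esum_set0.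
have dsge A : (0 <= ds A)%E by apply: esum_ge0 => x _; rewrite lee_fin.
have dsig : semi_sigma_additive ds.
  move=> F mF tF mU; have -> : ds (\bigcup_n F n) = (\sum_(i <oo) ds (F i))%E.
    have tr : trivIset setT (fun n => F n `&` L).
      by move=> i j _ _ [x [[Fi _] [Fj _]]]; apply: tF => //; exists x.
    rewrite /ds setI_bigcupl; apply: (nneseries_sum_bigcup tr) => x.
    by rewrite lee_fin.
  by apply: is_cvg_nneseries => n _ _.
pose mm := isMeasure.Build d T R ds ds0 dsge dsig.
pose nu : {measure set T -> \bar R} := HB.pack ds mm.
by exists nu.
Qed.

End AtomicMeasure.

Section Spectral.
Context {R : realType} {G : topologicalZmodType}.
Variables (m : {measure set (borel G) -> \bar R}) (D : nat -> set G).
Hypotheses (hG : lcag G) (hm : haar m) (hD : van_hove m D).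
Local Notation C := (R[i]^o).
Local Notation DG := (dual_group R G).
(** [Gam phi] stands for the autocorrelation at the convolution of [phi] with its tilde; [bes] and
    [par] are the two halves of Parseval's identity, phrased with finite lists since [L] may be
    uncountable. *)
Variables (L : set DG) (a : DG -> R) (Gam : (G -> C) -> R).
Hypotheses (a0 : forall chi, 0 <= a chi)
  (bes : forall phi (P : seq DG), continuous_cs phi -> uniq P -> (forall chi, chi \in P -> L chi) ->
    \sum_(chi <- P) power m phi chi * a chi <= Gam phi)
  (par : forall phi (e : R), continuous_cs phi -> 0 < e -> exists P : seq DG,
    [/\ uniq P, forall chi, chi \in P -> L chi &
        Gam phi - e <= \sum_(chi <- P) power m phi chi * a chi]).

Definition has_power (nu : {measure set (borel DG) -> \bar R}) := forall phi, continuous_cs phi ->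
  nu.-integrable setT (EFin \o power m phi) /\
  (\int[nu]_(chi in setT) (power m phi chi)%:E = (Gam phi)%:E)%E.

(** The lists with errors [n.+1%:R^-1] together exhaust [Gam phi]. A character outside all of them
    could be appended to each, so Bessel leaves it no power. *)
Lemma spectral_support phi : continuous_cs phi -> exists N : set DG,
  [/\ countable N, N `<=` L, (\esum_(chi in N) (power m phi chi * a chi)%:E = (Gam phi)%:E)%E &
      forall chi, L chi -> ~ N chi -> power m phi chi * a chi = 0].
Proof.
move=> cphi; have pa0 chi : 0 <= power m phi chi * a chi by rewrite mulr_ge0 ?power_ge0.
have e0 n : 0 < n.+1%:R^-1 :> R by rewrite invr_gt0 ltr0n.
have [P hP] := choice (fun n => par cphi (e0 n)).
exists (\bigcup_n [set` P n]); split.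
- by apply: bigcup_countable => // n _; exact/finite_set_countable/finite_seq.
- by move=> chi [n _ /=]; have [_ h _] := hP n; exact: h.
- apply/eqP; rewrite eq_le; apply/andP; split.
    apply: ge_ereal_sup => _ [X [fX XN] <-].
    have [s us Xs] := finite_uniq_list fX; rewrite Xs fsum_EFin// lee_fin.
    apply: bes => // chi cs; have [|n _ /=] := XN chi; first by rewrite Xs.
    by have [_ h _] := hP n; exact: h.
  apply/lee_addgt0Pr => e e1; rewrite -leeBlDr//.
  have [n _ hn] : \forall n \near \oo, n.+1%:R^-1 < e by exact: near_infty_natSinv_lt (PosNum e1).
  have {}hn := hn n (leqnn n); have [uP PL hPn] := hP n.
  apply: esum_ge; exists [set` P n]; first by split; [exact: finite_seq|move=> chi h; exists n].
  rewrite fsum_EFin// -EFinB lee_fin (le_trans _ hPn)// lerD2l lerN2; exact: ltW.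
- move=> chi Lchi nN; apply/eqP; rewrite eq_le pa0 andbT.
  apply/ler_addgt0Pr => e e1; rewrite add0r.
  have [n _ hn] : \forall n \near \oo, n.+1%:R^-1 < e by exact: near_infty_natSinv_lt (PosNum e1).
  have {}hn := hn n (leqnn n); have [uP PL hPn] := hP n.
  have : \sum_(eta <- chi :: P n) power m phi eta * a eta <= Gam phi.
    apply: bes => //=; first by rewrite uP andbT; apply/negP => h; apply: nN; exists n.
    by move=> eta; rewrite inE => /orP[/eqP ->//|/PL].
  rewrite big_cons; move: hPn hn; move: (n.+1%:R^-1) => q; lra.
Qed.

Lemma spectral_countable N : countable N -> measurable (N : set (borel DG)).
Proof.
move=> cN; have [] // := @integral_countable _ (borel DG) R (@mzero _ (borel DG) R)
  (@dual_set1 R G) N (fun=> 0) cN (fun=> lexx 0).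
Qed.

Lemma power_integral_countable (nu : {measure set (borel DG) -> \bar R}) N (f : DG -> R) :
  countable N -> (forall x, 0 <= f x) -> measurable_fun setT (f : borel DG -> R) ->
  (\int[nu]_(x in N) (f x)%:E = \esum_(x in N) ((f x)%:E * nu [set x]))%E.
Proof. by move=> cN f0 mf; exact: (integral_countable nu (@dual_set1 R G) cN f0 mf).2. Qed.

(** Local finiteness comes from [test_family] and Bessel, inner regularity from the compactness of
    finite sets, and the value of each integral from the countable support of its integrand. *)
Lemma spectral_exists : exists nu : {measure set (borel DG) -> \bar R}, [/\ radon nu, has_power nu &
  forall A, nu A = \esum_(chi in A `&` L) (a chi)%:E].
Proof.
have [nu nuE] := @atomic_measure R _ (borel DG) L a a0; exists nu.
have fin_le (P : seq DG) (A : set DG) : uniq P -> (forall chi, chi \in P -> A chi /\ L chi) ->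
    ((\sum_(chi <- P) a chi)%:E <= nu A)%E.
  move=> uP PA; rewrite nuE; apply: esum_ge; exists [set` P]; first by split; [exact: finite_seq|move=> chi /PA].
  by rewrite fsum_EFin.
split => //; first split.
- move=> K cK; have [Phi [cPhi hPhi]] := test_family hG hm cK.
  apply: (@le_lt_trans _ _ (\sum_(phi <- Phi) Gam phi)%:E); last exact: ltry.
  rewrite nuE; apply: ge_ereal_sup => _ [X [fX XK] <-].
  have [s us Xs] := finite_uniq_list fX; rewrite Xs fsum_EFin// lee_fin.
  apply: (@le_trans _ _ (\sum_(chi <- s) \sum_(phi <- Phi) power m phi chi * a chi)).
    rewrite big_seq [leRHS]big_seq; apply: ler_sum => chi cs.
    rewrite -mulr_suml ler_peMl//; apply: hPhi.
    by have [] : (K `&` L) chi by apply: XK; rewrite Xs.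
  rewrite exchange_big /= big_seq [leRHS]big_seq; apply: ler_sum => phi pP.
  apply: bes => //; first exact: cPhi.
  by move=> chi cs; have [] : (K `&` L) chi by apply: XK; rewrite Xs.
- move=> A mA; apply/eqP; rewrite eq_le; apply/andP; split; last first.
    apply: ge_ereal_sup => _ [K [cK KA] <-]; apply: le_measure => //; rewrite inE//.
    exact: dual_compact.
  rewrite [leLHS]nuE; apply: ge_ereal_sup => _ [X [fX XA] <-].
  have [s us Xs] := finite_uniq_list fX; rewrite Xs fsum_EFin//.
  apply: (@le_trans _ _ (nu [set` s])).
    by apply: fin_le => // chi cs; split => //; have [] : (A `&` L) chi by apply: XA; rewrite Xs.
  apply: ereal_sup_ubound; exists [set` s] => //; split.
    by apply: finite_compact; exact: finite_seq.
  by move=> chi cs; have [] : (A `&` L) chi by apply: XA; rewrite Xs.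
- move=> phi cphi; have mp := power_measurable hG hm cphi.
  have mpE : measurable_fun setT (EFin \o (power m phi : borel DG -> R)) by exact/measurable_EFinP.
  have p0 := power_ge0 m phi.
  have [N [cN NL EN N0]] := spectral_support cphi.
  have mN := spectral_countable cN.
  have I : (\int[nu]_(chi in setT) (power m phi chi)%:E = (Gam phi)%:E)%E.
    rewrite -(setUv N) ge0_integral_setU//=; first last.
    + by apply/disj_setPS => x [].
    + by move=> chi _; rewrite lee_fin.
    + by rewrite setUv.
    + exact: measurableC.
    rewrite power_integral_countable//.
    rewrite (_ : \esum_(x in N) _ = (Gam phi)%:E)%E; last first.
      rewrite -EN; apply: eq_esum => chi Nchi.
      rewrite nuE (_ : [set chi] `&` L = [set chi]) ?esum_set1 ?lee_fin//.
      by apply/seteqP; split => [x []//|x ->]; split=> //; exact: NL.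
    rewrite (_ : \int[nu]_(x in ~` N) _ = 0)%E ?adde0//.
    have mE : measurable ([set chi | 0 < power m phi chi] : set (borel DG)).
      have := mp measurableT _ (measurable_itv `]0, +oo[).
      rewrite setTI; congr measurable; apply/seteqP; split => x /=; by rewrite in_itv /= andbT.
    rewrite -[RHS](integral0 nu (~` N)); apply: ge0_ae_eq_integral => //.
    + exact: measurableC.
    + exact: measurable_funTS.
    + by move=> x _; rewrite lee_fin.
    exists (~` N `&` [set chi | 0 < power m phi chi]); split.
    + by apply: measurableI => //; exact: measurableC.
    + rewrite nuE; apply: esum1 => chi [[nN /= pp] Lchi].
      by have /eqP := N0 _ Lchi nN; rewrite mulf_eq0 (gt_eqF pp) => /eqP ->.
    + move=> chi /= /not_implyP[nN /eqP h]; split => //=.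
      by rewrite lt0r p0 andbT; apply/eqP => h2; apply: (negP h); rewrite h2.
  split => //; apply/integrableP; split => //.
  under eq_integral do rewrite /= ger0_norm//.
  by rewrite I ltry.
Qed.

(** Dominated convergence with majorant the power of [phi0]; the limit of the [Gam (phi n)] thus
    determines the atom at [chi]. *)
Lemma power_atom_limit (nu : {measure set (borel DG) -> \bar R}) chi (phi : nat -> G -> C) phi0 :
  has_power nu -> (forall n, continuous_cs (phi n)) -> continuous_cs phi0 ->
  (forall n eta, power m (phi n) eta <= power m phi0 eta) ->
  (forall eta, (fun n => power m (phi n) eta) @ \oo --> (if eta == chi then 4 else 0 : R)) ->
  (fun n => (Gam (phi n))%:E) @ \oo --> (4%:E * nu [set chi])%E.
Proof.
move=> pnu cphi cphi0 dom lim.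
have mE f : continuous_cs f -> measurable_fun setT (EFin \o (power m f : borel DG -> R)).
  by move=> cf; apply/measurable_EFinP; exact: (power_measurable hG hm).
have h := @dominated_cvg _ (borel DG) R nu setT measurableT (fun n => EFin \o power m (phi n))
  (fun eta => (if eta == chi then 4 else 0 : R)%:E) (EFin \o power m phi0)
  (fun n => mE _ (cphi n)).
have limE eta : setT eta -> (fun n => (EFin \o power m (phi n)) eta) @ \oo -->
    (if eta == chi then 4 else 0 : R)%:E.
  by move=> _; apply/fine_cvgP; split; [exact: nearW|exact: lim].
have {}h := h limE.
have {}h := h (fun _ _ => isT) (pnu _ cphi0).1.
have E : (\int[nu]_(eta in setT) (if eta == chi then 4 else 0 : R)%:E = 4%:E * nu [set chi])%E.
  rewrite -[X in nu X](setIT [set chi]) -(integral_indic nu measurableT (dual_set1 chi)).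
  rewrite -ge0_integralZl_EFin//; last first.
    by apply/measurable_EFinP; apply: measurable_indic; exact: dual_set1.
  apply: eq_integral => eta _; rewrite indicE; case: eqP => [->|ne].
    by rewrite mem_set// mule1.
  by rewrite memNset// mule0.
rewrite -E; have -> : (fun n => (Gam (phi n))%:E) =
    fun n => (\int[nu]_(eta in setT) (EFin \o power m (phi n)) eta)%E.
  by apply/funext => n; rewrite (pnu _ (cphi n)).2.
apply: h => n eta _; rewrite /= ger0_norm ?power_ge0// lee_fin; exact: dom.
Qed.

(** On [L] the atoms are those of the measure of [spectral_exists], since both are read off the same
    limit of [Gam]. These atoms already exhaust every integral [Gam phi], so each compact set
    carries nothing outside a countable part of [L], and inner regularity extends this. *)
Lemma spectral_unique (nu : {measure set (borel DG) -> \bar R}) : radon nu -> has_power nu ->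
  forall A : set (borel DG), measurable A -> nu A = \esum_(chi in A `&` L) (a chi)%:E.
Proof.
move=> rnu pnu; have [nu0 [rnu0 pnu0 nu0E]] := spectral_exists.
have atom chi : L chi -> nu [set chi] = (a chi)%:E.
  move=> Lchi; have [phi [phi0 [cphi cphi0 _ dom lim]]] := atom_tests hG hm hD chi.
  have h1 := power_atom_limit pnu cphi cphi0 dom lim.
  have h2 := power_atom_limit pnu0 cphi cphi0 dom lim.
  have h3 := eq_trans (esym (cvg_lim (@ereal_hausdorff R) h1)) (cvg_lim (@ereal_hausdorff R) h2).
  have E (x : \bar R) : ((4^-1)%:E * (4%:E * x) = x)%E.
    by rewrite muleA -EFinM mulVf ?mul1e.
  rewrite -(E (nu [set chi])) h3 E nu0E (_ : [set chi] `&` L = [set chi]) ?esum_set1 ?lee_fin//.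
  by apply/seteqP; split => [x []//|x ->].
have mE f : continuous_cs f -> measurable_fun setT (EFin \o (power m f : borel DG -> R)).
  by move=> cf; apply/measurable_EFinP; exact: (power_measurable hG hm).
have single phi : continuous_cs phi -> exists N : set DG, [/\ countable N, N `<=` L &
    (\int[nu]_(chi in ~` N) (power m phi chi)%:E = 0)%E].
  move=> cphi; have [N [cN NL EN _]] := spectral_support cphi; exists N; split => //.
  have mN := spectral_countable cN.
  have := (pnu _ cphi).2; rewrite -(setUv N) ge0_integral_setU//=; first last.
  - by apply/disj_setPS => x [].
  - by move=> chi _; rewrite lee_fin power_ge0.
  - by rewrite setUv; exact: mE.
  - exact: measurableC.
  rewrite (power_integral_countable nu cN (power_ge0 m phi) (power_measurable hG hm cphi)).
  rewrite (_ : \esum_(x in N) _ = (Gam phi)%:E)%E; last first.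
    by rewrite -EN; apply: eq_esum => chi Nchi; rewrite (atom _ (NL _ Nchi)).
  move=> h; have := congr1 (fun x => x - (Gam phi)%:E)%E h.
  by rewrite /= addeAC subee// add0e.
have many (Phi : seq (G -> C)) : (forall phi, phi \in Phi -> continuous_cs phi) ->
    exists N : set DG, [/\ countable N, N `<=` L & forall phi, phi \in Phi ->
    (\int[nu]_(chi in ~` N) (power m phi chi)%:E = 0)%E].
  elim: Phi => [|phi Phi IH] cPhi.
    by exists set0; split => //; exact: countable0.
  have [N1 [cN1 NL1 h1]] := single phi (cPhi _ (mem_head _ _)).
  have [|N2 [cN2 NL2 h2]] := IH; first by move=> f fP; apply: cPhi; rewrite inE fP orbT.
  have cU : countable (N1 `|` N2) by exact: countable_setU.
  exists (N1 `|` N2); split; [exact: cU|by move=> x [/NL1|/NL2]|].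
  have sub N f : continuous_cs f -> countable N -> N `<=` N1 `|` N2 ->
      (\int[nu]_(chi in ~` N) (power m f chi)%:E = 0)%E ->
      (\int[nu]_(chi in ~` (N1 `|` N2)) (power m f chi)%:E = 0)%E.
    move=> cf cN NS h; apply/eqP; rewrite eq_le; apply/andP; split.
      rewrite -[leRHS]h; apply: ge0_subset_integral => //.
      - by apply: measurableC; exact: spectral_countable.
      - by apply: measurableC; exact: spectral_countable.
      - by apply: measurable_funTS; exact: mE.
      - by move=> x _; rewrite lee_fin power_ge0.
      - exact: subsetC.
    by apply: integral_ge0 => x _; rewrite lee_fin power_ge0.
  move=> f; rewrite inE => /orP[/eqP ->|fP].
    exact: (sub N1 _ (cPhi _ (mem_head _ _)) cN1 (@subsetUl _ N1 N2) h1).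
  have cf : continuous_cs f by apply: cPhi; rewrite inE fP orbT.
  exact: (sub N2 _ cf cN2 (@subsetUr _ N1 N2) (h2 f fP)).
move=> A mA; apply/eqP; rewrite eq_le; apply/andP; split; last first.
  apply: ge_ereal_sup => _ [X [fX XA] <-].
  have [s us Xs] := finite_uniq_list fX.
  have cX : countable X := finite_set_countable fX.
  have mX := spectral_countable cX.
  apply: (@le_trans _ _ (nu X)); last by apply: le_measure; rewrite ?inE// => x /XA[].
  have -> : nu X = (\int[nu]_(x in X) ((fun=> 1 : R) x)%:E)%E by rewrite integral_cst// mul1e.
  rewrite (power_integral_countable nu cX (fun=> ler01)); last exact: measurable_cst.
  rewrite -esum_fset//; last by move=> x _; rewrite lee_fin.
  by apply: le_esum => chi /XA[_ Lchi]; rewrite mul1e atom.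
have [_ ->] := rnu; last exact: mA.
apply: ge_ereal_sup => _ [K [cK KA] <-].
have mK := dual_compact cK.
have [Phi [cPhi hPhi]] := test_family hG hm cK.
have [N [cN NL hN]] := many Phi cPhi.
have mN := spectral_countable cN.
have mKN : measurable (K `\` N : set (borel DG)) by exact: measurableD.
(* On [K] the powers of the test family sum to at least 1, and each of them has integral 0 outside
   [N]. *)
have KN0 : nu (K `\` N) = 0%E.
  apply/eqP; rewrite eq_le measure_ge0 andbT.
  have -> : nu (K `\` N) = (\int[nu]_(x in K `\` N) 1%:E)%E by rewrite integral_cst// mul1e.
  pose q (i : 'I_(size Phi)) : G -> C := nth (fun=> 0) Phi i.
  have cq i : continuous_cs (q i) by apply: cPhi; exact: mem_nth.
  have mq i : measurable_fun (K `\` N : set (borel DG)) (EFin \o (power m (q i) : borel DG -> R)).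
    by apply: measurable_funTS; exact: mE.
  apply: (@le_trans _ _ (\int[nu]_(x in K `\` N) \sum_(i < size Phi) (EFin \o power m (q i)) x)%E).
    apply: ge0_le_integral => //.
    - by apply: emeasurable_sum => i.
    - move=> x [Kx _]; have := hPhi x Kx; rewrite (big_nth (fun=> 0)) big_mkord => h.
      by rewrite sumEFin lee_fin.
  rewrite ge0_integral_sum//; last by move=> i x _; rewrite lee_fin power_ge0.
  rewrite big1// => i _; apply/eqP; rewrite eq_le; apply/andP; split; last first.
    by apply: integral_ge0 => x _; rewrite lee_fin power_ge0.
  rewrite -[leRHS](hN (q i)); last exact: mem_nth.
  apply: ge0_subset_integral => //.
  - exact: measurableC.
  - by apply: measurable_funTS; exact: mE.
  - by move=> x _; rewrite lee_fin power_ge0.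
have cKN : countable (K `&` N) := sub_countable (subset_card_le (@subIsetr _ K N)) cN.
have mKN' := spectral_countable cKN.
have -> : nu K = nu (K `&` N).
  have KE : K = (K `&` N) `|` (K `\` N) by rewrite setUIDK.
  have I0 : (K `&` N) `&` (K `\` N) = set0.
    by apply/seteqP; split => // x [[_ Nx] [_ /(_ Nx)]].
  have E2 : nu ((K `&` N) `|` (K `\` N)) = (nu (K `&` N) + nu (K `\` N))%E by exact: measureU.
  by rewrite -KE KN0 adde0 in E2.
have -> : nu (K `&` N) = (\int[nu]_(x in K `&` N) ((fun=> 1 : R) x)%:E)%E by rewrite integral_cst// mul1e.
rewrite (power_integral_countable nu cKN (fun=> ler01)); last exact: measurable_cst.
apply: ge_ereal_sup => _ [X [fX XK] <-]; apply: esum_ge; exists X.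
  by split => // x /XK[Kx Nx]; split; [exact: KA|exact: NL].
rewrite le_eqVlt; apply/orP; left; apply/eqP; apply: eq_fsbigr => x.
by rewrite inE => /XK[_ /NL Lx]; rewrite mul1e atom.
Qed.

End Spectral.

(** * Separability of characters on an aperiodic window *)

Lemma ImB (R : realType) (z w : R[i]^o) : complex.Im (z - w) = complex.Im z - complex.Im w.
Proof. by case: z; case: w. Qed.

Section WindowMetric.
Context {R : realType} {H : topologicalZmodType}.
Variable theta : {measure set (borel H) -> \bar R}.
Hypotheses (hH : lcag H) (htheta : haar theta).
Local Notation C := (R[i]^o).
Local Notation DH := (dual_group R H).
Variable W : set H.
Hypotheses (cW : compact W) (hreg : W = closure (interior W))
  (haper : [set c | translate c W = W] = [set 0]).

Let clW : closed W. Proof. exact: compact_is_closed. Qed.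
Let mW : measurable (W : set (borel H)). Proof. exact: borel_compact. Qed.
Let mtW c : measurable (translate c W : set (borel H)).
Proof. by apply: borel_compact => //; exact: compact_translate. Qed.

(** Half the measure of the symmetric difference of [W] and its translate, as both have the same
    finite measure; it gives a translation-invariant distance on the internal group. *)
Definition excess c : R := fine (theta (translate c W `\` W)).

Lemma excess_measurable c c' : measurable (translate c W `\` translate c' W : set (borel H)).
Proof. exact: measurableD. Qed.

Lemma excess_fin c c' : theta (translate c W `\` translate c' W) \is a fin_num.
Proof.
rewrite ge0_fin_numE//; apply: (@le_lt_trans _ _ (theta (translate c W))).
  by apply: measure_mono => //; exact: excess_measurable.
by apply: haar_lty => //; exact: compact_translate.
Qed.

Lemma translate0 : translate 0 W = W.
Proof. by rewrite translateE; apply/seteqP; split => x /=; rewrite subr0. Qed.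

Lemma excess_finW c : theta (translate c W `\` W) \is a fin_num.
Proof. by have := excess_fin c 0; rewrite translate0. Qed.

Lemma excessE c c' : theta (translate c W `\` translate c' W) = (excess (c - c'))%:E.
Proof.
rewrite /excess fineK ?excess_finW//.
have mD : measurable (translate (c - c') W `\` W : set (borel H)) by exact: measurableD.
rewrite -(haar_translate htheta c' mD); congr (theta _).
rewrite !translateE; apply/seteqP; split => x /=.
  by move=> [h1 h2]; split => //; rewrite opprB addrA subrK.
by move=> []; rewrite opprB addrA subrK.
Qed.

Lemma excess_ge0 c : 0 <= excess c.
Proof. exact: fine_ge0. Qed.

Lemma excess_triangle c u : excess c <= excess (- u) + excess (c + u).
Proof.
rewrite -lee_fin EFinD.
have e1 : theta (translate c W `\` translate (c + u) W) = (excess (- u))%:E.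
  by rewrite excessE opprD addrA subrr add0r.
have e2 : theta (translate (c + u) W `\` W) = (excess (c + u))%:E.
  by rewrite -[X in _ `\` X]translate0 excessE subr0.
have e3 : theta (translate c W `\` W) = (excess c)%:E.
  by rewrite -[X in _ `\` X]translate0 excessE subr0.
have m1 := excess_measurable c (c + u).
have m2 : measurable (translate (c + u) W `\` W : set (borel H)) by exact: measurableD.
rewrite -e1 -e2 -e3; apply: (@le_trans _ _ (theta ((translate c W `\` translate (c + u) W) `|`
  (translate (c + u) W `\` W)))); last exact: measureU2.
apply: measure_mono; [exact: measurableD|exact: measurableU|].
move=> x [h1 h2]; have [h|h] := pselect (translate (c + u) W x); first by right.
by left.
Qed.

Lemma excess_small (e : R) : 0 < e -> exists2 U, nbhs (0 : H) U & forall u, U u -> excess u <= e.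
Proof.
move=> e0; have [U nU hU] := haar_shift hH htheta cW e0; exists U => // u /hU.
by rewrite -lee_fin /excess fineK ?excess_finW.
Qed.

Lemma open_null_empty (A : set H) : open A -> theta A = 0%E -> A = set0.
Proof.
move=> oA A0; apply/seteqP; split => // x Ax.
have nA : nbhs x A by exact: open_nbhs_nbhs.
have n0 := nbhs0_shift nA; have oA' := open_translate (- x) oA.
have E : [set u | A (x + u)] = translate (- x) A.
  by rewrite translateE; apply/seteqP; split => u /=; rewrite opprK addrC.
rewrite E in n0; have := haar_gt0 hH htheta n0 (borel_open oA').
by rewrite (haar_translate htheta) ?A0 ?ltxx//; exact: borel_open.
Qed.

(** The translated interior outside [W] is open and null, hence empty; regular closedness of [W]
    carries the inclusion over to the whole of [W]. *)
Lemma excess0_sub c : excess c = 0 -> translate c W `<=` W.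
Proof.
move=> h; have h0 : theta (translate c W `\` W) = 0%E.
  by rewrite -(fineK (excess_finW c)) -/(excess c) h.
have oI : open (translate c (interior W) `&` ~` W).
  by apply: openI; [apply: open_translate; exact: open_interior|exact: closed_openC].
have I0 : translate c (interior W) `&` ~` W = set0.
  apply: open_null_empty => //; apply: (measure_null_sub _ _ _ h0).
  - exact: borel_open.
  - exact: measurableD.
  - by rewrite !translateE => x [h1 h2]; split => //=; exact: interior_subset h1.
move=> _ [w Ww <-]; apply: contrapT => nW.
have nb : nbhs w [set y | (~` W) (y + c)].
  by apply: nbhs_shift; apply: open_nbhs_nbhs; split; [exact: closed_openC|rewrite /= addrC].
move: Ww; rewrite {1}hreg => /(_ _ nb)[y [iy /= ny]].
have : (translate c (interior W) `&` ~` W) (c + y).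
  by split; [exists y|rewrite addrC].
by rewrite I0.
Qed.

(** Equal finite measures make the reverse difference null too, so the translate coincides with [W]
    and aperiodicity gives [c = 0]. *)
Lemma excess0 c : excess c = 0 -> c = 0.
Proof.
move=> h; have s1 := excess0_sub h.
have s2 : W `<=` translate c W.
  have hN : excess (- c) = 0.
    have := excessE 0 c; rewrite translate0 sub0r => hE; apply: EFin_inj; rewrite -hE.
    have fW : (theta (translate c W) < +oo)%E.
      by apply: haar_lty => //; exact: compact_translate.
    have fin : theta (translate c W) \is a fin_num by rewrite ge0_fin_numE.
    have add : theta W = (theta (translate c W) + theta (W `\` translate c W))%E.
      rewrite -[X in theta X = _](setDUK s1); apply: measureU => //; last exact: setDIK.
      exact: measurableD.
    have eqW : theta (translate c W) = theta W by exact: haar_translate.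
    move: add; rewrite -eqW -(fineK fin); case: (theta (W `\` _)) => [r| |]//.
    by rewrite -EFinD => h1; congr (_%:E); move: (EFin_inj h1); lra.
  have := excess0_sub hN; rewrite !translateE => s x Wx /=.
  by apply: s; rewrite /= opprK subrK.
have : [set c | translate c W = W] c by apply/seteqP.
by rewrite haper.
Qed.

(** The differences where [eta] is at least [e] away from 1 form a compact set on which [excess] is
    positive and, by the triangle inequality, locally bounded below; hence it is bounded below
    there. *)
Lemma excess_char (eta : DH) (e : R) : 0 < e -> exists n : nat, forall c, minkowski_diff W W c ->
  excess c < n.+1%:R^-1 -> nrm (eta c - 1) < e.
Proof.
move=> e0; pose Bd := minkowski_diff W W `&` [set c | e <= nrm (eta c - 1)].
have cB : compact Bd.
  apply: compact_closedI; first exact: compact_diff.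
  have cf : continuous (fun c => nrm (eta c - 1)).
    by apply: nrm_continuous => x; apply: cvgB; [exact: char_continuous|exact: cvg_cst].
  exact: (closed_comp (fun x _ => cf x) (@closed_ge _ e)).
have pos c : Bd c -> 0 < excess c.
  move=> [_ /= ec]; rewrite lt0r excess_ge0 andbT; apply/eqP => /excess0 c0.
  by move: ec; rewrite c0 char_at0 subrr nrm0 leNgt e0.
have nb c : Bd c -> nbhs c [set c' | excess c / 2 <= excess c'].
  move=> /pos p; have [U nU hU] := excess_small (divr_gt0 p (ltr0Sn R 1)).
  have := nbhs0_unshift c (nbhs0_opp nU); apply: filterS => c' /= /hU h.
  have := excess_triangle c (c' - c); have -> : c + (c' - c) = c' by rewrite addrC subrK.
  by move: h; lra.
have [s sB hs] := compact_finite_cover cB nb.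
suff [n hn] : exists n : nat, forall c, c \in s -> n.+1%:R^-1 <= excess c / 2.
  exists n => c Mc cn; rewrite ltNge; apply/negP => h.
  by have [c0 /hn c0s /= c1] := hs c (conj Mc h); have := lt_le_trans cn (le_trans c0s c1); rewrite ltxx.
elim: s sB {hs} => [|c s IH] sB; first by exists 0%N.
have [|n hn] := IH; first by move=> c' cs; apply: sB; rewrite inE cs orbT.
have p : 0 < excess c / 2 by rewrite divr_gt0//; apply: pos; apply: sB; exact: mem_head.
have [k _ hk] : \forall k \near \oo, k.+1%:R^-1 < excess c / 2 by exact: near_infty_natSinv_lt (PosNum p).
exists (maxn n k) => c'; rewrite inE => /orP[/eqP ->|/hn h].
  by apply/ltW/hk; exact: leq_maxr.
by apply: le_trans h; rewrite lef_pV2 ?posrE ?ltr0n// ler_nat ltnS leq_maxl.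
Qed.

Lemma excess_net n : exists s : seq H, (forall w, w \in s -> W w) /\
  forall y, W y -> exists2 w, w \in s & excess (y - w) < n.+1%:R^-1.
Proof.
have e0 : 0 < n.+1%:R^-1 / 2 :> R by rewrite divr_gt0// invr_gt0 ltr0n.
have [U nU hU] := excess_small e0.
have [s sW hs] := compact_finite_cover (U := fun x y => U (y - x)) cW (fun x _ => nbhs0_unshift x nU).
exists s; split => // y /hs[w ws /hU h]; exists w => //.
by apply: le_lt_trans h _; rewrite ltr_pdivrMr// ltr_pMr ?invr_gt0 ?ltr0n// ltr1n.
Qed.

(** The code records the fineness [n eta] required by [excess_char] and the rounded values on the
    net of that fineness. Equal codes refer to the same net, and a point of [W] is compared with a
    nearby point of it. *)
Lemma char_code (e : R) : 0 < e -> exists code : DH -> nat, forall eta eta', code eta = code eta' ->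
  forall y, W y -> nrm (eta y - eta' y) <= e.
Proof.
move=> e0; have e4 : 0 < e / 4 by rewrite divr_gt0.
have [n hn] := choice (fun eta => excess_char eta e4).
have [net hnet] := choice excess_net.
(* The grid has mesh [e / 4]: rounding costs [e / 4] for each of the real and imaginary parts, and
   moving from [y] to the net costs [e / 4] for each character. *)
pose cl (eta : DH) (w : H) : int * int :=
  (Num.floor (complex.Re (eta w) / (e / 4)), Num.floor (complex.Im (eta w) / (e / 4))).
exists (fun eta => pickle (n eta, map (cl eta) (net (n eta)))) => eta eta'.
move=> /(pcan_inj (@pickleK _)) [nE]; rewrite nE => clE y Wy.
have [netW] := hnet (n eta'); move=> /(_ y Wy)[w ws yw].
have Ww := netW w ws.
have Mw : minkowski_diff W W (y - w) by exists y => //; exists w.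
have near (z : DH) : n z = n eta' -> nrm (z y - z w) <= e / 4.
  move=> zn; have := hn z (y - w) Mw; rewrite zn => /(_ yw) /ltW; apply: le_trans.
  have -> : z y - z w = z w * (z (y - w) - 1) by rewrite mulrBr mulr1 -charD (addrC w) subrK.
  by rewrite nrmM char_nrm mul1r.
have fl (x x' : R) : Num.floor (x / (e / 4)) = Num.floor (x' / (e / 4)) -> `|x - x'| <= e / 4.
  move=> E; have /andP[a1 a2] := floor_itv (x / (e / 4)).
  have /andP[b1 b2] := floor_itv (x' / (e / 4)).
  rewrite E in a1 a2; rewrite intrD in a2 b2.
  rewrite -[leRHS]mul1r -ler_pdivrMr// -{1}(ger0_norm (ltW e4)) -normf_div mulrBl ler_norml.
  by apply/andP; split; lra.
have ww : nrm (eta w - eta' w) <= e / 4 + e / 4.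
  have := (eq_in_map _ _ _).2 clE _ ws; rewrite /cl => -[h1 h2].
  by rewrite (le_trans (nrm_ReIm _))// lerD//; [rewrite ReB|rewrite ImB]; exact: fl.
have w1 := near eta nE; have w2 := near eta' erefl; rewrite nrm_sym in w2.
rewrite (le_trans (nrm_split (eta w) _ _))// (_ : e = e / 4 + ((e / 4 + e / 4) + e / 4)); last by lra.
by rewrite lerD// (le_trans (nrm_split (eta' w) _ _))// lerD.
Qed.

(** A finite sum over [T1] is compared with the sum over the selected list having the same codes.
    The characters then agree on [W] up to [n.+1%:R^-1], so the coefficients of any bounded [b]
    supported in [W] are close. *)
Lemma countable_spectrum (T : choiceType) (T1 : set T) (g : T -> DH) : exists T0 : set T,
  [/\ T0 `<=` T1, countable T0 & forall (b : H -> C) (c : R), cmeas setT (b : borel H -> C) ->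
  (forall y, nrm (b y) <= c) -> (forall y, ~ W y -> b y = 0) ->
  (\esum_(t in T1) (nrm (fourier theta b (g t)) ^+ 2)%:E =
   \esum_(t in T0) (nrm (fourier theta b (g t)) ^+ 2)%:E)%E].
Proof.
have e0 n : 0 < n.+1%:R^-1 :> R by rewrite invr_gt0 ltr0n.
have [code hcode] := choice (fun n => char_code (e0 n)).
(* Whole lists are selected, not single elements: several characters may share a code, and a sum has
   to be matched with equally many distinct terms. *)
pose good (i : nat * seq nat) (l : seq T) := [/\ uniq l, forall t, t \in l -> T1 t &
  map (fun t => code i.1 (g t)) l = i.2].
have pick i : exists l, (exists l', good i l') -> good i l.
  have [[l' h]|h] := pselect (exists l', good i l'); first by exists l'.
  by exists [::] => /h.
have [sel hsel] := choice pick.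
pose T0 := \bigcup_(i in [set i | exists l', good i l']) [set` sel i].
have T01 : T0 `<=` T1.
  by move=> t [i hi /= ti]; have [_ h _] := hsel i hi; exact: h.
exists T0; split => //.
  by apply: bigcup_countable => // i _; exact/finite_set_countable/finite_seq.
move=> b c mb bc bW; apply/eqP; rewrite eq_le; apply/andP; split; last first.
  apply: ge_ereal_sup => _ [X [fX XT] <-]; apply: ereal_sup_ubound; exists X => //.
  by split => // t /XT/T01.
have bi := bounded_support_cintble hH htheta cW mb bc bW.
have c0 : 0 <= c by rewrite (le_trans (nrm_ge0 _) (bc 0)).
have Wfin : (theta W < +oo)%E by exact: haar_lty.
pose B := c * fine (theta W).
have B0 : 0 <= B by rewrite mulr_ge0// fine_ge0.
have tw (eta : DH) : cintble theta setT (fun y => b y * (eta y)^*).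
  apply: (cintbleM (c := 1)) => //; last by move=> x _; rewrite char_conj_nrm.
  by apply: cmeas_continuous; exact: char_conj_cont.
have fB (eta : DH) : nrm (fourier theta b eta) <= B.
  rewrite fourierE; apply: cint_layer => //; first exact: cintble_cmeas (tw eta).
    by move=> y; rewrite nrmM char_conj_nrm mulr1.
  by move=> y /bW ->; rewrite mul0r.
have fd (eta eta' : DH) (e : R) : 0 <= e -> (forall y, W y -> nrm (eta y - eta' y) <= e) ->
    nrm (fourier theta b eta - fourier theta b eta') <= e * B.
  move=> e1 h; rewrite !fourierE -cintB// /B mulrA; apply: cint_layer => //.
  - by apply: cmeasB; exact: cintble_cmeas (tw _).
  - move=> y; rewrite -mulrBr nrmM mulrC -conjB nrmJ.
    have [Wy|/bW ->] := pselect (W y); last by rewrite nrm0 mulr0 mulr_ge0.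
    by rewrite ler_pM ?nrm_ge0// h.
  - by move=> y /bW ->; rewrite !mul0r subrr.
have fsq (eta eta' : DH) (e : R) : 0 <= e -> (forall y, W y -> nrm (eta y - eta' y) <= e) ->
    nrm (fourier theta b eta) ^+ 2 <= nrm (fourier theta b eta') ^+ 2 + e * (2 * B * B).
  move=> e1 /(fd _ _ _ e1) h; have := le_trans (nrm_dist _ _) h; rewrite ler_norml => /andP[_ h1].
  have := fB eta; have := fB eta'; move: (nrm_ge0 (fourier theta b eta)) (nrm_ge0 (fourier theta b eta')).
  move: h1; move: (nrm (fourier theta b eta)) (nrm (fourier theta b eta')) => p q h1 p0 q0 qB pB.
  have [pq|qp] := leP p q.
    apply: (@le_trans _ _ (q ^+ 2)); first by rewrite ler_pXn2r.
    by rewrite lerDl !mulr_ge0.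
  have : (p - q) * (p + q) <= (e * B) * (2 * B) by apply: ler_pM; lra.
  rewrite -subr_sqr; have -> : e * B * (2 * B) = e * (2 * B * B) by ring.
  lra.
apply: ge_ereal_sup => _ [X [fX XT] <-].
have [s us Xs] := finite_uniq_list fX; rewrite Xs fsum_EFin//.
have sT t : t \in s -> T1 t by move=> ts; apply: XT; rewrite Xs.
apply/lee_addgt0Pr => d d0.
have Q0 : 0 < (size s)%:R * (2 * B * B) + 1 by rewrite ltr_wpDl// !mulr_ge0.
have [n _ hn] : \forall n \near \oo, n.+1%:R^-1 < d / ((size s)%:R * (2 * B * B) + 1).
  exact: near_infty_natSinv_lt (PosNum (divr_gt0 d0 Q0)).
have {}hn := hn n (leqnn n).
pose i := (n, map (fun t => code n (g t)) s).
have gi : exists l', good i l' by exists s.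
have [ul lT lE] := hsel i gi.
have cmp (l l' : seq T) : map (fun t => code n (g t)) l = map (fun t => code n (g t)) l' ->
    \sum_(t <- l) nrm (fourier theta b (g t)) ^+ 2 <=
    \sum_(t <- l') nrm (fourier theta b (g t)) ^+ 2 + (size l)%:R * (n.+1%:R^-1 * (2 * B * B)).
  elim: l l' => [|t l IH] [|t' l'] //; first by rewrite !big_nil mul0r addr0.
  move=> [h1 /IH h2]; rewrite !big_cons (_ : size (t :: l) = (size l).+1)// -natr1 mulrDl mul1r.
  have := fsq (g t) (g t') n.+1%:R^-1 (ltW (e0 n)) (hcode n _ _ h1).
  by move: h2; set u := (size l)%:R * _; set v := _^-1 * _; lra.
have le1 := cmp s (sel i) (esym lE).
apply: (@le_trans _ _ ((\sum_(t <- sel i) nrm (fourier theta b (g t)) ^+ 2)%:E + d%:E)%E).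
  rewrite -EFinD lee_fin (le_trans le1)// lerD2l mulrCA.
  move: hn; rewrite ltr_pdivlMr// => hn; apply: le_trans (ltW hn).
  by rewrite ler_wpM2l ?(ltW (e0 n))// lerDl.
rewrite leeD2r// -fsum_EFin//; apply: ereal_sup_ubound; exists [set` sel i] => //.
by split; [exact: finite_seq|move=> t ti; exists i].
Qed.

End WindowMetric.

(** * Measurability of the random intensities *)

Section AlmostSure.
Context {R : realType} {d : measure_display} {Omega : measurableType d}.
Variable P : {measure set Omega -> \bar R}.
Implicit Types f g : Omega -> \bar R.

(** The integral of a nonnegative function is a supremum over simple functions below it, which is
    monotone without measurability. *)
Lemma ge0_le_integral_nomeas f g : (forall x, (0 <= f x)%E) -> (forall x, (f x <= g x)%E) ->
  (\int[P]_x f x <= \int[P]_x g x)%E.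
Proof.
move=> f0 fg; have g0 x : (0 <= g x)%E by exact: le_trans (fg x).
rewrite !ge0_integralTE//; apply: ge_ereal_sup => _ [h hf <-].
by apply: ereal_sup_ubound; exists h => // x; exact: le_trans (fg x).
Qed.

(* Since [f] need not be measurable, it is squeezed between two measurable
   functions that equal [g] off a null set. *)
Lemma ge0_integral_ae_eq f g : (forall x, (0 <= f x)%E) -> (forall x, (0 <= g x)%E) ->
  measurable_fun setT g -> {ae P, forall x, f x = g x} ->
  (\int[P]_x f x = \int[P]_x g x)%E.
Proof.
move=> f0 g0 mg [N [mN N0 hN]].
pose gN (z : \bar R) x := if x \in N then z else g x.
have mgN z : measurable_fun setT (gN z).
  apply: measurable_fun_if => //; last exact: measurable_funTS.
  apply: (measurable_fun_bool true); rewrite setTI preimage_mem_true//.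
have gN0 z x : (0 <= z)%E -> (0 <= gN z x)%E by rewrite /gN; case: ifP.
have gNE z : (0 <= z)%E -> (\int[P]_x gN z x = \int[P]_x g x)%E.
  move=> z0; apply: ge0_ae_eq_integral => //; first by move=> x _; exact: gN0.
  exists N; split => // x /= h; apply: contrapT => Nx; apply: h => _.
  by rewrite /gN memNset.
apply/eqP; rewrite eq_le; apply/andP; split.
  rewrite -(gNE +oo%E)//; apply: ge0_le_integral_nomeas => // x; rewrite /gN.
  have [|Nx] := boolP (x \in N); first by rewrite leey.
  suff -> : f x = g x by [].
  by apply: contrapT => h; move/negP: Nx; apply; rewrite inE; exact: hN.
rewrite -(gNE 0%E)//; apply: ge0_le_integral_nomeas => // x; first exact: gN0.
rewrite /gN; have [|Nx] := boolP (x \in N); first by [].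
suff -> : f x = g x by [].
by apply: contrapT => h; move/negP: Nx; apply; rewrite inE; exact: hN.
Qed.

Lemma integral_countable_esum (T : choiceType) (T0 : set T) (Y : T -> Omega -> R) :
  countable T0 -> (forall t x, 0 <= Y t x) -> (forall t, measurable_fun setT (Y t)) ->
  (measurable_fun setT (fun x => \esum_(t in T0) (Y t x)%:E) /\
   \int[P]_x (\esum_(t in T0) (Y t x)%:E) = \esum_(t in T0) \int[P]_x (Y t x)%:E)%E.
Proof.
move=> /countable_injP[e einj] Y0 mY.
pose J n := T0 `&` [set t | e t = n].
have JE n : J n = set0 \/ exists t, J n = [set t].
  have [[t [Nt et]]|h] := pselect (exists t, T0 t /\ e t = n); [right|left].
    exists t; apply/seteqP; split => [y [Ny ey]|y ->] //.
    by apply: einj; rewrite ?inE// ey.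
  by apply/seteqP; split => // y [Ny ey]; apply: h; exists y.
have tJ : trivIset setT J by move=> i j _ _ [t [[_ <-] [_ <-]]].
have T0E : T0 = \bigcup_n J n.
  by apply/seteqP; split => [t Nt|t [n _ []]//]; exists (e t).
have split_sum (f : T -> \bar R) : (forall t, 0 <= f t)%E ->
    (\esum_(t in T0) f t = \sum_(n <oo) \esum_(t in J n) f t)%E.
  by move=> f0; rewrite T0E; apply: (nneseries_sum_bigcup tJ).
have J1 n : measurable_fun setT (fun x => \esum_(t in J n) (Y t x)%:E)%E /\
    (\int[P]_x (\esum_(t in J n) (Y t x)%:E) = \esum_(t in J n) \int[P]_x (Y t x)%:E)%E.
  have [->|[t ->]] := JE n.
    rewrite esum_set0; have -> : (fun x => \esum_(t in set0) (Y t x)%:E)%E = cst 0%E.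
      by apply/funext => x; rewrite esum_set0.
    by split; [exact: measurable_cst|rewrite integral0].
  have E x : (\esum_(t in [set t]) (Y t x)%:E = (Y t x)%:E)%E by rewrite esum_set1 ?lee_fin.
  have -> : (fun x => \esum_(t in [set t]) (Y t x)%:E)%E = fun x => (Y t x)%:E by exact/funext.
  split; first exact/measurable_EFinP.
  by rewrite esum_set1//; apply: integral_ge0 => x _; rewrite lee_fin.
have JY0 n x : (0 <= \esum_(t in J n) (Y t x)%:E)%E.
  by apply: esum_ge0 => t _; rewrite lee_fin.
have -> : (fun x => \esum_(t in T0) (Y t x)%:E)%E =
    fun x => (\sum_(n <oo) \esum_(t in J n) (Y t x)%:E)%E.
  by apply/funext => x; apply: split_sum => t; rewrite lee_fin.
split.
  have := @ge0_emeasurable_sum _ _ _ setT (fun n x => \esum_(t in J n) (Y t x)%:E)%E xpredT.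
  by apply => // n _; exact: (J1 n).1.
rewrite integral_nneseries//; last by move=> n; exact: (J1 n).1.
rewrite split_sum; last by move=> t; apply: integral_ge0 => x _; rewrite lee_fin.
by apply: eq_eseriesr => n _; exact: (J1 n).2.
Qed.

End AlmostSure.

Lemma sample_path_out (R : realType) (I Omega : Type) (W : set I) (B : I -> Omega -> R[i]^o) om y :
  ~ W y -> sample_path W B om y = 0.
Proof. by move=> nW; rewrite /sample_path memNset// mul0r. Qed.

Section Intensity.
Context {R : realType} {G Gint : topologicalZmodType}.
Variables (m : {sigma_finite_measure set (borel G) -> \bar R})
  (theta : {sigma_finite_measure set (borel Gint) -> \bar R})
  (Lt : zmodClosed (G * Gint)%type) (D : nat -> set G).
Hypotheses (hLt : cut_project_scheme Lt) (hm : haar m) (htheta : haar theta)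
  (hD : van_hove m D).
Local Notation C := (R[i]^o).
Local Notation X := (prodG G Gint).
Local Notation Lam := (Lam Lt : set X).
Variables (F K : set X).
Hypotheses (hF : fundamental_domain Lt F) (cK : compact K) (FK : F `<=` K).
Context {d : measure_display} {Omega : measurableType d}.
Variables (W : set Gint) (B : Gint -> Omega -> C).
Hypotheses (cW : compact W) (hB : complex_process W B).

Lemma sample_path_measurable y : cmeas setT (fun om => sample_path W B om y).
Proof.
have [Wy|nW] := pselect (W y); last first.
  have -> : (fun om => sample_path W B om y) = fun=> 0.
    by apply/funext => om; exact: sample_path_out.
  exact: cmeas_cst.
by rewrite /sample_path mem_set//; apply: cmeasZ; exact: hB.
Qed.

(* The Fourier coefficient is the limit of its averages over the point set,
   which are finite sums. *)
Lemma intensity_measurable (eta : dual_group R Gint) : exists Y : Omega -> R,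
  [/\ measurable_fun setT Y, forall om, 0 <= Y om & forall om c,
      apx theta W c (sample_path W B om) ->
      Y om = nrm (fourier theta (sample_path W B om) eta) ^+ 2].
Proof.
pose f om y := sample_path W B om y * (eta y)^*.
pose cv := covol m theta F; have cv0 : 0 < cv by exact: (covol_gt0 hLt hm htheta hF cK FK).
pose Z n om := cv * nrm (((vol m D n)^-1)%:C * count Lt D n (f om) : C).
have mZ n : measurable_fun setT (Z n).
  apply: measurable_funM => //; apply: measurable_nrm; apply: cmeasZ.
  have [s [us sL hs]] := count_list hLt hD n cW.
  have -> : (fun om => count Lt D n (f om)) = fun om => \sum_(l <- s) ind (D n) l.1 * f om l.2.
    by apply/funext => om; apply: hs => y nW; rewrite /f sample_path_out// mul0r.
  apply: cmeas_sum => l; apply: cmeasZ; apply: cmeasM; last exact: cmeas_cst.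
  exact: sample_path_measurable.
(* The upper limit is measurable and defined for every realization, also for the exceptional ones
   where the averages need not converge. *)
exists (fun om => fine (limn_esup (fun n => (Z n om)%:E)) ^+ 2); split.
- apply: measurable_funX; apply: measurableT_comp => //.
  by apply: measurable_fun_limn_esup => n; exact/measurable_EFinP.
- by move=> om; exact: sqr_ge0.
- move=> om c am; have af : apx theta W c (f om).
    by apply: apx_mulr => //; [exact: char_conj_cont|move=> y; rewrite char_conj_nrm].
  suff h : Z n om @[n --> \oo] --> nrm (fourier theta (sample_path W B om) eta).
    have h' : (Z n om)%:E @[n --> \oo] --> (nrm (fourier theta (sample_path W B om) eta))%:E.
      by apply: cvg_EFin => //; exact: nearW.
    by rewrite (cvg_limn_einf_sup h').2.
  apply/cvgrPdist_le => e e0; have ecv : 0 < e / cv by rewrite divr_gt0.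
  have [N hN] := counting_apx hLt hm htheta hD hF cK FK cW af ecv.
  exists N => // n Nn; have h := hN n Nn; rewrite -fourierE in h.
  set q := fourier theta _ eta in h *; set a : C := _%:C * count _ _ _ _ in h.
  have cvE : nrm q = cv * nrm ((cv^-1)%:C * q).
    by rewrite nrmM nrmR ger0_norm ?invr_ge0 ?(ltW cv0)// mulrA divff ?gt_eqF// mul1r.
  rewrite {1}cvE /Z -mulrBr normrM gtr0_norm// mulrC -ler_pdivlMr//.
  by rewrite distrC (le_trans (nrm_dist _ _)).
Qed.

End Intensity.

(** * The diffraction measure of a weighted model set *)

(** The convolution of [phi] with its tilde must be an admissible test function for the vague limit;
    otherwise two autocorrelations could not be compared on it. *)
Lemma convolution_cs (R : realType) (G : topologicalZmodType)
    (m : {sigma_finite_measure set (borel G) -> \bar R}) (phi : G -> R[i]^o) : lcag G -> haar m ->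
  continuous_cs phi -> continuous_cs (convolution m phi (tilde phi)).
Proof.
move=> hG hm cphi; have [cp [K cK pK]] := (csP hG phi).1 cphi.
apply/(csP hG); split; last first.
  exists (minkowski_diff K K); first exact: compact_diff.
  by move=> x; exact: convolution_tilde_out.
move=> x; apply/continuous_nrm => e e0.
have [M M0 hM] := cs_bounded hG cphi.
have mK := borel_compact hG cK; have Kfin := haar_lty hm cK.
have k0 : 0 <= M * fine (m K) by rewrite mulr_ge0// fine_ge0.
have k1 : 0 < M * fine (m K) + 1 by rewrite ltr_wpDl.
have d0 := divr_gt0 e0 k1; have [U nU hU] := unif_of_cs cphi d0.
have := nbhs0_unshift x nU; apply: filterS => z zU; have {zU}Uz : U (z - x) := zU.
have fi t : cintble m setT (fun y : G => phi y * (phi (y - t))^*).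
  by apply: (cs_cintble hG hm); apply: (cs_pair (- t) hG cphi).
rewrite !convolution_tildeE -cintB//.
apply: (@le_lt_trans _ _ (M * (e / (M * fine (m K) + 1)) * fine (m K))).
  apply: cint_layer => //; first by apply: cmeasB; exact: cintble_cmeas (fi _).
    move=> y; rewrite -mulrBr nrmM -conjB nrmJ; apply: ler_pM; rewrite ?nrm_ge0//.
    have := hU ((y : G) - z) (z - x) Uz; rewrite (_ : y - z + (z - x) = y - x :> G); last first.
      by rewrite addrA subrK.
    by rewrite nrm_sym.
  by move=> y /pK ->; rewrite !mul0r subrr.
rewrite mulrAC mulrA ltr_pdivrMr// mulrC ltr_pM2l//; lra.
Qed.

Section Diffraction.
Context {R : realType} {G Gint : topologicalZmodType}.
Variables (m : {sigma_finite_measure set (borel G) -> \bar R})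
  (theta : {sigma_finite_measure set (borel Gint) -> \bar R})
  (Lt : zmodClosed (G * Gint)%type) (D : nat -> set G).
Hypotheses (hLt : cut_project_scheme Lt) (hm : haar m) (htheta : haar theta)
  (hD : van_hove m D).
Local Notation C := (R[i]^o).
Local Notation X := (prodG G Gint).
Local Notation Lam := (Lam Lt : set X).
Local Notation DG := (dual_group R G).
Local Notation DGint := (dual_group R Gint).
Local Notation dual := (dual_lattice R Lt).
Let hG := cps_lcag1 hLt.
Let hGint := cps_lcag2 hLt.

Lemma covolumeE (F : set X) : fundamental_domain Lt F -> covolume m theta Lt = covol m theta F.
Proof.
move=> hF; rewrite /covolume /covol; congr fine; apply: (fd_measure hLt hm htheta) => //.
by apply: (xgetPex set0 (P := [set F | fundamental_domain Lt F])); exists F.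
Qed.

Lemma covolume_gt0 : 0 < covolume m theta Lt.
Proof.
have [F [K [hF cK FK]]] := exists_fd hLt.
by rewrite (covolumeE hF); exact: (covol_gt0 hLt hm htheta hF cK FK).
Qed.

Lemma proj_dual_star chi : proj_lattice dual chi -> dual (chi, star_map dual chi).
Proof. by move=> [p dp <-]; rewrite (star_dual hLt dp); case: (p) dp. Qed.

Section Window.
Variables (W : set Gint) (b : Gint -> C) (c : R).
Hypotheses (cW : compact W) (ab : apx theta W c b).

Definition intensity (chi : DG) : R :=
  sqnorm (fourier theta b (- star_map dual chi)) * (covolume m theta Lt ^+ 2)^-1.

Lemma intensity_ge0 chi : 0 <= intensity chi.
Proof. by rewrite mulr_ge0 ?invr_ge0 ?sqr_ge0. Qed.

Local Notation comb := (fun f : G -> C => \sum_(l \in Lam) b l.2 * f l.1).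

(** The Bessel and Parseval bounds are brought into the form asked for by the spectral lemmas, with
    terms indexed by [chi] alone: [star_dual] determines the internal component. *)
Lemma diffraction_system : exists gamma : functional R G,
  [/\ autocorrelation m D comb gamma,
      forall phi, continuous_cs phi -> gamma (convolution m phi (tilde phi)) =
        (complex.Re (gamma (convolution m phi (tilde phi))))%:C,
      forall phi (P : seq DG), continuous_cs phi -> uniq P ->
        (forall chi, chi \in P -> proj_lattice dual chi) ->
        \sum_(chi <- P) power m phi chi * intensity chi <=
        complex.Re (gamma (convolution m phi (tilde phi))) &
      forall phi (e : R), continuous_cs phi -> 0 < e -> exists P : seq DG,
        [/\ uniq P, forall chi, chi \in P -> proj_lattice dual chi &
        complex.Re (gamma (convolution m phi (tilde phi))) - e <=
        \sum_(chi <- P) power m phi chi * intensity chi]].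
Proof.
have [F [K [hF cK FK]]] := exists_fd hLt.
have cv0 := covolume_gt0.
(* The character of the quotient that belongs to [chi] has components [- chi] and
   [- star_map dual chi], since both transforms are taken at the opposite character. *)
have term phi (chi : DG) (p : DG * DGint) : p.1 = - chi -> p.2 = - star_map dual chi ->
    power m phi chi * intensity chi =
    nrm (((covol m theta F)^-1)%:C * fourier m phi p.1 * fourier theta b p.2 : C) ^+ 2.
  move=> -> ->; rewrite -(covolumeE hF) nrmM [X in (X * _) ^+ 2]nrmM nrmR.
  rewrite ger0_norm ?invr_ge0 ?(ltW cv0)// /power /intensity /sqnorm !exprMn exprVn.
  by rewrite [LHS]mulrA [LHS]mulrC [LHS]mulrA.
exists (gam m theta Lt F b); split.
- exact: (comb_autocorrelation hLt hm htheta hD hF cK FK cW ab).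
- by move=> phi cphi; exact: (gam_real hLt hm htheta hF cK FK cphi cW ab).
- move=> phi P cphi uP PL.
  have := bessel_apx hLt hm htheta hF cK FK cphi cW ab
    (P := map (fun chi : DG => (- chi, - star_map dual chi)) P).
  rewrite big_map => h; apply: le_trans (h _ _).
  + by rewrite le_eqVlt; apply/orP; left; apply/eqP; apply: eq_bigr => chi _; exact: term.
  + by rewrite map_inj_uniq// => x y xy; apply: oppr_inj; exact: (congr1 fst xy).
  + by move=> p /mapP[chi /PL /proj_dual_star /dualN h1 ->].
- move=> phi e cphi e0.
  have [P [uP Pd hP]] := parseval_apx hLt hm htheta hF cK FK cphi cW ab e0.
  exists (map (fun p : DG * DGint => - p.1) P); split.
  + rewrite map_inj_in_uniq// => p q /Pd dp /Pd dq /oppr_inj pq.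
    have := star_dual hLt dp; rewrite pq (star_dual hLt dq) => pq2.
    by move: pq pq2; case: (p) => ? ?; case: (q) => ? ? /= -> ->.
  + by move=> _ /mapP[p /Pd /dualN dp ->]; exists (- p.1, - p.2).
  + rewrite big_map; apply: le_trans hP _; rewrite le_eqVlt; apply/orP; left; apply/eqP.
    apply: eq_big_seq => p /Pd dp; apply/esym/term; first by rewrite opprK.
    by rewrite (star_dual hLt (dualN dp)) opprK.
Qed.

Lemma diffraction_exists : exists nu : {measure set (borel DG) -> \bar R},
  diffraction_measure m D comb nu.
Proof.
have [gamma [ac gR bes par]] := diffraction_system.
have [nu [rnu pnu _]] := spectral_exists hG hm intensity_ge0 bes par.
exists nu; exists gamma => //; split => // f cf; have [fi fE] := pnu f cf.
by split => //; rewrite gR// /Rintegral fE.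
Qed.

(** Another autocorrelation is the vague limit of the same sequence, so it has the same values at
    the convolutions that define the Fourier transform; [spectral_unique] does the rest. *)
Lemma diffraction_unique (nu : {measure set (borel DG) -> \bar R}) :
  diffraction_measure m D comb nu -> forall A : set (borel DG), measurable A ->
  nu A = \esum_(chi in A `&` proj_lattice dual) (intensity chi)%:E.
Proof.
move=> [gamma' [_ ac'] [rnu pnu]]; have [gamma [[_ ac] gR bes par]] := diffraction_system.
apply: (spectral_unique hG hm hD intensity_ge0 bes par rnu) => phi cphi.
have cc := convolution_cs hG hm cphi; have [fi fE] := pnu phi cphi; split => //.
have gE : gamma' (convolution m phi (tilde phi)) = gamma (convolution m phi (tilde phi)).
  have hC : hausdorff_space C by exact: norm_hausdorff.
  by rewrite -(cvg_lim hC (ac' _ cc)) -(cvg_lim hC (ac _ cc)).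
have := fE; rewrite gE gR// => /(congr1 (@complex.Re R)) /= ->.
by rewrite /Rintegral fineK//; exact: integrable_fin_num.
Qed.

End Window.

Lemma random_combE (Omega : Type) (W : set Gint) (B : Gint -> Omega -> C) om :
  random_comb Lt W B om = fun f : G -> C => \sum_(l \in Lam) sample_path W B om l.2 * f l.1.
Proof.
apply/funext => f; rewrite -(comb_lattice hLt f (fun y => @sample_path_out _ Gint Omega W B om y)).
by apply: eq_fsbigr => s; rewrite inE => -[_ Ws]; rewrite /sample_path mem_set// mul1r.
Qed.

End Diffraction.

(** * The expected diffraction *)

Lemma esum_subset (R : realType) (T : choiceType) (A B : set T) (f : T -> \bar R) :
  A `<=` B -> (\esum_(t in A) f t <= \esum_(t in B) f t)%E.
Proof.
move=> AB; apply: ge_ereal_sup => _ [S [fS SA] <-]; apply: ereal_sup_ubound; exists S => //.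
by split => // t /SA/AB.
Qed.

Section Expected.
Context {R : realType} {G Gint : topologicalZmodType}.
Variables (m : {sigma_finite_measure set (borel G) -> \bar R})
  (theta : {sigma_finite_measure set (borel Gint) -> \bar R})
  (Lt : zmodClosed (G * Gint)%type) (D : nat -> set G).
Hypotheses (hLt : cut_project_scheme Lt) (hm : haar m) (htheta : haar theta)
  (hD : van_hove m D).
Local Notation C := (R[i]^o).
Local Notation DG := (dual_group R G).
Local Notation DGint := (dual_group R Gint).
Local Notation dual := (dual_lattice R Lt).
Let hG := cps_lcag1 hLt.
Let hGint := cps_lcag2 hLt.
Context {d : measure_display} {Omega : measurableType d}.
Variables (P : probability Omega R) (W : set Gint) (B : Gint -> Omega -> C).
Hypotheses (cW : compact W) (hreg : W = closure (interior W))
  (haper : [set c | translate c W = W] = [set 0])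
  (hbd : theta (closure W `\` interior W) = 0%E) (hB : complex_process W B)
  (hcont : {ae P, forall om, {within W, continuous (sample_path W B om)}}).
Local Notation b om := (sample_path W B om).
Local Notation k := ((covolume m theta Lt ^+ 2)^-1).

Let k0 : 0 <= k. Proof. by rewrite invr_ge0 sqr_ge0. Qed.

Lemma ae_apx : {ae P, forall om, exists c : R, apx theta W c (b om)}.
Proof.
have clW : closed W by apply: compact_is_closed.
apply: filterS hcont => om h.
by apply: (apx_window hGint htheta cW clW hbd h) => y; exact: sample_path_out.
Qed.

(** [Z] is the sum over the countable set of [countable_spectrum], which does not depend on the
    realization: it is measurable, and Tonelli applies to it. *)
Lemma expected_diffraction (A : set DG) : exists Z : Omega -> \bar R,
  [/\ measurable_fun setT Z, forall om, (0 <= Z om)%E,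
      {ae P, forall om, \esum_(chi in A `&` proj_lattice dual)
        (intensity m theta Lt (b om) chi)%:E = Z om} &
      (\int[P]_om Z om = \esum_(chi in A `&` proj_lattice dual)
        'E_P[fun om => sqnorm (fourier theta (b om) (- star_map dual chi)%R)] * k%:E)%E].
Proof.
have [F [K [hF cK FK]]] := exists_fd hLt.
have [Y hY] := choice (fun chi : DG =>
  intensity_measurable hLt hm htheta hD hF cK FK cW hB (- star_map dual chi)).
set T1 := A `&` proj_lattice dual.
have [T0 [T01 cT0 hT0]] := countable_spectrum hGint htheta cW hreg haper T1
  (fun chi : DG => - star_map dual chi).
pose Yk (chi : DG) om := Y chi om * k.
have Yk0 chi om : 0 <= Yk chi om by rewrite mulr_ge0//; have [_ h _] := hY chi.
have mYk chi : measurable_fun setT (Yk chi) by apply: measurable_funM => //; have [] := hY chi.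
have YkE om c chi : apx theta W c (b om) -> intensity m theta Lt (b om) chi = Yk chi om.
  by move=> ab; rewrite /intensity /Yk; have [_ _ h] := hY chi; rewrite (h _ _ ab).
(* Multiplying the sample path by the inverse covolume puts the factor of the intensity inside the
   squared coefficient, so [countable_spectrum] applies as it stands. *)
have total om c : apx theta W c (b om) ->
    \esum_(chi in T1) (Yk chi om)%:E = \esum_(chi in T0) (Yk chi om)%:E.
  move=> ab; have [mb bc b0 _] := ab; pose v : C := ((covolume m theta Lt)^-1)%:C.
  have := hT0 (fun y => v * b om y) (nrm v * c) (cmeasZ v mb).
  have fZ chi : (nrm (fourier theta (fun y => v * b om y) (- star_map dual chi)) ^+ 2)%:E =
      (Yk chi om)%:E.
    pose eta : DGint := - star_map dual chi.
    have -> : fourier theta (fun y => v * b om y) eta = v * fourier theta (b om) eta.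
      rewrite !fourierE -cintZ; first by apply: cint_eq => y _; rewrite mulrA.
        exact: measurableT.
      apply: (cintbleM (c := 1)) => //; last by move=> x _; rewrite char_conj_nrm.
        by apply: cmeas_continuous; exact: char_conj_cont.
      exact: (apx_cintble hGint htheta cW ab).
    rewrite nrmM exprMn nrmR ger0_norm ?invr_ge0 ?(ltW (covolume_gt0 hLt hm htheta))//.
    by rewrite exprVn mulrC -(YkE om c chi ab).
  rewrite (eq_esum (fun chi _ => fZ chi)) (eq_esum (fun chi _ => fZ chi)); apply.
    by move=> y; rewrite nrmM ler_wpM2l// nrm_ge0.
  by move=> y /b0 ->; rewrite mulr0.
pose Z om := \esum_(chi in T0) (Yk chi om)%:E.
have ZE T' om c : T0 `<=` T' -> T' `<=` T1 -> apx theta W c (b om) ->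
    \esum_(chi in T') (Yk chi om)%:E = Z om.
  move=> h0 h1 ab; apply/eqP; rewrite eq_le; apply/andP; split; last exact: esum_subset.
  by rewrite /Z -(total om c ab); exact: esum_subset.
have mean chi : ('E_P[fun om => sqnorm (fourier theta (b om) (- star_map dual chi)%R)] * k%:E =
    \int[P]_om (Yk chi om)%:E)%E.
  have [mY Y0 YE] := hY chi.
  have -> : ('E_P[fun om => sqnorm (fourier theta (b om) (- star_map dual chi)%R)] =
      \int[P]_om (Y chi om)%:E)%E.
    rewrite expectation.unlock; apply: ge0_integral_ae_eq.
    - by move=> om; rewrite lee_fin sqr_ge0.
    - by move=> om; rewrite lee_fin.
    - exact/measurable_EFinP.
    - by apply: filterS ae_apx => om [c ab]; rewrite (YE om c ab).
  rewrite -ge0_integralZr//; first exact/measurable_EFinP.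
  by move=> om _; rewrite lee_fin.
have cint_sum T' : countable T' -> measurable_fun setT (fun om => \esum_(chi in T') (Yk chi om)%:E) /\
    (\int[P]_om (\esum_(chi in T') (Yk chi om)%:E) = \esum_(chi in T') \int[P]_om (Yk chi om)%:E)%E.
  by move=> cT'; exact: integral_countable_esum.
have Z0 om : (0 <= Z om)%E by apply: esum_ge0 => chi _; rewrite lee_fin.
exists Z; split => //.
- exact: (cint_sum T0 cT0).1.
- apply: filterS ae_apx => om [c ab]; rewrite -(ZE T1 om c T01 (@subset_refl _ _) ab).
  by apply: eq_esum => chi _; rewrite (YkE om c chi ab).
- rewrite (eq_esum (fun chi _ => mean chi)) (cint_sum T0 cT0).2.
  apply/eqP; rewrite eq_le; apply/andP; split; first exact: esum_subset.
  (* Characters outside [T0] must have expected intensity 0. Adding a finite [S] to [T0] leaves a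
     countable set with almost surely the same sum, so the expectations over [S] cannot exceed the
     total. *)
  apply: ge_ereal_sup => _ [S [fS ST] <-].
  have cT' : countable (T0 `|` S) by apply: countable_setU => //; exact: finite_set_countable.
  have T'1 : T0 `|` S `<=` T1 by move=> chi [/T01|/ST].
  rewrite -(cint_sum T0 cT0).2.
  have -> : (\int[P]_om (\esum_(chi in T0) (Yk chi om)%:E) =
      \int[P]_om (\esum_(chi in T0 `|` S) (Yk chi om)%:E))%E.
    apply: ge0_integral_ae_eq => //.
    + by move=> om; apply: esum_ge0 => chi _; rewrite lee_fin.
    + exact: (cint_sum _ cT').1.
    + apply: filterS ae_apx => om [c ab]; apply/esym.
      by apply: (ZE _ om c _ T'1 ab); exact: subsetUl.
  by rewrite (cint_sum _ cT').2; apply: ereal_sup_ubound; exists S.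
Qed.

End Expected.

Theorem theorem4 (R : realType) (G Gint : topologicalZmodType)
    (m : {measure set (borel G) -> \bar R})
    (theta : {measure set (borel Gint) -> \bar R})
    (Lt : zmodClosed (G * Gint)%type)
    (D : nat -> set G) (W : set Gint)
    (d : measure_display) (Omega : measurableType d)
    (P : probability Omega R) (B : Gint -> Omega -> R[i]^o)
    (hLt : cut_project_scheme Lt)
    (hm : haar m) (htheta : haar theta)
    (hD : van_hove m D)
    (hW : window W)
    (hrep : repetitive (model_set Lt W))
    (hgen : generated (minkowski_diff (model_set Lt W) (model_set Lt W))
            = proj_lattice [set` Lt])
    (hreg : W = closure (interior W))
    (haper : [set c | translate c W = W] = [set 0])
    (hbd : theta (closure W `\` interior W) = 0%E)
    (hB : complex_process W B)
    (hcont : {ae P, forall om, {within W, continuous (sample_path W B om)}}) :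
  {ae P, forall om, exists nu : {measure set (borel (dual_group R G)) -> \bar R},
     diffraction_measure m D (random_comb Lt W B om) nu} /\
  forall nu : Omega -> {measure set (borel (dual_group R G)) -> \bar R},
    {ae P, forall om,
       diffraction_measure m D (random_comb Lt W B om) (nu om)} ->
    forall A : set (borel (dual_group R G)), measurable A ->
      ae_measurable P (fun om => nu om A) /\
      (\int[P]_om nu om A =
       \esum_(chi in proj_lattice (dual_lattice R Lt))
         'E_P[fun om => sqnorm (fourier theta (sample_path W B om)
                                  (- star_map (dual_lattice R Lt) chi)%R)]
         * ((covolume m theta Lt ^+ 2)^-1)%:E
         * \d_(chi : borel (dual_group R G)) A)%E.
Proof.
have [[hG hGint] _ _ _ _] := hLt.
have [m' Em] := sigma_finite_pack (haar_sigma_finite hG hm).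
have [theta' Et] := sigma_finite_pack (haar_sigma_finite hGint htheta).
(* From here on both measures are their sigma-finite packages, so the product measure is
   available. *)
subst m theta.
have cW : compact W.
  have clW : closed W by rewrite hreg; exact: closed_closure.
  by have [_ _] := hW; rewrite precompact_closed.
have good := ae_apx hLt htheta cW hbd hcont.
split.
  apply: filterS good => om [c ab]; rewrite random_combE//.
  exact: (diffraction_exists hLt hm htheta hD cW ab).
move=> nu hnu A mA.
have [Z [mZ Z0 ZE Zint]] := expected_diffraction hLt hm htheta hD cW hreg haper hbd hB hcont A.
(* Whatever measures were selected, uniqueness fixes their value on [A] for almost every
   realization. *)
have nuZ : {ae P, forall om, nu om A = Z om}.
  apply: filterS3 good hnu ZE => om [c ab] h <-; rewrite random_combE// in h.
  exact: (diffraction_unique hLt hm htheta hD cW ab h mA).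
split; first by exists Z.
(* Only almost sure equality with the measurable [Z] is known; the Dirac factor then restricts the
   sum to the characters in [A]. *)
rewrite (ge0_integral_ae_eq (g := Z))// Zint esum_mkcondl; apply: eq_esum => chi _.
by rewrite diracE; case: ifPn => _; rewrite ?mule1 ?mule0.
Qed.
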